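(* Let $\Omega\subset\mathbb{R}^2$ be a bounded polygonal domain with Lipschitz continuous boundary, $T>0$, $0<\alpha<1$, $q\in[-1,1]$. Let $u$ be the (weak) solution of $\partial_t^{\alpha}u(t)+Au(t)=f(t)$, $0<t\le T$, with $u(0)=0$ and $f\in W^{1,\infty}([0,T];D(A^{q/2}))\cap W^{2,1}(0,T;L^2(\Omega))$. Then, for all $\epsilon\in(0,1)$, $$\|u(t)\|_{D(A^{q/2+1-\epsilon/2})}\lesssim\epsilon^{-1}t^{\alpha\epsilon/2}\|f\|_{L^\infty(0,t;D(A^{q/2}))},\quad t\in[0,T],$$ $$\|u'(t)\|_{D(A^{q/2+1-\epsilon/2})}\lesssim\epsilon^{-1}t^{\alpha\epsilon/2}\|f'\|_{L^\infty(0,t;D(A^{q/2}))}+t^{-1+\alpha\epsilon/2}\|f(0)\|_{D(A^{q/2})},\quad t\in(0,T],$$ $$\|u''(t)\|\lesssim\mathcal{I}^\alpha\big(\|f''(\cdot)\|\big)(t)+t^{\alpha-1}\|f'(0)\|+t^{\alpha-2}\|f(0)\|,\quad t\in(0,T],$$ $$\|\partial_t^\alpha u(t)\|\lesssim\epsilon^{-1}t^{\alpha\epsilon/2}\|f\|_{L^\infty(0,t;D(A^{\epsilon/2}))}+\|f(t)\|,\quad t\in[0,T].$$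
   Context: $(\cdot,\cdot)$ and $\|\cdot\|$ are the $L^2(\Omega)$ inner product and norm. $V:=H^2_0(\Omega)$, $V^*$ is its dual. $A$ is the unbounded operator in $L^2(\Omega)$ with $D(A)=\{\phi\in H^2_0(\Omega):\Delta^2\phi\in L^2(\Omega)\}$, $A\phi=\Delta^2\phi$. $(\mu_j,\phi_j)_{j\ge1}$ are its eigenpairs, $0<\mu_1\le\mu_2\le\dots\to\infty$, with $\{\phi_j\}$ an orthonormal basis of $L^2(\Omega)$. For $r\ge0$, $D(A^r)=\{v=\sum_jv_j\phi_j:\sum_j\mu_j^{2r}|v_j|^2<\infty\}$ with norm $(\sum_j\mu_j^{2r}|(v,\phi_j)|^2)^{1/2}$; for $r>0$, $D(A^{-r})$ is the dual of $D(A^r)$ with norm $(\sum_j\mu_j^{-2r}|\langle g,\phi_j\rangle|^2)^{1/2}$ ($L^2(\Omega)$ being identified with its dual, $\langle\cdot,\cdot\rangle$ the duality pairing). $D(A^{1/2})=V$. Primes denote time derivatives. A norm of a function not belonging to the corresponding space is understood as $+\infty$. $\mathcal{I}^{\beta}g(t)=\frac1{\Gamma(\beta)}\int_0^t(t-s)^{\beta-1}g(s)\,ds$ is the Riemann–Liouville integral ($\beta>0$). Caputo derivative: $\partial_t^\alpha g=\mathcal{I}^{1-\alpha}g'$; for $u\in W^{1,1}(0,T;V^* )$, $\langle\partial_t^\alpha u(t),v\rangle:=\partial_t^\alpha\langle u(t),v\rangle$ for $v\in V$. Weak solution: $u\in L^1(0,T;V)\cap W^{1,1}(0,T;V^* )$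 such that for all $v\in V$, $\partial_t^\alpha\langle u(t),v\rangle+\int_\Omega D^2u(t):D^2v\,dx=\langle f(t),v\rangle$ in $L^1(0,T)$, and $\lim_{t\to0}\|u(t)-u(0)\|_{V^*}=0$ with the prescribed initial value. For zero initial value it is unique and given by $u(t)=\int_0^tF(t-s)f(s)\,ds$, $F(t)g=\sum_j\langle g,\phi_j\rangle t^{\alpha-1}E_{\alpha,\alpha}(-\mu_jt^\alpha)\phi_j$, $E_{\alpha,\beta}(z)=\sum_{k\ge0}z^k/\Gamma(k\alpha+\beta)$. $a\lesssim b$ means $a\le Cb$ with a constant $C>0$ that may depend on $\alpha$, $T$ (and the fixed domain $\Omega$) but not on $t,\epsilon,f$. *)

(* Defs.v *)
From HB Require Import structures.
From mathcomp Require Import all_boot all_order all_algebra.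
From mathcomp Require Import all_classical all_reals all_analysis.

Set Implicit Arguments.
Unset Strict Implicit.
Unset Printing Implicit Defensive.
Import Order.TTheory GRing.Theory Num.Theory.
Import numFieldNormedType.Exports.
Local Open Scope classical_set_scope.
Local Open Scope ring_scope.

Section PolygonalDomain.
Variable R : realType.
Implicit Type Omega : set (R * R).

Definition segment (a b : R * R) : set (R * R) :=
  [set x | exists2 s : R, 0 <= s <= 1 &
    x = ((1 - s) * a.1 + s * b.1, (1 - s) * a.2 + s * b.2)].

Definition boundary Omega : set (R * R) := closure Omega `\` interior Omega.

(* Near each boundary point, in coordinates rotated by the unit vector (a, b),
   Omega is the strict epigraph of a Lipschitz function. *)
Definition lipschitz_boundary Omega :=
  forall x0, boundary Omega x0 ->
  exists (rad a b k : R) (gamma : R -> R),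
    [/\ 0 < rad, a ^+ 2 + b ^+ 2 = 1,
        forall s t, `|gamma s - gamma t| <= k * `|s - t| &
        forall x, ball x0 rad x ->
          (Omega x <-> gamma (a * x.1 + b * x.2) < a * x.2 - b * x.1)].

Definition polygonal_domain Omega :=
  [/\ open Omega, connected Omega, Omega !=set0, bounded_set Omega &
      lipschitz_boundary Omega /\
      exists (n : nat) (a b : 'I_n -> R * R),
        boundary Omega = \bigcup_i segment (a i) (b i)].

End PolygonalDomain.

(* Elements of L^2(Omega) are represented by functions on the plane, of which
   only the restriction to Omega, up to null sets, matters. *)
Section SobolevSpaces.
Variables (R : realType) (Omega : set (R * R)).
Notation plane := (R * R)%type.
Notation leb2 := (@lebesgue_measure R \x @lebesgue_measure R)%E.

Definition partial (i : 'I_2) (psi : plane -> R) : plane -> R :=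
  fun x => 'D_(if i == ord0 then (1, 0) else (0, 1) : plane) psi x.

Definition dpart (l : seq 'I_2) (psi : plane -> R) : plane -> R :=
  foldr partial psi l.

Definition smooth (psi : plane -> R) :=
  forall l : seq 'I_2, continuous (dpart l psi) /\
    forall (i : 'I_2) x,
      derivable (dpart l psi) x (if i == ord0 then (1, 0) else (0, 1) : plane).

Definition test_function (psi : plane -> R) :=
  smooth psi /\
  exists K : set plane,
    [/\ compact K, K `<=` Omega & forall x, ~ K x -> psi x = 0].

Definition L2 (w : plane -> R) : Prop := w \_ Omega \in Lfun leb2 2%:E.

Definition norm_L2 (w : plane -> R) : \bar R :=
  ('N[leb2]_(2%:E)[EFin \o (w \_ Omega)])%E.

Definition inner (v w : plane -> R) : R :=
  \int[leb2]_(x in Omega) (v x * w x).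

Definition weak_partial (l : seq 'I_2) (v g : plane -> R) :=
  forall psi, test_function psi ->
    inner v (dpart l psi) = (-1) ^+ size l * inner g psi.

(* A function together with its weak derivatives: J [::] is the function itself,
   J [:: i] its first and J [:: i; j] its second derivatives. *)
Definition jet := seq 'I_2 -> plane -> R.

Definition is_H2 (J : jet) :=
  forall l, (size l <= 2)%N -> L2 (J l) /\ weak_partial l (J [::]) (J l).

Definition norm_H2 (J : jet) : \bar R :=
  ((\sum_(k < 3) \sum_(l : k.-tuple 'I_2) norm_L2 (J l) `^ 2) `^ 2^-1)%E.

(* H^2_0(Omega), the closure of the test functions in H^2(Omega) *)
Definition is_H20 (J : jet) :=
  is_H2 J /\
  exists psi : nat -> plane -> R, (forall n, test_function (psi n)) /\
    norm_H2 (fun l x => dpart l (psi n) x - J l x) @[n --> \oo] --> 0%E.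

Definition V (v : plane -> R) := exists2 J : jet, is_H20 J & J [::] = v.

Definition norm_H20 (v : plane -> R) : \bar R :=
  ereal_inf [set norm_H2 J | J in [set J | is_H20 J /\ J [::] = v]].

(* the integral of D^2 u : D^2 v *)
Definition hess_form (J K : jet) : R :=
  \sum_(i < 2) \sum_(j < 2) inner (J [:: i; j]) (K [:: i; j]).

Definition bilaplacian (psi : plane -> R) : plane -> R :=
  fun x => \sum_(i < 2) \sum_(j < 2) dpart [:: i; i; j; j] psi x.

(* v \in D(A) and A v = w, the bilaplacian being distributional *)
Definition is_A (v w : plane -> R) :=
  [/\ V v, L2 w & forall psi, test_function psi ->
        inner v (bilaplacian psi) = inner w psi].

Definition eigenpairs (mu : nat -> R) (phi : nat -> plane -> R) :=
  [/\ 0 < mu 0 /\ {homo mu : i j / (i <= j)%N >-> i <= j},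
      mu n @[n --> \oo] --> +oo,
      forall j, is_A (phi j) (fun x => mu j * phi j x),
      forall i j, inner (phi i) (phi j) = (i == j)%:R &
      forall v, L2 v ->
        norm_L2 (fun x => v x - \sum_(j < n) inner v (phi j) * phi j x)
          @[n --> \oo] --> 0%E].

(* Every space between V and V^* is seen as a subspace of V^*, L^2(Omega) being
   identified with its dual. A subspace is given by its norm, with value +oo
   outside the subspace. Functionals that agree on V are identified. *)
Definition functional := (plane -> R) -> R.

Definition eqV (g h : functional) := forall v, V v -> g v = h v.

Definition of_L2 (w : plane -> R) : functional := inner w.

Definition linear_on (X : set (plane -> R)) (g : functional) :=
  forall (a : R) v w, X v -> X w ->
    g (fun x => a * v x + w x) = a * g v + g w.

Definition nVdual (g : functional) : \bar R :=
  if `[< linear_on V g >]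
  then ereal_sup [set `|g v|%:E | v in [set v | V v /\ (norm_H20 v <= 1)%E]]
  else +oo%E.

Definition nV (g : functional) : \bar R :=
  ereal_inf [set norm_H2 J | J in [set J | is_H20 J /\ eqV (of_L2 (J [::])) g]].

Definition nL2 (g : functional) : \bar R :=
  ereal_inf [set norm_L2 w | w in [set w | L2 w /\ eqV (of_L2 w) g]].

Section FractionalPowers.
Variables (mu : nat -> R) (phi : nat -> plane -> R).

Definition weighted_norm (r : R) (c : nat -> R) : \bar R :=
  ((\sum_(0 <= j <oo) (mu j `^ (2 * r) * `|c j| ^+ 2)%:E) `^ 2^-1)%E.

(* D(A^r) for r >= 0 *)
Definition norm_DA (r : R) (w : plane -> R) : \bar R :=
  weighted_norm r (fun j => inner w (phi j)).

Definition DA (r : R) (w : plane -> R) := L2 w /\ (norm_DA r w < +oo)%E.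

(* the dual of D(A^r), for r > 0 *)
Definition DA_dual (r : R) (g : functional) :=
  linear_on (DA r) g /\
  exists C : R, forall w, DA r w -> (`|g w|%:E <= C%:E * norm_DA r w)%E.

(* For r < 0 the space is the dual of D(A^(-r)); restriction to V embeds it in
   V^* = D(A^(-1/2)) as long as r >= -1/2. *)
Definition nDA (r : R) (g : functional) : \bar R :=
  if 0 <= r
  then ereal_inf [set norm_DA r w | w in [set w | L2 w /\ eqV (of_L2 w) g]]
  else ereal_inf [set weighted_norm r (fun j => h (phi j)) |
                   h in [set h | DA_dual (- r) h /\ eqV h g]].

End FractionalPowers.

End SobolevSpaces.

(* Bochner spaces of W-valued functions, for a subspace of W with norm N. *)
Section Bochner.
Variables (R : realType) (W : lmodType R) (N : W -> \bar R).
Notation leb := (@lebesgue_measure R).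

Record step := Step {
  step_size : nat;
  step_set : 'I_step_size -> set R;
  step_val : 'I_step_size -> W }.

Definition is_step (s : step) :=
  forall i : 'I_(step_size s),
    measurable (step_set i) /\ (N (step_val i) < +oo)%E.

Definition step_fun (s : step) (t : R) : W :=
  \sum_(i < step_size s) \1_(step_set i) t *: step_val i.

Definition step_int (D : set R) (s : step) : W :=
  \sum_(i < step_size s) fine (leb (D `&` step_set i)) *: step_val i.

Definition strongly_measurable (D : set R) (g : R -> W) :=
  exists s : nat -> step, (forall n, is_step (s n)) /\
    {ae leb, forall t, D t ->
      N (g t - step_fun (s n) t) @[n --> \oo] --> 0%E}.

(* x is the Bochner integral of g over the bounded set D *)
Definition bochner_int (D : set R) (g : R -> W) (x : W) :=
  strongly_measurable D g /\
  exists s : nat -> step,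
    [/\ forall n, is_step (s n),
        (\int[leb]_(t in D) N (g t - step_fun (s n) t))%E
          @[n --> \oo] --> 0%E &
        N (step_int D (s n) - x) @[n --> \oo] --> 0%E].

Definition bochner_Lp (p : \bar R) (T : R) (g : R -> W) :=
  strongly_measurable `]0, T[ g /\
  ('N[leb]_p[(N \o g) \_ `]0%R, T[%classic] < +oo)%E.

(* g \in W^{1,p}(0,T) with derivative g1: g is the continuous representative,
   a primitive of g1 on [0,T] (H. Brezis, Operateurs maximaux monotones,
   Appendice). *)
Definition sobolev1 (p : \bar R) (T : R) (g g1 : R -> W) :=
  [/\ bochner_Lp p T g, bochner_Lp p T g1 &
      forall s t, 0 <= s -> s <= t -> t <= T ->
        bochner_int `]s, t[ g1 (g t - g s)].

(* g : [0,T] -> W is differentiable at t (one-sidedly at 0 and T) *)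
Definition deriv_at (T : R) (g : R -> W) (t : R) (d : W) :=
  N (h^-1 *: (g (t + h) - g t) - d)
    @[h --> within [set h | 0 <= t + h <= T] 0^'] --> 0%E.

End Bochner.

Section FractionalCalculus.
Variable R : realType.
Notation leb := (@lebesgue_measure R).

Definition Gamma (a : R) : R :=
  \int[leb]_(x in `]0, +oo[) (x `^ (a - 1) * expR (- x)).

Definition RLint (beta : R) (g : R -> \bar R) (t : R) : \bar R :=
  ((Gamma beta)^-1%:E *
   \int[leb]_(s in `]0%R, t[) (((t - s) `^ (beta - 1))%:E * g s))%E.

(* The Caputo derivative of g \in W^{1,1}(0,T) exists at t, with value c; the
   choice of the representative g1 of g' is immaterial. *)
Definition caputo_at (alpha T : R) (g : R -> R) (t c : R) :=
  exists g1 : R -> R,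
    [/\ leb.-integrable `]0, T[ (EFin \o g1),
        forall a b, 0 <= a -> a <= b -> b <= T ->
          g b - g a = \int[leb]_(s in `]a, b[) g1 s,
        leb.-integrable `]0, t[ (fun s => ((t - s) `^ (- alpha) * g1 s)%:E) &
        c%:E = RLint (1 - alpha) (EFin \o g1) t].

Definition norm_Linf (t : R) (h : R -> \bar R) : \bar R :=
  ('N[leb]_(+oo)[h \_ `]0%R, t[%classic])%E.

End FractionalCalculus.

Section WeakSolution.
Variables (R : realType) (Omega : set (R * R)) (alpha T : R).
Notation W := (functional R).

Definition weak_solution (f : R -> W) (u0 : W) (u : R -> W) :=
  [/\ bochner_Lp (nV Omega) 1%E T u,
      exists u1 : R -> W, sobolev1 (nVdual Omega) 1%E T u u1,
      forall K : jet R, is_H20 Omega K ->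
        {ae lebesgue_measure, forall t : R, `]0, T[%classic t ->
          exists (J : jet R) (c : R),
            [/\ is_H20 Omega J, eqV Omega (of_L2 Omega (J [::])) (u t),
                caputo_at alpha T (fun s => u s (K [::])) t c &
                c + hess_form Omega J K = f t (K [::])]} &
      eqV Omega (u 0) u0 /\
      nVdual Omega (u t - u 0) @[t --> 0^'+] --> 0%E].

(* w is the Caputo derivative of u at t, as an element of V^* *)
Definition caputo_deriv_at (u : R -> W) (t : R) (w : W) :=
  forall v, V Omega v -> caputo_at alpha T (fun s => u s v) t (w v).

End WeakSolution.

(* Main.v *)
From HB Require Import structures.
From mathcomp Require Import all_boot all_order all_algebra.
From mathcomp Require Import finmap.
From mathcomp Require Import all_classical all_reals all_analysis.
From mathcomp Require Import measurable_realfun ess_sup_inf.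
From mathcomp Require Import ring lra.
Require Import Defs.
Set Implicit Arguments.
Unset Strict Implicit.
Unset Printing Implicit Defensive.
Import Order.TTheory GRing.Theory Num.Theory.
Import numFieldNormedType.Exports.
Import HBSimple HBNNSimple.
Local Open Scope classical_set_scope.
Local Open Scope ring_scope.

(* The coefficients u_j = (u, phi_j) solve scalar fractional equations, so that
   u_j = k_j * f_j, u_j' = f_j(0) k_j + k_j * f_j' and
   u_j'' = f_j(0) k_j' + f_j'(0) k_j + k_j * f_j'', where k_j is the kernel
   t^(al-1) E_{al,al}(- mu_j t^al), that is, the resolvent k + mu_j a*k = a of
   a(t) = a0 t^(al-1). The constant a0 is normalized by b*a = Gamma(1-al) for
   b(t) = t^(-al), which makes b*k + mu_j Gamma(1-al) (1*k) = Gamma(1-al).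

   Everything rests on 0 < k_j <= a, mu_j t k_j(t) <= 1 and
   |k_j'(t)| <= C t^(al-2), uniformly in j. Positivity: at a first zero t0,
   the increment of b*k over [t0 - h, t0] is at most - c h + O(h^(2-al)), whereas
   it equals - mu_j Gamma(1-al) times an integral of k that is O(h^2).
   Interpolation gives mu_j^(1-eps/2) k_j(t) <= (1 + a0) t^(-1 + al eps/2), whose
   integral produces the factor eps^-1 t^(al eps/2). Minkowski's inequality
   applied to the first n coordinates, with n -> oo, carries these scalar bounds
   over to the Hilbert scale.

   For u'' the convolution with f'' converges for almost every t only; at the
   other t any derivative of u' may serve as the value of u''. Left difference
   quotients are bounded in L2 and converge coordinatewise, hence weakly, which
   identifies the derivative of u' wherever it exists. *)

(** Positivity of [k] is what yields the other kernel bounds. The operator [t d/dt] applied to the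
    resolvent equation gives [t k' = (al - 1) k - al mu k*k], so a positive [k] is nonincreasing.
    Dropping the nonnegative [b*k] bounds [mu] times the integral of [k] by 1. Monotonicity then
    gives [mu t k(t) <= 1], and it controls [k*k], hence [t k'].

    Two obstacles shape the rest. Norms of the data take the value [+oo] and need not be measurable
    in time, so the coordinates of [f''] get a measurable Euclidean norm [G] lying below
    [nL2 (f'' t)], and integrals of arbitrary nonnegative functions are compared directly. Moreover
    the weak equation holds for almost every t, whereas the bounds are claimed for every t: the
    coefficients of u are primitives, which determines them at each t, and u(t) is recovered on all
    of [V] by continuity in time.

    As [k] is singular at 0, the quotients of u' are formed with the primitive of [k]; its
    difference quotients are at most a multiple of [t^(al-1)], uniformly in the step and in j. *)

Local Notation leb := lebesgue_measure.

(** * Integrals and convolution on (0, T) *)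

Section Affine.
Context {R : realType}.
Implicit Types (f : R -> \bar R) (c d : R).

Let affine c d (x : measurableTypeR R) : measurableTypeR R := c * x + d.

Lemma measurable_affine c d :
  measurable_fun setT (fun x : R => c * x + d).
Proof.
by apply: measurable_funD => //; apply: measurable_funM.
Qed.

Let maffine c d : measurable_fun [set: measurableTypeR R] (affine c d).
Proof. exact: measurable_affine. Qed.

Let mopp : measurable_fun [set: measurableTypeR R] (-%R : measurableTypeR R -> measurableTypeR R).
Proof. exact: oppr_measurable. Qed.

Section pos.
Variables (c d : R) (c0 : 0 < c).

Let pf : {measure set (measurableTypeR R) -> \bar R} :=
  measure_function_pushforward__canonical__measure_function_Measure
    leb (maffine c d).

Let m := mscale (NngNum (ltW c0)) pf.

(** Lebesgue measure is determined by its values on half-open intervals, and the scaled pushforward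
    has the same values there. *)
Lemma lebesgue_measure_affine (A : set R) : measurable A ->
  (c%:E * leb ((fun x => c * x + d)%R @^-1` A) = leb A)%E.
Proof.
move=> mA.
have -> : (c%:E * leb ((fun x => c * x + d)%R @^-1` A) = m A)%E by [].
apply/esym/lebesgue_measure_unique => //= _ [[a b]] _ <-.
rewrite /m /mscale/= /pushforward.
have -> : affine c d @^-1` `]a, b]%classic = `](a - d) / c, (b - d) / c]%classic.
  apply/seteqP; split => x /=; rewrite !in_itv/= /affine;
  by rewrite ltr_pdivrMr// ler_pdivlMr// mulrC ltrBlDr lerBrDr.
rewrite !lebesgue_measure_itv/= !lte_fin ltr_pM2r ?invr_gt0// ltrD2r.
case: ifPn => _; last by rewrite mule0.
by rewrite -EFinD -EFinM; congr EFin; field; exact: lt0r_neq0.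
Qed.

Lemma ge0_integral_affine_pos f : measurable_fun setT f ->
  (forall x, 0 <= f x)%E ->
  (\int[leb]_x f x = c%:E * \int[leb]_x f (c * x + d)%R)%E.
Proof.
move=> mf f0.
rewrite -(@ge0_integral_pushforward _ _ _ _ _ _ (maffine c d) leb setT f)//.
rewrite -(@ge0_integral_mscale _ _ _ pf _ measurableT (NngNum (ltW c0)))//.
apply: eq_measure_integral => A mA _.
exact/esym/(lebesgue_measure_affine mA).
Qed.
End pos.

Lemma ge0_integral_opp f : measurable_fun setT f ->
  (forall x, 0 <= f x)%E ->
  (\int[leb]_x f x = \int[leb]_x f (- x)%R)%E.
Proof.
move=> mf f0.
rewrite -(@ge0_integral_pushforward _ _ _ _ _ _ mopp leb setT f)//.
by apply: eq_measure_integral => A mA _; rewrite /= lebesgue_measureN.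
Qed.

Lemma ge0_integral_reflect f t : measurable_fun setT f ->
  (forall x, 0 <= f x)%E ->
  (\int[leb]_x f x = \int[leb]_x f (t - x)%R)%E.
Proof.
move=> mf f0; rewrite (@ge0_integral_affine_pos 1 t _ f)// mul1e.
rewrite ge0_integral_opp//; last first.
  apply: (measurableT_comp mf); exact: measurable_affine.
by apply: eq_integral => x _; rewrite mul1r addrC.
Qed.

Lemma integral_reflect f t : measurable_fun setT f ->
  (\int[leb]_x f x = \int[leb]_x f (t - x)%R)%E.
Proof.
move=> mf; rewrite [LHS]integralE [RHS]integralE; congr (_ - _)%E.
  rewrite [LHS](ge0_integral_reflect t (measurable_funepos mf) (funepos_ge0 f)).
  by apply: eq_integral => x _; rewrite !funeposE.
rewrite [LHS](ge0_integral_reflect t (measurable_funeneg mf) (funeneg_ge0 f)).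
by apply: eq_integral => x _; rewrite !funenegE.
Qed.

(** A translation is the composition of two reflections. *)
Lemma integral_translate f t : measurable_fun setT f ->
  (\int[leb]_x f x = \int[leb]_x f (x - t)%R)%E.
Proof.
move=> mf; rewrite (integral_reflect 0)// (integral_reflect t); last first.
  by apply: measurableT_comp mf _; exact: measurable_funB.
by apply: eq_integral => x _; congr f; ring.
Qed.

Lemma integral_itv_reflect f (t : R) : measurable_fun `]0, t[ f ->
  (\int[leb]_(x in `]0%R, t[) f x = \int[leb]_(x in `]0%R, t[) f (t - x)%R)%E.
Proof.
move=> mf; rewrite integral_mkcond [RHS]integral_mkcond (integral_reflect t).
  apply: eq_integral => x _; rewrite !patchE.
  have -> : (t - x \in `]0, t[%classic) = (x \in `]0, t[%classic).
    by rewrite !mem_setE !in_itv/=; apply/idP/idP => /andP[? ?]; apply/andP; split; lra.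
  by [].
by apply/(measurable_restrictT _ _).1.
Qed.

Lemma ge0_integral_itv_scale f (t : R) : 0 < t -> measurable_fun `]0, t[ f ->
  (forall x, `]0%R, t[%classic x -> 0 <= f x)%E ->
  (\int[leb]_(x in `]0%R, t[) f x = t%:E * \int[leb]_(x in `]0%R, 1%R[) f (t * x)%R)%E.
Proof.
move=> t0 mf f0.
rewrite integral_mkcond [in RHS]integral_mkcond (@ge0_integral_affine_pos t 0)//.
- congr (_ * _)%E; apply: eq_integral => x _; rewrite !patchE addr0.
  suff -> : (t * x \in `]0, t[%classic) = (x \in `]0, 1[%classic) by [].
  have e : (t * x < t) = (x < 1) by rewrite -[X in _ < X]mulr1 ltr_pM2l.
  by rewrite !mem_setE !in_itv/= pmulr_rgt0// e.
- by apply/(measurable_restrictT _ _).1.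
- by move=> x; apply: erestrict_ge0.
Qed.

End Affine.

Section RealIntegrable.
Context d (T : measurableType d) {R : realType}.
Variables (mu : {measure set T -> \bar R}) (D : set T) (mD : measurable D).
Implicit Types f g : T -> R.

Lemma integrable_dom f g : measurable_fun D f ->
  mu.-integrable D (EFin \o g) -> (forall x, D x -> `|f x| <= g x) ->
  mu.-integrable D (EFin \o f).
Proof.
move=> mf ig fg; apply: le_integrable ig => //; first exact/measurable_EFinP.
by move=> x Dx /=; rewrite lee_fin (le_trans (fg _ Dx))// ler_norm.
Qed.

Lemma integrableZ_real k f : mu.-integrable D (EFin \o f) ->
  mu.-integrable D (EFin \o (fun x => k * f x)).
Proof. exact: integrableZl. Qed.

Lemma integrableD_real f g : mu.-integrable D (EFin \o f) ->
  mu.-integrable D (EFin \o g) -> mu.-integrable D (EFin \o (fun x => f x + g x)).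
Proof. exact: integrableD. Qed.

Lemma integrable_cst_real k : (mu D < +oo)%E ->
  mu.-integrable D (EFin \o (fun=> k)).
Proof.
move=> D1; apply/integrableP; split; first exact/measurable_EFinP.
by rewrite integral_cst// lte_mul_pinfty.
Qed.

Lemma EFin_Rintegral f : mu.-integrable D (EFin \o f) ->
  ((\int[mu]_(x in D) f x)%:E = \int[mu]_(x in D) (f x)%:E)%E.
Proof. by move=> fi; rewrite /Rintegral fineK//; exact: integrable_fin_num. Qed.

End RealIntegrable.

(** * Integrals of powers and the Beta function *)

Section PowerIntegrals.
Context {R : realType}.
Implicit Types (a b t s : R).

Lemma cvg_powR0 {T : Type} (F : set_system T) {FF : Filter F} (u : T -> R) b :
  0 < b -> (\forall x \near F, 0 <= u x) -> u x @[x --> F] --> 0 ->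
  u x `^ b @[x --> F] --> 0.
Proof.
move=> b0 u0 ucvg; apply/cvgr0Pnorm_lt => e e0.
have e1 : 0 < e `^ b^-1 by rewrite powR_gt0.
move/cvgr0Pnorm_lt : ucvg => /(_ _ e1); apply: filterS2 u0 => x u0.
rewrite ger0_norm// ger0_norm ?powR_ge0// => h.
have -> : e = (e `^ b^-1) `^ b.
  by rewrite -powRrM mulVf ?gt_eqF// powRr1// ltW.
by apply: gt0_ltr_powR => //; rewrite nnegrE ?powR_ge0.
Qed.

Lemma powR_addr s a b : 0 < s -> s `^ (a + b) = s `^ a * s `^ b.
Proof. by move=> s0; rewrite powRD// (gt_eqF s0) implybT. Qed.

Lemma powR_le1 s a : 0 <= s <= 1 -> 0 <= a -> s `^ a <= 1.
Proof.
move=> /andP[s0 s1] a0; have <- : 1 `^ a = 1 :> R by rewrite powR1.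
by apply: ge0_ler_powR => //; rewrite nnegrE.
Qed.

Lemma powR_ge1 s a : 0 < s <= 1 -> a <= 0 -> 1 <= s `^ a.
Proof.
move=> /andP[s0 s1] a0; rewrite -[a]opprK powRN -[leLHS]invr1.
rewrite lef_pV2 ?posrE ?powR_gt0//; apply: powR_le1; last by rewrite oppr_ge0.
by rewrite ltW.
Qed.

Lemma le_powRN s t a : 0 < s -> s <= t -> a <= 0 -> t `^ a <= s `^ a.
Proof.
move=> s0 st a0; rewrite -[a]opprK !(powRN _ (- a)).
rewrite lef_pV2 ?posrE ?powR_gt0//; last exact: lt_le_trans st.
apply: ge0_ler_powR => //; rewrite ?nnegrE ?oppr_ge0//; apply: ltW => //.
exact: lt_le_trans st.
Qed.

Lemma measurable_powRB a t (D : set R) :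
  measurable_fun D (fun s => (t - s) `^ a).
Proof.
apply: measurable_funTS.
apply: (measurableT_comp (measurable_powR a)) => //.
by apply: measurable_funB.
Qed.

Lemma measurable_powRl a (D : set R) : measurable_fun D (fun s => s `^ a).
Proof. by apply: measurable_funTS; exact: measurable_powR. Qed.

Lemma powR_cvg a s : 0 < s -> {for s, continuous (fun x : R => x `^ a)}.
Proof.
move=> s0; apply/differentiable_continuous/derivable1_diffP.
by have [] := is_derive1_powR a s0.
Qed.

Lemma integral_powR b t : 0 < b -> 0 <= t ->
  (\int[leb]_(s in `]0%R, t[) (s `^ (b - 1))%:E = (t `^ b / b)%:E)%E.
Proof.
move=> b0; rewrite le_eqVlt => /predU1P[<-|t0].
  by rewrite set_itvoo0 integral_set0 powR0 ?gt_eqF// mul0r.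
(* For [b < 1] the integrand is singular at 0, so the fundamental theorem of calculus is applied on
   these intervals and monotone convergence exhausts []0, t]]. The index [n.+2] keeps every interval
   nondegenerate. *)
pose F n := `[t / n.+2%:R, t]%classic : set R.
have tn n : 0 < t / n.+2%:R by rewrite divr_gt0.
have FU : \bigcup_n F n = `]0, t]%classic.
  apply/seteqP; split => [x [n _]|x] /=.
    rewrite /F/= !in_itv/= => /andP[h ->]; rewrite andbT.
    exact: lt_le_trans h.
  rewrite in_itv/= => /andP[x0 xt].
  exists (Num.truncn (t / x)) => //=; rewrite /F/= in_itv/= xt andbT ler_pdivrMr// mulrC.
  rewrite -ler_pdivrMr//; apply: ltW; apply: (lt_trans (truncnS_gt _)).
  by rewrite ltr_nat.
have ndF : nondecreasing_seq F.
  move=> m n mn; apply/subsetPset => x /=; rewrite /F/= !in_itv/= => /andP[h ->].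
  rewrite andbT; apply: le_trans h; rewrite ler_pM2l// lef_pV2 ?posrE//.
  by rewrite ler_nat !ltnS.
have mf (D : set R) : measurable_fun D (fun s : R => (s `^ (b - 1))%:E).
  by apply/measurable_EFinP; exact: measurable_powRl.
have h := ge0_nondecreasing_set_cvg_integral (mu := leb) ndF
  (fun i => measurable_itv _) (fun i => mf (F i)) (fun i x _ => powR_ge0 _ _).
rewrite FU in h.
rewrite integral_itv_bndo_bndc; last exact: mf.
apply: (cvg_unique _ h) => //.
have -> : (fun i => \int[leb]_(x in F i) (x `^ (b - 1))%:E)%E =
   (fun i => (t `^ b / b - (t / i.+2%:R) `^ b / b)%:E).
  apply/funext => i.
  have ti : t / i.+2%:R < t by rewrite ltr_pdivrMr// ltr_pMr// ltr1n.
  have d x : x \in `[t / i.+2%:R, t] -> 0 < x.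
    by rewrite in_itv/= => /andP[h1 _]; exact: lt_le_trans h1.
  have dd (x : R) : 0 < x -> is_derive x 1 (fun y : R => y `^ b / b) (x `^ (b - 1)).
    move=> x0; have := is_derive1_powR b x0 => H.
    have -> : x `^ (b - 1) = b^-1 *: (b * x `^ (b - 1)).
      by rewrite /GRing.scale/= mulrA mulVf ?mul1r// gt_eqF.
    have -> : (fun y => y `^ b / b) = b^-1 *: (fun y => y `^ b).
      by apply/funext => y; rewrite /= mulrC.
    exact: is_deriveZ.
  rewrite /F (@continuous_FTC2 _ _ (fun x => x `^ b / b))//.
  - apply: continuous_in_subspaceT => x /set_mem /= /d x0.
    exact: powR_cvg.
  - split => [x /subset_itv_oo_cc /d x0| |].
    + by have [] := dd _ x0.
    + apply: cvg_at_right_filter; apply: cvgMr_tmp; exact: powR_cvg.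
    + apply: cvg_at_left_filter; apply: cvgMr_tmp; exact: powR_cvg.
  - move=> x /subset_itv_oo_cc /d x0; rewrite derive1E.
    by have [_ ->] := dd _ x0.
apply: cvg_EFin; first by near=> n.
rewrite -[X in _ --> X]subr0 -[X in _ --> _ - X](mul0r b^-1).
apply: cvgB; first exact: cvg_cst.
apply: cvgMr_tmp; apply: cvg_powR0 => //; first by apply: nearW => n; exact: ltW.
rewrite -[X in _ --> X](mulr0 t); apply: cvgMl_tmp.
have : harmonic x @[x --> \oo] --> (0:R) by exact: cvg_harmonic.
rewrite -cvg_shiftS.
exact.
Unshelve. all: by end_near. Qed.

Lemma integrable_powR b t : 0 < b -> 0 <= t ->
  leb.-integrable `]0, t[ (EFin \o (fun s => s `^ (b - 1))).
Proof.
move=> b0 t0; apply/integrableP; split.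
  by apply/measurable_EFinP; exact: measurable_powRl.
under eq_integral do rewrite /= ger0_norm ?powR_ge0//.
by rewrite integral_powR// ltry.
Qed.

Lemma integral_powRB b t : 0 < b -> 0 <= t ->
  (\int[leb]_(s in `]0%R, t[) ((t - s) `^ (b - 1))%:E = (t `^ b / b)%:E)%E.
Proof.
move=> b0 t0; rewrite -(integral_powR b0 t0) [RHS]integral_itv_reflect//.
by apply/measurable_EFinP; exact: measurable_powRl.
Qed.

Lemma integrable_powRB b t : 0 < b -> 0 <= t ->
  leb.-integrable `]0, t[ (EFin \o (fun s => (t - s) `^ (b - 1))).
Proof.
move=> b0 t0; apply/integrableP; split.
  by apply/measurable_EFinP; exact: measurable_powRB.
under eq_integral do rewrite /= ger0_norm ?powR_ge0//.
by rewrite integral_powRB// ltry.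
Qed.

Definition beta a b : R :=
  \int[leb]_(s in `]0, 1[) ((1 - s) `^ (a - 1) * s `^ (b - 1)).

Let half_bound a s : 2^-1 <= s <= 1 -> s `^ (a - 1) <= 1 + 2^-1 `^ (a - 1).
Proof.
move=> /andP[s2 s1]; have s0 : 0 < s by apply: lt_le_trans s2.
have [a1|a1] := leP 1 a.
  apply: (@le_trans _ _ 1); last by rewrite lerDl powR_ge0.
  by apply: powR_le1; rewrite ?subr_ge0// ltW.
apply: (@le_trans _ _ (2^-1 `^ (a - 1))); last by rewrite lerDr.
by apply: le_powRN => //; rewrite subr_le0 ltW.
Qed.

(** On each half of the unit interval only one factor can be singular, and the other is bounded by
    [half_bound]. Adding the two majorants avoids cutting the integral. *)
Lemma integrable_beta a b : 0 < a -> 0 < b ->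
  leb.-integrable `]0, 1[ (EFin \o (fun s => (1 - s) `^ (a - 1) * s `^ (b - 1))).
Proof.
move=> a0 b0.
pose Ma := 1 + 2^-1 `^ (a - 1) : R; pose Mb := 1 + 2^-1 `^ (b - 1) : R.
have h : leb.-integrable `]0, 1[ (EFin \o (fun s : R => Ma * s `^ (b - 1) +
    Mb * (1 - s) `^ (a - 1))).
  apply: integrableD_real => //; apply: integrableZ_real => //.
    exact: integrable_powR.
  exact: integrable_powRB.
apply: integrable_dom h _ => //.
  apply: measurable_funM; first exact: measurable_powRB.
  exact: measurable_powRl.
move=> s /=; rewrite in_itv/= => /andP[s0 s1].
have Ma0 : 0 <= Ma by rewrite addr_ge0// powR_ge0.
have Mb0 : 0 <= Mb by rewrite addr_ge0// powR_ge0.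
have p0 x c : 0 <= x `^ c :> R by exact: powR_ge0.
rewrite ger0_norm ?mulr_ge0//.
have [s2|s2] := leP s 2^-1.
  apply: ler_wpDr; first exact: mulr_ge0.
  by apply: ler_wpM2r => //; apply: half_bound; lra.
apply: ler_wpDl; first exact: mulr_ge0.
by rewrite mulrC; apply: ler_wpM2r => //; apply: half_bound; lra.
Qed.

Lemma beta_ge0 a b : 0 <= beta a b.
Proof. by apply: Rintegral_ge0 => s _; rewrite mulr_ge0// powR_ge0. Qed.

(** Nonpositive exponents make both factors at least 1. What is used later is that the Beta value is
    positive. *)
Lemma beta_ge1 a b : 0 < a <= 1 -> 0 < b <= 1 -> 1 <= beta a b.
Proof.
move=> /andP[a0 a1] /andP[b0 b1].
have -> : (1:R) = \int[leb]_(s in `]0, 1[) (fun=> 1) s.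
  rewrite Rintegral_cst//= lebesgue_measure_itv/= lte_fin ltr01 sube0/=.
  by rewrite mul1r.
apply: le_Rintegral => //.
- by apply: integrable_cst_real => //=; rewrite lebesgue_measure_itv/= lte_fin ltr01 ltry.
- exact: integrable_beta.
- move=> s /=; rewrite in_itv/= => /andP[s0 s1].
  rewrite -[leLHS]mulr1; apply: ler_pM => //; apply: powR_ge1; rewrite ?subr_le0//; lra.
Qed.

Lemma integral_powR_conv a b t : 0 < a -> 0 < b -> 0 < t ->
  (\int[leb]_(s in `]0%R, t[) ((t - s) `^ (a - 1) * s `^ (b - 1))%:E =
   (beta a b * t `^ (a + b - 1))%:E)%E.
Proof.
move=> a0 b0 t0; rewrite ge0_integral_itv_scale//; last 2 first.
- apply/measurable_EFinP; apply: measurable_funM.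
    exact: measurable_powRB.
  exact: measurable_powRl.
- by move=> x _; rewrite lee_fin mulr_ge0 ?powR_ge0.
rewrite [X in (_ * X)%E](_ : _ = \int[leb]_(s in `]0%R, 1%R[) ((t `^ (a + b - 1 - 1))%:E *
   ((1 - s) `^ (a - 1) * s `^ (b - 1))%:E))%E; last first.
  apply: eq_integral => s /set_mem/=; rewrite in_itv/= => /andP[s0 s1].
  rewrite -EFinM; congr EFin.
  have -> : t - t * s = t * (1 - s) by ring.
  rewrite !powRM//; try lra.
  have -> : a + b - 1 - 1 = (a - 1) + (b - 1) by ring.
  by rewrite (powR_addr (a - 1) (b - 1) t0) mulrACA.
have ib := integrable_beta a0 b0.
rewrite integralZl// muleA -EFinM; have -> : t * t `^ (a + b - 1 - 1) = t `^ (a + b - 1).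
  rewrite -{1}[t]powRr1 ?ltW// -(powR_addr _ _ t0); congr (_ `^ _); ring.
rewrite /beta /Rintegral mulrC EFinM; congr (_ * _)%E; rewrite fineK//.
exact: integrable_fin_num.
Qed.

End PowerIntegrals.

(* No measurability is assumed: the integral of a nonnegative function is the
   supremum of the integrals of the simple functions below it. *)
Lemma ge0_le_integral_sup d (T : measurableType d) (R : realType)
    (mu : {measure set T -> \bar R}) (D : set T) (f g : T -> \bar R) :
  (forall x, D x -> 0 <= f x)%E -> (forall x, D x -> f x <= g x)%E ->
  (\int[mu]_(x in D) f x <= \int[mu]_(x in D) g x)%E.
Proof.
move=> f0 fg; have g0 x : D x -> (0 <= g x)%E by move=> Dx; exact: le_trans (f0 _ Dx) (fg _ Dx).
rewrite !ge0_integralE//; apply: ub_ereal_sup => _ [h hf <-].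
apply: ereal_sup_ubound; exists h => // x; apply: le_trans (hf x) _.
by apply: lee_restrict.
Qed.

(** * Convolution over an interval and its associativity *)

Section Convolution.
Context {R : realType}.
Implicit Types (f g h : R -> R) (t T : R).

Lemma measurable_oo (a b : R) : measurable (`]a, b[%classic : set (measurableTypeR R)).
Proof. by []. Qed.

(** A real-valued integral is total, with a default value where the product is not integrable; hence
    the integrability side conditions of the algebraic rules below. *)
Definition conv f g t : R := \int[leb]_(s in `]0, t[) (f (t - s) * g s).

(** Extension by zero turns the variable domain of a convolution into the whole line, where
    translations and Fubini's theorem apply. *)
Definition cut t f : R -> R := f \_ `]0, t[.

Lemma measurable_cut t f : measurable_fun `]0, t[ f -> measurable_fun setT (cut t f).
Proof. by move=> mf; apply/(measurable_restrictT _ _).1. Qed.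

Lemma cutE t f s : 0 < s < t -> cut t f s = f s.
Proof. by move=> st; rewrite /cut patchE mem_setE in_itv/= st. Qed.

Lemma cut0 t f s : ~~ (0 < s < t) -> cut t f s = 0.
Proof. by move=> st; rewrite /cut patchE mem_setE in_itv/= (negbTE st). Qed.

Lemma measurable_reflect t f : measurable_fun `]0, t[ f ->
  measurable_fun `]0, t[ (fun s => f (t - s)).
Proof.
move=> /measurable_cut mf; apply: (eq_measurable_fun (fun s : R => cut t f (t - s))).
  move=> s /set_mem/=; rewrite in_itv/= => st; rewrite cutE//; lra.
apply: measurable_funTS; apply: (measurableT_comp mf).
exact: measurable_funB.
Qed.

Lemma measurable_itvS t T f : t <= T -> measurable_fun `]0, T[ f -> measurable_fun `]0, t[ f.
Proof.
move=> tT; apply: measurable_funS => //; apply: subset_itvl; rewrite bnd_simp//.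
Qed.

Lemma integrable_itvS t T f : t <= T -> leb.-integrable `]0, T[ (EFin \o f) ->
  leb.-integrable `]0, t[ (EFin \o f).
Proof.
move=> tT; apply: integrableS => //; apply: subset_itvl; rewrite bnd_simp//.
Qed.

Lemma integrable_itv_reflect t f : leb.-integrable `]0, t[ (EFin \o f) ->
  leb.-integrable `]0, t[ (EFin \o (fun s => f (t - s))).
Proof.
move=> /integrableP[/measurable_EFinP mf fi]; apply/integrableP; split.
  by apply/measurable_EFinP; exact: measurable_reflect.
rewrite -(integral_itv_reflect (f := fun s => (`|(EFin \o f) s|)%E))//.
by apply: measurableT_comp => //; exact/measurable_EFinP.
Qed.

Lemma convC f g t : measurable_fun `]0, t[ f -> measurable_fun `]0, t[ g ->
  conv f g t = conv g f t.
Proof.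
move=> mf mg; rewrite /conv /Rintegral; congr fine.
rewrite integral_itv_reflect; last first.
  apply/measurable_EFinP; apply: measurable_funM => //.
  exact: measurable_reflect.
by apply: eq_integral => s _; rewrite subKr mulrC.
Qed.

(** Stated for a general [F] so as to serve both for products and for their absolute values. *)
Lemma cut_conv (F : R -> R -> \bar R) T f g s : s <= T -> (forall a, F a 0 = 0%E) ->
  (forall a, F 0 a = 0%E) ->
  (\int[leb]_(r in `]0%R, s[) F (f (s - r)%R) (g r) =
   \int[leb]_r F (cut T f (s - r)%R) (cut T g r))%E.
Proof.
move=> sT F0 F0'; rewrite integral_mkcond; apply: eq_integral => r _.
rewrite patchE mem_setE in_itv/=; case: ifPn => rs.
  by rewrite !cutE//; lra.
have [r0|r0] := leP r 0; first by rewrite [cut T g r]cut0 ?F0//; lra.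
by rewrite [cut T f _]cut0 ?F0'//; move: rs; rewrite r0/= -leNgt => rs; lra.
Qed.

Lemma conv_cutE T f g s : s <= T ->
  conv f g s = \int[leb]_r (cut T f (s - r) * cut T g r).
Proof.
move=> sT; rewrite /conv /Rintegral; congr fine.
apply: (cut_conv (F := fun a b => (a * b)%:E)) => // a; first by rewrite mulr0.
by rewrite mul0r.
Qed.

Lemma measurable_int_param (k : R * R -> R) : measurable_fun setT k ->
  measurable_fun setT (fun x => (\int[leb]_y (k (x, y))%:E)%E).
Proof.
move=> mk.
have -> : (fun x => (\int[leb]_y (k (x, y))%:E)%E) =
   ((fun x => (\int[leb]_y (EFin \o k)^\+ (x, y)))%E \- (fun x => (\int[leb]_y (EFin \o k)^\- (x, y)))%E)%E.
  apply/funext => x; rewrite [LHS]integralE /=; congr (_ - _)%E.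
    by apply: eq_integral => y _; rewrite !funeposE.
  by apply: eq_integral => y _; rewrite !funenegE.
have mk' : measurable_fun setT (EFin \o k) by exact/measurable_EFinP.
apply: emeasurable_funB; apply: measurable_fun_fubini_tonelli_F => //.
  exact: measurable_funepos.
exact: measurable_funeneg.
Qed.

Lemma measurable_conv T f g : measurable_fun `]0, T[ f -> measurable_fun `]0, T[ g ->
  measurable_fun `]0, T[ (conv f g).
Proof.
move=> /measurable_cut mf /measurable_cut mg.
apply: (eq_measurable_fun (fun s : R => fine (\int[leb]_r (cut T f (s - r) * cut T g r)%:E)%E)).
  by move=> s /set_mem/=; rewrite in_itv/= => /andP[_ /ltW sT]; rewrite (conv_cutE _ _ sT).
apply: measurable_funTS; apply: measurableT_comp; first exact: fine_measurable.
apply: (measurable_int_param (k := fun p => cut T f (p.1 - p.2) * cut T g p.2)).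
apply: measurable_funM.
  by apply: (measurableT_comp mf); apply: measurable_funB.
exact: measurableT_comp mg _.
Qed.

Lemma cut_convE f g h t x :
  cut t f (t - x) * cut t (conv g h) x =
  cut t f (t - x) * \int[leb]_y (cut t g (x - y) * cut t h y).
Proof.
have [xt|xt] := boolP (0 < x < t); first by rewrite [cut t (conv _ _) x]cutE ?(@conv_cutE t)//; lra.
have [x0|x0] := leP x 0; last first.
  by rewrite [cut t f _]cut0 ?mul0r//; move: xt; rewrite x0/= -leNgt => xt; lra.
congr (_ * _); rewrite [LHS]cut0//; apply/esym.
rewrite /Rintegral [X in fine X](_ : _ = 0%E)//; apply: integral0_eq => y _; congr EFin.
have [y0|y0] := leP y 0; first by rewrite [cut t h y]cut0 ?mulr0//; lra.
by rewrite [cut t g _]cut0 ?mul0r//; lra.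
Qed.

Lemma cut_convE2 f g h t y : measurable_fun `]0, t[ f -> measurable_fun `]0, t[ g ->
  cut t (conv f g) (t - y) * cut t h y =
  cut t h y * \int[leb]_x (cut t f (t - x) * cut t g (x - y)).
Proof.
move=> /measurable_cut mf /measurable_cut mg; rewrite mulrC.
have [yt|yt] := boolP (0 < y < t); last by rewrite [cut t h y]cut0 ?mul0r.
congr (_ * _); rewrite cutE; last lra.
rewrite (@conv_cutE t); last lra.
rewrite /Rintegral; congr fine; rewrite (integral_translate y).
  by apply: eq_integral => x _; congr ((cut t f _ * _)%:E); ring.
apply/measurable_EFinP; apply: measurable_funM; last exact: mg.
by apply: (measurableT_comp mf); apply: measurable_funB.
Qed.

Section Assoc.
Variables (f g h : R -> R) (t : R).
Hypotheses (mf : measurable_fun `]0, t[ f) (mg : measurable_fun `]0, t[ g)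
  (mh : measurable_fun `]0, t[ h).

Let K (p : R * R) : R := cut t f (t - p.1) * (cut t g (p.1 - p.2) * cut t h p.2).

Let mK : measurable_fun setT K.
Proof.
have mf' := measurable_cut mf; have mg' := measurable_cut mg; have mh' := measurable_cut mh.
apply: measurable_funM.
  by apply: (measurableT_comp mf'); apply: measurable_funB.
apply: measurable_funM.
  by apply: (measurableT_comp mg'); apply: measurable_funB.
exact: measurableT_comp mh' _.
Qed.

(** Integrability is known for the product only, so [c = 0] has to be treated apart. *)
Let iZ (c : R) (b : R -> R) : leb.-integrable setT (EFin \o (fun y => c * b y)) ->
  (\int[leb]_y (c * b y)%:E = (c * \int[leb]_y b y)%:E)%E.
Proof.
move=> ib; have [->|c0] := eqVneq c 0.
  by rewrite mul0r; under eq_integral do rewrite mul0r; rewrite integral0.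
have ib' : leb.-integrable setT (EFin \o b).
  have := integrableZ_real measurableT (c^-1) ib.
  by congr (_.-integrable _ _); apply/funext => y; rewrite /= mulKf.
by rewrite EFinM EFin_Rintegral// -integralZl.
Qed.

(** The two sides are the iterated integrals of [K]. A slice of [K] is integrable only almost
    everywhere, so each inner convolution is identified almost everywhere. *)
Let convA_int : (leb \x leb)%E.-integrable setT (EFin \o K) ->
  conv f (conv g h) t = conv (conv f g) h t.
Proof.
move=> iK.
have mK' : measurable_fun setT (EFin \o K) by exact/measurable_EFinP.
have fub := Fubini iK.
have mcgh := measurable_cut (measurable_conv mg mh).
have mcfg := measurable_cut (measurable_conv mf mg).
have mf' := measurable_cut mf; have mh' := measurable_cut mh.
have -> : conv f (conv g h) t = fine (\int[leb]_x \int[leb]_y (K (x, y))%:E)%E.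
  rewrite (conv_cutE _ _ (lexx t)) /Rintegral; congr fine.
  apply: ae_eq_integral; first exact: measurableT.
  - apply/measurable_EFinP; apply: measurable_funM => //.
    by apply: (measurableT_comp mf'); apply: measurable_funB.
  - exact: measurable_int_param.
  - have := ae_integrable1 iK; apply: filterS => x ix _.
    rewrite (@iZ (cut t f (t - x)) (fun y => cut t g (x - y) * cut t h y) ix).
    congr EFin; exact: cut_convE.
have -> : conv (conv f g) h t = fine (\int[leb]_y \int[leb]_x (K (x, y))%:E)%E.
  rewrite (conv_cutE _ _ (lexx t)) /Rintegral; congr fine.
  apply: ae_eq_integral; first exact: measurableT.
  - apply/measurable_EFinP; apply: measurable_funM => //.
    by apply: (measurableT_comp mcfg); apply: measurable_funB.
  - apply: (measurable_int_param (k := fun p => K (p.2, p.1))).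
    by apply: (measurableT_comp mK); exact: measurable_swap.
  - have := ae_integrable2 iK; apply: filterS => y iy _.
    have KE x : K (x, y) = cut t h y * (cut t f (t - x) * cut t g (x - y)).
      by rewrite /K/=; ring.
    transitivity (\int[leb]_x (cut t h y * (cut t f (t - x) * cut t g (x - y)))%:E)%E; last first.
      by apply: eq_integral => x _; congr EFin; exact/esym/KE.
    rewrite (@iZ (cut t h y) (fun x => cut t f (t - x) * cut t g (x - y))); last first.
      by move: iy; congr (_.-integrable _ _); apply/funext => x /=; rewrite KE.
    congr EFin; exact: cut_convE2.
exact: (congr1 fine fub).
Qed.

(** Tonelli with the inner convolution of [g] and [h] estimated first: suited to three kernels with
    power bounds. *)
Lemma convA12 :
  (\int[leb]_(s in `]0%R, t[) ((`|f (t - s)|)%:E * \int[leb]_(r in `]0%R, s[) (`|g (s - r) * h r|)%:E) < +oo)%E ->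
  conv f (conv g h) t = conv (conv f g) h t.
Proof.
move=> H; apply: convA_int; apply/integrable12ltyP; first exact/measurable_EFinP.
apply: le_lt_trans H; rewrite le_eqVlt; apply/orP; left; apply/eqP.
rewrite [RHS]integral_mkcond; apply: eq_integral => x _.
rewrite patchE mem_setE in_itv/=.
transitivity ((`|cut t f (t - x)|)%:E * \int[leb]_y (`|cut t g (x - y) * cut t h y|)%:E)%E.
  rewrite -ge0_integralZl//.
  - by apply: eq_integral => y _; rewrite -EFinM -normrM.
  - apply/measurable_EFinP; apply: measurableT_comp; first exact: normr_measurable.
    apply: measurable_funM; last exact: measurable_cut.
    by apply: (measurableT_comp (measurable_cut mg)); apply: measurable_funB.
have [xt|xt] := boolP (0 < x < t).
  rewrite cutE; last lra.
  congr (_ * _)%E; rewrite (@cut_conv (fun a b => (`|(a * b)%R|)%:E) t)//; try lra.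
  - by move=> a; rewrite mulr0 normr0.
  - by move=> a; rewrite mul0r normr0.
have [x0|x0] := leP x 0; last first.
  by rewrite [cut t f _]cut0 ?normr0 ?mul0e//; move: xt; rewrite x0/= -leNgt => xt; lra.
rewrite [X in (_ * X)%E](_ : _ = 0%E) ?mule0//; apply: integral0_eq => y _; congr EFin.
have [y0|y0] := leP y 0; first by rewrite [cut t h y]cut0 ?mulr0 ?normr0//; lra.
by rewrite [cut t g _]cut0 ?mul0r ?normr0//; lra.
Qed.

(** Tonelli in the other order, with [h] outermost: here [h] may be merely integrable, provided the
    convolution of [|f|] and [|g|] is bounded. *)
Lemma convA21 :
  (\int[leb]_(r in `]0%R, t[) ((`|h r|)%:E * \int[leb]_(s in `]0%R, (t - r)%R[) (`|f (t - r - s) * g s|)%:E) < +oo)%E ->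
  conv f (conv g h) t = conv (conv f g) h t.
Proof.
move=> H; apply: convA_int; apply/integrable21ltyP; first exact/measurable_EFinP.
apply: le_lt_trans H; rewrite le_eqVlt; apply/orP; left; apply/eqP.
rewrite [RHS]integral_mkcond; apply: eq_integral => y _.
rewrite patchE mem_setE in_itv/=.
transitivity ((`|cut t h y|)%:E * \int[leb]_x (`|cut t f (t - x) * cut t g (x - y)|)%:E)%E.
  rewrite -ge0_integralZl//.
  - by apply: eq_integral => x _; rewrite -EFinM -normrM/=; congr (`|_|%:E); rewrite /K/=; ring.
  - apply/measurable_EFinP; apply: measurableT_comp; first exact: normr_measurable.
    apply: measurable_funM; apply: measurableT_comp; try exact: measurable_cut.
      exact: measurable_funB.
    exact: measurable_funB.
have [yt|yt] := boolP (0 < y < t); last by rewrite [cut t h y]cut0 ?normr0 ?mul0e.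
have ty : t - y <= t by lra.
rewrite cutE//; congr (_ * _)%E; rewrite (@cut_conv (fun a b => (`|(a * b)%R|)%:E) t _ _ _ ty).
- rewrite [RHS](integral_translate y).
    by apply: eq_integral => x _; congr ((`|cut t f _ * _|)%:E); ring.
  apply/measurable_EFinP; apply: measurableT_comp; first exact: normr_measurable.
  apply: measurable_funM; last exact: measurable_cut.
  by apply: (measurableT_comp (measurable_cut mf)); apply: measurable_funB.
- by move=> a; rewrite mulr0 normr0.
- by move=> a; rewrite mul0r normr0.
Qed.
End Assoc.

(** The index is shifted by one so that convolution adds indices; index 1 means bounded, and a
    positive index means an integrable majorant. *)
Definition powb (a C T : R) f := forall s, 0 < s < T -> `|f s| <= C * s `^ (a - 1).

Section Bounds.
Variables (T a b Cf Cg : R) (f g : R -> R).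
Hypotheses (mf : measurable_fun `]0, T[ f) (mg : measurable_fun `]0, T[ g).
Hypotheses (a0 : 0 < a) (b0 : 0 < b) (fb : powb a Cf T f) (gb : powb b Cg T g).

Let mfg s : s <= T -> measurable_fun `]0, s[ (fun r => f (s - r) * g r).
Proof.
move=> sT; apply: measurable_funM; last exact: measurable_itvS mg.
by apply: measurable_reflect; exact: measurable_itvS mf.
Qed.

Lemma powb_convE_le s : 0 < s <= T ->
  (\int[leb]_(r in `]0%R, s[) (`|f (s - r) * g r|)%:E <=
   (Cf * Cg * beta a b * s `^ (a + b - 1))%:E)%E.
Proof.
move=> /andP[s0 sT].
apply: (@le_trans _ _ (\int[leb]_(r in `]0%R, s[)
    (Cf * Cg * ((s - r) `^ (a - 1) * r `^ (b - 1)))%:E)%E).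
  apply: ge0_le_integral => //.
  - by apply/measurable_EFinP; apply: measurableT_comp; [exact: normr_measurable|exact: mfg].
  - apply/measurable_EFinP; apply: measurable_funM => //; apply: measurable_funM.
      exact: measurable_powRB.
    exact: measurable_powRl.
  - move=> r /=; rewrite in_itv/= => /andP[r0 rs].
    rewrite lee_fin normrM mulrACA; apply: ler_pM => //; [apply: fb|apply: gb]; lra.
have h := integral_powR_conv a0 b0 s0.
have ic : leb.-integrable `]0, s[ (EFin \o (fun r => (s - r) `^ (a - 1) * r `^ (b - 1))).
  apply/integrableP; split.
    apply/measurable_EFinP; apply: measurable_funM.
      exact: measurable_powRB.
    exact: measurable_powRl.
  under eq_integral do rewrite /= ger0_norm ?mulr_ge0 ?powR_ge0//.
  by rewrite h ltry.
under eq_integral do rewrite EFinM.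
by rewrite integralZl// h -EFinM mulrA.
Qed.

Lemma powb_conv_integrable s : 0 < s <= T ->
  leb.-integrable `]0, s[ (EFin \o (fun r => f (s - r) * g r)).
Proof.
move=> sT; apply/integrableP; split.
  by apply/measurable_EFinP; apply: mfg; case/andP: sT.
exact: le_lt_trans (powb_convE_le sT) (ltry _).
Qed.

Lemma powb_conv_le s : 0 < s <= T ->
  `|conv f g s| <= Cf * Cg * beta a b * s `^ (a + b - 1).
Proof.
move=> sT; have i := powb_conv_integrable sT.
rewrite -lee_fin; apply: le_trans (powb_convE_le sT).
have := le_normr_Rintegral (measurable_oo 0 s) i; rewrite -lee_fin; move=> /le_trans; apply.
rewrite EFin_Rintegral//; exact: integrable_norm.
Qed.

Lemma powb_conv : powb (a + b) (Cf * Cg * beta a b) T (conv f g).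
Proof. by move=> s /andP[s0 sT]; apply: powb_conv_le; rewrite s0 ltW. Qed.

End Bounds.

Lemma powb_ge0 T a C f : 0 < T -> powb a C T f -> 0 <= C.
Proof.
move=> T0 fb; have := fb (T / 2); rewrite divr_gt0// ltr_pdivrMr// ltr_pMr// ltr1n => /(_ isT) h.
have := le_trans (normr_ge0 _) h; rewrite pmulr_lge0// powR_gt0// divr_gt0//.
Qed.

Lemma convA_powb T a b c Cf Cg Ch f g h t :
  measurable_fun `]0, T[ f -> measurable_fun `]0, T[ g -> measurable_fun `]0, T[ h ->
  0 < a -> 0 < b -> 0 < c -> powb a Cf T f -> powb b Cg T g -> powb c Ch T h ->
  0 < t <= T -> conv f (conv g h) t = conv (conv f g) h t.
Proof.
move=> mf mg mh a0 b0 c0 fb gb hb /andP[t0 tT].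
have T0 : 0 < T by exact: lt_le_trans tT.
have C1 := powb_ge0 T0 fb; have C2 := powb_ge0 T0 gb; have C3 := powb_ge0 T0 hb.
apply: convA12; [exact: measurable_itvS mf|exact: measurable_itvS mg|exact: measurable_itvS mh|].
pose G s := Cg * Ch * beta b c * s `^ (b + c - 1).
have G0 s : 0 <= G s by rewrite /G !mulr_ge0// ?beta_ge0 ?powR_ge0.
have mG : measurable_fun `]0, T[ G by apply: measurable_funM => //; exact: measurable_powRl.
have bG : powb (b + c) (Cg * Ch * beta b c) T G by move=> s _; rewrite ger0_norm.
have bc0 : 0 < b + c by exact: addr_gt0.
apply: (@le_lt_trans _ _ (\int[leb]_(s in `]0%R, t[) (`|f (t - s) * G s|)%:E)%E); last first.
  have := @powb_convE_le T _ _ _ _ _ _ mf mG a0 bc0 fb bG t.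
  by rewrite t0 tT => /(_ isT) H; exact: le_lt_trans H (ltry _).
apply: ge0_le_integral_sup => s /=; rewrite in_itv/= => /andP[s0 st].
  by apply: mule_ge0; rewrite ?lee_fin//; apply: integral_ge0.
rewrite normrM EFinM (ger0_norm (G0 _)) lee_wpmul2l ?lee_fin//.
by apply: powb_convE_le mg mh b0 c0 gb hb _ _; lra.
Qed.

(** The condition [1 <= a + b] makes the convolution of [|f|] and [|g|] bounded on []0, t[], so that
    an integrable [h] is admissible. *)
Lemma convA_L1 T a b Cf Cg f g h t :
  measurable_fun `]0, T[ f -> measurable_fun `]0, T[ g ->
  leb.-integrable `]0, T[ (EFin \o h) ->
  0 < a -> 0 < b -> 1 <= a + b -> powb a Cf T f -> powb b Cg T g ->
  0 < t <= T -> conv f (conv g h) t = conv (conv f g) h t.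
Proof.
move=> mf mg ih a0 b0 ab fb gb /andP[t0 tT].
have mh : measurable_fun `]0, T[ h by apply/measurable_EFinP; exact: measurable_int ih.
have T0 : 0 < T by exact: lt_le_trans tT.
have C1 := powb_ge0 T0 fb; have C2 := powb_ge0 T0 gb.
apply: convA21; [exact: measurable_itvS mf|exact: measurable_itvS mg|exact: measurable_itvS mh|].
pose C := Cf * Cg * beta a b * t `^ (a + b - 1).
have C0 : 0 <= C by rewrite /C !mulr_ge0// ?beta_ge0 ?powR_ge0.
have iCh := integrableZ_real (measurable_oo 0 t) C (integrable_norm (integrable_itvS tT ih)).
apply: (@le_lt_trans _ _ (\int[leb]_(r in `]0%R, t[) (C * `|h r|)%:E)%E); last first.
  by have := integrable_lty (measurable_oo 0 t) iCh.
apply: ge0_le_integral_sup => r /=; rewrite in_itv/= => /andP[r0 rt].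
  by apply: mule_ge0; rewrite ?lee_fin//; apply: integral_ge0.
rewrite EFinM muleC lee_wpmul2r ?lee_fin//.
have rT : 0 < t - r <= T by lra.
apply: le_trans (powb_convE_le mf mg a0 b0 fb gb rT) _.
rewrite lee_fin /C ler_wpM2l ?mulr_ge0 ?beta_ge0//.
apply: ge0_ler_powR; rewrite ?nnegrE; lra.
Qed.

End Convolution.

(** * The Mittag-Leffler kernel *)

Lemma le_powR (R : realType) (a s t : R) : 0 <= a -> 0 <= s -> s <= t -> s `^ a <= t `^ a.
Proof.
by move=> a0 s0 st; apply: ge0_ler_powR; rewrite ?nnegrE// (le_trans s0).
Qed.

Section EntireSeries.
Context {R : realType}.
Implicit Types (c : nat -> R) (x : R).

(** Infinite radius of convergence, encoded by bounded terms at every radius; in this form it passes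
    easily to shifted and differentiated coefficients. *)
Definition entire c := forall x, 0 < x -> exists M, forall k, `|c k| * x ^+ k <= M.

(** A bound on the terms at radius [2 * X] becomes a geometric majorant of ratio 1/2 at radius [X].
    It does not depend on [n], as dominated convergence will require. *)
Lemma entire_partial_le c X : entire c -> 0 < X -> exists M : R, 0 <= M /\
  forall n x, 0 <= x <= X -> \sum_(0 <= k < n) `|c k| * x ^+ k <= M.
Proof.
move=> ec X0; have [M Mb] := ec (2 * X) (mulr_gt0 (ltr0Sn _ 1) X0).
have M0 : 0 <= M by apply: le_trans (Mb 0%N); rewrite mulr_ge0.
exists (2 * M); split => [|n x /andP[x0 xX]]; first by rewrite mulr_ge0.
apply: (@le_trans _ _ (\sum_(0 <= k < n) M * 2^-1 ^+ k)).
  apply: ler_sum_nat => k _; have := Mb k; rewrite exprMn => h.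
  rewrite exprVn ler_pdivlMr ?exprn_gt0//; apply: le_trans h.
  rewrite -mulrA ler_wpM2l// mulrC ler_pM2l ?exprn_gt0//.
  by apply: lerXn2r; rewrite ?nnegrE// (le_trans x0).
rewrite -mulr_sumr mulrC ler_wpM2r//.
elim: n => [|n ih]; first by rewrite big_nil.
have e m : \sum_(0 <= k < m) (2^-1 : R) ^+ k = 2 - 2 * 2^-1 ^+ m.
  elim: m => [|m e]; first by rewrite big_nil expr0; ring.
  by rewrite big_nat_recr//= e exprS; field.
by rewrite e lerBlDr lerDl mulr_ge0// exprn_ge0.
Qed.

Lemma entire_cvg c x : entire c -> cvgn (pseries c x).
Proof.
move=> ec; apply: normed_cvg; rewrite /normed_series_of/=.
have [M [M0 Mb]] := entire_partial_le ec (ltr_pwDr ltr01 (normr_ge0 x)).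
apply: nondecreasing_is_cvgn.
  apply: nondecreasing_series => n _ _; exact: normr_ge0.
exists M => _ [n _ <-]; rewrite /series/=.
have := Mb n `|x|; rewrite normr_ge0 lerDl ler01 => /(_ isT); apply: le_trans.
by apply: ler_sum_nat => k _; rewrite normrM normrX.
Qed.

Lemma entire_lim_le c X : entire c -> 0 < X -> exists M : R, 0 <= M /\
  (forall n x, 0 <= x <= X -> `|\sum_(0 <= k < n) c k * x ^+ k| <= M) /\
  (forall x, 0 <= x <= X -> `|limn (pseries c x)| <= M).
Proof.
move=> ec X0; have [M [M0 Mb]] := entire_partial_le ec X0.
have h n x : 0 <= x <= X -> `|\sum_(0 <= k < n) c k * x ^+ k| <= M.
  move=> xX; apply: le_trans (Mb n x xX); apply: le_trans (ler_norm_sum _ _ _) _.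
  by apply: ler_sum_nat => k _; rewrite normrM (ger0_norm (exprn_ge0 _ _))//; case/andP: xX.
exists M; split => //; split => // x xX.
have := cvg_norm (entire_cvg (x:=x) ec) => /(_ _) H.
rewrite -(cvg_lim _ H)//; apply: limr_le; first by apply: cvgP H.
by apply: nearW => n; exact: h.
Qed.

(** The linear factor is at most [2 ^+ k], which doubling the radius absorbs. *)
Lemma entire_scale c (A : R) : entire c -> entire (fun k => k.+1%:R * A * c k).
Proof.
move=> ec x x0; have [M Mb] := ec (2 * x) (mulr_gt0 (ltr0Sn _ 1) x0).
exists (`|A| * M) => k; rewrite !normrM.
apply: (@le_trans _ _ (`|A| * (`|c k| * (2 * x) ^+ k))); last by rewrite ler_wpM2l.
have k2 : k.+1%:R <= 2 ^+ k :> R by rewrite -natrX ler_nat ltn_expl.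
rewrite exprMn ger0_norm// -!mulrA.
rewrite [X in _ <= X](_ : _ = 2 ^+ k * (`|A| * (`|c k| * x ^+ k))); last by ring.
by apply: ler_wpM2r => //; rewrite !mulr_ge0// exprn_ge0// ltW.
Qed.

Lemma entire_le c c' : entire c -> (forall k, `|c' k| <= `|c k|) -> entire c'.
Proof.
move=> ec h x x0; have [M Mb] := ec x x0; exists M => k.
by apply: le_trans (Mb k); rewrite ler_wpM2r// exprn_ge0// ltW.
Qed.

Lemma entire_shift c : entire c -> entire (fun k => c k.+1).
Proof.
move=> ec x x0; have [M Mb] := ec x x0; exists (M / x) => k.
by rewrite ler_pdivlMr// -mulrA -exprSr.
Qed.

Lemma entire_diffs c : entire c -> entire (pseries_diffs c).
Proof.
move=> ec; apply: (entire_le (entire_scale 1 (entire_shift ec))) => k.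
by rewrite /pseries_diffs mulr1.
Qed.

Lemma entire_ratio c (r : nat -> R) : (forall k, c k.+1 = r k * c k) ->
  r k @[k --> \oo] --> 0 -> entire c.
Proof.
move=> cr r0 x x0; have /cvgr0Pnorm_lt /(_ x^-1) := r0; rewrite invr_gt0 => /(_ x0) [N _ hN].
(* From [N] on the ratio of consecutive terms is at most 1, so the terms no longer grow; the sum of
   the first ones stands in for their maximum. *)
exists (\sum_(0 <= k < N.+1) `|c k| * x ^+ k) => k.
have h0 j : 0 <= `|c j| * x ^+ j by rewrite mulr_ge0// exprn_ge0// ltW.
have small j : (j <= N)%N -> `|c j| * x ^+ j <= \sum_(0 <= k < N.+1) `|c k| * x ^+ k.
  move=> jN; rewrite (bigD1_seq j) ?mem_index_iota ?iota_uniq//=.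
  by rewrite lerDl; apply: sumr_ge0.
have [kN|/ltnW kN] := leqP k N; first exact: small.
apply: le_trans (small N (leqnn _)); elim: k kN => [|k ih].
  by rewrite leqn0 => /eqP ->.
rewrite leq_eqVlt => /predU1P[->//|]; rewrite ltnS => kN; apply: le_trans (ih kN).
have := hN k kN => /ltW h.
rewrite cr normrM exprS mulrACA -[leRHS]mul1r ler_wpM2r//.
by rewrite -ler_pdivlMr// mul1r.
Qed.

Lemma pseries_derivable c x : entire c ->
  is_derive x (1:R) (fun x => limn (pseries c x)) (limn (pseries (pseries_diffs c) x)).
Proof.
move=> ec; apply: (@pseries_snd_diffs _ _ (`|x| + 1)).
- exact: entire_cvg.
- exact/entire_cvg/entire_diffs.
- exact/entire_cvg/entire_diffs/entire_diffs.
- by rewrite (ger0_norm (addr_ge0 _ _))// ltrDl.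
Qed.

End EntireSeries.

(** * Series in fractional powers and their convolution *)

Section FractionalSeries.
Context {R : realType}.
Variables (al : R) (al0 : 0 < al).
Implicit Types (c : nat -> R) (t T : R).

(** The term of index k is [c k * t]^ (al * k.+1%:R - 1)[; the singular factor is taken out so that
    an ordinary power series in]t [^ al] remains. *)
Definition fser c t := t `^ (al - 1) * limn (pseries c (t `^ al)).

Lemma powR_fser t k : 0 < t -> t `^ (al - 1) * (t `^ al) ^+ k = t `^ (al * k.+1%:R - 1).
Proof.
move=> t0; rewrite -powR_mulrn ?powR_ge0// -powRrM -(powR_addr _ _ t0).
by congr (_ `^ _); rewrite -[k.+1%:R]natr1; ring.
Qed.

Lemma fser_powb c T : 0 < T -> entire c -> exists2 M : R, 0 <= M & powb al M T (fser c).
Proof.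
move=> T0 ec; have [M [M0 [_ Mb]]] := entire_lim_le ec (powR_gt0 al T0).
exists M => // s /andP[s0 sT]; rewrite /fser normrM ger0_norm ?powR_ge0// mulrC.
rewrite ler_wpM2r ?powR_ge0//; apply: Mb; rewrite powR_ge0/=.
by apply: le_powR => //; exact: ltW.
Qed.

Lemma measurable_fser c (D : set R) : entire c -> measurable_fun D (fser c).
Proof.
move=> ec; apply: measurable_funTS; apply: measurable_funM.
  exact: measurable_powR.
have h : measurable_fun setT (fun x => limn (pseries c x)).
  apply: continuous_measurable_fun => x.
  apply/differentiable_continuous/derivable1_diffP.
  by have [] := pseries_derivable x ec.
exact: (measurableT_comp h (measurable_powR al)).
Qed.

Lemma cvg_fser c t : entire c ->
  t `^ (al - 1) * \sum_(0 <= k < n) c k * (t `^ al) ^+ k @[n --> \oo] --> fser c t.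
Proof. by move=> ec; apply: cvgMl_tmp; exact: entire_cvg. Qed.

(** Convolution with [t^(al-1)] acts termwise: it raises the index by one and multiplies by a Beta
    value. The partial sums are dominated by a constant times a product of two integrable powers. *)
Lemma conv_fser c c' t : entire c -> entire c' -> c' 0%N = 0 ->
  (forall k, c' k.+1 = beta al (al * k.+1%:R) * c k) -> 0 < t ->
  conv (fun s => s `^ (al - 1)) (fser c) t = fser c' t.
Proof.
move=> ec ec' c0 cS t0.
have [M [M0 [Mb _]]] := entire_lim_le ec (powR_gt0 al t0).
pose S n s : R := s `^ (al - 1) * \sum_(0 <= k < n) c k * (s `^ al) ^+ k.
pose f_ n s := ((t - s) `^ (al - 1) * S n s)%:E.
pose f s := ((t - s) `^ (al - 1) * fser c s)%:E.
pose g s := (M * ((t - s) `^ (al - 1) * s `^ (al - 1)))%:E.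
have mS n : measurable_fun setT (S n).
  apply: measurable_funM; first exact: measurable_powR.
  apply: measurable_sum => k; apply: measurable_funM => //.
  by apply: measurable_funX; exact: measurable_powR.
have pb : powb al 1 t (fun s : R => s `^ (al - 1)).
  by move=> s _; rewrite mul1r ger0_norm ?powR_ge0.
have ip : leb.-integrable `]0, t[ (EFin \o (fun s => (t - s) `^ (al - 1) * s `^ (al - 1))).
  apply: (@powb_conv_integrable _ t al al 1 1 (fun s => s `^ (al - 1)) (fun s => s `^ (al - 1))) => //.
  - exact: measurable_powRl.
  - exact: measurable_powRl.
  - by rewrite t0 lexx.
have [||||| _ _ H] := @dominated_convergence _ _ _ leb `]0, t[%classic (measurable_oo 0 t) f_ f g.
- move=> n; apply/measurable_EFinP; apply: measurable_funM; first exact: measurable_powRB.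
  exact: measurable_funTS (mS n).
- apply/measurable_EFinP; apply: measurable_funM; first exact: measurable_powRB.
  exact: measurable_fser.
- apply: aeW => s _; apply: cvg_EFin; first by near=> n.
  by apply: cvgMl_tmp; exact: cvg_fser.
- exact: (integrableZ_real (measurable_oo 0 t) M ip).
- apply: aeW => s n /=; rewrite in_itv/= => /andP[s0 st].
  rewrite lee_fin normrM ger0_norm ?powR_ge0// mulrCA ler_wpM2l ?powR_ge0//.
  rewrite normrM ger0_norm ?powR_ge0// mulrC ler_wpM2r ?powR_ge0//.
  apply: Mb; rewrite powR_ge0/=; apply: le_powR => //; exact: ltW.
have e n : (\int[leb]_(x in `]0%R, t[) f_ n x = (t `^ (al - 1) * \sum_(0 <= k < n.+1) c' k * (t `^ al) ^+ k)%:E)%E.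
  under eq_integral do rewrite /f_ /S mulrA mulr_sumr -sumEFin.
  have ik k : leb.-integrable `]0, t[ (EFin \o (fun s => ((t - s) `^ (al - 1) * s `^ (al * k.+1%:R - 1)))).
    apply: (@powb_conv_integrable _ t al (al * k.+1%:R) 1 1 (fun s => s `^ (al - 1)) (fun s => s `^ (al * k.+1%:R - 1))) => //.
    + exact: measurable_powRl.
    + exact: measurable_powRl.
    + by rewrite mulr_gt0.
    + by move=> s _; rewrite mul1r ger0_norm ?powR_ge0.
    + by rewrite t0 lexx.
  transitivity (\int[leb]_(s in `]0%R, t[) \sum_(0 <= k < n) (c k * ((t - s) `^ (al - 1) * s `^ (al * k.+1%:R - 1)))%:E)%E.
    apply: eq_integral => s /set_mem/=; rewrite in_itv/= => /andP[s0 _].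
    by apply: eq_bigr => k _; congr EFin; rewrite -powR_fser//; ring.
  rewrite integral_sum//; last by move=> k; exact: integrableZ_real.
  rewrite big_nat_recl//= c0 mul0r add0r mulr_sumr -sumEFin; apply: eq_bigr => k _.
  under eq_integral do rewrite EFinM.
  rewrite integralZl//; last exact: ik.
  have ak : 0 < al * k.+1%:R by rewrite mulr_gt0.
  rewrite (integral_powR_conv al0 ak t0) -EFinM; congr EFin.
  rewrite cS [RHS]mulrCA powR_fser// mulrCA mulrA; congr (_ * _ `^ _).
  by rewrite -[k.+2%:R]natr1; ring.
rewrite /conv /Rintegral -(cvg_lim _ H)// (_ : (fun n => _) = fun n => (t `^ (al - 1) * \sum_(0 <= k < n.+1) c' k * (t `^ al) ^+ k)%:E)%E; last exact/funext.
suff h : (t `^ (al - 1) * \sum_(0 <= k < n.+1) c' k * (t `^ al) ^+ k)%:E @[n --> \oo] --> (fser c' t)%:E.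
  by rewrite (cvg_lim _ h).
apply: cvg_EFin; first by near=> n.
have := cvg_fser (t := t) ec'; rewrite -cvg_shiftS; exact.
Unshelve. all: try by end_near.
Qed.

(** The second factor of the integrand is [s^(al-1)] times the k-th power of [s^al < 1], so
    dominated convergence suffices and no asymptotics of Gamma enters. *)
Lemma cvg_beta : beta al (al * k.+1%:R) @[k --> \oo] --> 0.
Proof.
pose f_ (k : nat) (s : R) := ((1 - s) `^ (al - 1) * s `^ (al * k.+1%:R - 1))%:E.
have [|||||_ _ H] := @dominated_convergence _ _ _ leb `]0, 1[%classic (measurable_oo (0:R) 1) f_ (cst 0%E) (f_ 0%N).
- move=> k; apply/measurable_EFinP; apply: measurable_funM; first exact: measurable_powRB.
  exact: measurable_powRl.
- exact: measurable_cst.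
- apply: aeW => s /=; rewrite in_itv/= => /andP[s0 s1].
  apply: cvg_EFin; first by near=> n.
  rewrite -[X in _ --> X](mulr0 ((1 - s) `^ (al - 1))); apply: cvgMl_tmp.
  have -> : (fun k : nat => s `^ (al * k.+1%:R - 1)) = (fun k => s `^ (al - 1) * (s `^ al) ^+ k).
    by apply/funext => k; rewrite powR_fser.
  apply: cvg_geometric; rewrite ger0_norm ?powR_ge0//.
  have <- : 1 `^ al = 1 :> R by rewrite powR1.
  by apply: gt0_ltr_powR; rewrite ?nnegrE//; exact: ltW.
- by have := integrable_beta al0 (b := al * 1) ; rewrite mulr1 => /(_ al0); rewrite /f_ mulr1.
- apply: aeW => s k /=; rewrite in_itv/= => /andP[s0 s1].
  rewrite lee_fin ger0_norm ?mulr_ge0 ?powR_ge0// ler_wpM2l ?powR_ge0//.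
  rewrite -!powR_fser// expr0 ler_wpM2l ?powR_ge0//.
  apply: exprn_ile1; first exact: powR_ge0.
  by apply: powR_le1; [rewrite (ltW s0) (ltW s1)|exact: ltW].
rewrite integral0 in H.
have /fine_cvg := H; exact.
Unshelve. all: by end_near. Qed.

End FractionalSeries.

Section KernelSeries.
Context {R : realType}.
Variables (al : R) (al0 : 0 < al).
Implicit Types (c : nat -> R) (t : R).

Lemma fserD c c' (A : R) t : entire c -> entire c' ->
  fser al (fun k => c k + A * c' k) t = fser al c t + A * fser al c' t.
Proof.
move=> ec ec'; rewrite /fser mulrCA -mulrDr; congr (_ * _).
apply: cvg_lim => //.
have -> : pseries (fun k => c k + A * c' k) (t `^ al) =
  (fun n => pseries c (t `^ al) n + A * pseries c' (t `^ al) n).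
  apply/funext => n; rewrite /pseries /series/= mulr_sumr -big_split/=.
  by apply: eq_bigr => k _; rewrite mulrDl mulrA.
by apply: cvgD; [exact: entire_cvg|apply: cvgMl_tmp; exact: entire_cvg].
Qed.

Lemma fser_mono (A : R) t : fser al (fun k => if k is 0%N then A else 0) t = A * t `^ (al - 1).
Proof.
rewrite /fser mulrC; congr (_ * _); apply: cvg_lim => //.
rewrite -cvg_shiftS; apply: cvg_near_cst; apply: nearW => n.
rewrite /pseries /series/= big_nat_recl//= expr0 mulr1 big1 ?addr0// => i _.
by rewrite mul0r.
Qed.

(** Powers are eigenfunctions of the Euler operator [t d/dt], so [t] times the derivative is again
    such a series, with coefficients multiplied by the exponents. *)
Lemma fser_derive c t : entire c -> 0 < t ->
  is_derive t (1:R) (fser al c) (fser al (fun k => (al * k.+1%:R - 1) * c k) t / t).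
Proof.
move=> ec t0; set L := fun x => limn (pseries c x).
have dL := pseries_derivable (t `^ al) ec.
have dp := is_derive1_powR al t0.
have dq := is_derive1_powR (al - 1) t0.
have dLp : is_derive t (1:R) (L \o (fun x => x `^ al))
   ((al * t `^ (al - 1)) * limn (pseries (pseries_diffs c) (t `^ al))).
  by have := @is_derive1_comp _ L (fun x => x `^ al) t _ _ dL dp; rewrite mulrC.
have d := is_deriveM dq dLp.
apply: (is_derive_eq d).
rewrite /= /GRing.scale/=.
have xt : t `^ al = t * t `^ (al - 1).
  rewrite -{2}[t]powRr1 ?ltW// -(powR_addr _ _ t0); congr (_ `^ _); ring.
have qt : t `^ (al - 1) = t * t `^ (al - 1 - 1).
  rewrite -{2}[t]powRr1 ?ltW// -(powR_addr _ _ t0); congr (_ `^ _); ring.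
have -> : fser al (fun k => (al * k.+1%:R - 1) * c k) t = t `^ (al - 1) *
   ((al - 1) * L (t `^ al) + al * (t `^ al * limn (pseries (pseries_diffs c) (t `^ al)))).
  rewrite /fser; congr (_ * _); apply: cvg_lim => //.
  rewrite -cvg_shiftS.
  have -> : (fun n => pseries (fun k => (al * k.+1%:R - 1) * c k) (t `^ al) n.+1) =
    (fun n => (al - 1) * pseries c (t `^ al) n.+1 +
              al * (t `^ al * pseries (pseries_diffs c) (t `^ al) n)).
    apply/funext => n; rewrite /pseries /series/=.
    have -> : t `^ al * (\sum_(0 <= k < n) pseries_diffs c k * (t `^ al) ^+ k) =
       \sum_(0 <= k < n.+1) k%:R * c k * (t `^ al) ^+ k.
      rewrite big_nat_recl//= mul0r mul0r add0r mulr_sumr; apply: eq_bigr => k _.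
      by rewrite /pseries_diffs exprS mulrCA.
    rewrite !mulr_sumr -big_split/=; apply: eq_bigr => k _.
    by rewrite -[k.+1%:R]natr1; ring.
  apply: cvgD; apply: cvgMl_tmp.
    by have := entire_cvg (x := t `^ al) ec; rewrite -cvg_shiftS; exact.
  by apply: cvgMl_tmp; exact/entire_cvg/entire_diffs.
rewrite -/(L _); set A := L _; set D := limn _; clearbody A D; move: (A : R) (D : R) => {}A {}D.
move: xt qt; move: (t `^ al) (t `^ (al - 1)) (t `^ (al - 1 - 1)) => x q r -> ->.
by field; exact: lt0r_neq0.
Qed.

Variables (a0 mu : R) (a0_gt0 : 0 < a0) (mu_gt0 : 0 < mu).

(** The recursion solves [k + mu a*k = a] coefficient by coefficient. If [a0] is [1 / Gamma al], the
    Beta factors telescope to [(- mu)^k / Gamma (al (k + 1))]. *)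
Fixpoint kcoef k := if k is k'.+1 then - (mu * a0 * beta al (al * k'.+1%:R)) * kcoef k' else a0.

Lemma entire_kcoef : entire kcoef.
Proof.
apply: (@entire_ratio _ _ (fun k => - (mu * a0 * beta al (al * k.+1%:R)))) => //.
rewrite -[X in _ --> X]oppr0; apply: cvgN.
by rewrite -[X in _ --> X](mulr0 (mu * a0)); apply: cvgMl_tmp; exact: cvg_beta.
Qed.

(* The resolvent t^(al-1) E_{al,al}(- mu t^al), up to the normalization of a0. *)
Fact fser_key : unit. Proof. exact: tt. Qed.

(* Locked, so that unification does not unfold the limit of the series. *)
Definition ker := locked_with fser_key (fser al kcoef).

Lemma ker_fser : ker = fser al kcoef.
Proof. by rewrite /ker unlock. Qed.

Definition akern t := a0 * t `^ (al - 1).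
(** The function [t k'(t)], by [ker_derive]. *)
Definition wker := locked_with fser_key (fser al (fun k => (al * k.+1%:R - 1) * kcoef k)).

Lemma wker_fser : wker = fser al (fun k => (al * k.+1%:R - 1) * kcoef k).
Proof. by rewrite /wker unlock. Qed.


Lemma entire_wcoef : entire (fun k => (al * k.+1%:R - 1) * kcoef k).
Proof.
apply: (entire_le (entire_scale (al + 1) entire_kcoef)) => k.
rewrite !normrM ler_wpM2r//; apply: le_trans (ler_normB _ _) _.
rewrite normrM normr1 (ger0_norm (ltW al0)) !ger0_norm ?addr_ge0 ?(ltW al0)//.
by rewrite mulrDr mulr1 mulrC lerD2l ler1n.
Qed.

Lemma akern_powb T : powb al a0 T akern.
Proof. by move=> s _; rewrite ger0_norm// /akern mulr_ge0 ?powR_ge0// ltW. Qed.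

Lemma measurable_akern D : measurable_fun D akern.
Proof. by apply: measurable_funM => //; exact: measurable_powRl. Qed.

Lemma conv_akern_fser c t : entire c -> 0 < t ->
  mu * conv akern (fser al c) t =
  fser al (fun k => if k is k'.+1 then mu * a0 * beta al (al * k'.+1%:R) * c k' else 0) t.
Proof.
move=> ec t0.
pose c' k := if k is k'.+1 then beta al (al * k'.+1%:R) * c k' else 0 : R.
have ec' : entire c'.
  (* The Beta factors tend to 0, hence are bounded by some [B], and multiplication by them keeps a
     sequence entire. *)
  have /cvgr0Pnorm_lt /(_ 1 ltr01)[N _ hN] := cvg_beta al0.
  pose B := \sum_(0 <= k < N) beta al (al * k.+1%:R) + 1.
  have bB k : beta al (al * k.+1%:R) <= B.
    rewrite /B; have [kN|Nk] := ltnP k N.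
      rewrite (bigD1_seq k) ?mem_index_iota ?iota_uniq//= -addrA lerDl addr_ge0//.
      by apply: sumr_ge0 => i _; exact: beta_ge0.
    have := hN k Nk => /= /ltW; rewrite ger0_norm ?beta_ge0// => /le_trans; apply.
    by rewrite lerDr; apply: sumr_ge0 => i _; exact: beta_ge0.
  move=> x x0; have [M Mb] := ec x x0; exists (B * x * M) => -[|k].
    rewrite normr0 mul0r mulr_ge0//.
      by rewrite mulr_ge0 ?(ltW x0)//; apply: le_trans (bB 0%N); exact: beta_ge0.
    by apply: le_trans (Mb 0%N); rewrite mulr_ge0// exprn_ge0// ltW.
  rewrite /c' normrM (ger0_norm (beta_ge0 _ _)) exprS mulrACA -!mulrA.
  apply: ler_pM => //; first exact: beta_ge0.
    by rewrite mulr_ge0 ?(ltW x0)// mulr_ge0// exprn_ge0// ltW.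
  by rewrite ler_pM2l.
have H := @conv_fser _ _ al0 c c' t ec ec' erefl (fun=> erefl) t0.
transitivity (mu * a0 * fser al c' t).
  rewrite -mulrA; congr (_ * _); rewrite -H /conv /akern.
  have [M M0 Mb] := fser_powb (al := al) al0 t0 ec.
  rewrite -RintegralZl//; last first.
    apply: (@powb_conv_integrable _ t al al 1 M (fun s => s `^ (al - 1))) => //.
    - exact: measurable_powRl.
    - exact: measurable_fser.
    - by move=> s _; rewrite mul1r ger0_norm ?powR_ge0.
    - by rewrite t0 lexx.
  by apply: eq_Rintegral => s _; rewrite mulrA.
rewrite -[LHS]add0r -[X in X + _](_ : fser al (fun=> 0) t = 0); last first.
  transitivity (fser al (fun k => if k is 0%N then 0 else 0) t).
    by congr fser; apply/funext => -[].
  by rewrite fser_mono mul0r.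
rewrite -fserD//; last first.
  by move=> x x0; exists 0 => k; rewrite normr0 mul0r.
congr fser; apply/funext => -[|k]; rewrite add0r ?mulr0// /c' mulrA//.
Qed.

Lemma ker_eq t : 0 < t -> ker t + mu * conv akern ker t = akern t.
Proof.
move=> t0; rewrite ker_fser conv_akern_fser//; last exact: entire_kcoef.
rewrite -[X in _ + X]mul1r -fserD; [|exact: entire_kcoef|].
  rewrite /akern -fser_mono; congr fser; apply/funext => -[|k] /=; first by rewrite mulr0 addr0.
  by rewrite mul1r mulNr addNr.
apply: (entire_le entire_kcoef) => -[|k] /=; first by rewrite normr0.
by rewrite mulNr normrN.
Qed.

(** By the recursion the convolution contributes minus the weight of the previous index times the
    current coefficient. Consecutive weights differ by [al], which leaves [al * k]; index 0, where
    no convolution term occurs, accounts for [- a]. *)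
Lemma wker_eq t : 0 < t -> wker t + mu * conv akern wker t = al * ker t - akern t.
Proof.
move=> t0; rewrite wker_fser conv_akern_fser//; last exact: entire_wcoef.
pose d k : R := if k is 0%N then - a0 else 0.
rewrite -[X in _ + X]mul1r -fserD; [|exact: entire_wcoef|]; last first.
  apply: (entire_le (entire_scale (al + 1) entire_kcoef)) => -[|k]; first by rewrite normr0.
  rewrite [X in `|X|](_ : _ = (1 - al * k.+1%:R) * kcoef k.+1) /=; last by ring.
  rewrite normrM [in leRHS]normrM ler_wpM2r//; apply: le_trans (ler_normB _ _) _.
  have k1 : 0 <= k.+1%:R :> R by exact: ler0n.
  have k2 : 0 <= k.+2%:R :> R by exact: ler0n.
  have al1 : 0 <= al + 1 by rewrite addr_ge0// ltW.
  rewrite normr1 (ger0_norm (mulr_ge0 (ltW al0) k1)) (ger0_norm (mulr_ge0 k2 al1)).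
  rewrite mulrDr mulr1 mulrC addrC lerD//; last by rewrite ler1n.
  by rewrite ler_pM2r// ler_nat.
have -> : al * ker t - akern t = fser al (fun k => d k + al * kcoef k) t.
  rewrite fserD ?fser_mono//; last exact: entire_kcoef.
    by rewrite ker_fser /akern mulNr addrC.
  move=> x x0; exists `|a0| => -[|k]; first by rewrite normrN expr0 mulr1.
  by rewrite normr0 mul0r.
congr fser; apply/funext => -[|k] /=; first by ring.
by rewrite -[k.+2%:R]natr1; ring.
Qed.

Lemma ker_derive t : 0 < t -> is_derive t (1:R) ker (wker t / t).
Proof. by move=> t0; rewrite ker_fser wker_fser; apply: fser_derive => //; exact: entire_kcoef. Qed.

End KernelSeries.

Lemma integrableB_real d (T : measurableType d) (R : realType)
    (mu : {measure set T -> \bar R}) (D : set T) (f g : T -> R) : measurable D ->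
  mu.-integrable D (EFin \o f) -> mu.-integrable D (EFin \o g) ->
  mu.-integrable D (EFin \o (fun x => f x - g x)).
Proof. by move=> mD; exact: integrableB. Qed.

Section ConvLinear.
Context {R : realType}.
Implicit Types (f g h : R -> R) (t : R).

Lemma eq_convr f g h t : (forall s, 0 < s < t -> g s = h s) -> conv f g t = conv f h t.
Proof. by move=> gh; apply: eq_Rintegral => s /set_mem/=; rewrite in_itv/= => /gh ->. Qed.

Lemma eq_convl f g h t : (forall s, 0 < s < t -> g s = h s) -> conv g f t = conv h f t.
Proof.
move=> gh; apply: eq_Rintegral => s /set_mem/=; rewrite in_itv/= => st.
by rewrite gh//; lra.
Qed.

Lemma convDZr f g h c t :
  leb.-integrable `]0, t[ (EFin \o (fun s => f (t - s) * g s)) ->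
  leb.-integrable `]0, t[ (EFin \o (fun s => f (t - s) * h s)) ->
  conv f (fun s => g s + c * h s) t = conv f g t + c * conv f h t.
Proof.
move=> ig ih; rewrite /conv -RintegralZl// -RintegralD//.
  by apply: eq_Rintegral => s _; ring.
exact: integrableZ_real.
Qed.

Lemma convDZl f g h c t :
  leb.-integrable `]0, t[ (EFin \o (fun s => g (t - s) * f s)) ->
  leb.-integrable `]0, t[ (EFin \o (fun s => h (t - s) * f s)) ->
  conv (fun s => g s + c * h s) f t = conv g f t + c * conv h f t.
Proof.
move=> ig ih; rewrite /conv -RintegralZl// -RintegralD//.
  by apply: eq_Rintegral => s _; ring.
exact: integrableZ_real.
Qed.

Lemma convZl f g c t :
  leb.-integrable `]0, t[ (EFin \o (fun s => f (t - s) * g s)) ->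
  conv (fun s => c * f s) g t = c * conv f g t.
Proof.
by move=> ig; rewrite /conv -RintegralZl//; apply: eq_Rintegral => s _; rewrite mulrA.
Qed.

Lemma convZr f g c t :
  leb.-integrable `]0, t[ (EFin \o (fun s => f (t - s) * g s)) ->
  conv f (fun s => c * g s) t = c * conv f g t.
Proof.
by move=> ig; rewrite /conv -RintegralZl//; apply: eq_Rintegral => s _; rewrite mulrCA.
Qed.

Lemma integrable_convZr f g c t :
  leb.-integrable `]0, t[ (EFin \o (fun s => f (t - s) * g s)) ->
  leb.-integrable `]0, t[ (EFin \o (fun s => f (t - s) * (c * g s))).
Proof.
have -> : (fun s => f (t - s) * (c * g s)) = (fun s => c * (f (t - s) * g s)).
  by apply/funext => s; rewrite mulrCA.
exact: integrableZ_real.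
Qed.

Lemma conv1 f t : conv (fun=> 1) f t = \int[leb]_(s in `]0, t[) f s.
Proof. by apply: eq_Rintegral => s _; rewrite mul1r. Qed.

Lemma powR_powb a T : powb a 1 T (fun s : R => s `^ (a - 1)).
Proof. by move=> s _; rewrite mul1r ger0_norm ?powR_ge0. Qed.

Lemma conv_powR a b t : 0 < a -> 0 < b -> 0 < t ->
  conv (fun s => s `^ (a - 1)) (fun s => s `^ (b - 1)) t = beta a b * t `^ (a + b - 1).
Proof. by move=> a0 b0 t0; rewrite /conv /Rintegral integral_powR_conv. Qed.

Lemma conv_ge0 f g t : (forall s, 0 < s < t -> 0 <= f s) ->
  (forall s, 0 < s < t -> 0 <= g s) -> 0 <= conv f g t.
Proof.
move=> f0 g0; apply: Rintegral_ge0 => s /=; rewrite in_itv/= => st.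
by apply: mulr_ge0; [apply: f0; lra|exact: g0].
Qed.

Lemma Rintegral_oo_split f (a s b : R) : leb.-integrable `]a, b[ (EFin \o f) ->
  a <= s <= b -> \int[leb]_(x in `]a, b[) f x =
    \int[leb]_(x in `]a, s[) f x + \int[leb]_(x in `]s, b[) f x.
Proof.
move=> fi /andP[as_ sb].
have [<-|sb'] := eqVneq s b.
  by rewrite set_itvoo0 Rintegral_set0 addr0.
have sb2 : s < b by rewrite lt_neqAle sb' sb.
have h := @Rintegral_itvB _ f (BRight a) (BLeft b) s fi.
rewrite -[LHS](subrK (\int[leb]_(x in `]a, s]) f x)) h ?bnd_simp// addrC; congr (_ + _).
rewrite -Rintegral_itv_bndo_bndc//.
apply: integrableS fi => //; apply: subset_itvl; rewrite bnd_simp//.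
Qed.

(** One of [s] and [t - s] is at least [t / 2], and there [f] is at most [f (t / 2)]; the two cases
    contribute one integral each. *)
Lemma conv_nonincr_le (f : R -> R) t : 0 < t -> (forall s, 0 < s < t -> 0 <= f s) ->
  (forall r s, 0 < r -> r <= s -> f s <= f r) ->
  leb.-integrable `]0, t[ (EFin \o f) ->
  leb.-integrable `]0, t[ (EFin \o (fun s => f (t - s) * f s)) ->
  conv f f t <= 2 * f (t / 2) * \int[leb]_(s in `]0, t[) f s.
Proof.
move=> t0 f0 fn ik ikk.
have ikr := integrable_itv_reflect ik.
have H : conv f f t <= f (t / 2) * (\int[leb]_(s in `]0, t[) f s + \int[leb]_(s in `]0, t[) f (t - s)).
  rewrite -RintegralD// -RintegralZl//; last exact: integrableD_real.
  apply: le_Rintegral => //; first by apply: integrableZ_real => //; exact: integrableD_real.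
  move=> s /=; rewrite in_itv/= => /andP[s0 st].
  have ts : 0 < t - s by rewrite subr_gt0.
  have ks : 0 <= f s by rewrite f0// s0.
  have kts : 0 <= f (t - s) by rewrite f0// ts gtrBl.
  have k2 : 0 <= f (t / 2) by rewrite f0// divr_gt0// ltr_pdivrMr// ltr_pMr// ltr1n.
  rewrite mulrDr; have [s2|s2] := leP (t / 2) s.
    apply: ler_wpDl; first exact: mulr_ge0.
    by rewrite mulrC; apply: ler_wpM2r => //; apply: fn => //; rewrite divr_gt0.
  apply: ler_wpDr; first exact: mulr_ge0.
  apply: ler_wpM2r => //; apply: fn; rewrite ?divr_gt0//.
  by rewrite lerBrDr; apply: le_trans (_ : t / 2 + t / 2 <= _); [rewrite lerD2l ltW|rewrite -splitr].
have e : \int[leb]_(s in `]0, t[) f (t - s) = \int[leb]_(s in `]0, t[) f s.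
  rewrite /Rintegral; congr fine; rewrite [RHS]integral_itv_reflect//.
  exact: measurable_int ik.
rewrite e in H; apply: le_trans H _; rewrite le_eqVlt; apply/orP; left; apply/eqP; ring.
Qed.

End ConvLinear.

(** * Resolvent identities and the first-zero argument *)

Section Resolvent.
Context {R : realType}.
Variables (al : R) (al0 : 0 < al).
Variables (a0 mu : R) (a0_gt0 : 0 < a0) (mu_gt0 : 0 < mu).
Implicit Types (f g x : R -> R) (t T : R).

Local Notation k := (ker al a0 mu).
Local Notation a := (akern al a0).

Lemma ker_powb_ex T : 0 < T -> exists2 M : R, 0 <= M & powb al M T k.
Proof. by move=> T0; rewrite ker_fser; apply: fser_powb => //; exact: entire_kcoef. Qed.

Lemma measurable_ker D : measurable_fun D k.
Proof. by rewrite ker_fser; apply: measurable_fser; exact: entire_kcoef. Qed.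

Lemma powb_mono c C T t f : t <= T -> powb c C T f -> powb c C t f.
Proof. by move=> tT h s /andP[s0 st]; apply: h; rewrite s0 (lt_le_trans st). Qed.

(* If x + mu a*x = g then k*g = k*x + (a - k)*x = a*x. *)
Lemma resolvent_inv c X T x g : measurable_fun `]0, T[ x -> 0 < c -> powb c X T x ->
  (forall s, 0 < s < T -> x s + mu * conv a x s = g s) ->
  forall t, 0 < t <= T -> conv k g t = conv a x t.
Proof.
move=> mx c0 xb xg t /andP[t0 tT].
have T0 : 0 < T by exact: lt_le_trans tT.
have tT' : 0 < t <= T by rewrite t0.
have [M M0 kb] := ker_powb_ex T0.
have ab : powb al a0 T a by exact: akern_powb.
have mk : measurable_fun `]0, T[ k by exact: measurable_ker.
have ma : measurable_fun `]0, T[ a by exact: measurable_akern.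
have acb := powb_conv ma mx al0 c0 ab xb.
rewrite -(@eq_convr _ k (fun s => x s + mu * conv a x s)); last first.
  by move=> s /andP[s0 st]; apply: xg; rewrite s0 (lt_le_trans st).
have mcax := measurable_conv ma mx.
rewrite convDZr; last 2 first.
- exact: (powb_conv_integrable mk mx al0 c0 kb xb).
- exact: (powb_conv_integrable mk mcax al0 (addr_gt0 al0 c0) kb acb).
rewrite (convA_powb mk ma mx al0 al0 c0 kb ab xb tT').
rewrite -convDZl; last 2 first.
- exact: (powb_conv_integrable mk mx al0 c0 kb xb).
- apply: (powb_conv_integrable (measurable_conv mk ma) mx (addr_gt0 al0 al0) c0 _ xb tT').
  exact: (powb_conv mk ma al0 al0 kb ab).
apply: eq_convl => s /andP[s0 st].
have sT : s <= T by rewrite ltW// (lt_le_trans st).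
rewrite convC; [|exact: measurable_itvS mk|exact: measurable_itvS ma].
exact: ker_eq.
Qed.

(* The Euler operator t d/dt of a convolution of homogeneous kernels turns
   k + mu a*k = a into w + mu a*w = al k - a for w = t k'. *)
Lemma wkerE t : 0 < t -> wker al a0 mu t = (al - 1) * k t - al * mu * conv k k t.
Proof.
move=> t0; set w := wker al a0 mu.
have tt : 0 < t <= t by rewrite t0 lexx.
have ew := entire_wcoef al0 a0 mu.
have [W W0 wb] := fser_powb (al := al) al0 t0 ew.
rewrite -wker_fser -/w in wb.
have mw : measurable_fun `]0, t[ w by rewrite /w wker_fser; exact: measurable_fser.
have [M M0 kb] := ker_powb_ex t0.
have mk : measurable_fun `]0, t[ k by exact: measurable_ker.
have ma : measurable_fun `]0, t[ a by exact: measurable_akern.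
have ab : powb al a0 t a by exact: akern_powb.
have weq s : 0 < s < t -> w s + mu * conv a w s = al * k s - a s.
  by move=> /andP[s0 _]; exact: wker_eq.
have H := resolvent_inv mw al0 wb weq tt.
have -> : w t = al * k t - a t - mu * conv a w t by rewrite -(wker_eq al0 a0 mu t0) addrK.
have ikk := powb_conv_integrable mk mk al0 al0 kb kb tt.
have ika := powb_conv_integrable mk ma al0 al0 kb ab tt.
have e : conv k (fun s => al * k s - a s) t = al * conv k k t - conv k a t.
  rewrite -(@eq_convr _ k (fun s => (-1) * a s + al * k s)); last by move=> s _; ring.
  rewrite convDZr//; last exact: integrable_convZr.
  by rewrite convZr//; ring.
rewrite -H e [conv k a t]convC//.
have := ker_eq al0 a0 mu t0; set ca := conv a k t => <-; ring.
Qed.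

Hypothesis al1 : al < 1.
Let g := a0 * beta (1 - al) al.

Lemma conv_bkern_akern t : 0 < t -> conv (fun s => s `^ (- al)) a t = g.
Proof.
move=> t0; have b0 : 0 < 1 - al by rewrite subr_gt0.
have <- : 1 - al - 1 = - al by ring.
rewrite convZr ?conv_powR//; first by rewrite subrK subrr powRr0 mulr1.
apply: (@powb_conv_integrable _ t (1 - al) al 1 1 (fun s => s `^ (1 - al - 1)) (fun s => s `^ (al - 1))) => //.
- exact: measurable_powRl.
- exact: measurable_powRl.
- exact: powR_powb.
- exact: powR_powb.
- by rewrite t0 lexx.
Qed.

Lemma bkern_powb T : powb (1 - al) 1 T (fun s => s `^ (- al)).
Proof. by move=> s _; rewrite mul1r ger0_norm ?powR_ge0// (_ : 1 - al - 1 = - al)//; ring. Qed.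

Lemma one_powb (C : R) T : powb 1 `|C| T (fun=> C).
Proof. by move=> s _; rewrite subrr powRr0 mulr1. Qed.

Lemma conv_bkern_ker t : 0 < t ->
  conv (fun s => s `^ (- al)) k t + mu * g * \int[leb]_(s in `]0, t[) k s = g.
Proof.
rewrite -conv1; move=> t0; have tt : 0 < t <= t by rewrite t0 lexx.
have b0 : 0 < 1 - al by rewrite subr_gt0.
have [M M0 kb] := ker_powb_ex t0.
have mk : measurable_fun `]0, t[ k by exact: measurable_ker.
have ma : measurable_fun `]0, t[ a by exact: measurable_akern.
have ab : powb al a0 t a by exact: akern_powb.
have mb : measurable_fun `]0, t[ (fun s : R => s `^ (- al)) by exact: measurable_powRl.
have bb : powb (1 - al) 1 t (fun s : R => s `^ (- al)) by exact: bkern_powb.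
have ob : powb 1 1 t (fun=> 1 : R) by have := @one_powb 1 t; rewrite normr1.
have akb := powb_conv ma mk al0 al0 ab kb.
rewrite -{2}(conv_bkern_akern t0).
rewrite -(@eq_convr _ (fun s => s `^ (- al)) (fun s => k s + mu * conv a k s) a t); last first.
  by move=> s /andP[s0 _]; exact: ker_eq.
rewrite convDZr; last 2 first.
- exact: (powb_conv_integrable mb mk b0 al0 bb kb).
- apply: (powb_conv_integrable mb (measurable_conv ma mk) b0 (addr_gt0 al0 al0) bb akb tt).
rewrite (convA_powb mb ma mk b0 al0 al0 bb ab kb tt) -mulrA; congr (_ + _ * _).
rewrite -convZl; last exact: (powb_conv_integrable _ mk ltr01 al0 ob kb).
apply: eq_convl => s /andP[s0 _]; rewrite mulr1 conv_bkern_akern//.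
Qed.


Let b0 : 0 < 1 - al. Proof. by rewrite subr_gt0. Qed.

Let g_gt0 : 0 < g.
Proof.
rewrite mulr_gt0//; apply: lt_le_trans ltr01 _; apply: beta_ge1; apply/andP; split => //.
- by rewrite lerBlDr lerDl ltW.
- exact: ltW.
Qed.

Lemma ker_integrable t : 0 < t -> leb.-integrable `]0, t[ (EFin \o k).
Proof.
move=> t0; have [M M0 kb] := ker_powb_ex t0.
have := integrableZ_real (measurable_oo 0 t) M (integrable_powR al0 (ltW t0)).
move=> /integrable_dom; apply => //; exact: measurable_ker.
Qed.

(** The power series in [s]^ al[is continuous with value]a0[at 0, so it exceeds]a0 / 2[on some]]0,
    e[[; in terms of]s[the threshold is]e [^ al^-1]. *)
Lemma ker_near0 : exists2 d : R, 0 < d & forall s, 0 < s < d -> a0 / 2 * s `^ (al - 1) <= k s.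
Proof.
have ek := entire_kcoef al0 a0 mu.
have cL : {for (0:R), continuous (fun x : R => limn (pseries (kcoef al a0 mu) x))}.
  apply/differentiable_continuous/derivable1_diffP.
  by have [] := pseries_derivable (0:R) ek.
have L0 : limn (pseries (kcoef al a0 mu) 0) = a0.
  apply: cvg_lim => //; rewrite -cvg_shiftS; apply: cvg_near_cst; apply: nearW => n.
  rewrite /pseries /series/= big_nat_recl//= expr0 mulr1 big1 ?addr0// => i _.
  by rewrite expr0n/= mulr0.
have : \forall x \near (0:R), a0 / 2 < limn (pseries (kcoef al a0 mu) x).
  move: cL; rewrite /prop_for /continuous_at L0 => /cvgr_gt; apply.
  by rewrite ltr_pdivrMr// ltr_pMr// ltr1n.
move=> /nbhs_ballP[e /= e0 he].
exists (e `^ al^-1); first exact: powR_gt0.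
move=> s /andP[s0 se]; rewrite ker_fser /fser mulrC ler_wpM2l ?powR_ge0//.
apply/ltW/he; rewrite /ball/= sub0r normrN ger0_norm ?powR_ge0//.
have -> : e = (e `^ al^-1) `^ al.
  by rewrite -powRrM mulVf ?gt_eqF// powRr1// ltW.
by apply: gt0_ltr_powR => //; rewrite nnegrE ?powR_ge0// ltW.
Qed.

Lemma ker_continuous t : 0 < t -> {for t, continuous k}.
Proof.
move=> t0; apply/differentiable_continuous/derivable1_diffP.
by have [] := ker_derive al0 a0 mu t0.
Qed.

Lemma ker_locally_lipschitz t : 0 < t -> exists L d : R, [/\ 0 <= L, 0 < d &
  forall s, t - d < s < t -> `|k s - k t| <= L * (t - s)].
Proof.
move=> t0; have [dk _] := ker_derive al0 a0 mu t0.
move: dk => /cvg_ex[/= D /cvgr_dist_lt /(_ 1 ltr01)].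
move=> /nbhs_ballP[e /= e0 he].
exists (`|D| + 1), e; split => // s /andP[s1 s2].
have h0 : s - t != 0 by rewrite subr_eq0 lt_eqF.
have := he (s - t); rewrite /ball/= sub0r normrN.
have -> : `|s - t| = t - s by rewrite ltr0_norm ?subr_lt0// opprB.
have -> : t - s < e by lra.
move=> /(_ isT h0); rewrite /GRing.scale/= mulr1 subrK => H.
have : `|(s - t)^-1 * (k s - k t)| <= `|D| + 1.
  rewrite -[X in `|X|](subKr D); apply: le_trans (ler_normB _ _) _.
  by rewrite lerD2l ltW.
rewrite normrM normfV (_ : `|s - t| = t - s); last by rewrite ltr0_norm ?subr_lt0// opprB.
by rewrite mulrC ler_pdivrMr// subr_gt0.
Qed.

(** Mean value theorem: the slope [al * z^(-al-1)] is smallest at the right end, so its value at [T]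
    is a uniform lower bound. *)
Lemma powRN_diff (T x y : R) : 0 < x -> x < y -> y <= T ->
  (y - x) * (al * T `^ (- al - 1)) <= x `^ (- al) - y `^ (- al).
Proof.
move=> x0 xy yT.
have dd (z : R) : x < z < y -> is_derive z (1:R) (fun z : R => z `^ (- al)) (- al * z `^ (- al - 1)).
  by move=> /andP[xz _]; apply: is_derive1_powR; exact: lt_trans xz.
have dd' z : z \in `]x, y[ -> is_derive z (1:R) (fun z : R => z `^ (- al)) (- al * z `^ (- al - 1)).
  by rewrite in_itv/= => /dd.
have [|c cxy H] := MVT xy dd'.
  apply: continuous_in_subspaceT => z /set_mem/=; rewrite in_itv/= => /andP[xz _].
  by apply: powR_cvg; exact: lt_le_trans xz.
have : x `^ (- al) - y `^ (- al) = (y - x) * (al * c `^ (- al - 1)).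
  by rewrite -opprB H; ring.
move=> ->; rewrite ler_pM2l ?subr_gt0// ler_pM2l//.
move: cxy; rewrite in_itv/= => /andP[xc cy]; apply: le_powRN.
- exact: lt_trans xc.
- by rewrite ltW// (lt_le_trans cy).
- by rewrite subr_le0 (le_trans _ ler01)// oppr_le0 ltW.
Qed.

(** The difference of [conv_bkern_ker] at [t0], with its convolution split at [t0 - h] into
    [x1 + x2], and at [t0 - h], with convolution [x3]; [y0] and [y1] are the integrals of [k]. *)
Let first_zero_arith (x1 x2 x3 y0 y1 G m A B h : R) : x1 + x2 + m * y0 = G ->
  x3 + m * y1 = G -> y0 - y1 <= A * h -> x2 <= B * h -> 0 <= m ->
  x3 - x1 <= h * (m * A + B).
Proof.
move=> E0 E1 I1 I2 m0; have := ler_wpM2l m0 I1.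
have -> : x3 - x1 = x2 + m * (y0 - y1) by move: E0 E1 => <- /(canRL (addrK _)) ->; ring.
move=> H; have -> : h * (m * A + B) = B * h + m * (A * h) by ring.
exact: lerD.
Qed.

Section FirstZero.
Variables (t0 : R) (t0_gt0 : 0 < t0) (k_pos : forall s, 0 < s < t0 -> 0 < k s) (kt0 : k t0 <= 0).

(* At a first zero t0 of k, b*k would decrease at rate O(h) over [t0 - h, t0]
   while int k, and hence b*k = g (1 - mu int k), varies by O(h^2). *)
Lemma first_zero_bound (L d h : R) : 0 <= L -> 0 < d -> d <= t0 / 2 ->
  (forall s, 0 < s < d -> a0 / 2 * s `^ (al - 1) <= k s) ->
  (forall s, t0 - h < s < t0 -> k s <= L * (t0 - s)) -> 0 < h < t0 / 2 ->
  al * t0 `^ (- al - 1) * (a0 / 2 * (d `^ al / al)) <= mu * g * L * h + L * h `^ (1 - al).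
Proof.
move=> L0 d0 dt0 kd kL /andP[h0 ht0].
pose B s : R := s `^ (- al).
have t1 : 0 < t0 - h by lra.
have tt : 0 < t0 <= t0 by rewrite t0_gt0 lexx.
have tt1 : 0 < t0 - h <= t0 by lra.
have tt1' : 0 < t0 - h <= t0 - h by rewrite lexx andbT.
have [M M0 kb] := ker_powb_ex t0_gt0.
have mk : measurable_fun `]0, t0[ k by exact: measurable_ker.
have mB : measurable_fun `]0, t0[ B by exact: measurable_powRl.
have Bb : powb (1 - al) 1 t0 B by exact: bkern_powb.
have iBk := powb_conv_integrable mB mk b0 al0 Bb kb tt.
have iBk1 := powb_conv_integrable mB mk b0 al0 Bb kb tt1.
have sub : [set` `]0, (t0 - h)[] `<=` [set` `]0, t0[].
  by apply: subset_itvl; rewrite bnd_simp; lra.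
have sub2 : [set` `](t0 - h), t0[] `<=` [set` `]0, t0[].
  by apply: subset_itvr; rewrite bnd_simp; lra.
have subd : [set` `]0, d[] `<=` [set` `]0, (t0 - h)[].
  by apply: subset_itvl; rewrite bnd_simp; lra.
have iBk0 : leb.-integrable `]0, (t0 - h)[ (EFin \o (fun s => B (t0 - s) * k s)).
  exact: integrableS iBk.
have ik := ker_integrable t0_gt0.
have leb_h : (leb `](t0 - h)%R, t0[%classic = h%:E :> \bar R)%E.
  rewrite lebesgue_measure_itv/= lte_fin ifT; last lra.
  by rewrite -EFinD; congr EFin; ring.
have cst_h (c : R) : \int[leb]_(s in `](t0 - h), t0[) c = c * h.
  transitivity (c * fine h%:E) => //.
  by rewrite Rintegral_cst//; congr (_ * fine _); exact: leb_h.
have icst (c : R) : leb.-integrable `](t0 - h), t0[ (EFin \o (fun=> c)).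
  by apply: integrable_cst_real => //; apply: (@le_lt_trans _ _ h%:E); [rewrite le_eqVlt; apply/orP; left; apply/eqP; exact: leb_h|exact: ltry].
have I1 : \int[leb]_(s in `]0, t0[) k s - \int[leb]_(s in `]0, (t0 - h)[) k s <= L * h * h.
  rewrite (@Rintegral_oo_split _ k 0 (t0 - h) t0 ik); last lra.
  rewrite addrAC subrr add0r -cst_h; apply: le_Rintegral => //.
    exact: integrableS ik.
  move=> s /=; rewrite in_itv/= => /andP[s1 s2].
  apply: le_trans (kL s _) _; first by rewrite s1.
  by rewrite ler_wpM2l//; lra.
(* The linear vanishing of [k] at [t0] beats the singularity of [B]: the integrand is at most
   [L * (t0 - s)^(1-al)]. *)
have I2 : \int[leb]_(s in `](t0 - h), t0[) (B (t0 - s) * k s) <= L * h `^ (1 - al) * h.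
  clear I1; rewrite -cst_h; apply: le_Rintegral => //; first exact: integrableS iBk.
  move=> s /=; rewrite in_itv/= => /andP[s1 s2].
  have ts : 0 < t0 - s by rewrite subr_gt0.
  apply: (@le_trans _ _ (B (t0 - s) * (L * (t0 - s)))).
    by rewrite ler_wpM2l ?powR_ge0//; apply: kL; rewrite s1.
  have -> : 1 - al = - al + 1 by ring.
  rewrite mulrCA ler_wpM2l// /B -[X in _ * X]powRr1 ?(ltW ts)// -(powR_addr _ _ ts).
  by apply: le_powR; [by rewrite addrC ltW|exact: ltW|by rewrite lerBlDr -lerBlDl ltW].
(* The integrand is nonnegative, so only []0, d[] is kept. There [k] is at least
   [a0 / 2 * s^(al-1)], and the increment of [B] is at least [h] times its smallest slope. *)
have I3 : h * (al * t0 `^ (- al - 1) * (a0 / 2 * (d `^ al / al))) <=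
    \int[leb]_(s in `]0, (t0 - h)[) (B (t0 - h - s) * k s - B (t0 - s) * k s).
  have iD : leb.-integrable `]0, (t0 - h)[ (EFin \o (fun s => B (t0 - h - s) * k s - B (t0 - s) * k s)).
    exact: (integrableB_real (measurable_oo 0 (t0 - h)) iBk1 iBk0).
  rewrite (@Rintegral_oo_split _ _ 0 d (t0 - h)) //; last lra.
  clear I1 I2; have dB (s : R) : 0 < s < t0 - h -> h * (al * t0 `^ (- al - 1)) <= B (t0 - h - s) - B (t0 - s).
    move=> /andP[s0 s1]; have e : t0 - s - (t0 - h - s) = h by ring.
    have := @powRN_diff t0 (t0 - h - s) (t0 - s); rewrite e; apply; lra.
  have c0 : 0 <= h * (al * t0 `^ (- al - 1)) by rewrite !mulr_ge0 ?powR_ge0// ltW.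
  apply: ler_wpDr.
    apply: Rintegral_ge0 => s /=; rewrite in_itv/= => /andP[s1 s2].
    rewrite -mulrBl mulr_ge0//; last by apply/ltW/k_pos; lra.
    by apply: le_trans c0 _; apply: dB; lra.
  have ip := integrable_powR al0 (ltW d0).
  have -> : h * (al * t0 `^ (- al - 1) * (a0 / 2 * (d `^ al / al))) =
      \int[leb]_(s in `]0, d[) (h * (al * t0 `^ (- al - 1)) * (a0 / 2) * s `^ (al - 1)).
    rewrite RintegralZl// {1}/Rintegral (integral_powR al0 (ltW d0))/=; ring.
  apply: le_Rintegral => //; first exact: integrableZ_real.
    exact: integrableS iD.
  move=> s /=; rewrite in_itv/= => /andP[s1 s2].
  rewrite -mulrBl -mulrA; apply: ler_pM => //.
  - by rewrite mulr_ge0 ?powR_ge0// divr_ge0// ltW.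
  - by apply: dB; lra.
  - by apply: kd; rewrite s1.
rewrite RintegralB// in I3.
have mg : 0 <= mu * g by rewrite mulr_ge0// ltW.
have E1 : \int[leb]_(s in `]0, (t0 - h)[) (B (t0 - h - s) * k s) +
    mu * g * \int[leb]_(s in `]0, (t0 - h)[) k s = g by exact: (conv_bkern_ker t1).
have E0 : \int[leb]_(s in `]0, (t0 - h)[) (B (t0 - s) * k s) +
    \int[leb]_(s in `](t0 - h), t0[) (B (t0 - s) * k s) +
    mu * g * \int[leb]_(s in `]0, t0[) k s = g.
  have th : 0 <= t0 - h <= t0 by rewrite (ltW t1) gerBl ltW.
  rewrite -(@Rintegral_oo_split _ (fun s => B (t0 - s) * k s) 0 (t0 - h) t0 iBk th).
  exact: (conv_bkern_ker t0_gt0).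
rewrite -(ler_pM2l h0); apply: le_trans I3 _.
by rewrite -mulrA; exact: (first_zero_arith E0 E1 I1 I2 mg).
Qed.
End FirstZero.

End Resolvent.

(** * Positivity, monotonicity and decay of the kernel *)

Section KernelBounds.
Context {R : realType}.
Variables (al : R) (al0 : 0 < al) (al1 : al < 1).
Variables (a0 mu : R) (a0_gt0 : 0 < a0) (mu_gt0 : 0 < mu).

Local Notation k := (ker al a0 mu).
Local Notation a := (akern al a0).
Let g := a0 * beta (1 - al) al.

Lemma ker_gt0 t : 0 < t -> 0 < k t.
Proof.
move=> t_gt0; rewrite ltNge; apply/negP => kt.
have [d d0 hd] := ker_near0 al0 mu a0_gt0.
pose S := [set s : R | 0 < s /\ k s <= 0].
have S0 : S !=set0 by exists t.
have Sd s : S s -> d <= s.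
  move=> [s0 ks]; rewrite leNgt; apply/negP => sd.
  have := hd s; rewrite s0 sd => /(_ isT) /le_trans /(_ ks).
  by rewrite leNgt mulr_gt0// ?divr_gt0// powR_gt0.
have infS : has_inf S by split => //; exists d => s /Sd.
(* The infimum is positive because [k] is positive near 0, and [k t0 <= 0] by continuity, so it is a
   genuine first zero. *)
set t0 := inf S.
have dt0 : d <= t0 by apply: lb_le_inf => // s /Sd.
have t0_gt0 : 0 < t0 by exact: lt_le_trans dt0.
have k_pos s : 0 < s < t0 -> 0 < k s.
  move=> /andP[s0 st]; rewrite ltNge; apply/negP => ks.
  by move: st; rewrite ltNge => /negP; apply; apply: ge_inf => //; exists d => r /Sd.
have kt0 : k t0 <= 0.
  rewrite leNgt; apply/negP => kt0.
  have : {for t0, continuous k} by exact: ker_continuous.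
  rewrite /prop_for /continuous_at => /cvgr_gt /(_ _ kt0).
  move=> /nbhs_ballP[e /= e0 he].
  have [s [s0 ks] se] := inf_adherent e0 infS.
  have ts : t0 <= s by apply: ge_inf; [exists d => r /Sd|].
  have := he s; rewrite /ball/= distrC ger0_norm ?subr_ge0// ltrBlDl => /(_ se).
  by rewrite ltNge ks.
have [L [e [L0 e0 kL]]] : exists L d : R, [/\ 0 <= L, 0 < d & forall s, t0 - d < s < t0 -> `|k s - k t0| <= L * (t0 - s)].
  exact: ker_locally_lipschitz.
(* [first_zero_bound] wants an initial interval on which [ker_near0] applies and which lies in the
   first half of []0, t0[]. *)
pose dd := Num.min d t0 / 2.
have mind : 0 < Num.min d t0 by rewrite lt_min d0.
have dd0 : 0 < dd by rewrite divr_gt0.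
have ddt : dd <= t0 / 2 by rewrite ler_pM2r// ge_min lexx orbT.
have ddd : dd <= d.
  by rewrite ler_pdivrMr// (le_trans (_ : _ <= d)) ?ge_min ?lexx// ler_peMr ?ler1n// ltW.
pose c := al * t0 `^ (- al - 1) * (a0 / 2 * (dd `^ al / al)).
have c0 : 0 < c by rewrite /c !mulr_gt0// ?powR_gt0// ?invr_gt0.
have H (h : R) : 0 < h -> h < e -> h < t0 / 2 -> c <= mu * g * L * h + L * h `^ (1 - al).
  move=> h0 he ht; apply: (first_zero_bound al0 a0_gt0 mu_gt0 al1 t0_gt0 k_pos) => //.
  - by move=> s /andP[s0 s1]; apply: hd; rewrite s0 (lt_le_trans s1).
  - move=> s /andP[s1 s2]; apply: le_trans (_ : k s - k t0 <= _); first by rewrite lerBrDl gerDr.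
    apply: le_trans (ler_norm _) _; apply: kL; rewrite s2 andbT.
    by apply: le_lt_trans s1; rewrite lerD2l lerN2 ltW.
  - by rewrite h0.
(* The lower bound [c] is positive and independent of [h], so letting [h] tend to 0 is
   contradictory. *)
have lim : mu * g * L * h + L * h `^ (1 - al) @[h --> (0:R)^'+] --> 0.
  rewrite -[X in _ --> X](addr0 0); apply: cvgD.
    rewrite -[X in _ --> X](mulr0 (mu * g * L)); apply: cvgMl_tmp.
    exact: cvg_at_right_filter cvg_id.
  rewrite -[X in _ --> X](mulr0 L); apply: cvgMl_tmp.
  apply: cvg_powR0; first by rewrite subr_gt0.
    by near=> h; apply: ltW; near: h; exact: nbhs_right_gt.
  exact: cvg_at_right_filter cvg_id.
have : \forall h \near (0:R)^'+, [/\ 0 < h, h < e, h < t0 / 2 & mu * g * L * h + L * h `^ (1 - al) < c].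
  near=> h; split.
  - by near: h; exact: nbhs_right_gt.
  - by near: h; exact: nbhs_right_lt.
  - by near: h; apply: nbhs_right_lt; rewrite divr_gt0.
  - by near: h; exact: (cvgr_lt _ lim).
move=> /filter_ex[h [h0 he ht]]; rewrite ltNge => /negP; apply; exact: H.
Unshelve. all: by end_near. Qed.

Lemma ker_le t : 0 < t -> k t <= a t.
Proof.
move=> t0; rewrite -(ker_eq al0 a0 mu t0) lerDl mulr_ge0 ?(ltW mu_gt0)//.
apply: conv_ge0 => s /andP[s0 _]; last by apply/ltW/ker_gt0.
by rewrite /akern mulr_ge0 ?powR_ge0// ltW.
Qed.

Lemma conv_ker_ge0 t : 0 <= conv k k t.
Proof. by apply: conv_ge0 => s /andP[s0 _]; apply/ltW/ker_gt0. Qed.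

Lemma wker_le0 t : 0 < t -> wker al a0 mu t <= 0.
Proof.
move=> t0; rewrite (wkerE al0 mu a0_gt0 t0) subr_le0; apply: (@le_trans _ _ 0).
  by apply: mulr_le0_ge0; [rewrite subr_le0 ltW|apply/ltW/ker_gt0].
by rewrite !mulr_ge0 ?conv_ker_ge0// ltW.
Qed.

Lemma ker_nonincr s t : 0 < s -> s <= t -> k t <= k s.
Proof.
move=> s0; rewrite le_eqVlt => /predU1P[->//|st].
have dd z : z \in `]s, t[ -> is_derive z (1:R) k (wker al a0 mu z / z).
  by rewrite in_itv/= => /andP[sz _]; apply: ker_derive => //; exact: lt_trans sz.
have [|c cst H] := MVT st dd.
  apply: continuous_in_subspaceT => z /set_mem/=; rewrite in_itv/= => /andP[sz _].
  by apply: ker_continuous => //; exact: lt_le_trans sz.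
rewrite -subr_le0 H; move: cst; rewrite in_itv/= => /andP[sc _].
have c0 : 0 < c by exact: lt_trans sc.
rewrite mulr_le0_ge0 ?subr_ge0 ?(ltW st)//.
by rewrite mulr_le0_ge0 ?wker_le0// invr_ge0 ltW.
Qed.

Lemma ker_int_le t : 0 < t -> mu * \int[leb]_(s in `]0, t[) k s <= 1.
Proof.
move=> t0; have g0 : 0 < g.
  rewrite mulr_gt0//; apply: lt_le_trans ltr01 _; apply: beta_ge1; apply/andP; split => //.
  - by rewrite subr_gt0.
  - by rewrite lerBlDr lerDl ltW.
  - exact: ltW.
have := conv_bkern_ker al0 mu a0_gt0 al1 t0; rewrite -/g => H.
have h : 0 <= conv (fun s => s `^ (- al)) k t.
  by apply: conv_ge0 => s /andP[s0 _]; [exact: powR_ge0|apply/ltW/ker_gt0].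
rewrite -(ler_pM2l g0) mulr1 -[leRHS]H mulrA [g * mu]mulrC lerDr//.
Qed.

(** A nonincreasing function satisfies [t * k t <=] its integral over []0, t[], to which
    [ker_int_le] applies. *)
Lemma ker_decay t : 0 < t -> mu * k t <= t^-1.
Proof.
move=> t0; rewrite -[leRHS]mul1r ler_pdivlMr// -mulrA; apply: le_trans (ker_int_le t0).
rewrite ler_pM2l//.
have -> : k t * t = \int[leb]_(s in `]0, t[) (fun=> k t) s.
  by rewrite Rintegral_cst//= lebesgue_measure_itv/= lte_fin t0 sube0.
apply: le_Rintegral => //.
- apply: integrable_cst_real => //=; by rewrite lebesgue_measure_itv/= lte_fin t0 sube0 ltry.
- exact: ker_integrable.
- by move=> s /=; rewrite in_itv/= => /andP[s0 st]; apply: ker_nonincr => //; exact: ltW.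
Qed.

Lemma conv_ker_le t : 0 < t -> mu * conv k k t <= 2 * k (t / 2).
Proof.
move=> t0; have t2 : 0 < t / 2 by rewrite divr_gt0.
have ik : leb.-integrable `]0, t[ (EFin \o k) by exact: ker_integrable.
have tt : 0 < t <= t by rewrite t0 lexx.
have [M M0 kb] := ker_powb_ex al0 a0 mu t0.
have mk : measurable_fun `]0, t[ k by exact: measurable_ker.
have ikk := powb_conv_integrable mk mk al0 al0 kb kb tt.
have H : conv k k t <= 2 * k (t / 2) * \int[leb]_(s in `]0, t[) k s.
  apply: conv_nonincr_le => //; first by move=> s /andP[s0 _]; apply/ltW/ker_gt0.
  by move=> r s r0 rs; exact: ker_nonincr.
have I1 := ker_int_le t0.
apply: le_trans (ler_wpM2l (ltW mu_gt0) H) _.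
by rewrite mulrCA ger_pMr ?mulr_gt0 ?ker_gt0.
Qed.

(** By [wkerE] and [conv_ker_le], the absolute value is at most [(1 + al) k (t / 2)], hence at most
    [3 a (t / 2)]; halving the argument of [a] costs [2^(1-al) <= 2], whence the 6. *)
Lemma wker_bound t : 0 < t -> `|wker al a0 mu t| <= 6 * a0 * t `^ (al - 1).
Proof.
move=> t0; have t2 : 0 < t / 2 by rewrite divr_gt0.
rewrite ler0_norm ?wker_le0// (wkerE al0 mu a0_gt0 t0).
have k2 : 0 < k (t / 2) by exact: ker_gt0.
apply: (@le_trans _ _ (3 * k (t / 2))).
  have h1 : k t <= k (t / 2) by apply: ker_nonincr => //; lra.
  have h2 := conv_ker_le t0; have h3 := ker_gt0 t0.
  have h4 : al * (mu * conv k k t) <= al * (2 * k (t / 2)) by rewrite ler_pM2l.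
  have h5 : (1 - al) * k t <= (1 - al) * k (t / 2) by rewrite ler_wpM2l// subr_ge0 ltW.
  rewrite opprB -mulrA; have -> : al * (mu * conv k k t) - (al - 1) * k t =
    al * (mu * conv k k t) + (1 - al) * k t by ring.
  apply: le_trans (lerD h4 h5) _; rewrite (_ : _ + _ = (1 + al) * k (t / 2)); last by ring.
  rewrite ler_pM2r// -[X in _ <= X]/(1 + 2); apply: (@le_trans _ _ (1 + 1)); rewrite lerD2l ?(ltW al1)// ler1n//.
apply: le_trans (_ : 3 * a (t / 2) <= _); first by rewrite ler_pM2l//; exact: ker_le.
rewrite /akern powRM ?invr_ge0 ?(ltW t0)//.
have h2 : 2^-1 `^ (al - 1) <= 2 :> R.
  have -> : al - 1 = - (1 - al) by ring.
  rewrite opprB (powR_addr al (-1)) ?invr_gt0// powR_inv1 ?invr_ge0// invrK.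
  by rewrite ler_piMl// powR_le1 ?(ltW al0)// invr_ge0 ler0n invf_le1// ler1n.
have -> : 3 * (a0 * (t `^ (al - 1) * 2^-1 `^ (al - 1))) = 3 * a0 * t `^ (al - 1) * 2^-1 `^ (al - 1) by ring.
apply: le_trans (_ : 3 * a0 * t `^ (al - 1) * 2 <= _).
  by rewrite ler_wpM2l// !mulr_ge0// ?powR_ge0// ltW.
by rewrite le_eqVlt; apply/orP; left; apply/eqP; ring.
Qed.

Lemma ker_interp (th t : R) : 0 <= th <= 1 -> 0 < t ->
  mu `^ th * k t <= (1 + a0) * t `^ (- th + (al - 1) * (1 - th)).
Proof.
move=> /andP[th0 th1] t0; have kt := ker_gt0 t0.
have -> : mu `^ th * k t = (mu * k t) `^ th * (k t) `^ (1 - th).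
  rewrite powRM ?(ltW mu_gt0) ?(ltW kt)// -mulrA -(powR_addr _ _ kt).
  by rewrite addrC subrK powRr1// ltW.
apply: (@le_trans _ _ ((t^-1) `^ th * (a t) `^ (1 - th))).
  apply: ler_pM; rewrite ?powR_ge0//; apply: le_powR => //; rewrite ?subr_ge0 ?(ltW kt)//.
  - by rewrite mulr_ge0// ltW.
  - exact: ker_decay.
  - exact: ker_le.
rewrite /akern powRM ?powR_ge0 ?(ltW a0_gt0)// -powRrM -powR_inv1 ?(ltW t0)// -powRrM mulN1r.
rewrite mulrCA -(powR_addr _ _ t0) ler_wpM2r ?powR_ge0//.
have [a1|a1] := leP 1 a0.
  apply: le_trans (_ : a0 `^ 1 <= _); last by rewrite powRr1 ?(ltW a0_gt0)// lerDr.
  by apply: ler_powR => //; rewrite gerBl.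
apply: le_trans (powR_le1 _ _) _; rewrite ?subr_ge0 ?lerDl ?(ltW a0_gt0) ?(ltW a1)//.
Qed.

End KernelBounds.

(** * One spectral mode *)

Section AlmostEverywhere.
Context d (T : measurableType d) (R : realType) (m : {measure set T -> \bar R}).
Implicit Types P Q : T -> Prop.

Lemma aeS P Q : (forall x, P x -> Q x) -> {ae m, forall x, P x} -> {ae m, forall x, Q x}.
Proof. by move=> PQ; apply: negligibleS => x; apply: contra_not; exact: PQ. Qed.

Lemma aeI P Q : {ae m, forall x, P x} -> {ae m, forall x, Q x} ->
  {ae m, forall x, P x /\ Q x}.
Proof.
move=> hP hQ; have := negligibleU hP hQ; apply: negligibleS => x /= h.
by have [Px|Px] := pselect (P x); [right => Qx; apply: h|left].
Qed.

Lemma ae_all (P : nat -> T -> Prop) : (forall n, {ae m, forall x, P n x}) ->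
  {ae m, forall x, forall n, P n x}.
Proof.
move=> hP; have := negligible_bigcup hP; apply: negligibleS => x /= /existsNP[n hn].
by exists n.
Qed.

End AlmostEverywhere.

(** A divergent integral would have the default value 0, so integrability must come before
    positivity. The lower bound keeps only []0, 1[], where the exponential is at least
    [expR (-1)]. *)
Lemma Gamma_gt0 (R : realType) (a : R) : 0 < a <= 1 -> 0 < Gamma a.
Proof.
move=> /andP[a0 a1]; rewrite /Gamma.
pose F (x : R) := x `^ (a - 1) * expR (- x).
have mF (D : set R) : measurable_fun D F.
  apply: measurable_funM; first exact: measurable_powRl.
  apply: measurableT_comp => //; exact: measurable_oppr.
have F0 x : 0 <= F x by rewrite mulr_ge0 ?powR_ge0 ?expR_ge0.
have m0 : measurable (`]0, +oo[%classic : set (measurableTypeR R)) by exact: measurable_itv.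
have iF : leb.-integrable `]0, +oo[ (EFin \o F).
  (* The power controls the singularity at 0, and a multiple of the exponential density controls the
     tail. *)
  pose G (x : R) := (cut 1 (fun x => x `^ (a - 1)) x) + expR 1 * exponential_pdf 1 x.
  apply: (@integrable_dom _ _ _ _ _ m0 _ G); first exact: mF.
    apply: integrableD_real => //.
      apply: (@integrableS _ _ _ _ setT) => //.
      rewrite /cut -restrict_EFin.
      apply/(integrable_mkcond _ (measurable_oo 0 1)); exact: integrable_powR.
    apply: integrableZ_real => //.
    apply: (@integrableS _ _ _ _ setT) => //.
    exact: integrable_exponential_pdf.
  move=> x /=; rewrite in_itv/= andbT => x0.
  rewrite ger0_norm// /G exponential_pdfE ?(ltW x0)// mul1r mulN1r.
  have e1 : 1 <= expR 1 :> R by rewrite -[leLHS]expR0 ler_expR.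
  have [x1|x1] := ltP x 1.
    rewrite cutE ?x0// -[F x]addr0; apply: lerD; last by rewrite mulr_ge0 ?expR_ge0.
    by rewrite ler_piMr ?powR_ge0// -[leRHS]expR0 ler_expR oppr_le0 ltW.
  rewrite cut0 ?negb_and -?leNgt ?x1 ?orbT// add0r ler_wpM2r ?expR_ge0//.
  apply: le_trans e1; have o1 : 1 `^ (a - 1) = 1 :> R by rewrite powR1.
  rewrite -[leRHS]o1.
  by apply: le_powRN => //; rewrite subr_le0.
apply: (@lt_le_trans _ _ (expR (-1) * (1 / a))).
  by rewrite mulr_gt0 ?expR_gt0// divr_gt0.
have -> : expR (-1) * (1 / a) = \int[leb]_(x in `]0, 1[) (expR (-1) * x `^ (a - 1)).
  rewrite RintegralZl//; last exact: integrable_powR.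
  by congr (_ * _); rewrite /Rintegral integral_powR// powR1.
apply: (@le_trans _ _ (\int[leb]_(x in `]0, 1[) F x)).
  apply: le_Rintegral => //.
  - by apply: integrableZ_real => //; exact: integrable_powR.
  - apply: integrableS iF => //; apply: subset_itvl => //; rewrite bnd_simp//.
  - move=> x /=; rewrite in_itv/= => /andP[x0 x1]; rewrite mulrC ler_wpM2l ?powR_ge0//.
    by rewrite ler_expR lerN2 ltW.
rewrite /Rintegral; apply: fine_le.
- apply: integrable_fin_num => //; apply: integrableS iF => //; apply: subset_itvl => //; rewrite bnd_simp//.
- exact: integrable_fin_num iF.
- apply: ge0_subset_integral => //; first by apply/measurable_EFinP; exact: mF.
  - by move=> x _; rewrite lee_fin.
  - by apply: subset_itvl; rewrite bnd_simp.
Qed.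

(** At a Lebesgue point [f] is the derivative of its primitive, and the primitive vanishes
    identically near that point. *)
Lemma itv_integral0_ae (R : realType) (f : R -> R) (T : R) : 0 < T ->
  leb.-integrable `]0, T[ (EFin \o f) ->
  (forall a b, 0 <= a -> a <= b -> b <= T -> \int[leb]_(s in `]a, b[) f s = 0) ->
  {ae (@leb R), forall s, `]0, T[%classic s -> f s = 0}.
Proof.
move=> T0 intf f0.
pose F : R -> R := f \_ `]0, T[.
have iF : leb.-integrable setT (EFin \o F).
  by rewrite /F -restrict_EFin; apply/(integrable_mkcond _ (measurable_oo 0 T)).
have lF : locally_integrable setT F.
  by apply: integrable_locally => //; exact: openT.
have := lebesgue_differentiation lF; apply: aeS => x Fx /=; rewrite in_itv/= => /andP[x0 xT].
have iF' : leb.-integrable [set` Interval (BRight 0) (BRight T)] (EFin \o F) by exact: integrableS iF.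
have lx : (BRight (0 : R) < BRight (x : R))%O by rewrite ltBSide.
have [dF eF] := @FTC1_lebesgue_pt R F (BRight 0) x T xT iF' lx Fx.
have -> : f x = F x by rewrite /F patchE mem_set//= in_itv/= x0.
rewrite -{}eF {dF} derive1E.
suff h : \forall y \near x, \int[leb]_(t in `]0, y]) F t = 0.
  by rewrite (near_eq_derive _ h) derive_cst.
near=> y.
have y0 : 0 < y by near: y; exact: lt_nbhsr.
have yT : y < T by near: y; exact: lt_nbhsl.
transitivity (\int[leb]_(t in `]0, y]) f t).
  apply: eq_Rintegral => z /set_mem/=; rewrite in_itv/= => /andP[z0 zy].
  by rewrite /F patchE mem_set//= in_itv/= z0 (le_lt_trans zy).
rewrite -Rintegral_itv_bndo_bndc ?f0// ?ltW//.
by apply: (integrable_itvS _ intf); exact: ltW.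
Unshelve. all: by end_near. Qed.

Section ConvIntegrable.
Context {R : realType}.
Implicit Types (f g : R -> R) (t T : R).

Let K T f g (p : R * R) : R := cut T f (p.1 - p.2) * cut T g p.2.

Let mK T f g : measurable_fun `]0, T[ f -> measurable_fun `]0, T[ g ->
  measurable_fun setT (K T f g).
Proof.
move=> /measurable_cut mf /measurable_cut mg; apply: measurable_funM.
  by apply: (measurableT_comp mf); apply: measurable_funB.
exact: measurableT_comp mg _.
Qed.

Let integrable_cut T f : leb.-integrable `]0, T[ (EFin \o f) ->
  leb.-integrable setT (EFin \o cut T f).
Proof.
by move=> h; rewrite /cut -restrict_EFin; apply/(integrable_mkcond _ (measurable_oo 0 T)).
Qed.

(** By translation invariance the double integral of the absolute value is the product of the two L1
    norms. Both the integrability of the convolution and that of almost every slice follow. *)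
Let iK T f g : leb.-integrable `]0, T[ (EFin \o f) -> leb.-integrable `]0, T[ (EFin \o g) ->
  (leb \x leb)%E.-integrable setT (EFin \o K T f g).
Proof.
move=> iF iG.
have mf : measurable_fun `]0, T[ f by case/integrableP : iF => /measurable_EFinP.
have mg : measurable_fun `]0, T[ g by case/integrableP : iG => /measurable_EFinP.
have mcf := measurable_cut mf; have mcg := measurable_cut mg.
apply/integrable21ltyP; first by apply/measurable_EFinP; exact: mK.
have /integrableP[_ If] := integrable_cut iF.
have iG' := integrable_cut iG; have /integrableP[_ Ig] := iG'.
have nF : (\int[leb]_x (`|cut T f x|)%:E)%E \is a fin_num by rewrite ge0_fin_numE ?integral_ge0.
rewrite [ltLHS](_ : _ = \int[leb]_y ((fine (\int[leb]_x (`|cut T f x|)%:E)%E)%:E * (`|cut T g y|)%:E)%E)%E; last first.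
  apply: eq_integral => y _; rewrite fineK// muleC.
  rewrite [X in (_ = _ * X)%E](integral_translate y); last first.
    by apply/measurable_EFinP; apply: measurableT_comp mcf; exact: normr_measurable.
  rewrite -ge0_integralZl//.
    by apply: eq_integral => x _; rewrite /K/= normrM EFinM muleC.
  apply/measurable_EFinP; apply: measurableT_comp; first exact: normr_measurable.
  apply: (measurableT_comp mcf); exact: measurable_funD.
rewrite ge0_integralZl//.
- by rewrite lte_mul_pinfty ?lee_fin ?fine_ge0 ?integral_ge0.
- by apply/measurable_EFinP; apply: measurableT_comp mcg; exact: normr_measurable.
- by rewrite lee_fin fine_ge0// integral_ge0.
Qed.

Lemma integrable_conv T f g : leb.-integrable `]0, T[ (EFin \o f) ->
  leb.-integrable `]0, T[ (EFin \o g) -> leb.-integrable `]0, T[ (EFin \o conv f g).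
Proof.
move=> iF iG; have := integrable_fubini_F (iK iF iG).
move=> /(integrableS measurableT (measurable_oo 0 T) (@subsetT _ _)) h.
have mf : measurable_fun `]0, T[ f by case/integrableP : iF => /measurable_EFinP.
have mg : measurable_fun `]0, T[ g by case/integrableP : iG => /measurable_EFinP.
apply: (le_integrable (measurable_oo 0 T) _ _ h).
  by apply/measurable_EFinP; exact: measurable_conv.
move=> t /=; rewrite in_itv/= => /andP[_ tT].
rewrite (conv_cutE _ _ (ltW tT)) /Rintegral /fubini_F /K/=.
by case: (\int[leb]_y _)%E => //=; rewrite leey.
Qed.

Lemma ae_conv_integrable T f g : leb.-integrable `]0, T[ (EFin \o f) ->
  leb.-integrable `]0, T[ (EFin \o g) ->
  {ae (@leb R), forall t, `]0, T[%classic t ->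
    leb.-integrable `]0, t[ (EFin \o (fun s => f (t - s) * g s))}.
Proof.
move=> iF iG; have := ae_integrable1 (iK iF iG); apply: aeS => t it; rewrite /= in_itv/= => /andP[t0 tT].
have := integrableS measurableT (measurable_oo 0 t) (@subsetT _ _) it.
apply: eq_integrable => // s /set_mem/=; rewrite in_itv/= => /andP[s0 st].
rewrite /K/= !cutE ?subr_gt0 ?st ?s0 ?(lt_trans st)//.
by apply: lt_trans tT; rewrite ltrBlDr ltrDl.
Qed.

End ConvIntegrable.

Section Primitive.
Context {R : realType}.
Variables (T x0 : R) (x y : R -> R).
Hypotheses (iy : leb.-integrable `]0, T[ (EFin \o y))
  (xE : forall t, 0 < t <= T -> x t = x0 + \int[leb]_(s in `]0, t[) y s).

Lemma primitive_measurable : measurable_fun `]0, T[ x.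
Proof.
have my : measurable_fun `]0, T[ y by case/integrableP : iy => /measurable_EFinP.
apply: (eq_measurable_fun (fun t => x0 + conv (fun=> 1) y t)).
  by move=> s /set_mem/=; rewrite in_itv/= => /andP[s0 sT]; rewrite conv1 xE// s0 ltW.
by apply: measurable_funD; [exact: measurable_cst|apply: measurable_conv => //; exact: measurable_cst].
Qed.

Lemma primitive_powb : powb 1 (`|x0| + \int[leb]_(s in `]0, T[) `|y s|) T x.
Proof.
move=> s /andP[s0 sT]; rewrite subrr powRr0 mulr1 xE ?s0 ?(ltW sT)//.
have iys : leb.-integrable `]0, s[ (EFin \o y) by apply: (integrable_itvS _ iy); exact: ltW.
apply: le_trans (ler_normD _ _) _; rewrite lerD2l.
apply: le_trans (le_normr_Rintegral _ _) _ => //.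
rewrite (@Rintegral_oo_split _ _ 0 s T) ?(ltW s0) ?(ltW sT)//; last exact: (integrable_norm iy).
by rewrite lerDl; apply: Rintegral_ge0.
Qed.

End Primitive.

(** * The scalar fractional equation: solution and uniqueness *)

Section ScalarMode.
Context {R : realType}.
Variables (al : R) (al0 : 0 < al) (al1 : al < 1).
Variables (a0 mu : R) (a0_gt0 : 0 < a0) (mu_gt0 : 0 < mu).
Implicit Types (s t T : R).

Local Notation k := (ker al a0 mu).
Local Notation a := (akern al a0).
Local Notation b := (fun s => s `^ (- al)).
Local Notation one := (fun=> 1 : R).
Let g := a0 * beta (1 - al) al.

Variables (T : R) (T0 : 0 < T) (f fp : R -> R) (P : R).
Hypotheses (mfp : measurable_fun `]0, T[ fp) (fpb : powb 1 P T fp).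
Hypothesis fE : forall t, 0 <= t <= T -> f t = f 0 + \int[leb]_(s in `]0, t[) fp s.

(* If f is a coefficient f_j, then mode, mode1 and (below) mode2 are the
   coefficients of u, u' and u''. *)
Definition mode t := conv k f t.
Definition mode1 t := conv k fp t + f 0 * k t.

Let mk : measurable_fun `]0, T[ k. Proof. exact: measurable_ker. Qed.
Let m1 : measurable_fun `]0, T[ one. Proof. exact: measurable_cst. Qed.
Let kb : exists M, powb al M T k.
Proof. by have [M _ h] := ker_powb_ex al0 a0 mu T0; exists M. Qed.

Let powb1 (c : R) : powb 1 `|c| T (fun=> c). Proof. exact: one_powb. Qed.

Let ikf (x : R -> R) c C t : measurable_fun `]0, T[ x -> 0 < c -> powb c C T x -> 0 < t <= T ->
  leb.-integrable `]0, t[ (EFin \o (fun s => k (t - s) * x s)).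
Proof.
by move=> mx c0 xb tT; have [M kM] := kb; exact: (powb_conv_integrable mk mx al0 c0 kM xb tT).
Qed.

Let i1f (x : R -> R) c C t : measurable_fun `]0, T[ x -> 0 < c -> powb c C T x -> 0 < t <= T ->
  leb.-integrable `]0, t[ (EFin \o (fun s => one (t - s) * x s)).
Proof.
by move=> mx c0 xb tT; exact: (powb_conv_integrable m1 mx ltr01 c0 (powb1 1) xb tT).
Qed.

Let conv_k1 t : 0 < t <= T -> conv k one t = \int[leb]_(s in `]0, t[) k s.
Proof.
by move=> /andP[t0 tT]; rewrite -conv1; apply: convC; exact: measurable_itvS tT _.
Qed.

Let conv_k1f x c C t : measurable_fun `]0, T[ x -> 0 < c -> powb c C T x -> 0 < t <= T ->
  conv k (conv one x) t = conv one (conv k x) t.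
Proof.
move=> mx c0 xb tT; have [M kM] := kb.
rewrite (convA_powb mk m1 mx al0 ltr01 c0 kM (powb1 1) xb tT).
rewrite (convA_powb m1 mk mx ltr01 al0 c0 (powb1 1) kM xb tT).
apply: eq_convl => s /andP[s0 st]; apply: convC; apply: measurable_itvS (mk) || apply: measurable_itvS (m1).
  by move/andP: tT => [_]; apply: le_trans; exact: ltW.
by move/andP: tT => [_]; apply: le_trans; exact: ltW.
Qed.

Let mconv1 : measurable_fun `]0, T[ (conv one fp). Proof. exact: measurable_conv. Qed.
Let mconvk : measurable_fun `]0, T[ (conv k fp). Proof. exact: measurable_conv. Qed.
Let conv1b : exists C, powb 2 C T (conv one fp).
Proof. by eexists; have := powb_conv m1 mfp ltr01 ltr01 (powb1 1) fpb; apply. Qed.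
Let convkb : exists C, powb (al + 1) C T (conv k fp).
Proof. by have [M kM] := kb; eexists; have := powb_conv mk mfp al0 ltr01 kM fpb; apply. Qed.
Let al11 : 0 < al + 1. Proof. by rewrite addr_gt0. Qed.

(** Insert [f = f 0 + 1*f'] and move the convolution with 1 to the outside. *)
Lemma modeE t : 0 < t <= T -> mode t = conv one (conv k fp) t + f 0 * conv one k t.
Proof.
move=> tT; have [C1 c1b] := conv1b.
rewrite /mode (@eq_convr _ _ _ (fun s => conv one fp s + f 0 * one s)); last first.
  move=> s /andP[s0 st]; rewrite conv1 mulr1 addrC fE// (ltW s0)/=.
  by move/andP: tT => [_]; apply: le_trans; exact: ltW.
rewrite convDZr; [|exact: (ikf mconv1 _ c1b tT)|exact: (ikf m1 ltr01 (powb1 1) tT)].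
by rewrite (conv_k1f mfp ltr01 fpb tT) conv_k1//; congr (_ + _ * _); rewrite conv1.
Qed.

Lemma mode_primitive t : 0 < t <= T -> mode t = \int[leb]_(s in `]0, t[) mode1 s.
Proof.
move=> tT; rewrite modeE// -[RHS]conv1 /mode1; have [M kM] := kb; have [C kfM] := convkb.
by rewrite convDZr//; [exact: (i1f mconvk al11 kfM tT)|exact: (i1f mk al0 kM tT)].
Qed.

(** Once [g] is [Gamma (1 - al)], the convolution with [b] is [g] times the Caputo derivative of
    [mode], and this is the scalar equation. *)
Lemma conv_bkern_mode1 t : 0 < t <= T -> conv b mode1 t + mu * g * mode t = g * f t.
Proof.
move=> tT; have [M kM] := kb; have [C kfM] := convkb.
have bb : powb (1 - al) 1 T b by exact: bkern_powb.
have b1 : 0 < 1 - al by rewrite subr_gt0.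
have mb : measurable_fun `]0, T[ b by exact: measurable_powRl.
rewrite /mode1 convDZr; first last.
- exact: (powb_conv_integrable mb mk b1 al0 bb kM tT).
- exact: (powb_conv_integrable mb mconvk b1 al11 bb kfM tT).
rewrite (convA_powb mb mk mfp b1 al0 ltr01 bb kM fpb tT).
have t0 : 0 < t by case/andP: tT.
have bk s : 0 < s -> conv b k s = g + (- (mu * g)) * conv one k s.
  by move=> s0; rewrite conv1 -[in LHS](addrK (mu * g * \int[leb]_(x in `]0, s[) k x) (conv b k s)) conv_bkern_ker// mulNr.
rewrite (@eq_convl _ fp (conv b k) (fun s => g + (- (mu * g)) * conv one k s)); last first.
  by move=> s /andP[s0 _]; exact: bk.
have m1k : measurable_fun `]0, T[ (conv one k) by exact: measurable_conv.
have [C' k1b] : exists C, powb (1 + al) C T (conv one k).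
  by eexists; have := powb_conv m1 mk ltr01 al0 (powb1 1) kM; apply.
have al1' : 0 < 1 + al by rewrite addrC.
rewrite convDZl; first last.
- exact: (powb_conv_integrable m1k mfp al1' ltr01 k1b fpb tT).
- exact: (powb_conv_integrable _ mfp ltr01 ltr01 (powb1 g) fpb tT).
rewrite -(convA_powb m1 mk mfp ltr01 al0 ltr01 (powb1 1) kM fpb tT) bk// modeE//.
have tT' : 0 <= t <= T by rewrite (ltW t0); case/andP: tT.
have -> : conv (fun=> g) fp t = g * (f t - f 0).
  rewrite (fE tT') [f 0 + _]addrC addrK /conv RintegralZl//.
  by apply: eq_integrable (i1f mfp ltr01 fpb tT) => // s _; rewrite /= mul1r.
by ring.
Qed.


Lemma powb_bounded (c C : R) (x : R -> R) : 1 <= c -> powb c C T x -> powb 1 (C * T `^ (c - 1)) T x.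
Proof.
move=> c1 xb s sT; apply: le_trans (xb s sT) _; rewrite subrr powRr0 mulr1.
have C0 : 0 <= C by exact: powb_ge0 T0 xb.
by case/andP: sT => s0 sT; rewrite ler_wpM2l// le_powR ?subr_ge0// ltW.
Qed.

Section Uniqueness.
Variables (U g1 : R -> R).
Hypotheses (ig1 : leb.-integrable `]0, T[ (EFin \o g1))
  (UE : forall t, 0 < t <= T -> U t = \int[leb]_(s in `]0, t[) g1 s)
  (Ueq : {ae (@leb R), forall t, `]0, T[%classic t -> conv b g1 t + g * mu * U t = g * f t}).

Let mg1 : measurable_fun `]0, T[ g1.
Proof. by case/integrableP : ig1 => /measurable_EFinP. Qed.

Let UE0 t : 0 < t <= T -> U t = 0 + \int[leb]_(s in `]0, t[) g1 s.
Proof. by rewrite add0r; exact: UE. Qed.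
Let mU : measurable_fun `]0, T[ U. Proof. exact: primitive_measurable ig1 UE0. Qed.
Let Ub : powb 1 (`|0 : R| + \int[leb]_(s in `]0, T[) `|g1 s|) T U.
Proof. exact: primitive_powb ig1 UE0. Qed.

Let mf : measurable_fun `]0, T[ f.
Proof.
apply: (eq_measurable_fun (fun s => f 0 + conv one fp s)); last first.
  by apply: measurable_funD => //; exact: measurable_cst.
by move=> s /set_mem/=; rewrite in_itv/= => /andP[s0 sT]; rewrite conv1 [RHS]fE// (ltW s0) ltW.
Qed.

Let fb : exists C, powb 1 C T f.
Proof.
have [C hC] := conv1b; have h : (1 : R) <= 2 by rewrite ler1n.
exists (`|f 0| + C * T `^ (2 - 1)) => s sT.
rewrite fE; last by case/andP: sT => /ltW -> /ltW ->.
apply: le_trans (ler_normD _ _) _; rewrite subrr powRr0 mulr1 lerD2l -conv1.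
by apply: le_trans (powb_bounded h hC sT) _; rewrite subrr powRr0 mulr1.
Qed.

Let g_gt0 : 0 < g.
Proof.
rewrite mulr_gt0//; apply: lt_le_trans ltr01 _; apply: beta_ge1; apply/andP; split => //.
- by rewrite subr_gt0.
- by rewrite lerBlDr lerDl ltW.
- exact: ltW.
Qed.

Let ma : measurable_fun `]0, T[ a. Proof. exact: measurable_akern. Qed.
Let ab : powb al a0 T a. Proof. exact: akern_powb. Qed.

Let U_volterra t : 0 < t <= T -> U t + mu * conv a U t = conv a f t.
Proof.
move=> tT; have [t0 tT'] := andP tT.
have b1 : 0 < 1 - al by rewrite subr_gt0.
have mb : measurable_fun `]0, T[ b by exact: measurable_powRl.
have bb : powb (1 - al) 1 T b by exact: bkern_powb.
have al1b : 1 <= al + (1 - al) by rewrite addrC subrK.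
have [C fC] := fb.
have gf1 : measurable_fun `]0, T[ (fun s => g * f s) by apply: measurable_funM => //; exact: measurable_cst.
(* Convolution with [a] inverts the Caputo derivative, because [a*b] is the constant [g].
   Associativity with a merely integrable [g1] is available as the indices [al] and [1 - al] add up
   to 1. *)
have E1 : conv a (conv b g1) t = g * U t.
  rewrite (convA_L1 ma mb ig1 al0 b1 al1b ab bb tT) UE//.
  rewrite (@eq_convl _ _ _ (fun=> g)); last first.
    move=> s /andP[s0 st]; rewrite /g -(conv_bkern_akern al0 a0 al1 s0); apply: convC.
      by apply: measurable_itvS ma; rewrite (le_trans _ tT')// ltW.
    by apply: measurable_itvS mb; rewrite (le_trans _ tT')// ltW.
  by rewrite /conv RintegralZl//; exact: integrable_itvS ig1.
(* Under the convolution it is enough that the equation holds almost everywhere. *)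
have E2 : conv a (conv b g1) t = conv a (fun s => g * f s + - (g * mu) * U s) t.
  rewrite /conv /Rintegral; congr fine; apply: ae_eq_integral; first exact: measurable_oo.
  - apply/measurable_EFinP; apply: measurable_funM.
      exact: measurable_reflect (measurable_itvS tT' ma).
    exact: measurable_itvS tT' (measurable_conv mb mg1).
  - apply/measurable_EFinP; apply: measurable_funM.
      exact: measurable_reflect (measurable_itvS tT' ma).
    apply: measurable_itvS tT' _; apply: measurable_funD => //.
    by apply: measurable_funM => //; exact: measurable_cst.
  - move: Ueq; apply: aeS => s h; rewrite /= in_itv/= => /andP[s0 st].
    rewrite -/(conv b g1 s) -h ?addrK//= ?in_itv/= ?s0 ?(lt_le_trans st)//.
    by rewrite mulNr addrK.
apply: (mulfI (lt0r_neq0 g_gt0)).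
rewrite mulrDr -E1 E2 convDZr; first last.
- exact: (powb_conv_integrable ma mU al0 ltr01 ab Ub tT).
- apply: integrable_convZr; exact: (powb_conv_integrable ma mf al0 ltr01 ab fC tT).
rewrite convZr; last exact: (powb_conv_integrable ma mf al0 ltr01 ab fC tT).
by ring.
Qed.

Let mode_volterra t : 0 < t <= T -> mode t + mu * conv a mode t = conv a f t.
Proof.
move=> tT; have [C fC] := fb; have [K kM] := kb.
rewrite /mode (convA_powb ma mk mf al0 al0 ltr01 ab kM fC tT).
have [C' akb] : exists C, powb (al + al) C T (conv a k).
  by eexists; have := powb_conv ma mk al0 al0 ab kM; apply.
rewrite -convDZl; first last.
- exact: (powb_conv_integrable (measurable_conv ma mk) mf (addr_gt0 al0 al0) ltr01 akb fC tT).
- exact: (powb_conv_integrable mk mf al0 ltr01 kM fC tT).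
by apply: eq_convl => s /andP[s0 _]; exact: ker_eq.
Qed.

(** Both functions solve [x + mu a*x = a*f], and [resolvent_inv] expresses [a*x] through the right
    side alone. So the two convolutions agree, and then the functions themselves do, without any
    Gronwall argument. *)
Lemma mode_unique t : 0 < t <= T -> U t = mode t.
Proof.
move=> tT; have [C fC] := fb; have [K kM] := kb.
have [C' kfb] : exists C, powb (al + 1) C T (conv k f).
  by eexists; have := powb_conv mk mf al0 ltr01 kM fC; apply.
have h1 := resolvent_inv al0 a0_gt0 mU ltr01 Ub.
have h2 := resolvent_inv al0 a0_gt0 (measurable_conv mk mf) al11 kfb.
have e1 : conv k (conv a f) t = conv a U t.
  by apply: h1 => // s /andP[s0 sT]; apply: U_volterra; rewrite s0 ltW.
have e2 : conv k (conv a f) t = conv a mode t.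
  by apply: h2 => // s /andP[s0 sT]; apply: mode_volterra; rewrite s0 ltW.
apply: (addIr (mu * conv a U t)); rewrite U_volterra// -e1 e2.
exact/esym/mode_volterra.
Qed.

End Uniqueness.

End ScalarMode.

Lemma cvg_Rintegral_dominated d (T : measurableType d) (R : realType)
    (m : {measure set T -> \bar R}) (D : set T) (u : nat -> T -> R) (v g : T -> R) :
  measurable D -> (forall n, measurable_fun D (u n)) -> measurable_fun D v ->
  m.-integrable D (EFin \o g) ->
  {ae m, forall x, D x -> u n x @[n --> \oo] --> v x} ->
  (forall n x, D x -> `|u n x| <= g x) ->
  m.-integrable D (EFin \o v) /\
  \int[m]_(x in D) u n x @[n --> \oo] --> \int[m]_(x in D) v x.
Proof.
move=> mD mu mv ig uv ug.
have [||||| iv _ H] := @dominated_convergence _ _ _ m D mD (fun n => EFin \o u n) (EFin \o v) (EFin \o g).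
- by move=> n; exact/measurable_EFinP.
- exact/measurable_EFinP.
- move: uv; apply: aeS => x h Dx; apply: cvg_EFin; first by near=> n.
  exact: h.
- exact: ig.
- by apply: aeW => x n Dx; rewrite lee_fin ug.
split => //; apply: fine_cvg; rewrite fineK//; exact: integrable_fin_num iv.
Unshelve. all: by end_near. Qed.

(** * Difference quotients of the kernel and of its primitive *)

Section PrimitiveKernel.
Context {R : realType}.
Variables (al : R) (al0 : 0 < al) (al1 : al < 1).
Variables (a0 mu : R) (a0_gt0 : 0 < a0) (mu_gt0 : 0 < mu).
Implicit Types (r s t h : R).

Local Notation k := (ker al a0 mu).
Local Notation w := (wker al a0 mu).

(** The primitive is continuous and vanishes for [r <= 0], so it extends by zero across the origin,
    where [k] itself is singular. *)
Definition kint r := \int[leb]_(s in `]0, r[) k s.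
Definition kquot h r := (kint r - kint (r - h)) / h.

Lemma kint0 r : r <= 0 -> kint r = 0.
Proof. by move=> r0; rewrite /kint set_itv_ge ?Rintegral_set0// bnd_simp -leNgt. Qed.

Lemma kintB r h : 0 < h < r -> kint r - kint (r - h) = \int[leb]_(s in `]r - h, r[) k s.
Proof.
move=> /andP[h0 hr]; have r0 : 0 < r by exact: lt_trans hr.
rewrite /kint (@Rintegral_oo_split _ _ 0 (r - h) r); first by rewrite addrAC subrr add0r.
  exact: ker_integrable.
by rewrite subr_ge0 (ltW hr)/= gerBl ltW.
Qed.

Lemma kquot_bounds r h : 0 < h < r -> k r <= kquot h r <= k (r - h).
Proof.
move=> /andP[h0 hr]; have r0 : 0 < r by exact: lt_trans hr.
have rh0 : 0 < r - h by rewrite subr_gt0.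
have rhr : r - h <= r by rewrite gerBl ltW.
have ik : leb.-integrable `]r - h, r[ (EFin \o k).
  have ik0 : leb.-integrable `]0, r[ (EFin \o k) by exact: ker_integrable.
  apply: (integrableS (measurable_oo 0 r) (measurable_oo _ _) _ ik0).
  by apply: subset_itvr; rewrite bnd_simp ltW.
have ic c : leb.-integrable `]r - h, r[ (EFin \o (fun=> c : R)).
  apply: integrable_cst_real; first exact: measurable_oo.
  by rewrite /= lebesgue_measure_itv/= lte_fin gtrBl h0 -EFinB ltry.
have Ic c : \int[leb]_(s in `]r - h, r[) (fun=> c : R) s = c * h.
  by rewrite Rintegral_cst//= lebesgue_measure_itv/= lte_fin gtrBl h0 -EFinB/= opprB addrC subrK.
rewrite /kquot kintB ?h0// ler_pdivlMr// ler_pdivrMr// -!Ic.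
apply/andP; split; apply: le_Rintegral => //; try exact: measurable_oo.
- by move=> s /=; rewrite in_itv/= => /andP[s0 st]; apply: ker_nonincr => //; [exact: lt_trans s0|exact: ltW].
- by move=> s /=; rewrite in_itv/= => /andP[s0 st]; apply: ker_nonincr => //; exact: ltW.
Qed.

Lemma kint_le r : 0 < r -> kint r <= a0 / al * r `^ al.
Proof.
move=> r0; have -> : a0 / al * r `^ al = \int[leb]_(s in `]0, r[) (a0 * s `^ (al - 1)).
  rewrite RintegralZl//; last exact: integrable_powR (ltW r0).
  by rewrite /Rintegral integral_powR ?(ltW r0)//= mulrAC mulrA.
apply: le_Rintegral => //; first exact: ker_integrable.
  by apply: integrableZ_real => //; exact: integrable_powR (ltW r0).
by move=> s /=; rewrite in_itv/= => /andP[s0 st]; exact: ker_le.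
Qed.

Lemma kint_ge0 r : 0 <= kint r.
Proof.
by apply: Rintegral_ge0 => s /=; rewrite in_itv/= => /andP[s0 _]; apply/ltW/ker_gt0.
Qed.

Lemma half_powR_le r : 0 < r -> (r / 2) `^ (al - 1) <= 2 * r `^ (al - 1).
Proof.
move=> r0; rewrite powRM ?invr_ge0 ?(ltW r0)// mulrC ler_wpM2r ?powR_ge0//.
have -> : al - 1 = - (1 - al) by ring.
rewrite opprB (powR_addr al (-1)) ?invr_gt0// powR_inv1 ?invr_ge0// invrK.
by rewrite ler_piMl// powR_le1 ?(ltW al0)// invr_ge0 ler0n invf_le1// ler1n.
Qed.

(** For [h <= r / 2] the quotient is a mean of [k] over points beyond [r / 2]. For larger [h] it is
    at most [kint r / h], and [r < 2 * h] trades the division by [h] for one by [r]. Uniformity in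
    [h] makes this a majorant for dominated convergence. *)
Lemma kquot_le r h : 0 < r -> 0 < h -> 0 <= kquot h r <= 2 * (a0 / al + a0) * r `^ (al - 1).
Proof.
move=> r0 h0.
have aal : 0 < a0 / al by rewrite divr_gt0.
have rp : 0 <= r `^ (al - 1) by exact: powR_ge0.
have [hr|rh] := leP h (r / 2).
  have hr' : 0 < h < r by lra.
  have /andP[k1 k2] := kquot_bounds hr'.
  rewrite (le_trans (ltW (ker_gt0 al0 al1 a0_gt0 mu_gt0 r0)) k1)/=.
  have r2 : 0 < r / 2 by rewrite divr_gt0.
  apply: le_trans k2 _; apply: (@le_trans _ _ (k (r / 2))).
    by apply: ker_nonincr => //; lra.
  apply: le_trans (ker_le al0 al1 a0_gt0 mu_gt0 r2) _.
  apply: (@le_trans _ _ (a0 * (2 * r `^ (al - 1)))).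
    by rewrite ler_wpM2l ?(ltW a0_gt0)// half_powR_le.
  have -> : a0 * (2 * r `^ (al - 1)) = 2 * a0 * r `^ (al - 1) by ring.
  by rewrite ler_wpM2r// ler_wpM2l// lerDr ltW.
have ral : r `^ al = r `^ (al - 1) * r.
  by rewrite -[in LHS](subrK 1 al) (powR_addr (al - 1) 1 r0) powRr1 ?(ltW r0).
have kh : kint r <= 2 * (a0 / al + a0) * r `^ (al - 1) * h.
  apply: le_trans (kint_le r0) _; rewrite ral.
  have rh2 : r <= 2 * h by lra.
  apply: (@le_trans _ _ (a0 / al * (r `^ (al - 1) * (2 * h)))).
    by rewrite ler_wpM2l ?(ltW aal)// ler_wpM2l.
  have -> : a0 / al * (r `^ (al - 1) * (2 * h)) = 2 * (a0 / al) * r `^ (al - 1) * h by ring.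
  by rewrite ler_wpM2r ?(ltW h0)// ler_wpM2r// ler_wpM2l// lerDl ltW.
have kg := kint_ge0 (r - h); rewrite [X in _ && X]ler_pdivrMr//.
apply/andP; split; last by apply: le_trans kh; rewrite gerBl.
have [hr|hr] := ltP h r; last by rewrite /kquot [kint (r - h)]kint0 ?subr_le0// subr0 divr_ge0 ?(ltW h0)// kint_ge0.
have hr' : 0 < h < r by rewrite h0.
by have /andP[+ _] := kquot_bounds hr'; apply: le_trans; exact/ltW/ker_gt0.
Qed.

Lemma kquot_cvg r (h : nat -> R) : 0 < r -> (forall n, 0 < h n) -> h n @[n --> \oo] --> 0 ->
  kquot (h n) r @[n --> \oo] --> k r.
Proof.
move=> r0 h0 hc.
have hr : \forall n \near \oo, h n < r by exact: (cvgr_lt _ hc).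
apply: (@squeeze_cvgr _ _ _ _ (fun=> k r) (fun n => k (r - h n))).
- by near=> n; apply: kquot_bounds; rewrite h0; near: n.
- exact: cvg_cst.
- have ck : {for r, continuous k} by exact: ker_continuous.
  have rh : r - h n @[n --> \oo] --> r.
    by rewrite -[X in _ --> X]subr0; apply: cvgB => //; exact: cvg_cst.
  exact: (continuous_cvg _ ck rh).
Unshelve. all: by end_near. Qed.

Definition ker_quot h t := (k t - k (t - h)) / h.

(** The derivative of [k] may grow like [t^(al-2)] near 0; the restriction on [h] keeps the mean
    value point beyond [t / 2]. *)
Lemma ker_quot_le t h : 0 < h <= t / 2 -> `|ker_quot h t| <= 6 * a0 * (t / 2) `^ (al - 2).
Proof.
move=> /andP[h0 ht]; have t0 : 0 < t by lra.
have th : t - h < t by lra.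
have dd z : z \in `]t - h, t[ -> is_derive z (1:R) k (w z / z).
  by rewrite in_itv/= => /andP[sz _]; apply: ker_derive => //; lra.
have [|c cst H] := MVT th dd.
  apply: continuous_in_subspaceT => z /set_mem/=; rewrite in_itv/= => /andP[sz _].
  by apply: ker_continuous => //; lra.
have -> : ker_quot h t = w c / c.
  by rewrite /ker_quot H (_ : t - (t - h) = h) ?mulfK ?gt_eqF//; ring.
move: cst; rewrite in_itv/= => /andP[c1 c2]; have c0 : 0 < c by lra.
have tc : t / 2 <= c by lra.
rewrite normrM normfV (gtr0_norm c0) ler_pdivrMr//.
apply: le_trans (wker_bound al0 al1 a0_gt0 mu_gt0 c0) _.
rewrite -[leRHS]mulrA ler_wpM2l ?mulr_ge0 ?(ltW a0_gt0)//.
have -> : al - 1 = al - 2 + 1 by ring.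
rewrite (powR_addr (al - 2) 1 c0) powRr1 ?(ltW c0)// ler_wpM2r ?(ltW c0)//.
apply: le_powRN => //; first exact: divr_gt0.
by rewrite subr_le0 (le_trans (ltW al1))// ler1n.
Qed.

Lemma ker_quot_cvg t (h : nat -> R) : 0 < t -> (forall n, 0 < h n) -> h n @[n --> \oo] --> 0 ->
  ker_quot (h n) t @[n --> \oo] --> w t / t.
Proof.
move=> t0 h0 hc.
have [dk <-] := ker_derive al0 a0 mu t0.
have : (fun e => e^-1 *: (k (e *: 1 + t) - k t)) @ (0:R)^' --> 'D_1 k t by exact: dk.
move=> /cvgrPdist_lt H; apply/cvgrPdist_lt => e e0.
have := H _ e0; move=> /nbhs_ballP[d /= d0 hd].
have hnd : \forall n \near \oo, h n < d by exact: (cvgr_lt _ hc).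
near=> n; have hn : h n < d by near: n; exact: hnd.
have bn : ball 0 d (- h n) by rewrite /ball/= sub0r opprK gtr0_norm.
have nn : - h n != 0 by rewrite oppr_eq0 gt_eqF.
have := hd _ bn nn; rewrite /ker_quot/=; congr (`| _ - _ | < _).
rewrite /GRing.scale/= mulr1 [- h n + t]addrC invrN mulNr -mulrN opprB; exact: mulrC.
Unshelve. all: by end_near. Qed.

Lemma wker_div_continuous t : 0 < t -> {for t, continuous (fun t => w t / t)}.
Proof.
move=> t0; rewrite wker_fser; set c := (fun j : nat => _).
have [dw _] : is_derive t (1:R) (fser al c) (fser al (fun k => (al * k.+1%:R - 1) * c k) t / t).
  by apply: fser_derive => //; exact: entire_wcoef.
apply: cvgM; first exact/differentiable_continuous/derivable1_diffP.
by apply: cvgV; rewrite ?gt_eqF//; exact: cvg_id.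
Qed.

Lemma integrable_wker_div s t : 0 < s -> leb.-integrable `[s, t] (EFin \o (fun r => w r / r)).
Proof.
move=> s0; apply: continuous_compact_integrable; first exact: segment_compact.
apply: continuous_in_subspaceT => z /set_mem/=; rewrite in_itv/= => /andP[sz _].
by apply: wker_div_continuous; exact: lt_le_trans sz.
Qed.

Lemma ker_FTC s t : 0 < s -> s <= t -> k t - k s = \int[leb]_(r in `]s, t[) (w r / r).
Proof.
move=> s0; rewrite le_eqVlt => /predU1P[->|st].
  by rewrite subrr set_itv_ge ?Rintegral_set0// bnd_simp ltxx.
have cc : {within `[s, t], continuous (fun r => w r / r)}.
  apply: continuous_in_subspaceT => z /set_mem/=; rewrite in_itv/= => /andP[sz _].
  by apply: wker_div_continuous; exact: lt_le_trans sz.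
have ck z : s <= z -> {for z, continuous k}.
  by move=> sz; apply: ker_continuous => //; exact: lt_le_trans sz.
have H := @continuous_FTC2 R (fun r => w r / r) k s t st cc.
have icc := integrable_wker_div t s0.
rewrite Rintegral_itv_obnd_cbnd ?Rintegral_itv_bndo_bndc.
- rewrite /Rintegral H//.
  + split.
    * move=> z; rewrite in_itv/= => /andP[sz _].
      by have [] := ker_derive al0 a0 mu (lt_trans s0 sz).
    * exact/cvg_at_right_filter/ck.
    * exact/cvg_at_left_filter/ck/ltW.
  + move=> z; rewrite in_itv/= => /andP[sz _]; rewrite derive1E.
    by have [_ ->] := ker_derive al0 a0 mu (lt_trans s0 sz).
- by apply: integrableS icc => //; apply: subset_itvl; rewrite bnd_simp.
- by apply: integrableS icc => //; apply: subset_itv; rewrite bnd_simp.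
Qed.

End PrimitiveKernel.

(** * The second derivative of a mode *)

Section SecondMode.
Context {R : realType}.
Variables (al : R) (al0 : 0 < al) (al1 : al < 1).
Variables (a0 mu : R) (a0_gt0 : 0 < a0) (mu_gt0 : 0 < mu).
Implicit Types (r s t h : R).

Local Notation k := (ker al a0 mu).
Local Notation w := (wker al a0 mu).
Local Notation one := (fun=> 1 : R).

Variables (T : R) (T0 : 0 < T) (f fp gg : R -> R).
Hypotheses (ig : leb.-integrable `]0, T[ (EFin \o gg))
  (fpE : forall t, 0 < t <= T -> fp t = fp 0 + \int[leb]_(s in `]0, t[) gg s).

Local Notation mode1 := (mode1 al a0 mu f fp).

Definition mode2 t := conv k gg t + fp 0 * k t + f 0 * (w t / t).

Let mk : measurable_fun `]0, T[ k. Proof. exact: measurable_ker. Qed.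
Let m1 : measurable_fun `]0, T[ one. Proof. exact: measurable_cst. Qed.
Let mg : measurable_fun `]0, T[ gg. Proof. by case/integrableP : ig => /measurable_EFinP. Qed.
Let kb : exists M, powb al M T k.
Proof. by have [M _ h] := ker_powb_ex al0 a0 mu T0; exists M. Qed.
Let powb1 (c : R) : powb 1 `|c| T (fun=> c). Proof. exact: one_powb. Qed.
Let al11 : 1 <= al + 1. Proof. by rewrite lerDr ltW. Qed.
Let ik t : 0 < t -> leb.-integrable `]0, t[ (EFin \o k).
Proof. by move=> t0; exact: ker_integrable. Qed.

Let ikg : leb.-integrable `]0, T[ (EFin \o conv k gg).
Proof. by apply: integrable_conv => //; exact: ik. Qed.

Let mw : measurable_fun `]0, T[ (fun t => w t / t).
Proof.
apply: open_continuous_measurable_fun; first exact: interval_open.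
by move=> t /set_mem/=; rewrite in_itv/= => /andP[t0 _]; exact: wker_div_continuous.
Qed.

Lemma measurable_mode2 : measurable_fun `]0, T[ mode2.
Proof.
apply: measurable_funD; last by apply: measurable_funM => //; exact: measurable_cst.
apply: measurable_funD; first by case/integrableP : ikg => /measurable_EFinP.
by apply: measurable_funM => //; exact: measurable_cst.
Qed.

Let m11 : measurable_fun `]0, T[ (conv one gg). Proof. exact: measurable_conv. Qed.

Let conv1b : powb 1 (`|0 : R| + \int[leb]_(s in `]0, T[) `|gg s|) T (conv one gg).
Proof. by apply: (primitive_powb ig) => t _; rewrite conv1 add0r. Qed.

Let conv_k_fp t : 0 < t <= T -> conv k fp t = conv k (conv one gg) t + fp 0 * kint al a0 mu t.
Proof.
move=> tT; have [M kM] := kb.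
rewrite (@eq_convr _ _ _ (fun s => conv one gg s + fp 0 * one s)); last first.
  move=> s /andP[s0 st]; rewrite conv1 mulr1 addrC fpE// s0/=.
  by move/andP: tT => [_]; apply: le_trans; exact: ltW.
rewrite convDZr; first last.
- exact: (powb_conv_integrable mk m1 al0 ltr01 kM (powb1 1) tT).
- exact: (powb_conv_integrable mk m11 al0 ltr01 kM conv1b tT).
congr (_ + _ * _); rewrite /kint -conv1; apply: convC; case/andP: tT => _ tT; exact: measurable_itvS tT _.
Qed.

Let convk1 s : 0 < s <= T -> conv k one s = conv one k s.
Proof.
by move=> /andP[_ sT]; apply: convC; exact: measurable_itvS sT _.
Qed.

(** From [k*(1*gg) = (k*1)*gg]: the kernel facing the merely integrable [gg] is now bounded, and
    difference quotients in [t] fall on it. *)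
Lemma conv_kint t : 0 < t <= T -> conv k fp t = conv (kint al a0 mu) gg t + fp 0 * kint al a0 mu t.
Proof.
move=> tT; have [M kM] := kb; rewrite conv_k_fp//; congr (_ + _).
rewrite (convA_L1 mk m1 ig al0 ltr01 al11 kM (powb1 1) tT).
apply: eq_convl => s /andP[s0 st]; rewrite convk1; first by rewrite conv1.
by rewrite s0; move/andP: tT => [_]; apply: le_trans; exact: ltW.
Qed.

(** The other bracketing, [1*(k*gg)], exhibits a primitive. *)
Let conv_primitive t : 0 < t <= T ->
  conv k fp t = \int[leb]_(s in `]0, t[) (conv k gg s + fp 0 * k s).
Proof.
move=> tT; have [M kM] := kb; rewrite conv_k_fp//.
have [t0 tT'] := andP tT; have al11' : 1 <= 1 + al by rewrite addrC.
rewrite (convA_L1 mk m1 ig al0 ltr01 al11 kM (powb1 1) tT).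
rewrite (@eq_convl _ _ _ (conv one k)); last first.
  by move=> s /andP[s0 st]; apply: convk1; rewrite s0 (le_trans _ tT')// ltW.
rewrite -(convA_L1 m1 mk ig ltr01 al0 al11' (powb1 1) kM tT) conv1.
rewrite RintegralD//.
- by congr (_ + _); rewrite RintegralZl//; exact: ik.
- exact: integrable_itvS ikg.
- by apply: integrableZ_real => //; exact: ik.
Qed.

(** The restriction to [0 < s] is due to the term [f 0 * k']: as [k] is unbounded at 0, [k'] is not
    integrable there. *)
Lemma mode1_primitive s t : 0 < s -> s <= t -> t <= T ->
  mode1 t - mode1 s = \int[leb]_(r in `]s, t[) mode2 r.
Proof.
move=> s0 st tT; have t0 : 0 < t by exact: lt_le_trans st.
have sub : `]s, t[ `<=` `]0, T[ by apply: subset_itv; rewrite bnd_simp// ltW.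
have i1 : leb.-integrable `]0, T[ (EFin \o (fun s => conv k gg s + fp 0 * k s)).
  by apply: integrableD_real => //; apply: integrableZ_real => //; exact: ik.
rewrite /mode1/= !conv_primitive ?s0 ?t0//=; last exact: le_trans tT.
rewrite (@Rintegral_oo_split _ _ 0 s t); last by rewrite (ltW s0).
  rewrite (_ : _ + _ - _ = \int[leb]_(x in `]s, t[) (conv k gg x + fp 0 * k x) + f 0 * (k t - k s)); last by ring.
  have iw : leb.-integrable `]s, t[ (EFin \o (fun r => w r / r)).
    have := integrable_wker_div al0 a0 mu t s0; apply: integrableS => //.
    by apply: subset_itv; rewrite bnd_simp.
  rewrite ker_FTC// -RintegralZl// -RintegralD//.
  - exact: (integrableS (measurable_oo 0 T) (measurable_oo s t) sub i1).
  - by apply: integrableZ_real => //; exact: measurable_oo.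
exact: integrable_itvS i1.
Qed.

Let K := kint al a0 mu.

Let K_cut t r : r < t -> K r = cut t K r.
Proof.
move=> rt; have [r0|r0] := ltP 0 r; first by rewrite cutE// r0.
by rewrite /K kint0// cut0// negb_and -leNgt r0.
Qed.

Let mK t : measurable_fun `]0, t[ K.
Proof.
apply: (eq_measurable_fun (conv one k)); first by move=> s _; rewrite conv1.
by apply: measurable_conv; [exact: measurable_cst|exact: measurable_ker].
Qed.

Let mKs h t : 0 < h -> measurable_fun `]0, t[ (fun r => K (r - h)).
Proof.
move=> h0; apply: (eq_measurable_fun (fun r => cut t K (r - h))).
  move=> r /set_mem/=; rewrite in_itv/= => /andP[_ rt]; rewrite -K_cut//.
  by apply: lt_trans rt; rewrite gtrBl.
apply: measurable_funTS; apply: (measurableT_comp (measurable_cut (@mK t))).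
exact: measurable_funB.
Qed.

Lemma measurable_kquot h t : 0 < h -> measurable_fun `]0, t[ (kquot al a0 mu h).
Proof.
by move=> h0; apply: measurable_funM; [apply: measurable_funB; [exact: mK|exact: mKs]|exact: measurable_cst].
Qed.

Let K_bounded t r : 0 < r < t -> 0 <= K r <= a0 / al * t `^ al.
Proof.
move=> /andP[r0 rt]; rewrite kint_ge0//=; apply: le_trans (kint_le al0 al1 a0_gt0 mu_gt0 r0) _.
by rewrite ler_wpM2l ?divr_ge0 ?(ltW a0_gt0) ?(ltW al0)// le_powR// ltW.
Qed.

Let Ks_bounded h t r : 0 < t -> 0 < h -> 0 < r < t -> 0 <= K (r - h) <= a0 / al * t `^ al.
Proof.
move=> t0 h0 /andP[r0 rt]; have [rh|rh] := leP (r - h) 0.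
  by rewrite /K kint0// lexx mulr_ge0 ?powR_ge0// divr_ge0 ?(ltW a0_gt0)// ltW.
by apply: K_bounded; rewrite rh/= (lt_trans _ rt)// gtrBl.
Qed.

Let bounded_int t (x : R -> R) C : t <= T -> measurable_fun `]0, t[ x ->
  (forall r, 0 < r < t -> 0 <= x r <= C) ->
  leb.-integrable `]0, t[ (EFin \o (fun s => x (t - s) * gg s)).
Proof.
move=> tT mx xC.
apply: (@integrable_dom _ _ _ _ _ (measurable_oo 0 t) _ (fun s => C * `|gg s|)).
- by apply: measurable_funM; [exact: measurable_reflect|exact: measurable_itvS mg].
- apply: integrableZ_real; first exact: measurable_oo.
  exact: integrable_norm (integrable_itvS tT ig).
- move=> s /=; rewrite in_itv/= => /andP[s0 st]; rewrite normrM ler_wpM2r//.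
  have /andP[x0 xC'] : 0 <= x (t - s) <= C by apply: xC; rewrite subr_gt0 st gtrBl.
  by rewrite ger0_norm.
Qed.

Let quot_arith (A B p k1 k2 c x1 x2 h : R) : (A + p * k1 + c * x1 - (B + p * k2 + c * x2)) / h =
  (A - B) / h + p * ((k1 - k2) / h) + c * ((x1 - x2) / h).
Proof. by ring. Qed.

Lemma mode1_quot t h : 0 < h < t -> t <= T ->
  (mode1 t - mode1 (t - h)) / h =
  conv (kquot al a0 mu h) gg t + fp 0 * kquot al a0 mu h t + f 0 * ker_quot al a0 mu h t.
Proof.
move=> /andP[h0 ht] tT.
have t0 : 0 < t by exact: lt_trans ht.
have th0 : 0 < t - h by rewrite subr_gt0.
have thT : t - h <= T by rewrite (le_trans _ tT)// gerBl ltW.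
rewrite /mode1 !conv_kint ?t0 ?th0//.
pose Kh r := K (r - h).
have mKh : measurable_fun `]0, t[ Kh by exact: mKs.
have iKs : leb.-integrable `]0, t[ (EFin \o (fun s : R => Kh (t - s) * gg s)).
  by apply: bounded_int => // r; exact: Ks_bounded.
have iK : leb.-integrable `]0, t[ (EFin \o (fun s : R => K (t - s) * gg s)).
  exact: (@bounded_int t K _ tT (@mK t) (@K_bounded t)).
(* The shifted primitive vanishes for [r <= h], so both convolutions of the quotient live on the
   same interval []0, t[]. *)
have -> : conv (kint al a0 mu) gg (t - h) = conv Kh gg t.
  rewrite [RHS](@Rintegral_oo_split _ _ 0 (t - h) t iKs); last by rewrite (ltW th0) gerBl ltW.
  rewrite [X in _ = _ + X](_ : _ = 0); last first.
    rewrite /Rintegral integral0_eq// => s; rewrite /= in_itv/= => /andP[s0 st].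
    rewrite /Kh /K kint0 ?mul0r//.
    by rewrite subr_le0 lerBlDr addrC -lerBlDr ltW.
  by rewrite addr0 /conv; apply: eq_Rintegral => s _; rewrite /Kh addrAC.
have -> : conv (kquot al a0 mu h) gg t = (conv K gg t - conv Kh gg t) / h.
  transitivity (conv (fun r => h^-1 * (K r + (- 1) * Kh r)) gg t).
    by apply: eq_convl => s _; rewrite /kquot -/K -/(Kh s); ring.
  have e1 : conv (fun r => K r + (- 1) * Kh r) gg t = conv K gg t + (- 1) * conv Kh gg t by exact: convDZl.
  rewrite convZl; first by rewrite e1 mulN1r mulrC.
  have := integrableD_real (measurable_oo 0 t) iK (integrableZ_real (measurable_oo 0 t) (-1) iKs).
  by apply: eq_integrable => // s _; rewrite /= mulrDl mulrA.
exact: quot_arith.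
Qed.

(** Dominated convergence with the majorant of [kquot_le]; the last hypothesis says exactly that
    this majorant is integrable at the given [t]. *)
Lemma mode1_quot_cvg t (h : nat -> R) : 0 < t <= T -> (forall n, 0 < h n < t) ->
  h n @[n --> \oo] --> 0 ->
  leb.-integrable `]0, t[ (EFin \o (fun s => (t - s) `^ (al - 1) * gg s)) ->
  (mode1 t - mode1 (t - h n)) / h n @[n --> \oo] --> mode2 t.
Proof.
move=> /andP[t0 tT] ht hc ita.
have h0 n : 0 < h n by case/andP: (ht n).
rewrite (_ : (fun n => _) = (fun n => conv (kquot al a0 mu (h n)) gg t +
  fp 0 * kquot al a0 mu (h n) t + f 0 * ker_quot al a0 mu (h n) t)); last first.
  by apply/funext => n; rewrite mode1_quot.
rewrite /mode2; apply: cvgD; last by apply: cvgMl_tmp; exact: ker_quot_cvg.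
apply: cvgD; last by apply: cvgMl_tmp; exact: kquot_cvg.
have mkq n : measurable_fun `]0, t[ (kquot al a0 mu (h n)).
  exact: measurable_kquot.
have [|||||| _ H] := @cvg_Rintegral_dominated _ _ R leb `]0, t[%classic
  (fun n s => kquot al a0 mu (h n) (t - s) * gg s) (fun s => k (t - s) * gg s)
  (fun s => 2 * (a0 / al + a0) * `|(t - s) `^ (al - 1) * gg s|); first exact: measurable_oo.
- by move=> n; apply: measurable_funM; [exact: measurable_reflect|exact: measurable_itvS mg].
- by apply: measurable_funM; [apply: measurable_reflect; exact: measurable_itvS mk|exact: measurable_itvS mg].
- apply: integrableZ_real; first exact: measurable_oo.
  exact: integrable_norm ita.
- apply: aeW => s /=; rewrite in_itv/= => /andP[s0 st]; apply: cvgMr_tmp.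
  by apply: kquot_cvg => //; rewrite subr_gt0.
- move=> n s /=; rewrite in_itv/= => /andP[s0 st].
  have ts : 0 < t - s by rewrite subr_gt0.
  have /andP[q0 q1] := kquot_le al0 al1 a0_gt0 mu_gt0 ts (h0 n).
  rewrite normrM (ger0_norm q0) normrM (ger0_norm (powR_ge0 _ _)) mulrA.
  by rewrite ler_wpM2r.
- exact: H.
Qed.

End SecondMode.

(** * The space L2 and the eigenbasis *)

(** The discriminant argument behind the Cauchy-Schwarz inequality, used both in L2 and for finitely
    many coordinates. *)
Lemma le_discr (R : realFieldType) (A B C : R) : 0 <= A -> 0 <= C ->
  (forall c, 0 <= c ^+ 2 * A + 2 * c * B + C) -> B ^+ 2 <= A * C.
Proof.
move=> A0 C0 h; have [Az|An] := eqVneq A 0.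
  rewrite Az mul0r; have [->|Bn] := eqVneq B 0; first by rewrite expr0n.
  (* With [A = 0] the polynomial is affine, and this argument gives it the value -1. *)
  have := h (- (C + 1) / (2 * B)); rewrite Az mulr0 add0r.
  have -> : 2 * (- (C + 1) / (2 * B)) * B + C = - 1 by field.
  by rewrite oppr_ge0 ler10.
have Ap : 0 < A by rewrite lt_def An.
have := h (- B / A).
have -> : (- B / A) ^+ 2 * A + 2 * (- B / A) * B + C = C - B ^+ 2 / A by field.
by rewrite subr_ge0 ler_pdivrMr// mulrC.
Qed.

Section SquareIntegrable.
Context d (T : measurableType d) (R : realType) (m : {measure set T -> \bar R}).
Implicit Types (u v w : T -> R).

Definition sqi w := measurable_fun setT w /\ m.-integrable setT (EFin \o (fun x => w x ^+ 2)).

Definition ip v w : R := \int[m]_x (v x * w x).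

Lemma sqi_mul v w : sqi v -> sqi w -> m.-integrable setT (EFin \o (fun x => v x * w x)).
Proof.
move=> [mv iv] [mw iw].
apply: (integrable_dom measurableT _ (integrableD_real measurableT iv iw)).
  exact: measurable_funM.
move=> x _; rewrite normrM -[v x ^+ 2]real_normK ?num_real// -[w x ^+ 2]real_normK ?num_real//.
have := sqr_ge0 (`|v x| - `|w x|); have := normr_ge0 (v x); have := normr_ge0 (w x).
by move: `|v x| `|w x| => a b; nra.
Qed.

Lemma sqiD (c : R) v w : sqi v -> sqi w -> sqi (fun x => c * v x + w x).
Proof.
move=> [mv iv] [mw iw].
have ms : measurable_fun setT (fun x => c * v x + w x).
  by apply: measurable_funD => //; apply: measurable_funM => //; exact: measurable_cst.
split => //.
apply: (integrable_dom measurableT _ (integrableD_real measurableT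
  (integrableZ_real measurableT (2 * c ^+ 2) iv) (integrableZ_real measurableT 2 iw))).
  exact: measurable_funX.
move=> x _; rewrite ger0_norm ?sqr_ge0//.
by have := sqr_ge0 (c * v x - w x); move: (v x) (w x) => a b; nra.
Qed.

Lemma ipC v w : ip v w = ip w v.
Proof. by apply: eq_Rintegral => x _; rewrite mulrC. Qed.

Lemma ipD (c : R) u v w : sqi u -> sqi v -> sqi w ->
  ip (fun x => c * v x + w x) u = c * ip v u + ip w u.
Proof.
move=> su sv sw; rewrite /ip -RintegralZl//; last exact: sqi_mul.
rewrite -RintegralD//; [|apply: integrableZ_real => //; exact: sqi_mul|exact: sqi_mul].
by apply: eq_Rintegral => x _; rewrite mulrDl mulrA.
Qed.

Lemma ip_ge0 w : 0 <= ip w w.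
Proof. by apply: Rintegral_ge0 => x _; rewrite -expr2 sqr_ge0. Qed.

Lemma ip_EFin w : sqi w -> (\int[m]_x (w x ^+ 2)%:E = (ip w w)%:E)%E.
Proof.
move=> [mw iw]; rewrite /ip EFin_Rintegral//.
Qed.

Lemma Lnorm2E w : 'N[m]_(2%:E)[EFin \o w]%E = ((\int[m]_x (w x ^+ 2)%:E) `^ 2^-1)%E.
Proof.
rewrite unlock; congr (_ `^ _)%E; apply: eq_integral => x _.
by rewrite /= powR_mulrn// real_normK ?num_real.
Qed.

Lemma Lnorm2_sqi w : sqi w -> 'N[m]_(2%:E)[EFin \o w]%E = (Num.sqrt (ip w w))%:E.
Proof.
by move=> sw; rewrite Lnorm2E ip_EFin// poweR_EFin powR12_sqrt// ip_ge0.
Qed.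

Lemma sqiP w : w \in Lfun m 2%:E <-> sqi w.
Proof.
split=> [|[mw iw]].
  move=> /andP[]; rewrite !inE/= /finite_norm Lnorm2E => mw fw; split => //.
  apply/integrableP; split; first by apply/measurable_EFinP; exact: measurable_funX.
  under eq_integral do rewrite /= ger0_norm ?sqr_ge0//.
  by apply: lty_poweRy fw; rewrite invr_neq0.
apply/andP; split; rewrite inE/=; first exact: mw.
by rewrite /finite_norm Lnorm2_sqi// ltry.
Qed.

Section Completeness.
Variables (u : nat -> T -> R) (e : nat -> R).
Hypotheses (su : forall n, sqi (u n)) (e0 : e n @[n --> \oo] --> 0).
Hypothesis ue : forall n k, (n <= k)%N ->
  ip (fun x => u k x - u n x) (fun x => u k x - u n x) <= e n.

Let suB n k : sqi (fun x => u k x - u n x).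
Proof.
have := sqiD (-1) (su n) (su k); congr sqi; apply/funext => x.
by rewrite mulN1r addrC.
Qed.

Let subseq_ex : exists N : nat -> nat, forall k, [/\ (k <= N k)%N, (N k <= N k.+1)%N & e (N k) <= 8^-1 ^+ k].
Proof.
have h k n0 : exists n, (n0 <= n)%N /\ e n <= 8^-1 ^+ k.
  have : \forall n \near \oo, e n < 8^-1 ^+ k by apply: (cvgr_lt _ e0); rewrite exprn_gt0.
  move=> [N _ hN]; exists (maxn n0 N); rewrite leq_maxl; split => //.
  by apply/ltW/hN; rewrite /= leq_maxr.
have [f hf] := choice (fun p : nat * nat => h p.1 p.2).
pose N := fix N k := if k is k'.+1 then f (k'.+1, maxn k'.+1 (N k')) else f (0%N, 0%N).
exists N => k; split.
- by case: k => [|k]//=; have [] := hf (k.+1, maxn k.+1 (N k)); rewrite geq_max => /andP[].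
- by have [] := hf (k.+1, maxn k.+1 (N k)); rewrite geq_max => /andP[].
- by case: k => [|k]; [have [] := hf (0%N, 0%N)|have [] := hf (k.+1, maxn k.+1 (N k))].
Qed.

(** A rapidly converging subsequence converges almost everywhere, and Fatou's lemma passes the
    modulus [e] to the limit. The pointwise clause keeps the limit zero outside [Omega] when all
    terms vanish there. *)
Lemma sqi_complete : exists w, [/\ sqi w,
  forall x, (forall n, u n x = 0) -> w x = 0 &
  forall n, ip (fun x => w x - u n x) (fun x => w x - u n x) <= e n].
Proof.
have [N NP] := subseq_ex.
pose v k := u (N k).
have sv k : sqi (v k) by exact: su.
(* Against squared distances of at most [8^-k], the weight [4^k] leaves summable integrals [2^-k];
   where the sum is a finite [M], the increments are at most [sqrt M * 2^-k]. *)
pose h k x := ((4 ^+ k * (v k.+1 x - v k x) ^+ 2)%:E : \bar R).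
have mh k : measurable_fun setT (h k).
  apply/measurable_EFinP; apply: measurable_funM; first exact: measurable_cst.
  by apply: measurable_funX; have [] := suB (N k) (N k.+1).
have h0 k x : (0 <= h k x)%E by rewrite /h lee_fin; apply: mulr_ge0; [exact: exprn_ge0|exact: sqr_ge0].
have Ih k : (\int[m]_x h k x <= (2^-1 ^+ k)%:E)%E.
  under eq_integral do rewrite /h EFinM.
  have mD : measurable_fun setT (fun x => ((v k.+1 x - v k x) ^+ 2)%:E).
    by apply/measurable_EFinP; apply: measurable_funX; have [] := suB (N k) (N k.+1).
  have D0 x : setT x -> (0 <= ((v k.+1 x - v k x) ^+ 2)%:E)%E by move=> _; rewrite lee_fin sqr_ge0.
  have k0 : (0 <= (4 ^+ k : R)%:E)%E by rewrite lee_fin exprn_ge0.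
  rewrite (ge0_integralZl _ measurableT mD D0 k0)//.
  rewrite ip_EFin; last exact: suB.
  rewrite -EFinM lee_fin; have [_ Nk ek] := NP k.
  apply: (@le_trans _ _ (4 ^+ k * 8^-1 ^+ k)).
    by rewrite ler_wpM2l ?exprn_ge0// (le_trans (ue Nk)).
  by rewrite -exprMn le_eqVlt; apply/orP; left; apply/eqP; congr (_ ^+ _); field.
have sumfin : (\int[m]_x \sum_(0 <= k <oo) h k x < +oo)%E.
  rewrite (integral_nneseries _ measurableT mh (fun k x _ => h0 k x)).
  apply: (@le_lt_trans _ _ 2%:E); last exact: ltry.
  apply: lime_le; first by apply: is_cvg_nneseries => k _ _; exact: integral_ge0.
  near=> n; apply: (@le_trans _ _ (\sum_(0 <= k < n) (2^-1 ^+ k)%:E)%E).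
    by apply: lee_sum => k _; exact: Ih.
  rewrite sumEFin lee_fin (@le_trans _ _ (2 - 2 * 2^-1 ^+ n))//; last by rewrite gerBl mulr_ge0 ?exprn_ge0.
  elim: (n) => [|j IH]; first by rewrite big_geq// expr0 mulr1 subrr.
  rewrite big_nat_recr//= exprS; move: IH; move: (2^-1 ^+ j : R) => z; lra.
have msum : measurable_fun setT (fun x => \sum_(0 <= k <oo) h k x)%E.
  exact: ge0_emeasurable_sum.
have ae_fin : {ae m, forall x, (\sum_(0 <= k <oo) h k x < +oo)%E}.
  have /(integrable_ae measurableT) : m.-integrable setT (fun x => \sum_(0 <= k <oo) h k x)%E.
    apply/integrableP; split => //.
    by under eq_integral do rewrite gee0_abs ?nneseries_ge0//.
  by apply: aeS => x /(_ I); rewrite ge0_fin_numE// nneseries_ge0.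
(* The upper limit is measurable and defined everywhere, and equals the limit where that exists. *)
pose w x := fine (limn_esup (fun k => (v k x)%:E)).
have mw : measurable_fun setT w.
  apply: measurableT_comp; first exact: fine_measurable.
  apply: measurable_fun_limn_esup => k; apply/measurable_EFinP; by have [] := sv k.
have vw : {ae m, forall x, v k x @[k --> \oo] --> w x}.
  move: ae_fin; apply: aeS => x hx.
  have hx0 : (0 <= \sum_(0 <= k <oo) h k x)%E by exact: nneseries_ge0.
  pose M := fine (\sum_(0 <= k <oo) h k x)%E.
  have hM k : 4 ^+ k * (v k.+1 x - v k x) ^+ 2 <= M.
    rewrite -lee_fin /M fineK ?ge0_fin_numE//.
    apply: le_trans (nneseries_lim_ge k.+1 _) => //.
    by rewrite big_nat_recr//= leeDr// sume_ge0.
  have M0 : 0 <= M by rewrite fine_ge0.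
  have : cvgn (series (telescope (fun k => v k x))).
    have gc : cvgn (series (geometric (Num.sqrt M) 2^-1)).
      by apply: is_cvg_geometric_series; rewrite ger0_norm// invf_lt1// ltr1n.
    apply: normed_cvg; apply: series_le_cvg gc => k; first exact: normr_ge0.
      by apply: mulr_ge0; [exact: sqrtr_ge0|exact: exprn_ge0].
    have k2 : 0 <= 2^-1 ^+ k :> R by rewrite exprn_ge0.
    have ks : 0 <= Num.sqrt M * 2^-1 ^+ k by rewrite mulr_ge0// sqrtr_ge0.
    rewrite /geometric/= -(@ler_pXn2r _ 2)// ?nnegrE ?normr_ge0//.
    rewrite real_normK ?num_real// exprMn sqr_sqrtr// -exprM mulnC exprM exprVn -ler_pdivrMr.
      by rewrite exprVn invrK mulrC -natrX; exact: hM.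
    by rewrite exprn_gt0// invr_gt0 exprn_gt0.
  move=> cs; have cv : cvgn (fun k => v k x).
    rewrite (_ : (fun k => v k x) = (fun k => v 0%N x + series (telescope (fun k => v k x)) k)).
      by apply: is_cvgD => //; exact: is_cvg_cst.
    by apply/funext => k; exact: eq_sum_telescope.
  suff -> : w x = limn (fun k => v k x) by exact: cv.
  have cvE : (v k x)%:E @[k --> \oo] --> (limn (fun k => v k x))%:E.
    by apply: cvg_EFin; [near=> k|exact: cv].
  by rewrite /w is_cvg_limn_esupE ?(cvg_lim _ cvE)//; apply/cvg_ex; exists (limn (fun k => v k x))%:E.
have Hw n : (\int[m]_x ((w x - u n x) ^+ 2)%:E <= (e n)%:E)%E.
  have mB k : measurable_fun setT (fun x => ((v k x - u n x) ^+ 2)%:E).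
    by apply/measurable_EFinP; apply: measurable_funX; apply: measurable_funB; [have [] := sv k|have [] := su n].
  have B0 k x : setT x -> (0 <= ((v k x - u n x) ^+ 2)%:E)%E by move=> _; rewrite lee_fin sqr_ge0.
  have F := @fatou _ _ _ m _ measurableT (fun k x => ((v k x - u n x) ^+ 2)%:E)%E mB B0.
  apply: (@le_trans _ _ (\int[m]_x limn_einf (fun k => ((v k x - u n x) ^+ 2)%:E))%E).
    rewrite le_eqVlt; apply/orP; left; apply/eqP; apply: ae_eq_integral => //.
    - by apply/measurable_EFinP; apply: measurable_funX; apply: measurable_funB => //; have [] := su n.
    - rewrite (_ : (fun x => _) = (fun x => limn_esup (einfs (fun k => ((v k x - u n x) ^+ 2)%:E)))).
        by apply: measurable_fun_limn_esup => k; exact: measurable_fun_einfs.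
      by apply/funext => x; rewrite limn_einf_lim is_cvg_limn_esupE//; exact: is_cvg_einfs.
    - move: vw; apply: aeS => x cv _.
      have cvE : ((v k x - u n x) ^+ 2)%:E @[k --> \oo] --> ((w x - u n x) ^+ 2)%:E.
        apply: cvg_EFin; first by near=> k.
        rewrite expr2; under eq_fun do rewrite expr2.
        by apply: cvgM; apply: cvgB => //; exact: cvg_cst.
      rewrite is_cvg_limn_einfE ?(cvg_lim _ cvE)//; apply/cvg_ex; by exists ((w x - u n x) ^+ 2)%:E.
  apply: le_trans F _.
  rewrite limn_einf_lim; apply: lime_le; first exact: is_cvg_einfs.
  near=> k; apply: (@le_trans _ _ (\int[m]_x ((v (maxn n k) x - u n x) ^+ 2)%:E)%E).
    by apply: ereal_inf_lbound; exists (maxn n k) => //=; rewrite leq_maxr.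
  rewrite ip_EFin; last exact: suB.
  rewrite lee_fin; apply: ue; have [+ _ _] := NP (maxn n k).
  by apply: leq_trans; rewrite leq_maxl.
have swB n : sqi (fun x => w x - u n x).
  have mwu : measurable_fun setT (fun x => w x - u n x).
    by apply: measurable_funB => //; have [] := su n.
  split => //; apply/integrableP; split.
    by apply/measurable_EFinP; exact: measurable_funX.
  under eq_integral do rewrite /= ger0_norm ?sqr_ge0//.
  exact: le_lt_trans (Hw n) (ltry _).
exists w; split.
- have := sqiD 1 (swB 0%N) (su 0%N); congr sqi; apply/funext => x.
  by rewrite mul1r subrK.
- move=> x ux; rewrite /w (_ : (fun k => (v k x)%:E) = cst 0%E).
    have ic : cvgn (cst 0%E : nat -> \bar R) by exact: is_cvg_cst.
    by rewrite (is_cvg_limn_esupE ic) lim_cst.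
  by apply/funext => k; rewrite /v ux.
- by move=> n; rewrite -lee_fin -ip_EFin.
Unshelve. all: by end_near. Qed.

End Completeness.
End SquareIntegrable.

(** * L2 of the domain: completeness, Riesz-Fischer, Parseval *)

Section L2Space.
Variables (R : realType) (Omega : set (R * R)).
Notation plane := (R * R)%type.
Notation leb2 := (@lebesgue_measure R \x @lebesgue_measure R)%E.
Implicit Types (u v w : plane -> R) (c : nat -> R).
Local Notation L2 := (L2 Omega).
Local Notation inner := (inner Omega).

Lemma innerE v w : inner v w = ip leb2 (v \_ Omega) (w \_ Omega).
Proof.
rewrite /inner /ip Rintegral_mkcond; apply: eq_Rintegral => x _.
by rewrite !patchE; case: ifPn; rewrite ?mulr0.
Qed.

Lemma L2P w : L2 w <-> sqi leb2 (w \_ Omega).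
Proof. exact: sqiP. Qed.

Let patchD (a : R) v w : (fun x => a * v x + w x) \_ Omega =
  (fun x => a * (v \_ Omega) x + (w \_ Omega) x).
Proof.
by apply/funext => x; rewrite !patchE; case: ifPn; rewrite // mulr0 addr0.
Qed.

Lemma L2D (a : R) v w : L2 v -> L2 w -> L2 (fun x => a * v x + w x).
Proof. by move=> /L2P sv /L2P sw; apply/L2P; rewrite patchD; exact: sqiD. Qed.

Lemma L2_0 : L2 (fun=> 0).
Proof.
apply/L2P; rewrite (_ : _ \_ _ = cst 0); last first.
  by apply/funext => x; rewrite patchE; case: ifP.
split; first exact: measurable_cst.
apply: (eq_integrable _ (cst 0%E)) => //; first by move=> x _; rewrite /= expr0n.
exact: integrable0.
Qed.

Lemma L2Z (a : R) v : L2 v -> L2 (fun x => a * v x).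
Proof.
by move=> Lv; have := L2D a Lv L2_0; congr L2; apply/funext => x; rewrite addr0.
Qed.

Lemma L2B v w : L2 v -> L2 w -> L2 (fun x => v x - w x).
Proof.
by move=> Lv Lw; have := L2D (-1) Lw Lv; congr L2; apply/funext => x; rewrite mulN1r addrC.
Qed.

Lemma innerC v w : inner v w = inner w v.
Proof. by rewrite !innerE ipC. Qed.

Lemma innerD (a : R) u v w : L2 u -> L2 v -> L2 w ->
  inner (fun x => a * v x + w x) u = a * inner v u + inner w u.
Proof. by move=> /L2P ? /L2P ? /L2P ?; rewrite !innerE patchD ipD. Qed.

Lemma innerB u v w : L2 u -> L2 v -> L2 w ->
  inner (fun x => v x - w x) u = inner v u - inner w u.
Proof.
move=> Lu Lv Lw; have := innerD (-1) Lu Lw Lv; rewrite mulN1r addrC => <-.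
by congr inner; apply/funext => x; rewrite mulN1r addrC.
Qed.

Lemma inner0 w : inner (fun=> 0) w = 0.
Proof. by rewrite /inner /Rintegral integral0_eq// => x _; rewrite mul0r. Qed.

Lemma innerZ (a : R) u v : L2 u -> L2 v -> inner (fun x => a * v x) u = a * inner v u.
Proof.
move=> Lu Lv; have := innerD a Lu Lv L2_0; rewrite inner0 addr0 => <-.
by congr inner; apply/funext => x; rewrite addr0.
Qed.

Lemma inner_ge0 w : 0 <= inner w w.
Proof. by rewrite innerE ip_ge0. Qed.

Lemma innerDr (a : R) u v w : L2 u -> L2 v -> L2 w ->
  inner u (fun x => a * v x + w x) = a * inner u v + inner u w.
Proof. by move=> Lu Lv Lw; rewrite innerC innerD// ![inner _ u]innerC. Qed.

Definition nrm w := Num.sqrt (inner w w).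

Lemma nrm_ge0 w : 0 <= nrm w. Proof. exact: sqrtr_ge0. Qed.

Lemma nrm_sqr w : nrm w ^+ 2 = inner w w.
Proof. by rewrite sqr_sqrtr// inner_ge0. Qed.

Lemma norm_L2E w : L2 w -> norm_L2 Omega w = (nrm w)%:E.
Proof. by move=> /L2P sw; rewrite /norm_L2 Lnorm2_sqi// /nrm innerE. Qed.

Lemma cauchy_schwarz v w : L2 v -> L2 w -> `|inner v w| <= nrm v * nrm w.
Proof.
move=> Lv Lw; rewrite -(@ler_pXn2r _ 2)// ?nnegrE ?mulr_ge0 ?nrm_ge0//.
rewrite exprMn !nrm_sqr real_normK ?num_real//.
apply: le_discr; rewrite ?inner_ge0// => a.
have := inner_ge0 (fun x => a * v x + w x).
have Ls := L2D a Lv Lw.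
rewrite innerD// !innerDr// [inner w v]innerC.
by congr (0 <= _); ring.
Qed.

Lemma L2_complete (u : nat -> plane -> R) (e : nat -> R) : (forall n, L2 (u n)) ->
  e n @[n --> \oo] --> 0 ->
  (forall n k, (n <= k)%N -> inner (fun x => u k x - u n x) (fun x => u k x - u n x) <= e n) ->
  exists2 w, L2 w & forall n, inner (fun x => w x - u n x) (fun x => w x - u n x) <= e n.
Proof.
move=> Lu e0 ue.
have patchB v w : (fun x => v x - w x) \_ Omega = (fun x => (v \_ Omega) x - (w \_ Omega) x).
  by apply/funext => x; rewrite !patchE; case: ifPn; rewrite // subr0.
have [|||w [sw w0 we]] := @sqi_complete _ _ _ leb2 (fun n => u n \_ Omega) e.
- by move=> n; exact/L2P.
- exact: e0.
- by move=> n k nk; have := ue n k nk; rewrite innerE patchB.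
have wE : w \_ Omega = w.
  apply/funext => x; rewrite patchE; case: ifPn => // xO; rewrite w0// => n.
  by rewrite patchE (negbTE xO).
exists w; first by apply/L2P; rewrite wE.
by move=> n; rewrite innerE patchB wE.
Qed.

Definition ell2 c := exists M : R, forall n : nat, \sum_(j < n) c j ^+ 2 <= M.

Section Orthonormal.
Variables (phi : nat -> plane -> R).
Hypotheses (phiL2 : forall j, L2 (phi j)) (phiO : forall i j, inner (phi i) (phi j) = (i == j)%:R).

Definition comb n c : plane -> R := fun x => \sum_(j < n) c j * phi j x.

Let combS n c : comb n.+1 c = (fun x => c n * phi n x + comb n c x).
Proof. by apply/funext => x; rewrite /comb big_ord_recr/= addrC. Qed.

Let comb0 c : comb 0 c = (fun=> 0).
Proof. by apply/funext => x; rewrite /comb big_ord0. Qed.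

Lemma L2_comb n c : L2 (comb n c).
Proof. by elim: n => [|n IH]; [rewrite comb0; exact: L2_0|rewrite combS; exact: L2D]. Qed.

Lemma inner_comb n c w : L2 w -> inner (comb n c) w = \sum_(j < n) c j * inner (phi j) w.
Proof.
move=> Lw; elim: n => [|n IH]; first by rewrite comb0 inner0 big_ord0.
by rewrite combS innerD//; [rewrite IH big_ord_recr/= addrC|exact: L2_comb].
Qed.

Lemma inner_comb_phi n c i : inner (comb n c) (phi i) = if (i < n)%N then c i else 0.
Proof.
rewrite inner_comb//; under eq_bigr do rewrite phiO.
case: ifPn => [lin|]; last rewrite -leqNgt => ni.
  rewrite (bigD1 (Ordinal lin))//= eqxx mulr1 big1 ?addr0// => j.
  by rewrite -val_eqE/= => /negbTE ->; rewrite mulr0.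
by rewrite big1// => j _; rewrite (ltn_eqF (leq_trans (ltn_ord j) ni)) mulr0.
Qed.

Lemma inner_comb2 n c c' : inner (comb n c) (comb n c') = \sum_(j < n) c j * c' j.
Proof.
rewrite inner_comb; last exact: L2_comb.
by apply: eq_bigr => j _; rewrite innerC inner_comb_phi ltn_ord.
Qed.

Lemma comb_sub n k c : (n <= k)%N ->
  (fun x => comb k c x - comb n c x) = comb k (fun j => if (j < n)%N then 0 else c j).
Proof.
move=> nk; apply/funext => x; rewrite /comb -!(big_mkord xpredT (fun j => c j * phi j x)) -(big_mkord xpredT (fun j => (if (j < n)%N then 0 else c j) * phi j x)).
rewrite (big_cat_nat _ nk)//= [RHS](big_cat_nat _ nk)//= addrAC subrr add0r.
rewrite [X in _ = X + _]big1_seq ?add0r; last first.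
  by move=> j; rewrite mem_index_iota => /andP[_ /andP[_ ->]]; rewrite mul0r.
by rewrite !big_nat; apply: eq_bigr => j /andP[nj _]; rewrite ltnNge nj.
Qed.

Lemma riesz_fischer c : ell2 c -> exists2 w, L2 w & forall j, inner w (phi j) = c j.
Proof.
move=> [M cM].
pose S n := \sum_(j < n) c j ^+ 2.
have Snd : nondecreasing_seq S.
  by apply/nondecreasing_seqP => n; rewrite /S big_ord_recr/= lerDl sqr_ge0.
have Sc : cvgn S.
  by apply: nondecreasing_is_cvgn => //; exists M => _ [n _ <-]; exact: cM.
(* The tail of the series of squares bounds the squared distances of later partial sums from the
   n-th. *)
pose e n := limn S - S n.
have e0 : e n @[n --> \oo] --> 0.
  by rewrite -[X in _ --> X](subrr (limn S)); apply: cvgB => //; exact: cvg_cst.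
have [|||w Lw we] := @L2_complete (fun n => comb n c) e; first by move=> n; exact: L2_comb.
- exact: e0.
- move=> n k nk; rewrite comb_sub// inner_comb2.
  apply: (@le_trans _ _ (S k - S n)); last by rewrite lerD2r; exact: nondecreasing_cvgn_le.
  rewrite /S -!(big_mkord xpredT (fun j => c j ^+ 2)) -(big_mkord xpredT (fun j => (if (j < n)%N then 0 else c j) * (if (j < n)%N then 0 else c j))).
  rewrite (big_cat_nat _ nk)//= [X in X - _](big_cat_nat _ nk)//= [X in _ <= X]addrAC subrr add0r.
  rewrite [X in X + _]big1_seq ?add0r; last first.
    by move=> j; rewrite mem_index_iota => /andP[_ /andP[_ ->]]; rewrite mul0r.
  rewrite !big_nat le_eqVlt; apply/orP; left; apply/eqP; apply: eq_bigr => j /andP[nj _].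
  by rewrite ltnNge nj expr2.
exists w => // j; apply/eqP; rewrite -subr_eq0 -normr_le0.
have LB n : L2 (fun x => w x - comb n c x) by apply: L2B => //; exact: L2_comb.
have bnd n : (j < n)%N -> `|inner w (phi j) - c j| <= Num.sqrt (e n).
  move=> jn; have -> : c j = inner (comb n c) (phi j) by rewrite inner_comb_phi jn.
  rewrite -innerB//; last exact: L2_comb.
  apply: le_trans (cauchy_schwarz _ _) _ => //.
  rewrite [nrm (phi j)]/nrm phiO eqxx sqrtr1 mulr1 ler_wsqrtr//; exact: we.
have se : Num.sqrt (e n) @[n --> \oo] --> 0.
  rewrite -(@sqrtr0 R); apply: continuous_cvg e0; exact: sqrt_continuous.
rewrite -(cvg_lim (@Rhausdorff R) se); apply: limr_ge; first by apply/cvg_ex; exists 0.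
by exists j.+1 => // n /=; exact: bnd.
Qed.

Section Complete.
Hypothesis phiC : forall v, L2 v ->
  norm_L2 Omega (fun x => v x - \sum_(j < n) inner v (phi j) * phi j x) @[n --> \oo] --> 0%E.

Lemma comb_cvg v : L2 v ->
  nrm (fun x => v x - comb n (fun j => inner v (phi j)) x) @[n --> \oo] --> 0.
Proof.
move=> Lv; have := phiC Lv.
rewrite (_ : (fun n => _) = (fun n => (nrm (fun x => v x - comb n (fun j => inner v (phi j)) x))%:E)).
  by move/fine_cvg.
by apply/funext => n; rewrite -norm_L2E//; exact: L2B Lv (L2_comb _ _).
Qed.

Lemma parseval v w : L2 v -> L2 w ->
  \sum_(j < n) inner v (phi j) * inner w (phi j) @[n --> \oo] --> inner v w.
Proof.
move=> Lv Lw; apply/cvgrPdist_le => e e0.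
have := comb_cvg Lv => /cvgrPdist_le /(_ (e / (nrm w + 1))).
have w1 : 0 < nrm w + 1 by rewrite ltr_wpDl ?nrm_ge0.
rewrite divr_gt0// => /(_ isT); apply: filterS => n.
rewrite sub0r normrN ger0_norm ?nrm_ge0// => h.
have -> : \sum_(j < n) inner v (phi j) * inner w (phi j) = inner (comb n (fun j => inner v (phi j))) w.
  by rewrite inner_comb//; apply: eq_bigr => j _; rewrite [inner w _]innerC.
have Lc := L2_comb n (fun j => inner v (phi j)).
rewrite -innerB//; apply: le_trans (cauchy_schwarz (L2B Lv Lc) Lw) _.
apply: (@le_trans _ _ (e / (nrm w + 1) * nrm w)); first by rewrite ler_wpM2r ?nrm_ge0.
by rewrite mulrAC ler_pdivrMr// ler_pM2l// lerDl.
Qed.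

Lemma bessel v n : L2 v -> \sum_(j < n) inner v (phi j) ^+ 2 <= inner v v.
Proof.
move=> Lv; have h := parseval Lv Lv.
rewrite -(cvg_lim (@Rhausdorff R) h).
apply: (@nondecreasing_cvgn_le _ (fun n => \sum_(j < n) inner v (phi j) * inner v (phi j))).
  by apply/nondecreasing_seqP => k; rewrite big_ord_recr/= lerDl -expr2 sqr_ge0.
by apply/cvg_ex; exists (inner v v).
Qed.

End Complete.
End Orthonormal.
End L2Space.

Lemma integrable_indic_lty d (T : measurableType d) (R : realType)
    (m : {measure set T -> \bar R}) (A : set T) : measurable A -> (m A < +oo)%E ->
  m.-integrable setT (EFin \o (\1_A : T -> R)).
Proof.
move=> mA fA; apply/integrableP; split; first by apply/measurable_EFinP; exact: measurable_indic.
rewrite (eq_integral (fun x => (\1_A x)%:E)); first by rewrite integral_indic// setIT.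
by move=> x _; rewrite /= ger0_norm.
Qed.

(** * Smooth functions on the plane *)

Section PlaneMeasurability.
Variable R : realType.
Notation plane := (R * R)%type.

(** The measurable structure is the product one, so the open set is written as a countable union of
    rational boxes. *)
Lemma open_measurable_plane (O : set plane) : open O ->
  measurable (O : set (measurableTypeR R * measurableTypeR R)).
Proof.
move=> oO.
pose box (p : (rat * rat) * (rat * rat)) : set plane :=
  `]ratr p.1.1, ratr p.1.2[ `*` `]ratr p.2.1, ratr p.2.2[.
pose F p := if `[< box p `<=` O >] then box p else set0.
have -> : O = \bigcup_p F p.
  apply/seteqP; split => [[x y] Oxy|z [p _]]; last first.
    by rewrite /F; case: asboolP => // h; exact: h.
  move: oO; rewrite openE => /(_ _ Oxy); rewrite /interior => /nbhs_ballP[e /= e0 he].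
  have rat_lt (a : R) : exists q : rat * rat, [/\ a - e < ratr q.1, ratr q.1 < a, a < ratr q.2 & ratr q.2 < a + e].
    have ae1 : a - e < a by rewrite gtrBl.
    have ae2 : a < a + e by rewrite ltrDl.
    have [q1] := rat_in_itvoo ae1; rewrite in_itv/= => /andP[h1 h2].
    by have [q2] := rat_in_itvoo ae2; rewrite in_itv/= => /andP[h3 h4]; exists (q1, q2).
  have [p [p1 p2 p3 p4]] := rat_lt x; have [q [q1 q2 q3 q4]] := rat_lt y.
  exists (p, q) => //; rewrite /F asboolT; first by split; rewrite /= in_itv/= ?p2 ?p3 ?q2 ?q3.
  move=> [a b] [/=]; rewrite !in_itv/= => /andP[a1 a2] /andP[b1 b2]; apply: he.
  by split; rewrite /ball/= ltr_distlC; apply/andP; split; lra.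
apply: countable_bigcupT_measurable; first exact: countableP.
move=> p; rewrite /F; case: asboolP => // _; apply: measurableX; exact: measurable_oo.
Qed.

Lemma continuous_measurable_plane (f : plane -> R) : continuous f ->
  measurable_fun setT (f : measurableTypeR R * measurableTypeR R -> R).
Proof.
move=> /continuousP cf; apply: (measurability _ (RGenOpens.measurableE R)).
move=> _ [_ [a [b ->] <-]]; rewrite setTI; apply: open_measurable_plane.
exact/cf/interval_open.
Qed.

Definition evec (i : 'I_2) : plane := if i == ord0 then (1, 0) else (0, 1).

Lemma line_derive0 (f : plane -> R) (x y : R) : derivable f (x, y) (evec ord0) ->
  is_derive x (1 : R) (fun s => f (s, y)) ('D_(evec ord0) f (x, y)).
Proof.
move=> df.
have E : (fun h => h^-1 *: (f (h *: evec ord0 + (x, y)) - f (x, y))) =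
  (fun h => h^-1 *: (f (h *: (1 : R) + x, y) - f (x, y))).
  apply/funext => h; rewrite (_ : h *: evec ord0 + (x, y) = (h *: (1 : R) + x, y))//.
  rewrite [LHS]surjective_pairing /evec eqxx; congr pair => //=.
  by rewrite scaler0 add0r.
split; first by rewrite /derivable; rewrite /derivable E in df.
by rewrite /derive -E.
Qed.

Lemma line_derive1 (f : plane -> R) (x y : R) : derivable f (x, y) (evec ord_max) ->
  is_derive y (1 : R) (fun s => f (x, s)) ('D_(evec ord_max) f (x, y)).
Proof.
move=> df.
have E : (fun h => h^-1 *: (f (h *: evec ord_max + (x, y)) - f (x, y))) =
  (fun h => h^-1 *: (f (x, h *: (1 : R) + y) - f (x, y))).
  apply/funext => h; rewrite (_ : h *: evec ord_max + (x, y) = (x, h *: (1 : R) + y))//.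
  rewrite [LHS]surjective_pairing /evec; congr pair => //=.
  by rewrite scaler0 add0r.
split; first by rewrite /derivable; rewrite /derivable E in df.
by rewrite /derive -E.
Qed.

Local Notation P0 := (partial (ord0 : 'I_2)).
Local Notation P1 := (partial (ord_max : 'I_2)).

Let MVT1 (g dg : R -> R) (a h : R) : 0 < h -> (forall s, is_derive s (1 : R) g (dg s)) ->
  exists2 c, a < c < a + h & g (a + h) - g a = dg c * h.
Proof.
move=> h0 gd; have ah : a < a + h by rewrite ltrDl.
have [|c cI H] := @MVT _ g dg _ _ ah (fun z _ => gd z).
  apply: continuous_subspaceT => z; have [dz _] := gd z.
  exact/differentiable_continuous/derivable1_diffP.
by exists c; [move: cI; rewrite in_itv|rewrite H addrAC subrr add0r].
Qed.

Let smooth_derivable l i (f : plane -> R) z : smooth f -> derivable (dpart l f) z (evec i).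
Proof. by move=> sf; case: (sf l) => _ /(_ i z). Qed.

Let box_ball (x y d h z1 z2 : R) : h < d -> x < z1 < x + h -> y < z2 < y + h ->
  ball (x, y) d (z1, z2).
Proof.
by move=> hd /andP[? ?] /andP[? ?]; split; rewrite /ball/= ltr_distlC; apply/andP; split; lra.
Qed.

Let dist_le (a b a' b' e : R) : `|a - b| <= e -> `|a' - b'| <= e -> b' = b -> `|a - a'| <= e + e.
Proof.
move=> h1 h2 bb; rewrite (_ : a - a' = (a - b) - (a' - b')); last by rewrite bb; ring.
by apply: le_trans (ler_normB _ _) _; rewrite lerD.
Qed.

Let schwarz_arith (f11 f10 f01 f00 a1 a2 g1 g2 X Y h : R) : h != 0 ->
  f11 - f10 - (f01 - f00) = (a2 - a1) * h -> f11 - f01 - (f10 - f00) = (g2 - g1) * h ->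
  a2 - a1 = X * h -> g2 - g1 = Y * h -> X = Y.
Proof.
move=> h0 e1 e2 e3 e4; apply: (mulIf (mulf_neq0 h0 h0)).
by rewrite !mulrA -e3 -e4 -e1 -e2; ring.
Qed.

(** The second difference of [f] over a square of side [h] is [h^2] times either mixed derivative at
    some point of the square, by two mean value theorems in each order; continuity does the rest. *)
Lemma schwarz_le (f : plane -> R) (x y e : R) : smooth f -> 0 < e ->
  `|P0 (P1 f) (x, y) - P1 (P0 f) (x, y)| <= e + e.
Proof.
move=> sf e0.
have d0 l z : derivable (dpart l f) z (evec ord0) by exact: smooth_derivable.
have d1 l z : derivable (dpart l f) z (evec ord_max) by exact: smooth_derivable.
have c01 : {for (x, y), continuous (P0 (P1 f))} by case: (sf [:: ord0; ord_max]) => h _; exact: h.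
have c10 : {for (x, y), continuous (P1 (P0 f))} by case: (sf [:: ord_max; ord0]) => h _; exact: h.
move: c01 c10 => /cvgrPdist_le /(_ e e0) h01 /cvgrPdist_le /(_ e e0) h10.
have [d d_gt0 hd] : exists2 d : R, 0 < d & ball (x, y) d `<=` (fun z =>
    `|P0 (P1 f) (x, y) - P0 (P1 f) z| <= e /\ `|P1 (P0 f) (x, y) - P1 (P0 f) z| <= e).
  by apply/nbhs_ballP; exact: filterI h01 h10.
pose h := d / 2; have h0 : 0 < h by rewrite divr_gt0.
have hlt : h < d by rewrite ltr_pdivrMr// ltr_pMr// ltr1n.
have [c1 c1I E1] := MVT1 x h0 (fun s => is_deriveB (line_derive0 (d0 [::] (s, y + h))) (line_derive0 (d0 [::] (s, y)))).
have [c2 c2I E2] := MVT1 y h0 (fun s => line_derive1 (d1 [:: ord0] (c1, s))).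
have [b1 b1I F1] := MVT1 y h0 (fun s => is_deriveB (line_derive1 (d1 [::] (x + h, s))) (line_derive1 (d1 [::] (x, s)))).
have [b2 b2I F2] := MVT1 x h0 (fun s => line_derive0 (d0 [:: ord_max] (s, b1))).
have EF : P1 (P0 f) (c1, c2) = P0 (P1 f) (b2, b1).
  exact: schwarz_arith (lt0r_neq0 h0) E1 F1 E2 F2.
have [_ B1] := hd _ (box_ball hlt c1I c2I); have [B2 _] := hd _ (box_ball hlt b2I b1I).
exact: dist_le B2 B1 EF.
Qed.

Lemma schwarz (f : plane -> R) : smooth f -> P0 (P1 f) = P1 (P0 f).
Proof.
move=> sf; apply/funext => -[x y]; apply/eqP; rewrite -subr_eq0 -normr_le0.
apply/ler_addgt0Pl => e e0; rewrite addr0.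
have e2 : 0 < e / 2 by rewrite divr_gt0.
by have := schwarz_le x y sf e2; rewrite -splitr.
Qed.

Lemma schwarz_sym (i j : 'I_2) (f : plane -> R) : smooth f ->
  partial i (partial j f) = partial j (partial i f).
Proof.
move=> sf.
have cI (k : 'I_2) : k = ord0 \/ k = ord_max.
  by case: k => -[|[|//]] p; [left|right]; exact: val_inj.
have s := schwarz sf.
by case: (cI i) => ->; case: (cI j) => ->; [exact: erefl|exact: s|exact: (esym s)|exact: erefl].
Qed.

Lemma dpart_cat l l' (f : plane -> R) : dpart (l ++ l') f = dpart l (dpart l' f).
Proof. exact: foldr_cat. Qed.

Lemma smooth_dpart l (f : plane -> R) : smooth f -> smooth (dpart l f).
Proof. by move=> sf l'; rewrite -dpart_cat; exact: sf. Qed.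

(** Integrating the Hessian form by parts yields the first order of differentiation, the bilaplacian
    is written in the second. *)
Lemma dpart_ijij (i j : 'I_2) (f : plane -> R) : smooth f ->
  dpart [:: i; j; i; j] f = dpart [:: i; i; j; j] f.
Proof.
move=> sf; have := @schwarz_sym j i (dpart [:: j] f) (smooth_dpart [:: j] sf).
by rewrite /= => ->.
Qed.

Section Test.
Variable Omega : set plane.

Lemma test_dpart l (psi : plane -> R) : test_function Omega psi -> test_function Omega (dpart l psi).
Proof.
move=> [sp [K [cK KO pK]]]; split; first exact: smooth_dpart.
exists K; split => //; elim: l => [//|i l IH] x Kx; rewrite /= /partial.
have cl : closed K by apply: compact_closed cK; exact: norm_hausdorff.
(* Off the compact [K], whose complement is open, the function is locally zero. *)
have : \forall y \near x, dpart l psi y = cst (0 : R) y.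
  have : open (~` K) by exact: closed_openC.
  by rewrite openE => /(_ _ Kx); apply: filterS => y; exact: IH.
by move/near_eq_derive => ->; rewrite derive_cst.
Qed.

Lemma test_L2 (psi : plane -> R) : test_function Omega psi -> L2 Omega psi.
Proof.
move=> [sp [K [cK KO pK]]]; apply/L2P.
have -> : psi \_ Omega = psi.
  apply/funext => x; rewrite patchE; case: ifPn => // xO; rewrite pK// => Kx.
  by move: xO; rewrite mem_set//; exact: KO.
have cp : continuous psi by have [] := sp [::].
have mp := continuous_measurable_plane cp.
split => //.
have [M [_ KM]] := compact_bounded cK.
have bp : bounded_set (psi @` K).
  by apply: compact_bounded; apply: continuous_compact => //; exact: continuous_subspaceT.
have [B [_ pB]] := bp.
pose M' : R := `|M : R| + 1; pose B' : R := `|B : R| + 1.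
have B'0 : 0 <= B' by rewrite addr_ge0.
pose I0 : set (measurableTypeR R) := `[- M', M']%classic.
have mI : measurable I0 by exact: measurable_itv.
pose Q : set (measurableTypeR R * measurableTypeR R) := I0 `*` I0.
have mQ : measurable Q by exact: measurableX.
apply: (@integrable_dom _ _ _ _ _ measurableT _ (fun x => B' ^+ 2 * \1_Q x)).
- exact: measurable_funX.
- apply: integrableZ_real => //.
  apply: integrable_indic_lty => //.
  rewrite [X in (X < _)%E](_ : _ = (leb I0 * leb I0)%E); last exact: product_measure1E.
  by rewrite /I0 lebesgue_measure_itv/=; case: ifP => _; rewrite ?mul0e// -EFinB -EFinM ltry.
- move=> x _; rewrite ger0_norm ?sqr_ge0//.
  have [Kx|Kx] := pselect (K x); last by rewrite pK// expr0n/= mulr_ge0 ?sqr_ge0.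
  have Qx : Q x.
    have := KM M' _ x Kx; rewrite /M' (le_lt_trans (ler_norm M))// ?ltrDl// => /(_ isT).
    move=> xM; have : Num.max `|x.1| `|x.2| <= M' by exact: xM.
    rewrite ge_max => /andP[h1 h2].
    by split; rewrite /I0 /= in_itv/= -ler_norml.
  rewrite indicE mem_set// mulr1 -real_normK ?num_real// lerXn2r ?nnegrE//.
  apply: pB; last by exists x.
  by rewrite /B' (le_lt_trans (ler_norm B))// ltrDl.
Qed.

End Test.
End PlaneMeasurability.

(** * The Hessian form on eigenfunctions *)

Section HessianForm.
Variables (R : realType) (Omega : set (R * R)).
Notation plane := (R * R)%type.
Local Notation L2 := (L2 Omega).
Local Notation inner := (inner Omega).
Local Notation nrm := (nrm Omega).
Implicit Types (J K : jet R) (psi : plane -> R).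

Lemma norm_L2_ge0 (w : plane -> R) : (0 <= norm_L2 Omega w)%E.
Proof. exact: Lnorm_ge0. Qed.

Lemma norm_L2_le_H2 J l : (size l <= 2)%N -> (norm_L2 Omega (J l) <= norm_H2 Omega J)%E.
Proof.
move=> l2; have l3 : (size l < 3)%N by [].
have -> : norm_L2 Omega (J l) = ((norm_L2 Omega (J l) `^ 2) `^ 2^-1)%E.
  by rewrite -poweRrM divff// poweRe1// norm_L2_ge0.
rewrite /norm_H2.
have term0 (k : 'I_3) (i : k.-tuple 'I_2) : (0 <= norm_L2 Omega (J i) `^ 2)%E by exact: poweR_ge0.
apply: gt0_ler_poweR; rewrite ?invr_ge0//.
- by rewrite in_itv/= poweR_ge0 leey.
- rewrite in_itv/= leey andbT; apply: sume_ge0 => k _; exact: sume_ge0.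
rewrite (bigD1 (Ordinal l3))//= (bigD1 (in_tuple l))//= -addeA leeDl// adde_ge0//.
  by apply: sume_ge0 => i _; exact: poweR_ge0.
by apply: sume_ge0 => k _; exact: sume_ge0.
Qed.

Lemma H2_L2 J l : is_H20 Omega J -> (size l <= 2)%N -> L2 (J l).
Proof. by move=> [h _] l2; have [] := h l l2. Qed.

Lemma V_L2 (v : plane -> R) : V Omega v -> L2 v.
Proof. by move=> [J hJ <-]; exact: H2_L2. Qed.

Lemma H20_approx_cvg J (psi : nat -> plane -> R) : is_H20 Omega J ->
  (forall n, test_function Omega (psi n)) ->
  norm_H2 Omega (fun l x => dpart l (psi n) x - J l x) @[n --> \oo] --> 0%E ->
  forall l w, (size l <= 2)%N -> L2 w ->
  inner w (dpart l (psi n)) @[n --> \oo] --> inner w (J l).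
Proof.
move=> hJ tp pc l w l2 Lw.
have LJ : L2 (J l) by exact: H2_L2.
have Lp n : L2 (dpart l (psi n)) by apply: test_L2; exact: test_dpart.
have Ld n : L2 (fun x => dpart l (psi n) x - J l x) by exact: L2B.
have nc : nrm (fun x => dpart l (psi n) x - J l x) @[n --> \oo] --> 0.
  have : (nrm (fun x => dpart l (psi n) x - J l x))%:E @[n --> \oo] --> 0%E.
    apply: (@squeeze_cvge _ _ _ _ (cst 0%E)) pc; last exact: cvg_cst.
    near=> n; rewrite lee_fin nrm_ge0 -norm_L2E//=.
    exact: (@norm_L2_le_H2 (fun l x => dpart l (psi n) x - J l x) l l2).
  by move/fine_cvg.
apply/cvgrPdist_le => e e0.
have w1 : 0 < nrm w + 1 by rewrite ltr_wpDl ?nrm_ge0.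
move/cvgrPdist_le : nc => /(_ (e / (nrm w + 1))); rewrite divr_gt0// => /(_ isT).
apply: filterS => n; rewrite sub0r normrN ger0_norm ?nrm_ge0// => h.
rewrite distrC ![inner w _]innerC -innerB//.
apply: le_trans (cauchy_schwarz (Ld n) Lw) _.
apply: (@le_trans _ _ (e / (nrm w + 1) * nrm w)); first by rewrite ler_wpM2r ?nrm_ge0.
by rewrite mulrAC ler_pdivrMr// ler_pM2l// lerDl.
Unshelve. all: by end_near. Qed.

Lemma inner_sumr (I : Type) (s : seq I) (w : plane -> R) (v : I -> plane -> R) : L2 w ->
  (forall i, L2 (v i)) ->
  L2 (fun x => \sum_(i <- s) v i x) /\
  inner w (fun x => \sum_(i <- s) v i x) = \sum_(i <- s) inner w (v i).
Proof.
move=> Lw Lv; elim: s => [|i s [IH1 IH2]].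
  rewrite big_nil (_ : (fun x => _) = fun=> 0); last by apply/funext => x; rewrite big_nil.
  by split; [exact: L2_0|rewrite innerC inner0].
rewrite (_ : (fun x => _) = (fun x => 1 * v i x + \sum_(j <- s) v j x)); last first.
  by apply/funext => x; rewrite big_cons mul1r.
by split; [exact: L2D|rewrite innerDr// mul1r IH2 big_cons].
Qed.

Lemma cvg_sumr (I : Type) (s : seq I) (u : I -> nat -> R) (l : I -> R) :
  (forall i, u i n @[n --> \oo] --> l i) ->
  \sum_(i <- s) u i n @[n --> \oo] --> \sum_(i <- s) l i.
Proof.
move=> ul; elim: s => [|i s IH].
  by rewrite big_nil; under eq_fun do rewrite big_nil; exact: cvg_cst.
by rewrite big_cons; under eq_fun do rewrite big_cons; exact: cvgD.
Qed.

(** Approximate [J] by test functions. On these the weak second derivatives of [phi] move over and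
    form the bilaplacian, to which the distributional eigenvalue equation applies. *)
Lemma hess_form_eigen J K (m : R) (phi : plane -> R) : is_H20 Omega J -> is_H20 Omega K ->
  K [::] = phi -> is_A Omega phi (fun x => m * phi x) ->
  hess_form Omega J K = m * inner (J [::]) phi.
Proof.
move=> hJ hK Kphi [Vphi Lm Aphi].
have Lphi : L2 phi by exact: V_L2.
have [psi [tp pc]] : exists psi : nat -> plane -> R, (forall n, test_function Omega (psi n)) /\
    norm_H2 Omega (fun l x => dpart l (psi n) x - J l x) @[n --> \oo] --> 0%E by case: hJ.
have hc := H20_approx_cvg hJ tp pc.
have h1 : \sum_(i < 2) \sum_(j < 2) inner (K [:: i; j]) (dpart [:: i; j] (psi n)) @[n --> \oo] -->
    hess_form Omega J K.
  rewrite /hess_form; apply: cvg_sumr => i; apply: cvg_sumr => j.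
  by rewrite [inner (J _) _]innerC; apply: hc => //; exact: H2_L2.
have h2 : m * inner phi (psi n) @[n --> \oo] --> m * inner (J [::]) phi.
  by apply: cvgMl_tmp; rewrite [inner (J _) _]innerC; exact: (hc [::]).
rewrite -(cvg_lim (@Rhausdorff R) h1) -(cvg_lim (@Rhausdorff R) h2).
congr (limn _); apply/funext => n.
have [sp _] := tp n.
have tL l : L2 (dpart l (psi n)) by apply: test_L2; exact: test_dpart.
transitivity (inner phi (bilaplacian (psi n))); last by rewrite Aphi// innerZ//; exact: test_L2.
have [_ s1] : L2 (bilaplacian (psi n)) /\ inner phi (bilaplacian (psi n)) =
    \sum_(i < 2) \sum_(j < 2) inner phi (dpart [:: i; i; j; j] (psi n)).
  have in2 (i : 'I_2) := inner_sumr (index_enum 'I_2) Lphi (fun j : 'I_2 => tL [:: i; i; j; j]).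
  have [L s] := inner_sumr (index_enum 'I_2) Lphi (fun i => (in2 i).1).
  by split; [exact: L|rewrite s; apply: eq_bigr => i _; exact: (in2 i).2].
rewrite s1; apply: eq_bigr => i _; apply: eq_bigr => j _.
have [_ wp] := hK.1 [:: i; j] isT.
have E2 : dpart [:: i; j] (dpart [:: i; j] (psi n)) = dpart [:: i; i; j; j] (psi n).
  by rewrite -(dpart_cat [:: i; j] [:: i; j]); exact: dpart_ijij.
have H := wp (dpart [:: i; j] (psi n)) (test_dpart _ (tp n)).
move: H; rewrite E2 Kphi => H; rewrite H.
by rewrite [size _]/= sqrrN expr1n mul1r.
Qed.

End HessianForm.

Section Scaling.
Variables (R : realType) (Omega : set (R * R)).
Notation plane := (R * R)%type.
Implicit Types (J : jet R) (psi : plane -> R).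

Lemma dpartZ (c : R) l psi : smooth psi ->
  dpart l (fun x => c * psi x) = (fun x => c * dpart l psi x).
Proof.
move=> sp; elim: l => [//|i l IH] /=; rewrite IH; apply/funext => x.
exact: (deriveZ c ((sp l).2 i x)).
Qed.

Lemma test_functionZ (c : R) psi : test_function Omega psi -> test_function Omega (fun x => c * psi x).
Proof.
move=> [sp [K [cK KO pK]]]; split; last by exists K; split => // x Kx; rewrite pK// mulr0.
move=> l; rewrite dpartZ//; have [cl dl] := sp l; split.
  by move=> x; apply: cvgMl_tmp; exact: cl.
by move=> i x; exact: (derivableZ (k := c) (dl i x)).
Qed.

Lemma norm_L2Z (c : R) (w : plane -> R) : L2 Omega w ->
  norm_L2 Omega (fun x => c * w x) = (`|c|%:E * norm_L2 Omega w)%E.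
Proof.
move=> Lw; have Lc := L2Z c Lw; rewrite !norm_L2E// -EFinM; congr EFin.
by rewrite /nrm innerZ// innerC innerZ// mulrA -expr2 sqrtrM ?sqr_ge0// sqrtr_sqr.
Qed.

Lemma norm_H2Z (c : R) J : (forall l, (size l <= 2)%N -> L2 Omega (J l)) ->
  norm_H2 Omega (fun l x => c * J l x) = (`|c|%:E * norm_H2 Omega J)%E.
Proof.
move=> LJ; rewrite /norm_H2.
have n0 (w : plane -> R) : (0 <= norm_L2 Omega w `^ 2)%E by exact: poweR_ge0.
have -> : (\sum_(k < 3) \sum_(l : k.-tuple 'I_2) norm_L2 Omega (fun x => (c * J l x)%R) `^ 2 =
    (`|c| ^+ 2)%:E * \sum_(k < 3) \sum_(l : k.-tuple 'I_2) norm_L2 Omega (J l) `^ 2)%E.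
  rewrite ge0_sume_distrr; last by move=> k _; exact: sume_ge0.
  apply: eq_bigr => k _; rewrite ge0_sume_distrr//; apply: eq_bigr => l _.
  have l2 : (size l <= 2)%N by rewrite size_tuple -ltnS ltn_ord.
  rewrite norm_L2Z; last exact: LJ.
  by rewrite poweRM ?norm_L2_ge0// poweR_EFin powR_mulrn.
rewrite poweRM; last 2 first.
- by rewrite lee_fin exprn_ge0.
- by apply: sume_ge0 => k _; exact: sume_ge0.
by rewrite poweR_EFin -powR_mulrn// -powRrM divff// powRr1.
Qed.

Lemma is_H20Z (c : R) J : is_H20 Omega J -> is_H20 Omega (fun l x => c * J l x).
Proof.
move=> hJ0; have [hJ [psi [tp pc]]] := hJ0; split.
  move=> l l2; have [Ll wl] := hJ l l2; have [L0 _] := hJ [::] isT.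
  split; first exact: L2Z.
  move=> chi tc; have Lchi := test_L2 tc; have Lchi' := test_L2 (test_dpart l tc).
  by rewrite !innerZ// wl// mulrCA.
exists (fun n x => c * psi n x); split; first by move=> n; exact: test_functionZ.
rewrite (_ : (fun n => _) = (fun n => `|c|%:E * norm_H2 Omega (fun l x => (dpart l (psi n) x - J l x)%R))%E).
  by rewrite -[X in _ --> X](mule0 `|c|%:E); apply: cvgeMl.
apply/funext => n; rewrite -norm_H2Z.
  congr norm_H2; apply/funext => l; apply/funext => x.
  by rewrite dpartZ ?mulrBr//; case: (tp n).
move=> l l2; apply: L2B; last exact: H2_L2.
by apply: test_L2; exact: test_dpart.
Qed.

Lemma norm_H2_ge0 J : (0 <= norm_H2 Omega J)%E.
Proof. exact: poweR_ge0. Qed.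

Lemma norm_H2_lty J : is_H20 Omega J -> (norm_H2 Omega J < +oo)%E.
Proof.
move=> hJ; apply: poweR_lty; apply: lte_sum_pinfty => k _; apply: lte_sum_pinfty => l _.
by apply: poweR_lty; rewrite norm_L2E ?ltry//; apply: H2_L2 => //; rewrite size_tuple -ltnS ltn_ord.
Qed.

Lemma norm_L2_le_H20 v : (norm_L2 Omega v <= norm_H20 Omega v)%E.
Proof.
apply: le_ereal_inf_tmp => _ [J [hJ <-] <-].
exact: (@norm_L2_le_H2 _ _ J [::]).
Qed.

(** The dual norm is a supremum over the unit ball, so every [v] must be scaled into it; dividing by
    [N + 1] covers [N = 0] as well. *)
Lemma V_scale v : V Omega v -> exists2 c : R, 0 < c &
  V Omega (fun x => c * v x) /\ (norm_H20 Omega (fun x => (c * v x)%R) <= 1)%E.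
Proof.
move=> [J hJ Jv]; have N0 := norm_H2_ge0 J; have Nf := norm_H2_lty hJ.
pose N := fine (norm_H2 Omega J).
have NE : norm_H2 Omega J = N%:E by rewrite /N fineK// ge0_fin_numE.
have n0 : 0 <= N by rewrite fine_ge0.
have n1 : 0 < N + 1 by rewrite ltr_wpDl.
exists ((N + 1)^-1); first by rewrite invr_gt0.
have hJ' := is_H20Z (N + 1)^-1 hJ.
split; first by exists (fun l x => (N + 1)^-1 * J l x) => //; rewrite Jv.
apply: (@le_trans _ _ (norm_H2 Omega (fun l x => ((N + 1)^-1 * J l x)%R))).
  by apply: ereal_inf_lbound; exists (fun l x => (N + 1)^-1 * J l x) => //; split => //; rewrite Jv.
rewrite norm_H2Z; last by move=> l; exact: H2_L2.
rewrite NE -EFinM lee_fin ger0_norm ?invr_ge0 ?(ltW n1)//.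
by rewrite mulrC ler_pdivrMr// mul1r lerDl.
Qed.

End Scaling.

(** * The dual norm and evaluation of functionals *)

Section DualNorm.
Variables (R : realType) (Omega : set (R * R)).
Notation plane := (R * R)%type.
Implicit Types (g h : functional R).

Lemma of_L2_linear w : L2 Omega w -> linear_on (V Omega) (of_L2 Omega w).
Proof. by move=> Lw a v v' Vv Vv'; rewrite /of_L2 innerDr//; exact: V_L2. Qed.

Lemma nVdual_le g (C : R) : 0 <= C -> linear_on (V Omega) g ->
  (forall v, V Omega v -> `|g v| <= C * nrm Omega v) -> (nVdual Omega g <= C%:E)%E.
Proof.
move=> C0 lg gC; rewrite /nVdual asboolT//; apply: ge_ereal_sup => _ [v [Vv v1] <-].
rewrite lee_fin; apply: le_trans (gC v Vv) _.
rewrite -[leRHS]mulr1 ler_wpM2l// -lee_fin -norm_L2E; last exact: V_L2.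
exact: le_trans (norm_L2_le_H20 _ _) v1.
Qed.

Lemma linear_onZ (a : R) g v : linear_on (V Omega) g -> V Omega v -> g (fun x => a * v x) = a * g v.
Proof.
move=> lg Vv; have V0 : V Omega (fun=> 0).
  have [J hJ Jv] := Vv; exists (fun l x => 0 * J l x); first exact: is_H20Z.
  by apply/funext => x; rewrite mul0r.
have g0 : g (fun=> 0) = 0.
  have := lg 1 (fun=> 0) (fun=> 0) V0 V0.
  have -> : (fun=> 1 * 0 + 0 : R) = (fun=> 0) :> (plane -> R) by apply/funext => x; rewrite mulr0 addr0.
  by rewrite mul1r => e; apply: (addrI (g (fun=> 0))); rewrite addr0 -e.
have := lg a v (fun=> 0) Vv V0; rewrite g0 addr0 => <-.
by congr g; apply/funext => x; rewrite addr0.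
Qed.

(** Convergence to 0 makes the norms eventually finite, which by the definition of [nVdual] includes
    linearity; homogeneity then carries the convergence from the unit ball to all of [V]. *)
Lemma nVdual_cvg0 (g : nat -> functional R) : nVdual Omega (g n) @[n --> \oo] --> 0%E ->
  (\forall n \near \oo, linear_on (V Omega) (g n)) /\
  forall v, V Omega v -> g n v @[n --> \oo] --> 0.
Proof.
move=> gc; have /fine_cvgP[gf _] := gc.
have lin : \forall n \near \oo, linear_on (V Omega) (g n).
  by move: gf; apply: filterS => n; rewrite /nVdual; case: asboolP.
split => // v Vv; have [c c0 [Vc c1]] := V_scale Vv.
have h : `|g n (fun x => c * v x)| @[n --> \oo] --> 0.
  have : (`|g n (fun x => c * v x)|%R%:E) @[n --> \oo] --> 0%E.
    apply: (@squeeze_cvge _ _ _ _ (cst 0%E)) gc; last exact: cvg_cst.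
    near=> n; rewrite lee_fin normr_ge0/=.
    have ln : linear_on (V Omega) (g n) by near: n.
    by rewrite /nVdual asboolT//; apply: ereal_sup_ubound; exists (fun x => c * v x).
  by move/fine_cvg.
have h2 : c^-1 * g n (fun x => c * v x) @[n --> \oo] --> 0.
  by rewrite -[X in _ --> X](mulr0 c^-1); apply: cvgMl_tmp; exact/norm_cvg0P.
apply: cvg_trans h2; apply: near_eq_cvg; move: lin; apply: filterS => n ln.
by rewrite linear_onZ// mulKf// gt_eqF.
Unshelve. all: by end_near. Qed.

End DualNorm.

(** * Norms in terms of eigenfunction coefficients *)

Section Spectral.
Variables (R : realType) (Omega : set (R * R)).
Variables (mu : nat -> R) (phi : nat -> R * R -> R) (hphi : eigenpairs Omega mu phi).
Notation plane := (R * R)%type.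
Implicit Types (g h : functional R) (w v : plane -> R) (c : nat -> R).
Local Notation L2 := (L2 Omega).
Local Notation inner := (inner Omega).
Local Notation nrm := (nrm Omega).

Lemma mu_gt0 j : 0 < mu j.
Proof. by have [[m0 mm] _ _ _ _] := hphi; apply: lt_le_trans m0 _; exact: mm. Qed.

Lemma phiA j : is_A Omega (phi j) (fun x => mu j * phi j x).
Proof. by have [_ _ +] := hphi; exact. Qed.

Lemma phiV j : V Omega (phi j). Proof. by have [] := phiA j. Qed.

Lemma phiL2 j : L2 (phi j). Proof. exact: V_L2 (phiV j). Qed.

Lemma phiO i j : inner (phi i) (phi j) = (i == j)%:R.
Proof. by have [_ _ _ +] := hphi; exact. Qed.

Lemma phiC v : L2 v ->
  norm_L2 Omega (fun x => v x - \sum_(j < n) inner v (phi j) * phi j x) @[n --> \oo] --> 0%E.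
Proof. by have [_ _ _ _ +] := hphi; exact. Qed.

Definition enorm n c := Num.sqrt (\sum_(j < n) c j ^+ 2).

Lemma sum_sqr_ge0 n c : 0 <= \sum_(j < n) c j ^+ 2.
Proof. by apply: sumr_ge0 => j _; exact: sqr_ge0. Qed.

Lemma enorm_sqr n c : enorm n c ^+ 2 = \sum_(j < n) c j ^+ 2.
Proof. by rewrite sqr_sqrtr// sum_sqr_ge0. Qed.

Lemma enorm_ge0 n c : 0 <= enorm n c. Proof. exact: sqrtr_ge0. Qed.

Lemma enorm_le n c (B : R) : 0 <= B -> (enorm n c <= B) = (\sum_(j < n) c j ^+ 2 <= B ^+ 2).
Proof. by move=> B0; rewrite -enorm_sqr ler_pXn2r// nnegrE enorm_ge0. Qed.

Lemma enorm_coef w n : L2 w -> enorm n (fun j => inner w (phi j)) <= nrm w.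
Proof. by move=> Lw; rewrite enorm_le ?nrm_ge0// nrm_sqr; apply: bessel phiL2 phiC _ _ Lw. Qed.

Lemma nrm_le w (B : R) : L2 w -> 0 <= B -> (forall n, enorm n (fun j => inner w (phi j)) <= B) -> nrm w <= B.
Proof.
move=> Lw B0 wB; rewrite -(@ler_pXn2r _ 2)// ?nnegrE ?nrm_ge0// nrm_sqr.
have h := parseval phiL2 phiC Lw Lw; rewrite -(cvg_lim (@Rhausdorff R) h).
apply: limr_le; first by apply/cvg_ex; exists (inner w w).
near=> n; have := wB n; rewrite enorm_le//; under eq_bigr do rewrite expr2.
Unshelve. all: by end_near. Qed.

Lemma L2_coef_eq v w : L2 v -> L2 w -> (forall j, inner v (phi j) = inner w (phi j)) ->
  forall u, L2 u -> inner v u = inner w u.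
Proof.
move=> Lv Lw vw u Lu; have h1 := parseval phiL2 phiC Lv Lu; have h2 := parseval phiL2 phiC Lw Lu.
rewrite -(cvg_lim (@Rhausdorff R) h1) -(cvg_lim (@Rhausdorff R) h2); congr (limn _).
by apply/funext => n; apply: eq_bigr => j _; rewrite vw.
Qed.

(** A total choice of Riesz-Fischer representatives, so that functionals can be defined from
    coefficients before these are known to be square summable. *)
Lemma rf_ex : exists rf : (nat -> R) -> plane -> R, (forall c, L2 (rf c)) /\
  forall c, ell2 c -> forall j, inner (rf c) (phi j) = c j.
Proof.
have h c : exists w, L2 w /\ (ell2 c -> forall j, inner w (phi j) = c j).
  have [hc|hc] := pselect (ell2 c); last by exists (fun=> 0); split => //; exact: L2_0.
  by have [w Lw wc] := riesz_fischer phiL2 phiO hc; exists w.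
by have [rf hrf] := choice h; exists rf; split => c; [have [] := hrf c|have [_] := hrf c].
Qed.

Lemma of_L2_coef g w : eqV Omega (of_L2 Omega w) g -> forall j, inner w (phi j) = g (phi j).
Proof. by move=> wg j; rewrite -wg//; exact: phiV. Qed.

Lemma nL2_ge_coef g n : ((enorm n (fun j => g (phi j)))%:E <= nL2 Omega g)%E.
Proof.
apply: le_ereal_inf_tmp => _ [w [Lw wg] <-]; rewrite norm_L2E// lee_fin.
apply: le_trans (enorm_coef n Lw); rewrite le_eqVlt; apply/orP; left; apply/eqP.
by congr Num.sqrt; apply: eq_bigr => j _; rewrite (of_L2_coef wg).
Qed.

Lemma nL2_ge0 g : (0 <= nL2 Omega g)%E.
Proof. by apply: le_trans (nL2_ge_coef g 0); rewrite lee_fin enorm_ge0. Qed.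

Lemma nL2_le g w (B : R) : L2 w -> eqV Omega (of_L2 Omega w) g -> nrm w <= B -> (nL2 Omega g <= B%:E)%E.
Proof.
move=> Lw wg wB; apply: (@le_trans _ _ (nrm w)%:E); last by rewrite lee_fin.
by apply: ereal_inf_lbound; exists w; rewrite ?norm_L2E.
Qed.

Lemma nL2_fin g : (nL2 Omega g < +oo)%E -> exists2 w, L2 w & eqV Omega (of_L2 Omega w) g.
Proof.
move=> gf; have [[w [Lw wg]]|h] := pselect (exists w, L2 w /\ eqV Omega (of_L2 Omega w) g).
  by exists w.
move: gf; rewrite /nL2 [X in ereal_inf X](_ : _ = set0) ?ereal_inf0//.
by apply/seteqP; split => // x [w hw _]; exfalso; apply: h; exists w.
Qed.

Lemma nL2_D g h : (nL2 Omega g < +oo)%E -> (nL2 Omega h < +oo)%E -> (nL2 Omega (g + h)%R < +oo)%E.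
Proof.
move=> /nL2_fin[v Lv vg] /nL2_fin[w Lw wh].
apply: le_lt_trans (nL2_le (w := fun x => 1 * v x + w x) _ _ (lexx _)) (ltry _); first exact: L2D.
move=> z Vz; rewrite /of_L2 innerD//; [rewrite mul1r|exact: V_L2].
exact: (congr2 +%R (vg z Vz) (wh z Vz)).
Qed.

Lemma nL2_Z (a : R) g : (nL2 Omega g < +oo)%E -> (nL2 Omega (a *: g)%R < +oo)%E.
Proof.
move=> /nL2_fin[v Lv vg].
apply: le_lt_trans (nL2_le (w := fun x => a * v x) _ _ (lexx _)) (ltry _); first exact: L2Z.
move=> z Vz; rewrite /of_L2 innerZ//; [|exact: V_L2].
exact: (congr1 ( *%R a) (vg z Vz)).
Qed.

Definition wcoef (r : R) c j := mu j `^ r * c j.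

Lemma wcoef_sqr r c j : mu j `^ (2 * r) * `|c j| ^+ 2 = wcoef r c j ^+ 2.
Proof.
rewrite /wcoef exprMn real_normK ?num_real//; congr (_ * _).
by rewrite mulrC powRrM powR_mulrn ?powR_ge0.
Qed.

Lemma weighted_norm_ge r c n : ((enorm n (wcoef r c))%:E <= weighted_norm mu r c)%E.
Proof.
have t0 j : (0 <= (mu j `^ (2 * r) * `|c j| ^+ 2)%:E)%E by rewrite lee_fin wcoef_sqr sqr_ge0.
have h : ((\sum_(j < n) wcoef r c j ^+ 2)%:E <= \sum_(0 <= j <oo) (mu j `^ (2 * r) * `|c j| ^+ 2)%:E)%E.
  apply: le_trans (nneseries_lim_ge n _) => //.
  by rewrite sumEFin lee_fin big_mkord; apply: ler_sum => j _; rewrite wcoef_sqr.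
rewrite /weighted_norm /enorm.
have -> : (Num.sqrt (\sum_(j < n) wcoef r c j ^+ 2))%:E = ((\sum_(j < n) wcoef r c j ^+ 2)%:E `^ 2^-1)%E.
  by rewrite poweR_EFin powR12_sqrt// sum_sqr_ge0.
apply: gt0_ler_poweR; rewrite ?invr_ge0// in_itv/= leey andbT ?lee_fin ?sum_sqr_ge0//.
exact: nneseries_ge0.
Qed.

Lemma weighted_norm_le r c (B : R) : 0 <= B -> (forall n, enorm n (wcoef r c) <= B) ->
  (weighted_norm mu r c <= B%:E)%E.
Proof.
move=> B0 h.
have t0 j : (0 <= (mu j `^ (2 * r) * `|c j| ^+ 2)%:E)%E by rewrite lee_fin wcoef_sqr sqr_ge0.
have hs : (\sum_(0 <= j <oo) (mu j `^ (2 * r) * `|c j| ^+ 2)%:E <= (B ^+ 2)%:E)%E.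
  apply: lime_le; first exact: is_cvg_nneseries.
  near=> n; rewrite sumEFin lee_fin big_mkord; have := h n; rewrite enorm_le//.
  by apply: le_trans; apply: ler_sum => j _; rewrite wcoef_sqr.
rewrite /weighted_norm.
have -> : B%:E = ((B ^+ 2)%:E `^ 2^-1)%E.
  by rewrite poweR_EFin -powR_mulrn// -powRrM divff// powRr1.
apply: gt0_ler_poweR => //; rewrite ?invr_ge0// in_itv/= leey andbT ?lee_fin ?exprn_ge0//.
exact: nneseries_ge0.
Unshelve. all: by end_near. Qed.

(** Lower bounds are needed for the data, whose exponent [q / 2] may be negative, so both branches
    of [nDA] are covered. *)
Lemma nDA_ge_coef r g n : ((enorm n (wcoef r (fun j => g (phi j))))%:E <= nDA Omega mu phi r g)%E.
Proof.
apply: le_trans (weighted_norm_ge _ _ _) _; rewrite /nDA; case: ifPn => _.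
  apply: le_ereal_inf_tmp => _ [w [Lw wg] <-]; rewrite /norm_DA.
  by rewrite (_ : (fun j => inner w (phi j)) = fun j => g (phi j))//; apply/funext => j; exact: of_L2_coef.
apply: le_ereal_inf_tmp => _ [h [_ hg] <-].
by rewrite (_ : (fun j => h (phi j)) = fun j => g (phi j))//; apply/funext => j; rewrite hg//; exact: phiV.
Qed.

Lemma nDA_ge0 r g : (0 <= nDA Omega mu phi r g)%E.
Proof. by apply: le_trans (nDA_ge_coef r g 0); rewrite lee_fin enorm_ge0. Qed.

(** Upper bounds concern u and u' only, with exponent [q / 2 + 1 - eps / 2], which is positive when
    [-1 <= q] and [eps < 1]. *)
Lemma nDA_le r g w (B : R) : 0 <= r -> L2 w -> eqV Omega (of_L2 Omega w) g -> 0 <= B ->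
  (forall n, enorm n (wcoef r (fun j => inner w (phi j))) <= B) -> (nDA Omega mu phi r g <= B%:E)%E.
Proof.
move=> r0 Lw wg B0 wB; rewrite /nDA r0.
apply: (@le_trans _ _ (norm_DA Omega mu phi r w)); last exact: weighted_norm_le.
by apply: ereal_inf_lbound; exists w.
Qed.

End Spectral.

(** * Bochner integrals and coordinates *)

(** The larger function [k] is not assumed measurable; it will be the norm of a difference of
    functionals. *)
Lemma ae_ge0_le_integral_sup d (T : measurableType d) (R : realType)
    (m : {measure set T -> \bar R}) (D : set T) (h k : T -> \bar R) :
  measurable D -> measurable_fun D h -> (forall x, D x -> 0 <= h x)%E ->
  (forall x, D x -> 0 <= k x)%E -> {ae m, forall x, D x -> (h x <= k x)%E} ->
  (\int[m]_(x in D) h x <= \int[m]_(x in D) k x)%E.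
Proof.
move=> mD mh h0 k0 [N [mN N0 hN]].
rewrite (ge0_negligible_integral mN mD mh h0 N0) integral_mkcond [leRHS]integral_mkcond.
apply: ge0_le_integral_sup => x _; rewrite !patchE.
  by case: ifPn => // /set_mem[Dx _]; exact: h0.
case: ifPn => [/set_mem[Dx Nx]|_]; last by case: ifPn => // /set_mem Dx; exact: k0.
rewrite mem_set//; apply: contrapT => hk; apply: Nx; apply: hN => /= /(_ Dx).
exact: hk.
Qed.

Section StepEval.
Variables (R : realType) (v : R * R -> R).
Local Notation W := (functional R).
Implicit Types (s : step W).

Definition step_eval s (t : R) : R := step_fun s t v.

Lemma step_evalE s t : step_eval s t = \sum_(i < step_size s) \1_(step_set i) t * step_val i v.
Proof. by rewrite /step_eval /step_fun fct_sumE. Qed.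

Lemma measurable_step_eval (N : W -> \bar R) s (D : set R) : is_step N s -> measurable_fun D (step_eval s).
Proof.
move=> hs; apply: (eq_measurable_fun (fun t => \sum_(i < step_size s) \1_(step_set i) t * step_val i v)).
  by move=> t _; rewrite step_evalE.
apply: measurable_sum => i; apply: measurable_funM; last exact: measurable_cst.
by apply: measurable_indic; have [] := hs i.
Qed.

Lemma step_eval_int (N : W -> \bar R) s (D : set (measurableTypeR R)) : measurable D -> (leb D < +oo)%E -> is_step N s ->
  leb.-integrable D (EFin \o step_eval s) /\
  \int[leb]_(t in D) step_eval s t = step_int D s v.
Proof.
move=> mD fD hs.
have i1 (i : 'I_(step_size s)) : leb.-integrable D (EFin \o (\1_(step_set i) : R -> R)).
  apply: (@integrable_dom _ _ R (@leb R) D mD (\1_(step_set i)) (fun=> 1)).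
  - by apply: measurable_indic; have [] := hs i.
  - exact: integrable_cst_real.
  - by move=> t _; rewrite ger0_norm// indicE; case: (_ \in _).
have ii (i : 'I_(step_size s)) : leb.-integrable D (EFin \o (fun t => step_val i v * \1_(step_set i) t)).
  exact: integrableZ_real.
have Ii (i : 'I_(step_size s)) : \int[leb]_(t in D) (step_val i v * \1_(step_set i) t) =
    fine (leb (D `&` step_set i)) * step_val i v.
  rewrite RintegralZl//.
  rewrite mulrC; congr (_ * _); rewrite /Rintegral integral_indic//; last by have [] := hs i.
  by rewrite setIC.
have h (r : seq 'I_(step_size s)) : leb.-integrable D (EFin \o (fun t => \sum_(i <- r) step_val i v * \1_(step_set i) t)) /\
    \int[leb]_(t in D) (\sum_(i <- r) step_val i v * \1_(step_set i) t) =
    \sum_(i <- r) fine (leb (D `&` step_set i)) * step_val i v.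
  elim: r => [|i r [IH1 IH2]].
    split.
      apply: (@integrable_dom _ _ R (@leb R) D mD _ (fun=> 0)).
      - by under eq_fun do rewrite big_nil; exact: measurable_cst.
      - exact: integrable_cst_real.
      - by move=> t _; rewrite big_nil normr0.
    by rewrite big_nil /Rintegral integral0_eq// => t _; rewrite big_nil.
  split.
    have := integrableD_real mD (ii i) IH1; apply: eq_integrable => // t _.
    by rewrite /= big_cons.
  rewrite big_cons -Ii -IH2 -RintegralD//.
  by apply: eq_Rintegral => t _; rewrite big_cons.
have [h1 h2] := h (index_enum 'I_(step_size s)).
have E t : step_eval s t = \sum_(i < step_size s) step_val i v * \1_(step_set i) t.
  by rewrite step_evalE; apply: eq_bigr => i _; rewrite mulrC.
have {}E : step_eval s = (fun t => \sum_(i < step_size s) step_val i v * \1_(step_set i) t) by apply/funext => t; exact: E.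
split; first by rewrite E.
rewrite (_ : step_int D s v = \sum_(i < step_size s) fine (leb (D `&` step_set i)) * step_val i v).
  by rewrite -h2 E.
by rewrite /step_int fct_sumE.
Qed.

End StepEval.

Section BochnerEval.
Variables (R : realType) (v : R * R -> R).
Local Notation W := (functional R).
Variables (N : W -> \bar R) (N0 : forall g, (0 <= N g)%E).
Hypothesis Nv : forall g, (`|g v|%:E <= N g)%E.

(** Evaluation at [v] is continuous for [N], so the evaluated step functions converge almost
    everywhere; their upper limit is a measurable version. *)
Lemma strongly_measurable_eval (D : set R) (g : R -> W) : strongly_measurable N D g ->
  exists2 gt : R -> R, measurable_fun setT gt & {ae (@leb R), forall t, D t -> g t v = gt t}.
Proof.
move=> [s [hs sc]].
exists (fun t => fine (limn_esup (fun n => (step_eval v (s n) t)%:E))).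
  apply: measurableT_comp; first exact: fine_measurable.
  apply: measurable_fun_limn_esup => n; apply/measurable_EFinP; exact: measurable_step_eval.
move: sc; apply: aeS => t ht Dt; have {}ht := ht Dt.
have h : (step_eval v (s n) t)%:E @[n --> \oo] --> (g t v)%:E.
  apply: cvg_EFin; first by near=> n.
  have h1 : `|g t v - step_eval v (s n) t|%:E @[n --> \oo] --> 0%E.
    apply: (@squeeze_cvge _ _ _ _ (cst 0%E)) ht; last exact: cvg_cst.
    by near=> n; rewrite lee_fin normr_ge0/=; exact: (Nv (g t - step_fun (s n) t)).
  have /norm_cvg0P h2 : `|g t v - step_eval v (s n) t| @[n --> \oo] --> 0 by move/fine_cvg : h1.
  have h3 : g t v - (g t v - step_eval v (s n) t) @[n --> \oo] --> g t v.
    by rewrite -[X in _ --> X]subr0; apply: cvgB => //; exact: cvg_cst.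
  apply: cvg_trans h3; apply: near_eq_cvg; near=> n.
  by rewrite /= opprB addrC subrK.
by rewrite is_cvg_limn_esupE ?(cvg_lim _ h)//; apply/cvg_ex; exists (g t v)%:E.
Unshelve. all: by end_near. Qed.

(** Evaluation commutes with the integral of step functions, hence, being continuous, with the
    Bochner integral. Integrability of [gt] follows from one approximant at finite L1 distance. *)
Lemma bochner_int_eval (D : set (measurableTypeR R)) (g : R -> W) (x : W) (gt : R -> R) :
  measurable D -> (leb D < +oo)%E -> bochner_int N D g x ->
  measurable_fun D gt -> {ae (@leb R), forall t, D t -> g t v = gt t} ->
  leb.-integrable D (EFin \o gt) /\ \int[leb]_(t in D) gt t = x v.
Proof.
move=> mD fD [_ [s [hs sc xc]]] mgt ae_gt.
have si n := step_eval_int v mD fD (hs n).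
have ms n : measurable_fun D (step_eval v (s n)) by exact: measurable_step_eval.
have msB n : measurable_fun D (fun t => `|gt t - step_eval v (s n) t|).
  apply: measurableT_comp; first exact: normr_measurable.
  exact: measurable_funB.
have h n : (\int[leb]_(t in D) (`|gt t - step_eval v (s n) t|)%:E <=
    \int[leb]_(t in D) N (g t - step_fun (s n) t)%R)%E.
  apply: ae_ge0_le_integral_sup => //.
  - by apply/measurable_EFinP; exact: msB.
  - move: ae_gt; apply: aeS => t e Dt; rewrite -e//; exact: (Nv (g t - step_fun (s n) t)).
have hc : (\int[leb]_(t in D) (`|gt t - step_eval v (s n) t|)%:E)%E @[n --> \oo] --> 0%E.
  apply: (@squeeze_cvge _ _ _ _ (cst 0%E)) sc; last exact: cvg_cst.
  by near=> n; rewrite h andbT integral_ge0.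
have /fine_cvgP[hf hc'] := hc.
have iB n : (\int[leb]_(t in D) (`|gt t - step_eval v (s n) t|)%:E)%E \is a fin_num ->
    leb.-integrable D (EFin \o (fun t => gt t - step_eval v (s n) t)).
  move=> fin; apply/integrableP; split.
    by apply/measurable_EFinP; exact: (measurable_funB mgt (ms n)).
  by rewrite ltey_eq fin.
have ig : leb.-integrable D (EFin \o gt).
  have [n fn] := filter_ex hf.
  have := integrableD_real mD (iB n fn) (si n).1; apply: eq_integrable => // t _.
  by rewrite /= subrK.
split => //.
have c1 : \int[leb]_(t in D) gt t - step_int D (s n) v @[n --> \oo] --> 0.
  apply/norm_cvg0P; apply: (@squeeze_cvgr _ _ _ _ (fun=> 0)) hc'; last exact: cvg_cst.
  near=> n; rewrite normr_ge0/= -(si n).2 -RintegralB//; last exact: (si n).1.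
  apply: le_normr_Rintegral => //; apply: iB; near: n; exact: hf.
have c2 : step_int D (s n) v - x v @[n --> \oo] --> 0.
  apply/norm_cvg0P.
  have : `|step_int D (s n) v - x v|%:E @[n --> \oo] --> 0%E.
    apply: (@squeeze_cvge _ _ _ _ (cst 0%E)) xc; last exact: cvg_cst.
    by near=> n; rewrite lee_fin normr_ge0/=; exact: (Nv (step_int D (s n) - x)).
  by move/fine_cvg.
have c : \int[leb]_(t in D) gt t - x v @[n --> \oo] --> 0.
  have c0 : (\int[leb]_(t in D) gt t - step_int D (s n) v) + (step_int D (s n) v - x v) @[n --> \oo] --> 0 + 0.
    exact: cvgD.
  rewrite addr0 in c0; apply: cvg_trans c0; apply: near_eq_cvg; near=> n.
  by rewrite addrA subrK.
apply/eqP; rewrite -subr_eq0; apply/eqP.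
by rewrite -(cvg_lim (@Rhausdorff R) c) lim_cst.
Unshelve. all: by end_near. Qed.

End BochnerEval.

Section BochnerCoords.
Variables (R : realType) (Omega : set (R * R)).
Variables (mu : nat -> R) (phi : nat -> R * R -> R) (hphi : eigenpairs Omega mu phi).
Local Notation W := (functional R).

Lemma enorm_term n (c : nat -> R) j : (j < n)%N -> `|c j| <= enorm n c.
Proof.
move=> jn; rewrite -sqrtr_sqr ler_sqrt ?sum_sqr_ge0// (bigD1 (Ordinal jn))//= lerDl.
by apply: sumr_ge0 => i _; exact: sqr_ge0.
Qed.

Lemma nL2_ge_term (g : W) j : (`|g (phi j)|%:E <= nL2 Omega g)%E.
Proof.
by apply: le_trans (nL2_ge_coef hphi g j.+1); rewrite lee_fin; exact: (@enorm_term j.+1 (fun j => g (phi j))).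
Qed.

Lemma nL2_step_lty (s : step W) t : is_step (nL2 Omega) s -> (nL2 Omega (step_fun s t) < +oo)%E.
Proof.
move=> hs; rewrite /step_fun; elim/big_ind: _ => [|x y|i _]; last 2 first.
- exact: nL2_D.
- by apply: nL2_Z; have [] := hs i.
apply: le_lt_trans (nL2_le (w := fun=> 0) _ _ (lexx _)) (ltry _); first exact: L2_0.
by move=> v Vv; rewrite /of_L2 inner0.
Qed.

Lemma strongly_measurable_ae_lty (T : R) (g : R -> W) : strongly_measurable (nL2 Omega) `]0, T[ g ->
  {ae (@leb R), forall t, `]0, T[%classic t -> (nL2 Omega (g t) < +oo)%E}.
Proof.
move=> [s [hs sc]]; move: sc; apply: aeS => t h Dt.
have /fine_cvgP[hf _] := h Dt; have [n fn] := filter_ex hf.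
rewrite -[g t](subrK (step_fun (s n) t)); apply: nL2_D; last exact: (nL2_step_lty t (hs n)).
by rewrite ltey_eq fn.
Qed.

Variables (T : R) (T0 : 0 < T) (g g1 : R -> W).
Hypothesis H : sobolev1 (nL2 Omega) 1%E T g g1.

(** [G] is the Euclidean norm of the measurable versions [gg] of the coordinates of [g1]. It
    replaces [nL2 (g1 t)], whose measurability in [t] is not assumed, and lies below it at every [t]
    in []0, T[]. *)
Lemma coords_ex : exists (gg : nat -> R -> R) (G : R -> R), [/\
  (forall j, measurable_fun setT (gg j)) /\ measurable_fun setT G,
  leb.-integrable `]0, T[ (EFin \o G),
  forall t, 0 < t < T -> (forall n, enorm n (gg^~ t) <= G t) /\ ((G t)%:E <= nL2 Omega (g1 t))%E,
  {ae (@leb R), forall t, `]0, T[%classic t -> forall j, g1 t (phi j) = gg j t} &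
  forall j s t, 0 <= s -> s <= t -> t <= T ->
    g t (phi j) - g s (phi j) = \int[leb]_(r in `]s, t[) gg j r].
Proof.
have [_ [smg Lg] bi] := H.
have N0 : forall h : W, (0 <= nL2 Omega h)%E by move=> h; exact: (nL2_ge0 hphi).
have hx j : exists x : R -> R, measurable_fun setT x /\
    {ae (@leb R), forall t, `]0, T[%classic t -> g1 t (phi j) = x t}.
  have [x mx ax] := strongly_measurable_eval (fun h => nL2_ge_term h j) smg.
  by exists x.
have [gt hgt] := choice hx.
have all_ae : {ae (@leb R), forall t, forall j, `]0, T[%classic t -> g1 t (phi j) = gt j t}.
  by apply: ae_all => j; have [] := hgt j.
have [N [mN N00 hN]] := aeI all_ae (strongly_measurable_ae_lty smg).
have hN' t : ~ N t -> (forall j, `]0, T[%classic t -> g1 t (phi j) = gt j t) /\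
    (`]0, T[%classic t -> (nL2 Omega (g1 t) < +oo)%E).
  by move=> Nt; apply: contrapT => h; apply: Nt; exact: hN.
(* Vanishing on the null set of bad times makes the bounds on [gg] and [G] hold at every time. *)
pose gg j := gt j \_ (~` N).
have mC : measurable (~` N) by exact: measurableC.
have mgg j : measurable_fun setT (gg j).
  by apply/(measurable_restrictT _ mC); apply: measurable_funTS; have [] := hgt j.
pose S t := (\sum_(0 <= j <oo) (gg j t ^+ 2)%:E)%E.
have mS : measurable_fun setT S.
  have S0 j (x : R) : setT x -> true -> (0 <= (gg j x ^+ 2)%:E)%E by move=> _ _; rewrite lee_fin sqr_ge0.
  apply: (ge0_emeasurable_sum S0) => j _; apply/measurable_EFinP; exact: (measurable_funX 2 (mgg j)).
pose G t := Num.sqrt (fine (S t)).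
have mG : measurable_fun setT G.
  apply: (measurableT_comp (continuous_measurable_fun (@sqrt_continuous R))).
  by apply: measurableT_comp mS; exact: fine_measurable.
have S0 t : (0 <= S t)%E by apply: nneseries_ge0 => j _ _; rewrite lee_fin sqr_ge0.
have SB t (B : R) : (forall n, \sum_(j < n) gg j t ^+ 2 <= B) -> (S t <= B%:E)%E.
  move=> h; apply: lime_le; first by apply: is_cvg_nneseries => j _ _; rewrite lee_fin sqr_ge0.
  by near=> n; rewrite sumEFin lee_fin big_mkord.
have NB t : 0 < t < T -> exists2 B : R, 0 <= B /\ (B%:E <= nL2 Omega (g1 t))%E &
    forall n, enorm n (gg^~ t) <= B.
  move=> tT; have [Nt|Nt] := pselect (N t).
    exists 0; first by split => //; exact: N0.
    move=> n; rewrite enorm_le// big1 ?expr0n// => j _.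
    by rewrite /gg patchE memNset ?expr0n//=; apply.
  have [e l] := hN' t Nt; have tD : `]0, T[%classic t by rewrite /= in_itv.
  have B0 : 0 <= fine (nL2 Omega (g1 t)) by rewrite fine_ge0.
  have BE : (fine (nL2 Omega (g1 t)))%:E = nL2 Omega (g1 t) by rewrite fineK// ge0_fin_numE// l.
  exists (fine (nL2 Omega (g1 t))); first by split => //; rewrite BE.
  move=> n; rewrite -lee_fin BE; apply: le_trans (nL2_ge_coef hphi (g1 t) n).
  rewrite lee_fin le_eqVlt; apply/orP; left; apply/eqP; congr Num.sqrt; apply: eq_bigr => j _.
  by rewrite /gg patchE mem_set// e.
have GP t : 0 < t < T -> (forall n, enorm n (gg^~ t) <= G t) /\ ((G t)%:E <= nL2 Omega (g1 t))%E.
  move=> tT; have [B [B0 BN] hB] := NB t tT.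
  have SE : (S t <= (B ^+ 2)%:E)%E by apply: SB => n; have := hB n; rewrite enorm_le.
  have Sf : S t \is a fin_num by rewrite ge0_fin_numE// (le_lt_trans SE)// ltry.
  split.
    move=> n; rewrite enorm_le ?sqrtr_ge0// sqr_sqrtr ?fine_ge0// -lee_fin fineK//.
    apply: le_trans (nneseries_lim_ge n _); last by move=> j _ _; rewrite lee_fin sqr_ge0.
    by rewrite sumEFin lee_fin big_mkord.
  apply: le_trans BN; rewrite lee_fin -(ger0_norm B0) -sqrtr_sqr ler_wsqrtr//.
  by rewrite -lee_fin fineK.
have iG : leb.-integrable `]0, T[ (EFin \o G).
  apply/integrableP; split; first by apply/measurable_EFinP; exact: measurable_funTS.
  move: Lg; rewrite Lnorm1 => Lg; apply: le_lt_trans Lg.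
  rewrite [leLHS]integral_mkcond; apply: ge0_le_integral_sup => t _.
    by rewrite patchE; case: ifPn.
  rewrite !patchE; case: ifPn => [tD|_]; last exact: abse_ge0.
  have tT : 0 < t < T by move/set_mem: tD; rewrite /= in_itv.
  rewrite !gee0_abs//=; [by have [_ +] := GP t tT|by rewrite lee_fin sqrtr_ge0].
have ae_gg : {ae (@leb R), forall t, `]0, T[%classic t -> forall j, g1 t (phi j) = gg j t}.
  exists N; split => // t /= h; apply: contrapT => Nt; apply: h => Dt j.
  by rewrite /gg patchE mem_set//; have [-> ] := hN' t Nt.
exists gg, G; split => // j s t s0 st tT.
have Dst : `]s, t[ `<=` `]0, T[ by apply: subset_itv; rewrite bnd_simp.
have fst : (leb (`]s, t[%classic : set (measurableTypeR R)) < +oo)%E.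
  by rewrite lebesgue_measure_itv/=; case: ifP => _; rewrite ?ltry// -EFinB ltry.
have [||_ ->//] := bochner_int_eval (fun h => N0 h) (fun h => nL2_ge_term h j) (measurable_oo s t) fst (bi s t s0 st tT) (gt := gg j).
- exact: measurable_funTS.
- by move: ae_gg; apply: aeS => r h Dr; apply: h; exact: Dst.
Unshelve. all: by end_near. Qed.

End BochnerCoords.

(** * Estimates uniform in the number of modes *)

Section EuclideanNorm.
Variable R : realType.
Implicit Types (c d : nat -> R).

Lemma enorm_cs n c d : `|\sum_(j < n) c j * d j| <= enorm n c * enorm n d.
Proof.
rewrite -(@ler_pXn2r _ 2)// ?nnegrE ?mulr_ge0 ?enorm_ge0//.
rewrite exprMn !enorm_sqr real_normK ?num_real//.
apply: le_discr; rewrite ?sum_sqr_ge0// => a.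
have := sum_sqr_ge0 n (fun j => a * c j + d j); congr (0 <= _).
rewrite !mulr_sumr -!big_split/=; apply: eq_bigr => j _; ring.
Qed.

Lemma enormD n c d : enorm n (fun j => c j + d j) <= enorm n c + enorm n d.
Proof.
rewrite enorm_le ?addr_ge0 ?enorm_ge0// sqrrD !enorm_sqr.
have h := le_trans (ler_norm _) (enorm_cs n c d).
have -> : \sum_(j < n) (c j + d j) ^+ 2 = \sum_(j < n) c j ^+ 2 + \sum_(j < n) c j * d j *+ 2 + \sum_(j < n) d j ^+ 2.
  by rewrite -!big_split/=; apply: eq_bigr => j _; ring.
by rewrite lerD2r lerD2l sumrMnl lerMn2r.
Qed.

Lemma enormZ n (a : R) c : enorm n (fun j => a * c j) = `|a| * enorm n c.
Proof.
rewrite /enorm -sqrtr_sqr -sqrtrM ?sqr_ge0//; congr Num.sqrt.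
by rewrite mulr_sumr; apply: eq_bigr => j _; rewrite exprMn.
Qed.

Lemma enorm_mono n c d : (forall j, (j < n)%N -> `|c j| <= `|d j|) -> enorm n c <= enorm n d.
Proof.
move=> h; apply: ler_wsqrtr; apply: ler_sum => j _.
by rewrite -[c j ^+ 2]real_normK ?num_real// -[d j ^+ 2]real_normK ?num_real// lerXn2r ?nnegrE//; exact: h.
Qed.

Lemma enorm_scaled n (a : nat -> R) (b : R) c : (forall j, `|a j| <= b) ->
  enorm n (fun j => a j * c j) <= b * enorm n c.
Proof.
move=> ab; have b0 : 0 <= b by exact: le_trans (normr_ge0 _) (ab 0%N).
rewrite -[b in leRHS]ger0_norm// -enormZ; apply: enorm_mono => j _.
by rewrite !normrM ler_wpM2r// (ger0_norm b0).
Qed.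

(** Pair the vector [a] of integrals with itself: its squared norm is the integral of the inner
    product of [a] with [h], at most [enorm n a] times the integral of [G]. *)
Lemma minkowski_integral dX (X : measurableType dX) (m : {measure set X -> \bar R}) (D : set X)
    n (h : nat -> X -> R) (G : X -> R) : measurable D ->
  (forall j, measurable_fun D (h j)) -> m.-integrable D (EFin \o G) ->
  (forall s, D s -> enorm n (h^~ s) <= G s) ->
  enorm n (fun j => \int[m]_(s in D) h j s) <= \int[m]_(s in D) G s.
Proof.
move=> mD mh iG hG.
have ih (j : 'I_n) : m.-integrable D (EFin \o h j).
  apply: (integrable_dom mD (mh j) iG) => s Ds.
  by apply: le_trans (hG s Ds); exact: (@enorm_term _ n (h^~ s) j).
pose a j := \int[m]_(s in D) h j s.
have IG0 : 0 <= \int[m]_(s in D) G s.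
  by apply: Rintegral_ge0 => s Ds; apply: le_trans (hG s Ds); exact: enorm_ge0.
rewrite -/a; have [->//|a0] := eqVneq (enorm n a) 0.
have ap : 0 < enorm n a by rewrite lt_def a0 enorm_ge0.
rewrite -(ler_pM2l ap) -expr2 enorm_sqr.
have sumI (r : seq 'I_n) : m.-integrable D (EFin \o (fun s => \sum_(j <- r) a j * h j s)) /\
    \int[m]_(s in D) (\sum_(j <- r) a j * h j s) = \sum_(j <- r) a j ^+ 2.
  elim: r => [|j r [IH1 IH2]].
    split.
      have := integrableZ_real mD 0 iG; apply: eq_integrable => // s _.
      by rewrite /= big_nil mul0r.
    by rewrite big_nil /Rintegral integral0_eq// => s _; rewrite big_nil.
  split.
    have := integrableD_real mD (integrableZ_real mD (a j) (ih j)) IH1.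
    by apply: eq_integrable => // s _; rewrite /= big_cons.
  rewrite big_cons -IH2 expr2 -[X in _ = X * _ + _]/(a j) -{2}/(a j).
  rewrite -RintegralZl// -RintegralD//; first by apply: eq_Rintegral => s _; rewrite big_cons.
  exact: integrableZ_real.
have [h1 <-] := sumI (index_enum 'I_n).
rewrite -RintegralZl//; apply: le_Rintegral => //; first exact: integrableZ_real.
move=> s Ds; apply: le_trans (ler_norm _) _.
apply: le_trans (enorm_cs n a (h^~ s)) _.
by rewrite ler_wpM2l ?enorm_ge0//; exact: hG.
Qed.

Lemma minkowski_conv n (k h : nat -> R -> R) (c G : R -> R) (t : R) :
  (forall j, measurable_fun `]0, t[ (k j)) -> (forall j, measurable_fun `]0, t[ (h j)) ->
  (forall j r, 0 < r < t -> `|k j r| <= c r) ->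
  leb.-integrable `]0, t[ (EFin \o (fun s => c (t - s) * G s)) ->
  (forall s, 0 < s < t -> enorm n (h^~ s) <= G s) ->
  enorm n (fun j => conv (k j) (h j) t) <= conv c G t.
Proof.
move=> mk mh kc iG hG.
apply: minkowski_integral => //.
- by move=> j; exact: measurable_funM (measurable_reflect (mk j)) (mh j).
- move=> s /=; rewrite in_itv/= => /andP[s0 st].
  have ts : 0 < t - s < t by rewrite subr_gt0 st gtrBl.
  apply: le_trans (enorm_scaled n (h^~ s) (b := c (t - s)) _) _; first by move=> j; exact: kc.
  rewrite ler_wpM2l//; first by apply: le_trans (normr_ge0 _) (kc 0%N _ ts).
  by apply: hG; rewrite s0.
Qed.

End EuclideanNorm.

Lemma integrable_oo_sub (R : realType) (a b c d : R) (f : R -> R) : a <= c -> d <= b ->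
  leb.-integrable `]a, b[ (EFin \o f) -> leb.-integrable `]c, d[ (EFin \o f).
Proof.
move=> ac db; apply: integrableS; [exact: measurable_oo|exact: measurable_oo|].
by apply: subset_itv; rewrite bnd_simp.
Qed.

Lemma integral_shrink_cvg0 (R : realType) (c T t : R) (g : R -> R) (a b : nat -> R) :
  leb.-integrable `]c, T[ (EFin \o g) -> (forall n, c <= a n) -> (forall n, b n <= T) ->
  a n @[n --> \oo] --> t -> b n @[n --> \oo] --> t ->
  \int[leb]_(s in `]a n, b n[) g s @[n --> \oo] --> 0.
Proof.
move=> ig a0 bT ac bc.
have mg : measurable_fun `]c, T[ g by case/integrableP : ig => /measurable_EFinP.
pose u n := g \_ `]a n, b n[.
have sub n : `]a n, b n[ `<=` `]c, T[ by apply: subset_itv; rewrite bnd_simp.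
have [|||||_] := @cvg_Rintegral_dominated _ _ R leb `]c, T[%classic u (fun=> 0) (fun s => `|g s|) (measurable_oo c T).
- move=> n; apply/(measurable_restrict _ (measurable_oo (a n) (b n)) (measurable_oo c T)).
  apply: measurable_funS mg; first exact: measurable_oo.
  exact: subIsetl.
- exact: measurable_cst.
- exact: integrable_norm ig.
- exists [set t]; split => [||s /= h]; [exact: measurable_set1|exact: lebesgue_measure_set1|].
  apply: contrapT => st; apply: h => sT.
  have ne : \forall n \near \oo, u n s = 0.
    have [ts|ts|ts] := ltgtP s t; last by exfalso; apply: st.
    - have : \forall n \near \oo, s < a n by exact: (cvgr_gt _ ac).
      apply: filterS => n sa; rewrite /u patchE memNset//= in_itv/= => /andP[].
      by rewrite ltNge (ltW sa).
    - have : \forall n \near \oo, b n < s by exact: (cvgr_lt _ bc).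
      apply: filterS => n sa; rewrite /u patchE memNset//= in_itv/= => /andP[_].
      by rewrite ltNge (ltW sa).
  have z0 : (fun=> 0 : R) n @[n --> \oo] --> (0 : R) by exact: cvg_cst.
  by apply: cvg_trans z0; apply: near_eq_cvg; apply: filterS ne => n ->.
- by move=> n s _; rewrite /u patchE; case: ifPn => // _; rewrite normr0.
rewrite Rintegral_cst//= mul0r => H; apply: cvg_trans H; apply: near_eq_cvg; near=> n.
by rewrite /u -Rintegral_mkcondr; congr Rintegral; apply/setIidPr.
Unshelve. all: by end_near. Qed.

Lemma enorm0 (R : realType) n : enorm n (fun=> 0 : R) = 0.
Proof. by rewrite /enorm big1 ?sqrtr0// => j _; rewrite expr0n. Qed.

(** * Bounds for finitely many modes at once *)

Section VectorModes.
Variable R : realType.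
Variables (al T : R) (al0 : 0 < al) (al1 : al < 1) (T0 : 0 < T).
Variables (a0 : R) (a0_gt0 : 0 < a0) (mu : nat -> R) (mu_gt0 : forall j, 0 < mu j).
Variables (f fp gg : nat -> R -> R) (G : R -> R) (F Fp : R).
Hypotheses (mgg : forall j, measurable_fun `]0, T[ (gg j))
  (iG : leb.-integrable `]0, T[ (EFin \o G))
  (gG : forall n s, 0 < s < T -> enorm n (gg^~ s) <= G s)
  (fE : forall j t, 0 <= t <= T -> f j t = f j 0 + \int[leb]_(s in `]0, t[) fp j s)
  (fpE : forall j t, 0 < t <= T -> fp j t = fp j 0 + \int[leb]_(s in `]0, t[) gg j s)
  (fF : forall n t, 0 <= t <= T -> enorm n (f^~ t) <= F)
  (fpF : forall n t, 0 <= t <= T -> enorm n (fp^~ t) <= Fp).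
Implicit Types (s t : R) (n j : nat).

Local Notation k j := (ker al a0 (mu j)).
Local Notation a := (akern al a0).

Definition vmode t j := mode al a0 (mu j) (f j) t.
Definition vmode1 t j := mode1 al a0 (mu j) (f j) (fp j) t.
Definition vmode2 t j := mode2 al a0 (mu j) (f j) (fp j) (gg j) t.

Lemma gg_integrable j : leb.-integrable `]0, T[ (EFin \o gg j).
Proof.
apply: (integrable_dom (measurable_oo 0 T) (mgg j) iG) => s /=; rewrite in_itv/= => sT.
by apply: le_trans (gG j.+1 sT); exact: (@enorm_term _ j.+1 (gg^~ s)).
Qed.

Lemma fp_measurable j : measurable_fun `]0, T[ (fp j).
Proof. exact: primitive_measurable (gg_integrable j) (fpE j). Qed.

Lemma fp_powb j : exists P, powb 1 P T (fp j).
Proof. by eexists; exact: (primitive_powb (gg_integrable j) (fpE j)). Qed.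

Lemma fp_integrable j : leb.-integrable `]0, T[ (EFin \o fp j).
Proof.
apply: (@integrable_dom _ _ R leb _ (measurable_oo 0 T) (fp j) (fun=> Fp) (fp_measurable j)).
  by apply: integrable_cst_real; [exact: measurable_oo|rewrite /= lebesgue_measure_itv/= lte_fin T0 sube0 ltry].
move=> s /=; rewrite in_itv/= => /andP[/ltW s0 /ltW sT].
have sT' : 0 <= s <= T by rewrite s0.
by apply: le_trans (fpF j.+1 sT'); exact: (@enorm_term _ j.+1 (fp^~ s)).
Qed.

Lemma f_measurable j : measurable_fun `]0, T[ (f j).
Proof.
by apply: (primitive_measurable (fp_integrable j)) => t /andP[/ltW t0 tT]; apply: fE; rewrite t0.
Qed.

Lemma mk j D : measurable_fun D (k j). Proof. exact: measurable_ker. Qed.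

Lemma ker_abs_le j r t : 0 < r < t -> `|k j r| <= a r.
Proof. by move=> /andP[r0 _]; rewrite ger0_norm ?(ltW (ker_gt0 _ _ _ _ _))// ker_le. Qed.

Lemma F_ge0 : 0 <= F.
Proof. by apply: le_trans (enorm_ge0 0 (f^~ 0)) (fF _ _); rewrite lexx ltW. Qed.

Lemma Fp_ge0 : 0 <= Fp.
Proof. by apply: le_trans (enorm_ge0 0 (fp^~ 0)) (fpF _ _); rewrite lexx ltW. Qed.

Lemma minkowski_integral_ae n (t0 t : R) (h : nat -> R -> R) (H : R -> R) :
  (forall j, measurable_fun `]t0, t[ (h j)) -> leb.-integrable `]t0, t[ (EFin \o H) ->
  (forall s, t0 < s < t -> 0 <= H s) ->
  {ae (@leb R), forall s, `]t0, t[%classic s -> enorm n (h^~ s) <= H s} ->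
  enorm n (fun j => \int[leb]_(s in `]t0, t[) h j s) <= \int[leb]_(s in `]t0, t[) H s.
Proof.
move=> mh iH H0 [N [mN N0 hN]].
have mC : measurable (~` N) by exact: measurableC.
pose h' j := h j \_ (~` N).
have mh' j : measurable_fun `]t0, t[ (h' j).
  apply/(measurable_restrict _ mC (measurable_oo t0 t)).
  by apply: measurable_funS (mh j); [exact: measurable_oo|exact: subIsetl].
have -> : (fun j => \int[leb]_(s in `]t0, t[) h j s) = (fun j => \int[leb]_(s in `]t0, t[) h' j s).
  apply/funext => j; rewrite /Rintegral; congr fine; apply: ae_eq_integral.
  - exact: measurable_oo.
  - by apply/measurable_EFinP; exact: mh.
  - by apply/measurable_EFinP; exact: mh'.
  - exists N; split => // s /= e; apply: contrapT => Ns; apply: e => _.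
    by rewrite /h' patchE mem_set.
apply: minkowski_integral => //.
move=> s st; have [Ns|Ns] := pselect (N s).
  rewrite (_ : h'^~ s = fun=> 0); last by apply/funext => j; rewrite /h' patchE memNset//=; apply.
  by rewrite enorm0 H0//; move: st; rewrite /= in_itv.
rewrite (_ : h'^~ s = h^~ s); last by apply/funext => j; rewrite /h' patchE mem_set.
by apply: contrapT => e; apply: Ns; apply: hN => /= h1; apply: e; exact: h1.
Qed.

Lemma enorm_conv_ae n (kk x : nat -> R -> R) (c : R -> R) (B t : R) : 0 <= B ->
  (forall j, measurable_fun `]0, t[ (kk j)) -> (forall j, measurable_fun `]0, t[ (x j)) ->
  (forall j r, 0 < r < t -> `|kk j r| <= c r) -> leb.-integrable `]0, t[ (EFin \o c) ->
  {ae (@leb R), forall s, `]0, t[%classic s -> enorm n (x^~ s) <= B} ->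
  enorm n (fun j => conv (kk j) (x j) t) <= B * \int[leb]_(s in `]0, t[) c s.
Proof.
move=> B0 mkk mx kc ic xB.
have ict := integrable_itv_reflect ic.
have -> : B * \int[leb]_(s in `]0, t[) c s = \int[leb]_(s in `]0, t[) (B * c (t - s)).
  rewrite (RintegralZl B (measurable_oo 0 t) ict); congr (_ * _).
  rewrite /Rintegral; congr fine; apply: (@integral_itv_reflect R (EFin \o c) t).
  by case/integrableP : ic.
have ts s : 0 < s < t -> 0 < t - s < t by move=> /andP[s0 st]; rewrite subr_gt0 st gtrBl.
apply: minkowski_integral_ae.
- by move=> j; exact: measurable_funM (measurable_reflect (mkk j)) (mx j).
- exact: (@integrableZ_real _ _ R leb _ (measurable_oo 0 t) B (fun s => c (t - s)) ict).
- by move=> s /ts st; rewrite mulr_ge0//; exact: le_trans (normr_ge0 _) (kc 0%N _ st).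
- move: xB; apply: aeS => s xB; rewrite /= in_itv/= => st.
  have kB j : `|kk j (t - s)| <= c (t - s) by exact/kc/ts.
  apply: le_trans (enorm_scaled n (x^~ s) kB) _.
  rewrite mulrC ler_wpM2r//; last by apply: xB; rewrite /= in_itv.
  exact: le_trans (normr_ge0 _) (kB 0%N).
Qed.

Lemma fractional_estimate (r eps t B : R) (x : nat -> R -> R) n : 0 < eps < 1 -> 0 < t <= T -> 0 <= B ->
  (forall j, measurable_fun `]0, T[ (x j)) -> (forall j, exists P, powb 1 P T (x j)) ->
  {ae (@leb R), forall s, `]0, t[%classic s -> enorm n (wcoef mu r (x^~ s)) <= B} ->
  enorm n (wcoef mu (r + 1 - eps / 2) (fun j => conv (k j) (x j) t)) <=
    (1 + a0) * 2 / al * (eps^-1 * t `^ (al * eps / 2) * B).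
Proof.
move=> /andP[e0 e1] /andP[t0 tT] B0 mx xb hB.
(* The weight [mu^(r + 1 - eps/2)] is shared out as [mu^th] on the kernel, for [ker_interp], and
   [mu^r] on the data. *)
pose th := 1 - eps / 2.
have th01 : 0 <= th <= 1 by rewrite /th; lra.
have b0 : 0 < al * eps / 2 by rewrite divr_gt0// mulr_gt0.
have tt : 0 < t <= t by rewrite t0 lexx.
have E j : wcoef mu (r + 1 - eps / 2) (fun j => conv (k j) (x j) t) j =
    conv (fun s => mu j `^ th * k j s) (fun s => wcoef mu r (x^~ s) j) t.
  have [P xP] := xb j; have [M _ kM] := ker_powb_ex al0 a0 (mu j) t0.
  have ikx : leb.-integrable `]0, t[ (EFin \o (fun s => k j (t - s) * x j s)).
    have mxt := measurable_itvS tT (mx j).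
    have mkt := mk j (D := `]0, t[%classic).
    exact: (powb_conv_integrable mkt mxt al0 ltr01 kM (powb_mono tT xP) tt).
  rewrite /wcoef convZl; last exact: integrable_convZr.
  rewrite convZr// mulrA; congr (_ * _).
  by rewrite -powR_addr ?mu_gt0//; congr (_ `^ _); rewrite /th; ring.
have -> : wcoef mu (r + 1 - eps / 2) (fun j => conv (k j) (x j) t) =
    (fun j => conv (fun s => mu j `^ th * k j s) (fun s => wcoef mu r (x^~ s) j) t).
  by apply/funext => j; exact: E.
have ic : leb.-integrable `]0, t[ (EFin \o (fun s => (1 + a0) * s `^ (al * eps / 2 - 1))).
  apply: integrableZ_real; first exact: measurable_oo.
  exact: integrable_powR b0 (ltW t0).
apply: le_trans (enorm_conv_ae B0 _ _ _ ic hB) _.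
- by move=> j; apply: measurable_funM; [exact: measurable_cst|exact: mk].
- by move=> j; apply: measurable_funM; [exact: measurable_cst|exact: measurable_itvS tT (mx j)].
- move=> j s /andP[s0 st]; rewrite ger0_norm; last first.
    by rewrite mulr_ge0 ?powR_ge0// ltW// ker_gt0.
  apply: le_trans (ker_interp al0 al1 a0_gt0 (mu_gt0 j) th01 s0) _.
  rewrite le_eqVlt; apply/orP; left; apply/eqP; congr (_ * _ `^ _); rewrite /th; ring.
rewrite RintegralZl//; last exact: integrable_powR b0 (ltW t0).
rewrite /Rintegral integral_powR// ?(ltW t0)//=.
rewrite le_eqVlt; apply/orP; left; apply/eqP; field.
by rewrite !gt_eqF.
Qed.

Lemma akern_integrable t : 0 < t -> leb.-integrable `]0, t[ (EFin \o a).
Proof.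
move=> t0; apply: integrableZ_real; first exact: measurable_oo.
exact: integrable_powR al0 (ltW t0).
Qed.

Lemma akern_int t : 0 < t -> \int[leb]_(s in `]0, t[) a s = a0 / al * t `^ al.
Proof.
move=> t0; rewrite /akern RintegralZl//; last exact: integrable_powR al0 (ltW t0).
by rewrite /Rintegral integral_powR// ?(ltW t0)//= mulrAC mulrA.
Qed.

Lemma vmode_le n t : 0 < t <= T -> enorm n (vmode t) <= F * (a0 / al * t `^ al).
Proof.
move=> /andP[t0 tT]; rewrite -akern_int//.
apply: (@enorm_conv_ae n (fun j => k j) f a F t F_ge0).
- by move=> j; exact: mk.
- by move=> j; exact: measurable_itvS tT (f_measurable j).
- by move=> j r; exact: ker_abs_le.
- exact: akern_integrable.
- apply: aeW => s; rewrite /= in_itv/= => /andP[s0 st].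
  by apply: fF; rewrite ltW//= (le_trans (ltW st)).
Qed.

Lemma enorm_ker_scaled n t c : 0 < t -> enorm n (fun j => c j * k j t) <= enorm n c * a t.
Proof.
move=> t0; rewrite mulrC; under [X in enorm n X]funext do rewrite mulrC.
apply: enorm_scaled => j; apply: (@ker_abs_le j t (t + 1)).
by rewrite t0 ltrDl ltr01.
Qed.

Lemma vmode1_le n t : 0 < t <= T ->
  enorm n (vmode1 t) <= Fp * (a0 / al * t `^ al) + F * a t.
Proof.
move=> /andP[t0 tT]; apply: le_trans (enormD _ _ _) _; apply: lerD.
  rewrite -akern_int//; apply: (@enorm_conv_ae n (fun j => k j) fp a Fp t Fp_ge0).
  - by move=> j; exact: mk.
  - by move=> j; exact: measurable_itvS tT (fp_measurable j).
  - by move=> j r; exact: ker_abs_le.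
  - exact: akern_integrable.
  - apply: aeW => s; rewrite /= in_itv/= => /andP[s0 st].
    by apply: fpF; rewrite ltW//= (le_trans (ltW st)).
apply: le_trans (enorm_ker_scaled n _ t0) _.
rewrite ler_wpM2r//; first by rewrite mulr_ge0 ?powR_ge0// ltW.
by apply: fF; rewrite lexx ltW.
Qed.

(* At such t the convolution of t^(al-1) with |f''| converges; almost every t qualifies (good_ae). *)
Definition good t := leb.-integrable `]0, t[ (EFin \o (fun s => (t - s) `^ (al - 1) * G s)).

Lemma enorm_convG n (kk : nat -> R -> R) (c t : R) : t <= T -> good t ->
  (forall j, measurable_fun `]0, t[ (kk j)) ->
  (forall j r, 0 < r < t -> `|kk j r| <= c * r `^ (al - 1)) ->
  enorm n (fun j => conv (kk j) (gg j) t) <= conv (fun s => c * s `^ (al - 1)) G t.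
Proof.
move=> tT gt mkk kc.
apply: (@minkowski_conv _ n kk gg (fun s => c * s `^ (al - 1)) G t) => //.
- by move=> j; exact: measurable_itvS tT (mgg j).
- have := integrableZ_real (measurable_oo 0 t) c gt; apply: eq_integrable; first exact: measurable_oo.
  by move=> s _; rewrite /= mulrA.
- by move=> s /andP[s0 st]; apply: gG; rewrite s0 (lt_le_trans st).
Qed.

Lemma vmode2_le n t : 0 < t <= T -> good t ->
  enorm n (vmode2 t) <= conv a G t + enorm n (fp^~ 0) * a t +
    enorm n (f^~ 0) * (6 * a0 * t `^ (al - 2)).
Proof.
move=> /andP[t0 tT] gt.
apply: le_trans (enormD _ _ _) _; apply: lerD; last first.
  rewrite mulrC; under [X in enorm n X]funext do rewrite mulrC.
  apply: enorm_scaled => j; rewrite normrM normfV (gtr0_norm t0) ler_pdivrMr//.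
  apply: le_trans (wker_bound al0 al1 a0_gt0 (mu_gt0 j) t0) _.
  have -> : t `^ (al - 1) = t `^ (al - 2) * t; last by rewrite mulrA.
  by rewrite -[X in _ * X](powRr1 (ltW t0)) -powR_addr//; congr (_ `^ _); ring.
apply: le_trans (enormD _ _ _) _; apply: lerD; last exact: enorm_ker_scaled.
apply: enorm_convG => //; first by move=> j; exact: mk.
by move=> j r; exact: ker_abs_le.
Qed.

Lemma vquot_le n t h : 0 < h <= t / 2 -> t <= T -> good t ->
  enorm n (fun j => (vmode1 t j - vmode1 (t - h) j) / h) <=
  conv (fun s => 2 * (a0 / al + a0) * s `^ (al - 1)) G t +
  Fp * (2 * (a0 / al + a0) * t `^ (al - 1)) + F * (6 * a0 * (t / 2) `^ (al - 2)).
Proof.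
move=> /andP[h0 ht] tT gt; have t0 : 0 < t by lra.
have ht' : 0 < h < t by lra.
have -> : (fun j => (vmode1 t j - vmode1 (t - h) j) / h) =
   (fun j => conv (kquot al a0 (mu j) h) (gg j) t + fp j 0 * kquot al a0 (mu j) h t +
      f j 0 * ker_quot al a0 (mu j) h t).
  by apply/funext => j; exact: (mode1_quot al0 al1 a0_gt0 (mu_gt0 j) T0 (f j) (gg_integrable j) (fpE j) ht' tT).
have kq j r : 0 < r -> `|kquot al a0 (mu j) h r| <= 2 * (a0 / al + a0) * r `^ (al - 1).
  move=> r0; have /andP[kq0 kq1] := kquot_le al0 al1 a0_gt0 (mu_gt0 j) r0 h0.
  by rewrite ger0_norm.
apply: le_trans (enormD _ _ _) _; apply: lerD; last first.
  under [X in enorm n X]funext do rewrite mulrC.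
  have kb j : `|ker_quot al a0 (mu j) h t| <= 6 * a0 * (t / 2) `^ (al - 2).
    by apply: ker_quot_le => //; rewrite h0.
  apply: le_trans (enorm_scaled n (f^~ 0) kb) _.
  rewrite mulrC ler_wpM2r//; first exact: le_trans (normr_ge0 _) (kb 0%N).
  by apply: fF; rewrite lexx ltW.
apply: le_trans (enormD _ _ _) _; apply: lerD; last first.
  under [X in enorm n X]funext do rewrite mulrC.
  apply: le_trans (enorm_scaled n (fp^~ 0) (fun j => kq j t t0)) _.
  rewrite mulrC ler_wpM2r//; first exact: le_trans (normr_ge0 _) (kq 0%N t t0).
  by apply: fpF; rewrite lexx ltW.
apply: enorm_convG => //.
- by move=> j; apply: measurable_kquot.
- by move=> j r /andP[r0 _]; exact: kq.
Qed.

(** A cruder form of [vmode2_le], with uniform constants for the initial data. It serves square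
    summability, differentiability and Bochner integrability; the stated estimate of u'' uses
    [vmode2_le]. *)
Definition vmode2_bound t := conv a G t + Fp * a t + F * (6 * a0 * t `^ (al - 2)).

Lemma G_ge0 s : 0 < s < T -> 0 <= G s.
Proof. by move=> sT; apply: le_trans (enorm_ge0 0 _) (gG 0 sT). Qed.

Lemma vmode2_bound_ge0 t : 0 < t <= T -> 0 <= vmode2_bound t.
Proof.
move=> /andP[t0 tT]; rewrite /vmode2_bound !addr_ge0//.
- apply: Rintegral_ge0 => s /=; rewrite in_itv/= => /andP[s0 st].
  rewrite mulr_ge0 ?G_ge0 ?s0 ?(lt_le_trans st)//.
  by rewrite mulr_ge0 ?powR_ge0// ltW.
- by rewrite mulr_ge0 ?Fp_ge0// mulr_ge0 ?powR_ge0// ltW.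
- by rewrite mulr_ge0 ?F_ge0// !mulr_ge0 ?powR_ge0// ltW.
Qed.

Lemma vmode2_bound_integrable (d : R) : 0 < d -> leb.-integrable `]d, T[ (EFin \o vmode2_bound).
Proof.
move=> d0.
have sub : `]d, T[ `<=` `]0, T[ by apply: subset_itvr; rewrite bnd_simp ltW.
have S g := @integrableS _ _ R leb `]0, T[ `]d, T[ g (measurable_oo 0 T) (measurable_oo d T) sub.
have [Td|dT] := leP T d.
  by rewrite set_itv_ge ?bnd_simp -?leNgt//; exact: integrable_set0.
apply: integrableD_real; first exact: measurable_oo.
  apply: integrableD_real; first exact: measurable_oo.
    by apply: S; apply: integrable_conv => //; exact: akern_integrable.
  by apply: integrableZ_real; [exact: measurable_oo|apply: S; exact: akern_integrable].
apply: integrableZ_real; first exact: measurable_oo.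
apply: integrableZ_real; first exact: measurable_oo.
apply: (@integrable_dom _ _ R leb _ (measurable_oo d T) _ (fun=> d `^ (al - 2))).
- exact: measurable_powRl.
- by apply: integrable_cst_real; [exact: measurable_oo|rewrite /= lebesgue_measure_itv/= lte_fin dT -EFinD ltry].
- move=> s /=; rewrite in_itv/= => /andP[ds _]; rewrite ger0_norm ?powR_ge0//.
  have al2 : al - 2 <= 0 by move: al1; lra.
  by apply: le_powRN => //; exact: ltW.
Qed.

Lemma good_ae : {ae (@leb R), forall t, `]0, T[%classic t -> good t}.
Proof. exact: ae_conv_integrable (integrable_powR al0 (ltW T0)) iG. Qed.

Lemma vmode2_le_bound n t : 0 < t <= T -> good t -> enorm n (vmode2 t) <= vmode2_bound t.
Proof.
move=> tT gt; have t0 : 0 < t by case/andP: tT.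
apply: le_trans (vmode2_le n tT gt) _; rewrite /vmode2_bound lerD//.
  by rewrite lerD// ler_wpM2r ?mulr_ge0 ?powR_ge0 ?(ltW a0_gt0)// fpF// lexx ltW.
by rewrite ler_wpM2r ?mulr_ge0 ?powR_ge0 ?(ltW a0_gt0)// fF// lexx ltW.
Qed.

Lemma vmode1B_le n s t : 0 < s -> s <= t -> t <= T ->
  enorm n (fun j => vmode1 t j - vmode1 s j) <= \int[leb]_(r in `]s, t[) vmode2_bound r.
Proof.
move=> s0 st tT.
have -> : (fun j => vmode1 t j - vmode1 s j) = (fun j => \int[leb]_(r in `]s, t[) vmode2 r j).
  apply/funext => j.
  exact: (mode1_primitive al0 a0 (mu j) T0 (f j) (gg_integrable j) (fpE j) s0 st tT).
have sub : `]s, t[ `<=` `]s, T[ by apply: subset_itvl; rewrite bnd_simp.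
have sub0 : `]s, t[ `<=` `]0, T[ by apply: subset_itv; rewrite bnd_simp// ltW.
have st0 r : s < r < t -> 0 < r < T by move=> /andP[sr rt]; rewrite (lt_trans s0)//= (lt_le_trans rt).
apply: (@minkowski_integral_ae n s t (fun j r => vmode2 r j)).
- move=> j; have := measurable_mode2 al0 a0 (mu j) T0 (f j) (fp j) (gg_integrable j).
  by apply: measurable_funS => //; exact: measurable_oo.
- by apply: integrableS (vmode2_bound_integrable s0) => //; exact: measurable_oo.
- by move=> r /st0/andP[r0 rT]; rewrite vmode2_bound_ge0// r0 ltW.
- move: good_ae; apply: aeS => r gr; rewrite /= in_itv/= => /st0 rT.
  apply: vmode2_le_bound; first by case/andP: rT => -> /ltW.
  by apply: gr; rewrite /= in_itv.
Qed.

Lemma vmode1_measurable j : measurable_fun `]0, T[ (vmode1^~ j).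
Proof.
apply: measurable_funD; last by apply: measurable_funM; [exact: measurable_cst|exact: mk].
by apply: measurable_conv; [exact: mk|exact: fp_measurable].
Qed.

Lemma vmode1_integrable j : leb.-integrable `]0, T[ (EFin \o vmode1^~ j).
Proof.
have ia := akern_integrable T0.
apply: (@integrable_dom _ _ R leb _ (measurable_oo 0 T) _ (fun t => Fp * (a0 / al * T `^ al) + F * a t) (vmode1_measurable j)).
  apply: integrableD_real; first exact: measurable_oo.
    by apply: integrable_cst_real; [exact: measurable_oo|rewrite /= lebesgue_measure_itv/= lte_fin T0 -EFinD ltry].
  by apply: integrableZ_real => //; exact: measurable_oo.
move=> t /=; rewrite in_itv/= => /andP[t0 /ltW tT].
have tT' : 0 < t <= T by rewrite t0.
apply: le_trans (@enorm_term _ j.+1 (vmode1 t) j _) _ => //.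
apply: le_trans (vmode1_le _ tT') _; rewrite lerD2r ler_wpM2l ?Fp_ge0//.
rewrite ler_wpM2l ?divr_ge0 ?(ltW a0_gt0) ?(ltW al0)//.
by apply: ge0_ler_powR => //; rewrite ?nnegrE; exact: ltW.
Qed.

Lemma vmode_primitive j t : 0 < t <= T -> vmode t j = \int[leb]_(r in `]0, t[) vmode1 r j.
Proof.
move=> tT; have [P fpb] := fp_powb j.
exact: (mode_primitive al0 a0 (mu j) T0 (fp_measurable j) fpb (fE j) tT).
Qed.

Lemma vmodeB j s t : 0 < s -> s <= t -> t <= T ->
  vmode t j - vmode s j = \int[leb]_(r in `]s, t[) vmode1 r j.
Proof.
move=> s0 st tT; have t0 : 0 < t by exact: lt_le_trans st.
rewrite !vmode_primitive ?s0 ?t0 ?(le_trans st)//.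
rewrite (@Rintegral_oo_split _ _ 0 s t) ?(ltW s0)//; first by rewrite addrAC subrr add0r.
exact: integrable_oo_sub (lexx 0) tT (vmode1_integrable j).
Qed.

(** The left side is the mean of [vmode1 z - vmode1 r] over [z] in []s, t[]. Letting [r] be either
    end point gives right and left difference quotients at once. *)
Lemma vmode_quot_le n s t (r : R) : 0 < s -> s < t -> t <= T -> s <= r <= t ->
  enorm n (fun j => (vmode t j - vmode s j) / (t - s) - vmode1 r j) <= \int[leb]_(z in `]s, t[) vmode2_bound z.
Proof.
move=> s0 st tT /andP[sr rt]; have ts : 0 < t - s by rewrite subr_gt0.
have sub : `]s, t[ `<=` `]0, T[ by apply: subset_itv; rewrite bnd_simp// ltW.
have mst := measurable_oo s t.
have iZ : leb.-integrable `]s, t[ (EFin \o vmode2_bound).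
  exact: integrable_oo_sub (lexx s) tT (vmode2_bound_integrable s0).
have i1 j : leb.-integrable `]s, t[ (EFin \o vmode1^~ j).
  by apply: integrableS (vmode1_integrable j) => //; exact: measurable_oo.
have fl : (leb `]s, t[ < +oo :> \bar R)%E by rewrite lebesgue_measure_itv/= lte_fin st -EFinD ltry.
have lst : fine (leb `]s, t[ : \bar R) = t - s by rewrite lebesgue_measure_itv/= lte_fin st.
have E j : (vmode t j - vmode s j) / (t - s) - vmode1 r j =
    (t - s)^-1 * \int[leb]_(z in `]s, t[) (vmode1 z j - vmode1 r j).
  rewrite RintegralB//; last exact: integrable_cst_real.
  rewrite Rintegral_cst// lst vmodeB ?(ltW st)//.
  by rewrite mulrBr mulrC mulrCA mulVf ?gt_eqF// mulr1.
under [X in enorm n X]funext do rewrite E.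
rewrite enormZ ger0_norm ?invr_ge0 ?(ltW ts)// mulrC ler_pdivrMr//.
set c := (leRHS).
have -> : c = \int[leb]_(_ in `]s, t[) (\int[leb]_(z in `]s, t[) vmode2_bound z).
  by rewrite Rintegral_cst// lst.
apply: minkowski_integral => //.
- move=> j; apply: measurable_funB; last exact: measurable_cst.
  by apply: measurable_funS (vmode1_measurable j); [exact: measurable_oo|].
- exact: integrable_cst_real.
move=> z /=; rewrite in_itv/= => /andP[sz zt].
have Zmono x y : s <= x -> x <= y -> y <= t ->
    \int[leb]_(v in `]x, y[) vmode2_bound v <= \int[leb]_(v in `]s, t[) vmode2_bound v.
  move=> sx xy yt; have mxy := measurable_oo x y.
  have Z0 v : s < v < t -> 0 <= vmode2_bound v.
    by move=> /andP[sv vt]; rewrite vmode2_bound_ge0// (lt_trans s0)// (le_trans (ltW vt)).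
  have xyst : `]x, y[ `<=` `]s, t[ by apply: subset_itv; rewrite bnd_simp.
  rewrite /Rintegral fine_le//.
  - by apply: integrable_fin_num => //; apply: integrableS iZ.
  - exact: integrable_fin_num.
  apply: ge0_subset_integral => //; first by case/integrableP : iZ.
have [rz|zr] := leP r z.
  apply: le_trans (vmode1B_le n (lt_le_trans s0 sr) rz (le_trans (ltW zt) tT)) _.
  by apply: Zmono => //; exact: ltW.
rewrite (_ : (fun j => _) = (fun j => -1 * (vmode1 r j - vmode1 z j))); last first.
  by apply/funext => j; rewrite mulN1r opprB.
rewrite enormZ normrN normr1 mul1r.
apply: le_trans (vmode1B_le n (lt_trans s0 sz) (ltW zr) (le_trans rt tT)) _.
by apply: Zmono => //; exact: ltW.
Qed.

End VectorModes.

(** * From the weak formulation to the modes *)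

(** The index [m.+2] keeps the step at most [t / 2], so that backward steps from [t] stay away from
    0. *)
Lemma div_harmonic_cvg (R : realType) (t : R) : t / m.+2%:R @[m --> \oo] --> 0.
Proof.
rewrite -[X in _ --> X](mulr0 t); apply: cvgMl_tmp.
by have := @cvg_harmonic R; rewrite -(cvg_shiftn 1) /=; under eq_fun do rewrite addn1.
Qed.

Lemma ae_itv_point (R : realType) (a b : R) (P : R -> Prop) : a < b ->
  {ae (@leb R), forall t, `]a, b[%classic t -> P t} -> exists2 t, a < t < b & P t.
Proof.
move=> ab [N [mN N0 hN]]; apply: contrapT => h.
have sub : `]a, b[ `<=` N.
  move=> t tab; apply: hN => /= /(_ tab) Pt; apply: h; exists t => //.
have : (leb (`]a, b[%classic : set (measurableTypeR R)) <= leb N)%E.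
  by apply: le_measure => //; rewrite inE//; exact: measurable_oo.
rewrite N0 lebesgue_measure_itv/= lte_fin ab -EFinD lee_fin leNgt subr_gt0.
by rewrite ab.
Qed.

Section LinearOn.
Variables (R : realType) (X : set (R * R -> R)).
Local Notation W := (functional R).
Implicit Types (g h : W).

Lemma linear_on0 : linear_on X (0 : W).
Proof. by move=> a v w _ _ /=; rewrite mulr0 addr0. Qed.

Lemma linear_onD g h : linear_on X g -> linear_on X h -> linear_on X (g + h).
Proof.
move=> lg lh a v w Xv Xw; rewrite -[LHS]/(g _ + h _) lg// lh//.
rewrite -[X in _ = a * X + _]/(g v + h v) -[X in _ = _ + X]/(g w + h w); ring.
Qed.

Lemma linear_on_scale (c : R) g : linear_on X g -> linear_on X (c *: g).
Proof.
move=> lg a v w Xv Xw; rewrite -[LHS]/(c * g _) lg//.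
rewrite -[X in _ = a * X + _]/(c * g v) -[X in _ = _ + X]/(c * g w); ring.
Qed.

Lemma linear_onN g : linear_on X g -> linear_on X (- g).
Proof. by rewrite -scaleN1r; exact: linear_on_scale. Qed.

Lemma linear_onB g h : linear_on X g -> linear_on X h -> linear_on X (g - h).
Proof. by move=> lg lh; apply: linear_onD => //; exact: linear_onN. Qed.

End LinearOn.

Section DualLinear.
Variables (R : realType) (Omega : set (R * R)).
Local Notation W := (functional R).
Local Notation linear := (linear_on (V Omega)).

Lemma nVdual_lty_linear (g : W) : (nVdual Omega g < +oo)%E -> linear g.
Proof. by rewrite /nVdual; case: asboolP. Qed.

Lemma step_fun_linear (s : step W) t : is_step (nVdual Omega) s -> linear (step_fun s t).
Proof.
move=> hs; rewrite /step_fun; elim/big_ind: _ => [|g h|i _]; [exact: linear_on0|exact: linear_onD|].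
by apply: linear_on_scale; apply: nVdual_lty_linear; have [] := hs i.
Qed.

Lemma step_int_linear (s : step W) D : is_step (nVdual Omega) s -> linear (step_int D s).
Proof.
move=> hs; rewrite /step_int; elim/big_ind: _ => [|g h|i _]; [exact: linear_on0|exact: linear_onD|].
by apply: linear_on_scale; apply: nVdual_lty_linear; have [] := hs i.
Qed.

Variables (T : R) (T0 : 0 < T) (u u1 : R -> W).
Hypothesis H : sobolev1 (nVdual Omega) 1%E T u u1.

(** A functional at finite dual distance from a linear one is linear. This gives linearity at some
    time [t0] through step functions, and for every increment of u through step integrals, hence at
    each [t]. *)
Lemma sobolev1_linear t : 0 <= t <= T -> linear (u t).
Proof.
have [[[s [hs sc]] _] _ bi] := H.
have [t0 /andP[t00 t0T] l0] : exists2 t, 0 < t < T & linear (u t).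
  apply: ae_itv_point => //; move: sc; apply: aeS => r h Dr.
  have /fine_cvgP[hf _] := h Dr; have [n fn] := filter_ex hf.
  rewrite -[u r](subrK (step_fun (s n) r)); apply: linear_onD; last exact: step_fun_linear.
  by apply: nVdual_lty_linear; rewrite ltey_eq fn.
have D a b : 0 <= a -> a <= b -> b <= T -> linear (u b - u a).
  move=> a0 ab bT; have [_ [s' [hs' _ /fine_cvgP[hf _]]]] := bi a b a0 ab bT.
  have [n fn] := filter_ex hf.
  rewrite -[_ - _](subKr (step_int `]a, b[ (s' n))); apply: linear_onB; first exact: step_int_linear.
  by apply: nVdual_lty_linear; rewrite ltey_eq fn.
move=> /andP[t1 tT]; have [tt|tt] := leP t0 t.
  by rewrite -[u t](subrK (u t0)); apply: linear_onD => //; apply: D => //; exact: ltW.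
rewrite -[u t](subKr (u t0)); apply: linear_onB => //; apply: D => //; exact: ltW.
Qed.

End DualLinear.

Section Coordinates.
Variables (R : realType) (Omega : set (R * R)).
Variables (mu : nat -> R) (phi : nat -> R * R -> R) (hphi : eigenpairs Omega mu phi).
Local Notation W := (functional R).
Variables (T : R) (T0 : 0 < T).

(** Start from one time with finite norm; increments are controlled by the integral of [G]. *)
Lemma coords_bounded (g g1 : R -> W) : sobolev1 (nL2 Omega) 1%E T g g1 ->
  exists B : R, forall n t, 0 <= t <= T -> enorm n (fun j => g t (phi j)) <= B.
Proof.
move=> H; have [gg [G [[mgg mG] iG GP _ gE]]] := coords_ex hphi H.
have [[sg _] _ _] := H.
have [t0 /andP[t00 t0T] ft0] := ae_itv_point T0 (strongly_measurable_ae_lty sg).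
pose B0 := fine (nL2 Omega (g t0)).
have hB0 n : enorm n (fun j => g t0 (phi j)) <= B0.
  rewrite -lee_fin fineK; first exact: (nL2_ge_coef hphi).
  by rewrite ge0_fin_numE//; exact: (nL2_ge0 hphi).
have D n s t : 0 <= s -> s <= t -> t <= T ->
    enorm n (fun j => g t (phi j) - g s (phi j)) <= \int[leb]_(r in `]0, T[) G r.
  move=> s0 st tT; under [X in enorm n X]funext do rewrite gE//.
  have iGst := integrable_oo_sub s0 tT iG.
  have st0 r : s < r < t -> 0 < r < T.
    by move=> /andP[sr rt]; rewrite (le_lt_trans s0)//= (lt_le_trans rt).
  apply: (@le_trans _ _ (\int[leb]_(r in `]s, t[) G r)).
    apply: minkowski_integral => //.
      by move=> j; apply: measurable_funTS; exact: mgg.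
    by move=> r /=; rewrite in_itv/= => /st0 /GP[].
  rewrite /Rintegral fine_le//; [exact: integrable_fin_num|exact: integrable_fin_num|].
  apply: ge0_subset_integral; [exact: measurable_oo|exact: measurable_oo| | |].
  - by case/integrableP : iG.
  - move=> r /=; rewrite in_itv/= => /GP[+ _] => /(_ 0%N); rewrite lee_fin.
    by apply: le_trans; exact: enorm_ge0.
  - by apply: subset_itv; rewrite bnd_simp.
exists (B0 + \int[leb]_(r in `]0, T[) G r) => n t /andP[t1 tT].
have [tt|/ltW tt] := leP t0 t.
  rewrite (_ : (fun j => _) = (fun j => g t0 (phi j) + (g t (phi j) - g t0 (phi j)))); last first.
    by apply/funext => j; rewrite addrC subrK.
  apply: le_trans (enormD _ _ _) _; apply: lerD => //.
  by apply: D => //; exact: ltW.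
rewrite (_ : (fun j => _) = (fun j => g t0 (phi j) + -1 * (g t0 (phi j) - g t (phi j)))); last first.
  by apply/funext => j; rewrite mulN1r opprB addrC subrK.
apply: le_trans (enormD _ _ _) _; apply: lerD => //.
by rewrite enormZ normrN normr1 mul1r; apply: D => //; exact: ltW.
Qed.

Lemma data_ex (f f' f'' : R -> W) :
  sobolev1 (nL2 Omega) 1%E T f f' -> sobolev1 (nL2 Omega) 1%E T f' f'' ->
  exists (gg : nat -> R -> R) (G : R -> R) (F Fp : R),
  [/\ (forall j, measurable_fun setT (gg j)) /\ leb.-integrable `]0, T[ (EFin \o G),
      forall s, 0 < s < T -> (forall n, enorm n (gg^~ s) <= G s) /\ ((G s)%:E <= nL2 Omega (f'' s))%E,
      forall j t, 0 <= t <= T -> f t (phi j) = f 0 (phi j) + \int[leb]_(s in `]0, t[) f' s (phi j),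
      forall j t, 0 <= t <= T -> f' t (phi j) = f' 0 (phi j) + \int[leb]_(s in `]0, t[) gg j s &
      forall n t, 0 <= t <= T -> enorm n (fun j => f t (phi j)) <= F /\ enorm n (fun j => f' t (phi j)) <= Fp].
Proof.
move=> H1 H2.
have [F hF] := coords_bounded H1; have [Fp hFp] := coords_bounded H2.
have [gg [G [[mgg mG] iG GP _ gE]]] := coords_ex hphi H2.
have [g1 [G1 [[mg1 _] _ _ ag1 gE1]]] := coords_ex hphi H1.
have fpE j t : 0 <= t <= T -> f' t (phi j) = f' 0 (phi j) + \int[leb]_(s in `]0, t[) gg j s.
  by move=> /andP[t0 tT]; rewrite -gE// addrC subrK.
have ig j : leb.-integrable `]0, T[ (EFin \o gg j).
  apply: (integrable_dom (measurable_oo 0 T) (measurable_funTS (mgg j)) iG).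
  move=> s /=; rewrite in_itv/= => /GP[+ _]; move/(_ j.+1); apply: le_trans.
  exact: (@enorm_term _ j.+1 (gg^~ s)).
have mfp j : measurable_fun `]0, T[ (fun s => f' s (phi j)).
  by apply: (primitive_measurable (ig j)) => t /andP[t0 tT]; apply: fpE; rewrite ltW.
exists gg, G, F, Fp; split => //.
- move=> j t /andP[t0 tT].
  rewrite (_ : \int[leb]_(s in `]0, t[) f' s (phi j) = \int[leb]_(s in `]0, t[) g1 j s).
    by rewrite -gE1// addrC subrK.
  have sub : `]0, t[ `<=` `]0, T[ by apply: subset_itvl; rewrite bnd_simp.
  rewrite /Rintegral; congr fine; apply: ae_eq_integral.
  - exact: measurable_oo.
  - by apply/measurable_EFinP; exact: measurable_itvS tT (mfp j).
  - by apply/measurable_EFinP; apply: measurable_funTS; exact: mg1.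
  - by move: ag1; apply: aeS => s e /sub Ds; rewrite e.
- by move=> n t tT; rewrite hF ?hFp.
Qed.

End Coordinates.

(** * The Caputo derivative as a convolution *)

Section CaputoConv.
Variables (R : realType) (al T : R) (al0 : 0 < al) (al1 : al < 1) (T0 : 0 < T).
Local Notation b := (fun s : R => s `^ (- al)).

Lemma primitive_ae_eq (g h : R -> R) :
  leb.-integrable `]0, T[ (EFin \o g) -> leb.-integrable `]0, T[ (EFin \o h) ->
  (forall s t, 0 <= s -> s <= t -> t <= T ->
    \int[leb]_(r in `]s, t[) g r = \int[leb]_(r in `]s, t[) h r) ->
  {ae (@leb R), forall s, `]0, T[%classic s -> g s = h s}.
Proof.
move=> ig ih gh.
have : {ae (@leb R), forall s, `]0, T[%classic s -> g s - h s = 0}.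
  apply: (itv_integral0_ae T0); first exact: integrableB_real.
  move=> s t s0 st tT; rewrite RintegralB ?gh ?subrr//.
  - exact: integrable_oo_sub s0 tT ig.
  - exact: integrable_oo_sub s0 tT ih.
by apply: aeS => s e /e/eqP; rewrite subr_eq0 => /eqP.
Qed.

Lemma caputo_conv (x : R -> R) t c : caputo_at al T x t c -> exists g1 : R -> R,
  [/\ leb.-integrable `]0, T[ (EFin \o g1),
      forall s t, 0 <= s -> s <= t -> t <= T -> x t - x s = \int[leb]_(r in `]s, t[) g1 r &
      Gamma (1 - al) * c = conv b g1 t].
Proof.
move=> [g1 [i1 xE ik cE]]; exists g1; split => //.
have G0 : 0 < Gamma (1 - al) by apply: Gamma_gt0; rewrite subr_gt0 al1 lerBlDr lerDl ltW.
have If := integrable_fin_num (measurable_oo 0 t) ik.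
move: cE; rewrite /RLint addrAC subrr add0r => cE.
have : c%:E = ((Gamma (1 - al))^-1 * conv b g1 t)%:E.
  by rewrite cE EFinM /conv /Rintegral fineK.
by case=> ->; rewrite mulrA divff ?gt_eqF// mul1r.
Qed.

Lemma conv_caputo (x g1 : R -> R) t : leb.-integrable `]0, T[ (EFin \o g1) ->
  (forall s t, 0 <= s -> s <= t -> t <= T -> x t - x s = \int[leb]_(r in `]s, t[) g1 r) ->
  leb.-integrable `]0, t[ (EFin \o (fun s => (t - s) `^ (- al) * g1 s)) ->
  caputo_at al T x t ((Gamma (1 - al))^-1 * conv b g1 t).
Proof.
move=> i1 xE ik; exists g1; split => //.
have If := integrable_fin_num (measurable_oo 0 t) ik.
by rewrite /RLint addrAC subrr add0r EFinM /conv /Rintegral fineK.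
Qed.

End CaputoConv.

(** Classically [a0] is [1 / Gamma al]; the product with the Beta value is all that is used, so the
    Beta-Gamma identity does not enter. *)
Lemma kernel_normalization (R : realType) (al : R) : 0 < al < 1 ->
  exists2 a0 : R, 0 < a0 & a0 * beta (1 - al) al = Gamma (1 - al).
Proof.
move=> /andP[al0 al1].
have b1 : 1 <= beta (1 - al) al by apply: beta_ge1; rewrite ?subr_gt0 ?al1 ?al0/= ?lerBlDr ?lerDl ltW.
have b0 : 0 < beta (1 - al) al by exact: lt_le_trans b1.
exists (Gamma (1 - al) / beta (1 - al) al); last by rewrite divfK// gt_eqF.
by rewrite divr_gt0//; apply: Gamma_gt0; rewrite subr_gt0 al1 lerBlDr lerDl ltW.
Qed.


(** * Bochner integrals built from coordinates *)

Section StepBuilding.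
Variables (R : realType) (W : lmodType R) (N : W -> \bar R).

Definition stepable (h : R -> W) := exists2 s : step W, is_step N s & forall r, step_fun s r = h r.

Lemma stepable0 : stepable (fun=> 0).
Proof.
exists (@Step _ W 0 (fun _ => set0) (fun _ => 0)); first by move=> [].
by move=> r; rewrite /step_fun big_ord0.
Qed.

Lemma stepableD h1 h2 : stepable h1 -> stepable h2 -> stepable (fun r => h1 r + h2 r).
Proof.
move=> [s1 H1 E1] [s2 H2 E2].
pose st (i : 'I_(step_size s1 + step_size s2)) := match fintype.split i with inl a => step_set a | inr b => step_set b end.
pose sv (i : 'I_(step_size s1 + step_size s2)) := match fintype.split i with inl a => step_val a | inr b => step_val b end.
exists (Step st sv); first by move=> i /=; rewrite /st /sv; case: fintype.split => k; [exact: H1|exact: H2].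
move=> r; rewrite /step_fun /= big_split_ord/= -E1 -E2; congr (_ + _); apply: eq_bigr => i _.
  by rewrite /st /sv (unsplitK (inl i)).
by rewrite /st /sv (unsplitK (inr i)).
Qed.

Lemma stepable_sum n (h : nat -> R -> W) : (forall j, stepable (h j)) ->
  stepable (fun r => \sum_(j < n) h j r).
Proof.
move=> hh; elim: n => [|n IH].
  by have := stepable0; congr stepable; apply/funext => r; rewrite big_ord0.
have := stepableD IH (hh n); congr stepable; apply/funext => r.
by rewrite big_ord_recr.
Qed.

Lemma stepable_sfun (s : {sfun measurableTypeR R >-> R}) (w : W) : (forall a : R, N (a *: w) < +oo)%E ->
  stepable (fun r => s r *: w).
Proof.
move=> Nw; pose v := fset_set (s @` setT).
exists (@Step _ W #|`v| (fun i => s @^-1` [set v`_i]) (fun i => v`_i *: w)).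
  move=> i /=; split; last exact: Nw.
  by rewrite -[X in measurable X]setTI; apply: (measurable_funP s).
move=> r; rewrite /step_fun/= (fimfunEord s r) scaler_suml; apply: eq_bigr => i _.
by rewrite scalerA mulrC.
Qed.

End StepBuilding.

(** Neither function is assumed measurable: the integral on the left is a supremum over simple
    functions, each of which can be compared almost everywhere. *)
Lemma integral_le_ae d (X : measurableType d) (R : realType) (m : {measure set X -> \bar R})
    (D : set X) (h k : X -> \bar R) : measurable D ->
  (forall x, D x -> 0 <= h x)%E -> (forall x, D x -> 0 <= k x)%E ->
  {ae m, forall x, D x -> (h x <= k x)%E} ->
  (\int[m]_(x in D) h x <= \int[m]_(x in D) k x)%E.
Proof.
move=> mD h0 k0 hk; rewrite ge0_integralE//.
apply: ge_ereal_sup => _ [g /= gh <-].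
have g0 x : (0 <= (g x)%:E)%E by rewrite lee_fin.
have -> : sintegral m g = (\int[m]_(x in D) (g x)%:E)%E.
  rewrite -integralT_nnsfun [RHS]integral_mkcond; apply: eq_integral => x _.
  rewrite patchE; case: ifPn => // Dx; apply/eqP; rewrite eq_le g0 andbT.
  by have := gh x; rewrite patchE (negbTE Dx).
apply: ae_ge0_le_integral_sup => //.
  by apply/measurable_EFinP; exact: measurable_funTS.
move: hk; apply: aeS => x hk Dx; apply: le_trans (hk Dx).
by have := gh x; rewrite patchE mem_set.
Qed.

Lemma squeeze_ereal0 (R : realType) (N : nat -> \bar R) (q : nat -> R) :
  (forall n, 0 <= N n)%E -> (forall n, N n <= (q n)%:E)%E -> q n @[n --> \oo] --> 0 ->
  N n @[n --> \oo] --> 0%E.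
Proof.
move=> N0 Nq qc; have h : (q n)%:E @[n --> \oo] --> 0%E by apply: cvg_EFin => //; near=> n.
apply: (@squeeze_cvge _ _ _ _ (cst 0%E)) h; last exact: cvg_cst.
by near=> n; rewrite N0 Nq.
Unshelve. all: by end_near. Qed.

Section AeSummable.
Variables (R : realType) (D : set (measurableTypeR R)).

(** Summable L1 norms make the sum of the functions integrable, hence finite almost everywhere, so
    its terms tend to 0 without passing to a subsequence. *)
Lemma ae_cvg0_summable (e : nat -> R -> R) (c : R) : measurable D -> 0 <= c ->
  (forall n, measurable_fun D (e n)) -> (forall n r, 0 <= e n r) ->
  (forall n, (\int[leb]_(r in D) (e n r)%:E <= (c / (2 ^ n.+1)%:R)%:E)%E) ->
  {ae (@leb R), forall r, D r -> e n r @[n --> \oo] --> 0}.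
Proof.
move=> mD c0 me e0 ec.
have me' n : measurable_fun D (fun r => (e n r)%:E) by exact/measurable_EFinP.
have eE n r : D r -> (0 <= (e n r)%:E)%E by move=> _; rewrite lee_fin.
have Sle : (\int[leb]_(r in D) (\sum_(0 <= n <oo) (e n r)%:E) <= c%:E)%E.
  rewrite integral_nneseries//; apply: le_trans (epsilon_trick0 xpredT c0).
  by apply: lee_nneseries => n *; [apply: integral_ge0 => r; exact: eE|exact: ec].
have mS : measurable_fun D (fun r => \sum_(0 <= n <oo) (e n r)%:E)%E.
  by apply: ge0_emeasurable_sum => // n r Dr _; exact: eE.
have S0 r : (0 <= \sum_(0 <= n <oo) (e n r)%:E)%E by apply: nneseries_ge0 => n _ _; rewrite lee_fin.
have iS : leb.-integrable D (fun r => \sum_(0 <= n <oo) (e n r)%:E)%E.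
  apply/integrableP; split => //; under eq_integral do rewrite gee0_abs//.
  by apply: le_lt_trans Sle _; rewrite ltry.
have := integrable_ae mD iS; apply: aeS => r h Dr; have {}h := h Dr.
apply: cvg_series_cvg_0.
apply: nondecreasing_is_cvgn.
  by apply/nondecreasing_seqP => n; rewrite seriesSr lerDl.
exists (fine (\sum_(0 <= n <oo) (e n r)%:E)%E) => _ [n _ <-].
rewrite -lee_fin fineK// /series/= -sumEFin.
by apply: nneseries_lim_ge => k _ _; rewrite lee_fin.
Qed.

End AeSummable.

Section EnormTail.
Variable R : realType.
Implicit Types (c z : nat -> R).

Lemma enorm_widen m k c : (m <= k)%N -> enorm m c <= enorm k c.
Proof.
move=> mk; rewrite enorm_le ?enorm_ge0// enorm_sqr -(subnKC mk) big_split_ord/= lerDl.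
by apply: sumr_ge0 => i _; exact: sqr_ge0.
Qed.

Lemma enorm_delta m n (x : R) : enorm m (fun i => if i == n then x else 0) <= `|x|.
Proof.
rewrite enorm_le// real_normK ?num_real//.
have [nm|nm] := ltnP n m.
  rewrite (bigD1 (Ordinal nm))//= eqxx big1 ?addr0// => i; rewrite -val_eqE/= => /negbTE ->.
  by rewrite expr0n.
rewrite big1 ?sqr_ge0// => i _; case: eqP => [e|_]; last by rewrite expr0n.
by have := ltn_ord i; rewrite e ltnNge nm.
Qed.

Lemma enorm_head m n c : enorm m (fun i => if (i < n)%N then c i else 0) <= \sum_(j < n) `|c j|.
Proof.
elim: n => [|n IH]; first by rewrite big_ord0 enorm0.
rewrite big_ord_recr/=; apply: le_trans (lerD IH (enorm_delta m n (c n))).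
apply: le_trans (enormD _ _ _); rewrite le_eqVlt; apply/orP; left; apply/eqP; congr (enorm m _).
by apply/funext => i; rewrite ltnS; case: (ltngtP i n) => [||->]; rewrite ?addr0 ?add0r.
Qed.

Lemma enorm_tail m n z (S : R) : (forall k, \sum_(j < k) z j ^+ 2 <= S) ->
  enorm m (fun i => if (i < n)%N then 0 else z i) <= Num.sqrt (S - \sum_(j < n) z j ^+ 2).
Proof.
move=> hS; apply: le_trans (enorm_widen (fun i => if (i < n)%N then 0 else z i) (leq_addl n m)) _.
apply: ler_wsqrtr; rewrite lerBrDl; apply: le_trans (hS (n + m)%N).
rewrite !big_split_ord/= lerD2l big1 ?add0r => [|i _]; last by rewrite ltn_ord expr0n.
by apply: ler_sum => i _; rewrite ltnNge leq_addr.
Qed.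

End EnormTail.

Section NVdualFacts.
Variables (R : realType) (Omega : set (R * R)).
Variables (mu : nat -> R) (phi : nat -> R * R -> R) (hphi : eigenpairs Omega mu phi).
Local Notation W := (functional R).

Lemma nVdual_ge0 (g : W) : (0 <= nVdual Omega g)%E.
Proof.
rewrite /nVdual; case: asboolP => // _.
have [c c0 [Vc c1]] := V_scale (phiV hphi 0).
apply: (@le_trans _ _ (`|g (fun x => c * phi 0 x)|%:E)); first by rewrite lee_fin.
by apply: ereal_sup_ubound; eexists; first by split; [exact: Vc|exact: c1].
Qed.

Lemma nL2_of_L2_lty w : L2 Omega w -> (nL2 Omega (of_L2 Omega w) < +oo)%E.
Proof.
move=> Lw; have h : eqV Omega (of_L2 Omega w) (of_L2 Omega w) by [].
by apply: le_lt_trans (nL2_le Lw h (lexx _)) _; rewrite ltry.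
Qed.

Lemma coef_bound (g : W) (B : R) v : (nL2 Omega g < +oo)%E ->
  (forall n, enorm n (fun j => g (phi j)) <= B) -> V Omega v -> `|g v| <= B * nrm Omega v.
Proof.
move=> /nL2_fin[w Lw wg] gB Vv; have Lv := V_L2 Vv.
have B0 : 0 <= B by exact: le_trans (enorm_ge0 0 _) (gB 0%N).
rewrite -wg//; apply: le_trans (cauchy_schwarz Lw Lv) _.
rewrite ler_wpM2r ?nrm_ge0//; apply: (nrm_le hphi) => // n.
rewrite (_ : (fun j => _) = (fun j => g (phi j)))//.
by apply/funext => j; exact: of_L2_coef hphi _ _ wg j.
Qed.

Lemma nVdual_coef_le (g : W) (B : R) : linear_on (V Omega) g -> (nL2 Omega g < +oo)%E ->
  (forall n, enorm n (fun j => g (phi j)) <= B) -> (nVdual Omega g <= B%:E)%E.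
Proof.
move=> lg fg gB; apply: nVdual_le => //; first exact: le_trans (enorm_ge0 0 _) (gB 0%N).
by move=> v; exact: coef_bound.
Qed.

Lemma nL2_B (g h : W) : (nL2 Omega g < +oo)%E -> (nL2 Omega h < +oo)%E -> (nL2 Omega (g - h)%R < +oo)%E.
Proof. by move=> fg fh; rewrite -scaleN1r; apply: nL2_D => //; exact: nL2_Z. Qed.

End NVdualFacts.

Section BochnerFromCoords.
Variables (R : realType) (Omega : set (R * R)).
Variables (mu : nat -> R) (phi : nat -> R * R -> R) (hphi : eigenpairs Omega mu phi).
Local Notation W := (functional R).
Local Notation linear := (linear_on (V Omega)).
Variables (a b : R) (z : nat -> R -> R) (Z : R -> R).
Local Notation X := `]a, b[%classic.
Hypotheses (mz : forall j, measurable_fun X (z j)) (iZ : leb.-integrable X (EFin \o Z))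
  (zZ : forall n r, a < r < b -> enorm n (z^~ r) <= Z r).

(* Finite exactly where both norms are, so that [stepable N2] gives steps that
   are admissible for either of them. *)
Let N2 (g : W) : \bar R := if `[< (nVdual Omega g < +oo)%E /\ (nL2 Omega g < +oo)%E >] then 0%E else +oo%E.

Let N2P g : (N2 g < +oo)%E -> (nVdual Omega g < +oo)%E /\ (nL2 Omega g < +oo)%E.
Proof. by rewrite /N2; case: asboolP. Qed.

Let N2_phi j (c : R) : (N2 (c *: of_L2 Omega (phi j)) < +oo)%E.
Proof.
have Lj := phiL2 hphi j.
have h : (nL2 Omega (c *: of_L2 Omega (phi j))%R < +oo)%E by apply: nL2_Z; exact: nL2_of_L2_lty.
rewrite /N2 asboolT ?ltry//; split => //.
apply: (@le_lt_trans _ _ (`|c| * nrm Omega (phi j))%:E); last exact: ltry.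
apply: nVdual_le; first by rewrite mulr_ge0 ?nrm_ge0.
  by apply: linear_on_scale; exact: of_L2_linear.
move=> v Vv; rewrite -[(c *: _) v]/(c * inner Omega (phi j) v) normrM -mulrA ler_wpM2l//.
by apply: cauchy_schwarz => //; exact: V_L2.
Qed.

Let mX : measurable (X : set (measurableTypeR R)). Proof. exact: measurable_oo. Qed.

Let S r := (\sum_(0 <= j <oo) (z j r ^+ 2)%:E)%E.
(** The Euclidean norm of the coordinates from index n on. *)
Let tl n r := Num.sqrt (fine (S r) - \sum_(j < n) z j r ^+ 2).

Let S0 r : (0 <= S r)%E.
Proof. by apply: nneseries_ge0 => j _ _; rewrite lee_fin sqr_ge0. Qed.

Let Sle r : X r -> (S r <= (Z r ^+ 2)%:E)%E.
Proof.
rewrite /= in_itv/= => rX; have Z0 := le_trans (enorm_ge0 0 _) (zZ 0 rX).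
apply: lime_le; first by apply: is_cvg_nneseries => j _ _; rewrite lee_fin sqr_ge0.
by near=> n; rewrite sumEFin lee_fin big_mkord; have := zZ n rX; rewrite enorm_le.
Unshelve. all: by end_near. Qed.

Let Sfin r : X r -> S r \is a fin_num.
Proof. by move=> /Sle h; rewrite ge0_fin_numE// (le_lt_trans h)// ltry. Qed.

Let Sge r k : X r -> \sum_(j < k) z j r ^+ 2 <= fine (S r).
Proof.
move=> rX; rewrite -lee_fin fineK ?Sfin//.
apply: le_trans (nneseries_lim_ge k _); last by move=> j _ _; rewrite lee_fin sqr_ge0.
by rewrite sumEFin lee_fin big_mkord.
Qed.

Let mS : measurable_fun X S.
Proof.
apply: ge0_emeasurable_sum => [j r _ _|j _]; first by rewrite lee_fin sqr_ge0.
by apply/measurable_EFinP; exact: measurable_funX.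
Qed.

Let mtl n : measurable_fun X (tl n).
Proof.
apply: (measurableT_comp (continuous_measurable_fun (@sqrt_continuous R))).
apply: measurable_funB; first by apply: measurableT_comp mS; exact: fine_measurable.
by apply: measurable_sum => j; exact: measurable_funX.
Qed.

Let tl_le n r : X r -> `|tl n r| <= Z r.
Proof.
move=> rX; have rX' : a < r < b by move: rX; rewrite /= in_itv.
have Z0 := le_trans (enorm_ge0 0 _) (zZ 0 rX').
rewrite ger0_norm ?sqrtr_ge0// -(ger0_norm Z0) -sqrtr_sqr ler_wsqrtr//.
rewrite lerBlDr; apply: (@le_trans _ _ (Z r ^+ 2)); last by rewrite lerDl; exact: (sum_sqr_ge0 n (z^~ r)).
by rewrite -lee_fin fineK ?Sfin// Sle.
Qed.

Let tl_cvg r : X r -> tl n r @[n --> \oo] --> 0.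
Proof.
move=> rX; rewrite -[X in _ --> X]sqrtr0; apply: continuous_cvg; first exact: sqrt_continuous.
rewrite -[X in _ --> X](subrr (fine (S r))); apply: cvgB; first exact: cvg_cst.
have h : (\sum_(0 <= j < n) (z j r ^+ 2)%:E)%E @[n --> \oo] --> (fine (S r))%:E.
  by rewrite fineK ?Sfin//; apply: is_cvg_nneseries => j _ _; rewrite lee_fin sqr_ge0.
rewrite (_ : (fun n => _) = (fun n => (\sum_(j < n) z j r ^+ 2)%:E)) in h; first by move/fine_cvg : h.
by apply/funext => n; rewrite sumEFin big_mkord.
Qed.

Let iz j : leb.-integrable X (EFin \o z j).
Proof.
apply: (integrable_dom (measurable_oo a b) (mz j) iZ) => r /=; rewrite in_itv/= => rX.
by apply: le_trans (zZ j.+1 rX); exact: (@enorm_term _ j.+1 (z^~ r)).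
Qed.

(** At stage n the first n coordinates are approximated, so the factor [1 / n.+1] leaves a total
    error of at most [2^-(n+1)], summable in n. *)
Let sfun_ex : exists sg : nat -> nat -> {sfun measurableTypeR R >-> R}, forall j n,
  leb.-integrable X (EFin \o sg j n) /\
  (\int[leb]_(r in X) (`|z j r - sg j n r|)%:E <= (n.+1%:R^-1 / (2 ^ n.+1)%:R)%:E)%E.
Proof.
have h j n : exists s : {sfun measurableTypeR R >-> R}, leb.-integrable X (EFin \o s) /\
    (\int[leb]_(r in X) (`|z j r - s r|)%:E <= (n.+1%:R^-1 / (2 ^ n.+1)%:R)%:E)%E.
  have [g [ig _ gc]] := approximation_sfun_integrable mX (iz j).
  have e0 : 0 < n.+1%:R^-1 / (2 ^ n.+1)%:R :> R by rewrite divr_gt0// ltr0n expn_gt0.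
  have /fine_cvgP[hf hc] := gc.
  have : \forall k \near \oo, fine (\int[leb]_(r in X) `|(z j r)%:E - (g k r)%:E|)%E <= n.+1%:R^-1 / (2 ^ n.+1)%:R.
    exact: (cvgr_le _ hc).
  move=> hle; have [k [fk lk]] := filter_ex (filterI hf hle).
  exists (g k); split; first exact: ig.
  by rewrite -(fineK fk) lee_fin in lk *.
have h' j : exists s : nat -> {sfun measurableTypeR R >-> R}, forall n, leb.-integrable X (EFin \o s n) /\
    (\int[leb]_(r in X) (`|z j r - s n r|)%:E <= (n.+1%:R^-1 / (2 ^ n.+1)%:R)%:E)%E.
  by have [f hf] := choice (h j); exists f.
by have [sg hsg] := choice h'; exists sg.
Qed.

Lemma bochner_int_coords (y : R -> W) (x : W) :
  {ae (@leb R), forall r, X r ->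
    [/\ linear (y r), (nL2 Omega (y r) < +oo)%E & forall j, y r (phi j) = z j r]} ->
  linear x -> (nL2 Omega x < +oo)%E -> (forall j, x (phi j) = \int[leb]_(r in X) z j r) ->
  bochner_int (nVdual Omega) X y x.
Proof.
move=> hy lx fx xz; have [sg hsg] := sfun_ex.
have Nge0 := nVdual_ge0 hphi.
pose e n r := \sum_(j < n) `|z j r - sg j n r|.
(* The approximating step truncates to n coordinates and makes them simple: [e] is the error of the
   second operation, [tl] that of the first. Both tend to 0 almost everywhere and in L1. *)
pose q n r := e n r + tl n r.
have e0 n r : 0 <= e n r by apply: sumr_ge0.
have tl0 n r : 0 <= tl n r by exact: sqrtr_ge0.
have mze j n : measurable_fun X (fun r => `|z j r - sg j n r|).
  apply: measurableT_comp; first exact: normr_measurable.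
  by apply: measurable_funB => //; exact: (measurable_funP (sg j n)).
have me n : measurable_fun X (e n) by apply: measurable_sum => j.
have Ie n : (\int[leb]_(r in X) (e n r)%:E <= (1 / (2 ^ n.+1)%:R)%:E)%E.
  have -> : (\int[leb]_(r in X) (e n r)%:E = \sum_(j < n) \int[leb]_(r in X) (`|z j r - sg j n r|)%:E)%E.
    rewrite -ge0_integral_sum//.
    - by apply: eq_integral => r _; rewrite /e sumEFin.
    - by move=> j; apply/measurable_EFinP; exact: mze.
  apply: (@le_trans _ _ (\sum_(j < n) (n.+1%:R^-1 / (2 ^ n.+1)%:R)%:E)%E).
    by apply: lee_sum => j _; exact: (hsg j n).2.
  rewrite sumEFin lee_fin sumr_const card_ord -[leLHS]mulr_natl mulrA ler_wpM2r ?invr_ge0//.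
  by rewrite ler_pdivrMr// mul1r ler_nat.
have ie n : leb.-integrable X (EFin \o e n).
  apply/integrableP; split; first by apply/measurable_EFinP; exact: me.
  under eq_integral do rewrite gee0_abs ?lee_fin//.
  by apply: le_lt_trans (Ie n) _; rewrite ltry.
have itl n : leb.-integrable X (EFin \o tl n).
  by apply: (integrable_dom mX (mtl n) iZ) => r rX; exact: tl_le.
have iq n : leb.-integrable X (EFin \o q n) by exact: integrableD_real.
have Iq : \int[leb]_(r in X) q n r @[n --> \oo] --> 0.
  rewrite -[X in _ --> X]addr0.
  have c1 : \int[leb]_(r in X) e n r @[n --> \oo] --> 0.
    apply: (@squeeze_cvgr _ _ _ _ (fun=> 0) (fun n => 2^-1 ^+ n)).
    - near=> n; rewrite Rintegral_ge0//=.
      have fin := integrable_fin_num mX (ie n).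
      rewrite -lee_fin /Rintegral fineK//; apply: le_trans (Ie n) _.
      rewrite lee_fin div1r exprVn lef_pV2 ?posrE ?exprn_gt0 ?ltr0n ?expn_gt0//.
      by rewrite natrX ler_eXn2l ?ltr1n.
    - exact: cvg_cst.
    - by apply: cvg_expr; rewrite ger0_norm ?invr_ge0// invf_lt1 ?ltr1n.
  have [||||_ c2] := @cvg_Rintegral_dominated _ _ R leb X tl (fun=> 0) Z mX mtl.
  - exact: measurable_cst.
  - exact: iZ.
  - by apply: aeW => r rX; exact: tl_cvg.
  - by move=> n r rX; exact: tl_le.
  - rewrite Rintegral_cst// mul0r in c2.
    rewrite (_ : (fun n => _) = (fun n => \int[leb]_(r in X) e n r + \int[leb]_(r in X) tl n r)).
      exact: cvgD.
    by apply/funext => n; rewrite /q RintegralD.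
have q_cvg : {ae (@leb R), forall r, X r -> q n r @[n --> \oo] --> 0}.
  have := ae_cvg0_summable mX ler01 me e0 Ie; apply: aeS => r h rX.
  by rewrite -[X in _ --> X]addr0; apply: cvgD; [exact: h|exact: tl_cvg].
pose sp n i r := if (i < n)%N then sg i n r else 0.
have enq n m r : X r -> enorm m (fun i => z i r - sp n i r) <= q n r.
  move=> rX; rewrite (_ : (fun i => _) = (fun i => (if (i < n)%N then z i r - sg i n r else 0) +
      (if (i < n)%N then 0 else z i r))); last first.
    by apply/funext => i; rewrite /sp; case: ifP => _; rewrite ?addr0 ?subr0 ?add0r.
  apply: le_trans (enormD _ _ _) _; apply: lerD.
    exact: (enorm_head m n (fun i => z i r - sg i n r)).
  by apply: enorm_tail => k; exact: Sge.
have stp n : stepable N2 (fun r => \sum_(j < n) sg j n r *: of_L2 Omega (phi j)).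
  by apply: (@stepable_sum _ _ N2 n (fun j r => sg j n r *: of_L2 Omega (phi j))) => j; apply: stepable_sfun => c; exact: N2_phi.
have hs n : exists s : step W, is_step N2 s /\ forall r, step_fun s r = \sum_(j < n) sg j n r *: of_L2 Omega (phi j).
  by have [s s1 s2] := stp n; exists s.
have [s hs'] := choice hs.
have sV n : is_step (nVdual Omega) (s n).
  by move=> i; have [m1 n1] := (hs' n).1 i; split => //; have [] := N2P n1.
have sL n : is_step (nL2 Omega) (s n).
  by move=> i; have [m1 n1] := (hs' n).1 i; split => //; have [] := N2P n1.
have scoef n i r : step_fun (s n) r (phi i) = sp n i r.
  rewrite (hs' n).2 fct_sumE /sp.
  rewrite (eq_bigr (fun j : 'I_n => sg j n r * ((j : nat) == i)%:R)); last first.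
    by move=> j _; rewrite -(phiO hphi j i).
  case: ltnP => ni; last first.
    by rewrite big1// => j _; rewrite ltn_eqF ?mulr0// (leq_trans (ltn_ord j)).
  rewrite (bigD1 (Ordinal ni))//= eqxx mulr1 big1 ?addr0// => j.
  by rewrite -val_eqE/= => /negbTE ->; rewrite mulr0.
have Nle n r : X r -> linear (y r) -> (nL2 Omega (y r) < +oo)%E -> (forall j, y r (phi j) = z j r) ->
    (nVdual Omega (y r - step_fun (s n) r)%R <= (q n r)%:E)%E.
  move=> rX ly fy yz; apply: (nVdual_coef_le hphi).
  - by apply: linear_onB => //; exact: step_fun_linear.
  - by apply: nL2_B => //; exact: (nL2_step_lty r (sL n)).
  - move=> m; rewrite (_ : (fun j => _) = (fun i => z i r - sp n i r)) ?enq//.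
    by apply/funext => i; rewrite -[LHS]/(y r (phi i) - step_fun (s n) r (phi i)) yz scoef.
have q0 n r : 0 <= q n r by rewrite addr_ge0.
split.
  exists s; split => //; move: (aeI hy q_cvg); apply: aeS => r [h1 h2] rX.
  have [ly fy yz] := h1 rX; have {}h2 := h2 rX.
  by apply: (squeeze_ereal0 _ _ h2) => n; [exact: Nge0|exact: Nle].
have fX : (leb (X : set (measurableTypeR R)) < +oo)%E.
  by rewrite lebesgue_measure_itv/=; case: ifP => _; rewrite ?ltry// -EFinB ltry.
have si n i := step_eval_int (phi i) mX fX (sL n).
have spE n i : step_eval (phi i) (s n) = sp n i by apply/funext => r; rewrite /step_eval scoef.
exists s; split => //.
  apply: (squeeze_ereal0 _ _ Iq) => n; first by apply: integral_ge0 => r _; exact: Nge0.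
  rewrite /Rintegral fineK; last exact: (integrable_fin_num mX (iq n)).
  apply: integral_le_ae => //; first by move=> r _; rewrite lee_fin.
  by move: hy; apply: aeS => r h rX; have [ly fy yz] := h rX; exact: Nle.
apply: (squeeze_ereal0 _ _ Iq) => n; first exact: Nge0.
apply: (nVdual_coef_le hphi).
- by apply: linear_onB => //; exact: step_int_linear.
- apply: nL2_B => //; rewrite /step_int; elim/big_ind: _ => [|g h|i _]; last 2 first.
  + exact: nL2_D.
  + by apply: nL2_Z; have [] := sL n i.
  + have := nL2_of_L2_lty (L2_0 Omega); rewrite (_ : of_L2 Omega _ = 0)//.
    by apply/funext => v; rewrite /of_L2 inner0.
move=> m; rewrite (_ : (fun j => _) = (fun i => -1 * \int[leb]_(r in X) (z i r - sp n i r))).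
  rewrite enormZ normrN normr1 mul1r; apply: minkowski_integral => //.
  - have msp i : measurable_fun X (sp n i).
      by rewrite -spE; case/integrableP : (si n i).1 => /measurable_EFinP.
    by move=> i; exact: (measurable_funB (mz i) (msp i)).
  - by move=> r rX; exact: enq.
apply/funext => i; rewrite -[LHS]/(step_int X (s n) (phi i) - x (phi i)) xz.
have isp : leb.-integrable X (EFin \o sp n i) by rewrite -spE; exact: (si n i).1.
by rewrite RintegralB// mulN1r opprB -(si n i).2 spE.
Unshelve. all: by end_near. Qed.

End BochnerFromCoords.

Lemma bochner_int_coords_ae (R : realType) (Omega : set (R * R)) (mu : nat -> R) (phi : nat -> R * R -> R)
    (a b : R) (z : nat -> R -> R) (Z : R -> R) (y : R -> functional R) (x : functional R) :
  eigenpairs Omega mu phi ->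
  (forall j, measurable_fun `]a, b[ (z j)) -> leb.-integrable `]a, b[ (EFin \o Z) ->
  {ae (@leb R), forall r, `]a, b[%classic r -> (forall n, enorm n (z^~ r) <= Z r) /\
    [/\ linear_on (V Omega) (y r), (nL2 Omega (y r) < +oo)%E & forall j, y r (phi j) = z j r]} ->
  linear_on (V Omega) x -> (nL2 Omega x < +oo)%E ->
  (forall j, x (phi j) = \int[leb]_(r in `]a, b[) z j r) ->
  bochner_int (nVdual Omega) `]a, b[ y x.
Proof.
move=> hphi mz iZ [N [mN N0 hN]] lx fx xz.
have hN' r : a < r < b -> ~ N r -> (forall n, enorm n (z^~ r) <= Z r) /\
    [/\ linear_on (V Omega) (y r), (nL2 Omega (y r) < +oo)%E & forall j, y r (phi j) = z j r].
  by move=> rX Nr; apply: contrapT => h; apply: Nr; apply: hN => /= h'; apply: h; apply: h'; rewrite /= in_itv.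
have mC : measurable (~` N) by exact: measurableC.
pose z' j := z j \_ (~` N); pose Z' := Z \_ (~` N).
have mz' j : measurable_fun `]a, b[ (z' j).
  apply/(measurable_restrict _ mC (measurable_oo a b)).
  by apply: measurable_funS (mz j); [exact: measurable_oo|exact: subIsetl].
have iZ' : leb.-integrable `]a, b[ (EFin \o Z').
  apply: (integrable_dom (measurable_oo a b) _ (integrable_norm iZ)).
    apply/(measurable_restrict _ mC (measurable_oo a b)).
    case/integrableP : iZ => /measurable_EFinP mZ _.
    by apply: measurable_funS mZ; [exact: measurable_oo|exact: subIsetl].
  by move=> r _ /=; rewrite /Z' patchE; case: ifPn => // _; rewrite normr0.
have zr r : ~ N r -> z'^~ r = z^~ r by move=> Nr; apply/funext => j; rewrite /z' patchE mem_set.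
apply: (@bochner_int_coords R Omega mu phi hphi a b z' Z' mz' iZ') => // [n r rX||j].
- have [Nr|Nr] := pselect (N r).
    rewrite (_ : z'^~ r = fun=> 0) ?enorm0; last by apply/funext => j; rewrite /z' patchE memNset//=; apply.
    by rewrite /Z' patchE memNset//=; apply.
  by rewrite zr// /Z' patchE mem_set//; have [+ _] := hN' r rX Nr.
- exists N; split => // r /= h; apply: contrapT => Nr; apply: h => rX.
  have rX' : a < r < b by move: rX; rewrite in_itv.
  have [_ [l f e]] := hN' r rX' Nr; split => // j.
  by rewrite e /z' patchE mem_set.
- rewrite xz /Rintegral; congr fine; apply: ae_eq_integral.
  + exact: measurable_oo.
  + by apply/measurable_EFinP; exact: mz.
  + by apply/measurable_EFinP; exact: mz'.
  + exists N; split => // r /= h; apply: contrapT => Nr; apply: h => _.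
    by rewrite /z' patchE mem_set.
Qed.

Lemma ge0_Rintegral_oo_sub (R : realType) (a b c d : R) (f : R -> R) : a <= c -> d <= b ->
  leb.-integrable `]a, b[ (EFin \o f) -> (forall s, a < s < b -> 0 <= f s) ->
  \int[leb]_(s in `]c, d[) f s <= \int[leb]_(s in `]a, b[) f s.
Proof.
move=> ac db iF f0; have iF' := integrable_oo_sub ac db iF.
have m1 := measurable_oo a b; have m2 := measurable_oo c d.
rewrite /Rintegral fine_le//; [exact: (integrable_fin_num m2 iF')|exact: (integrable_fin_num m1 iF)|].
apply: ge0_subset_integral => //; first by case/integrableP : iF.
by apply: subset_itv; rewrite bnd_simp.
Qed.

(** * Weak convergence and reconstruction from coefficients *)

Section WeakConvergence.
Variables (R : realType) (Omega : set (R * R)).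
Variables (mu : nat -> R) (phi : nat -> R * R -> R) (hphi : eigenpairs Omega mu phi).
Local Notation W := (functional R).
Local Notation L2 := (L2 Omega).
Local Notation inner := (inner Omega).

Lemma weak_cvg0 (w : nat -> R * R -> R) (B : R) v : (forall n, L2 (w n)) ->
  (forall n, nrm Omega (w n) <= B) -> (forall j, inner (w n) (phi j) @[n --> \oo] --> 0) ->
  L2 v -> inner (w n) v @[n --> \oo] --> 0.
Proof.
move=> Lw wB wc Lv; have B0 := le_trans (nrm_ge0 Omega _) (wB 0%N).
have B1 : 0 < B + 1 by rewrite ltr_wpDl.
apply/cvgrPdist_lt => e e0.
have e2 : 0 < e / 2 / (B + 1) by rewrite !divr_gt0.
have [m hm] := filter_ex (cvgr_lt _ (comb_cvg (phiL2 hphi) (phiC hphi) Lv) _ e2).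
pose p := comb phi m (fun j => inner v (phi j)).
have Lp : L2 p by exact: L2_comb (phiL2 hphi) _ _.
have c1 : inner (w n) p @[n --> \oo] --> 0.
  have c : \sum_(j < m) inner v (phi j) * inner (w n) (phi j) @[n --> \oo] --> \sum_(j < m) inner v (phi j) * 0.
    apply: (@cvg_sumr R _ _ (fun (j : 'I_m) n => inner v (phi j) * inner (w n) (phi j)) (fun j : 'I_m => inner v (phi j) * 0)) => j.
    by apply: cvgMl_tmp; exact: wc.
  have z : \sum_(j < m) inner v (phi j) * 0 = 0 by rewrite big1// => j _; rewrite mulr0.
  rewrite z in c; apply: cvg_trans c; apply: near_eq_cvg; near=> n.
  rewrite innerC (inner_comb (phiL2 hphi))//; apply: eq_bigr => j _.
  by rewrite [inner (phi j) _]innerC.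
have e2' : 0 < e / 2 by rewrite divr_gt0.
have : \forall n \near \oo, `|inner (w n) p| < e / 2.
  by move/cvgrPdist_lt : c1 => /(_ _ e2'); apply: filterS => n; rewrite sub0r normrN.
apply: filterS => n hn; rewrite sub0r normrN.
have E : inner (w n) v = inner (w n) (fun x => v x - p x) + inner (w n) p.
  by rewrite [RHS]addrC ![inner (w n) _]innerC (innerB (Lw n) Lv Lp) addrC subrK.
rewrite E; apply: le_lt_trans (ler_normD _ _) _; rewrite [ltRHS](splitr e); apply: ltr_leD; last exact: ltW.
apply: le_lt_trans (cauchy_schwarz (Lw n) (L2B Lv Lp)) _.
apply: (@le_lt_trans _ _ (B * nrm Omega (fun x => v x - p x))); first by rewrite ler_wpM2r ?nrm_ge0.
apply: (@le_lt_trans _ _ ((B + 1) * nrm Omega (fun x => v x - p x))).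
  by rewrite ler_wpM2r ?nrm_ge0// lerDl.
by rewrite mulrC -ltr_pdivlMr.
Unshelve. all: by end_near. Qed.

Lemma functional_weak_cvg0 (g : nat -> W) (B : R) v : (forall n, nL2 Omega (g n) < +oo)%E ->
  (forall n m, enorm m (fun j => g n (phi j)) <= B) -> (forall j, g n (phi j) @[n --> \oo] --> 0) ->
  V Omega v -> g n v @[n --> \oo] --> 0.
Proof.
move=> fg gB gc Vv.
have hw n : exists w, L2 w /\ eqV Omega (of_L2 Omega w) (g n) by have [w Lw wg] := nL2_fin (fg n); exists w.
have [w hw'] := choice hw.
have wE n j : inner (w n) (phi j) = g n (phi j) by apply: of_L2_coef hphi _ _ (hw' n).2 j.
have B0 : 0 <= B by exact: le_trans (enorm_ge0 0 _) (gB 0%N 0%N).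
have c : inner (w n) v @[n --> \oo] --> 0.
  apply: (@weak_cvg0 w B v) => [n|n|j|].
  - exact: (hw' n).1.
  - apply: (nrm_le hphi (hw' n).1 B0) => m; have := gB n m; congr (enorm m _ <= _).
    by apply/funext => j; rewrite wE.
  - by under eq_fun do rewrite wE; exact: gc.
  - exact: V_L2 Vv.
apply: cvg_trans c; apply: near_eq_cvg; near=> n.
exact: ((hw' n).2 v Vv).
Unshelve. all: by end_near. Qed.

Variables (rf : (nat -> R) -> R * R -> R).
Hypotheses (rfL2 : forall c, L2 (rf c))
  (rfE : forall c, ell2 c -> forall j, inner (rf c) (phi j) = c j).

Lemma ell2_enorm (c : nat -> R) (B : R) : (forall n, enorm n c <= B) -> ell2 c.
Proof.
move=> h; have B0 : 0 <= B by exact: le_trans (enorm_ge0 0 c) (h 0%N).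
by exists (B ^+ 2) => n; have := h n; rewrite enorm_le.
Qed.

Lemma rf_nrm_le c (B : R) : (forall n, enorm n c <= B) -> nrm Omega (rf c) <= B.
Proof.
move=> h; have B0 : 0 <= B by exact: le_trans (enorm_ge0 0 c) (h 0%N).
apply: (nrm_le hphi) => // n; rewrite (_ : (fun j => _) = c)//.
by apply/funext => j; apply: rfE; exact: ell2_enorm h.
Qed.

Lemma rf_parseval c v : ell2 c -> L2 v ->
  \sum_(j < n) c j * inner v (phi j) @[n --> \oo] --> inner (rf c) v.
Proof.
move=> hc Lv; have := parseval (phiL2 hphi) (phiC hphi) (rfL2 c) Lv; apply: cvg_trans.
by apply: near_eq_cvg; near=> n; apply: eq_bigr => j _; rewrite rfE.
Unshelve. all: by end_near. Qed.

Lemma rfZ (a : R) c v : ell2 c -> ell2 (fun j => a * c j) -> L2 v ->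
  inner (rf (fun j => a * c j)) v = a * inner (rf c) v.
Proof.
move=> hc hac Lv; rewrite -innerZ//.
by apply: (L2_coef_eq hphi) => // [|j]; [exact: L2Z|rewrite innerZ ?rfE//; exact: (phiL2 hphi)].
Qed.

(** Integrate the partial sums of Parseval's series; by Cauchy-Schwarz they are dominated by
    [nrm Omega v * Z]. *)
Lemma coords_Rintegral (D : set (measurableTypeR R)) (z : nat -> R -> R) (Z g : R -> R) v :
  L2 v -> measurable D -> (forall j, measurable_fun D (z j)) -> leb.-integrable D (EFin \o Z) ->
  (forall n s, D s -> enorm n (z^~ s) <= Z s) -> (forall s, D s -> g s = inner (rf (z^~ s)) v) ->
  leb.-integrable D (EFin \o g) /\
  \int[leb]_(s in D) g s = inner (rf (fun j => \int[leb]_(s in D) z j s)) v.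
Proof.
move=> Lv mD mz iZ zZ gE.
have iz j : leb.-integrable D (EFin \o z j).
  apply: (integrable_dom mD (mz j) iZ) => s Ds.
  by apply: le_trans (zZ j.+1 s Ds); exact: (@enorm_term _ j.+1 (z^~ s)).
pose u n s := \sum_(j < n) z j s * inner v (phi j).
have mu_ n : measurable_fun D (u n).
  by apply: measurable_sum => j; apply: measurable_funM; [exact: mz|exact: measurable_cst].
have uc s : D s -> u n s @[n --> \oo] --> g s.
  by move=> Ds; rewrite gE//; apply: rf_parseval => //; apply: ell2_enorm => n; exact: zZ.
have mg : measurable_fun D g by exact: measurable_fun_cvg mu_ uc.
have uZ n s : D s -> `|u n s| <= nrm Omega v * Z s.
  move=> Ds; apply: le_trans (enorm_cs n (z^~ s) (fun j => inner v (phi j))) _.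
  by rewrite mulrC; apply: ler_pM; rewrite ?enorm_ge0//; [exact: (enorm_coef hphi)|exact: zZ].
have [|||ig c] := @cvg_Rintegral_dominated _ _ R leb D u g (fun s => nrm Omega v * Z s) mD mu_ mg.
- exact: integrableZ_real.
- by apply: aeW => s; exact: uc.
- by move=> n s; exact: uZ.
split => //; have h : ell2 (fun j => \int[leb]_(s in D) z j s).
  by apply: ell2_enorm => n; apply: minkowski_integral mD mz iZ _ => s Ds; exact: zZ.
rewrite -(cvg_lim (@Rhausdorff R) c) -(cvg_lim (@Rhausdorff R) (rf_parseval h Lv)).
congr (limn _); apply/funext => n.
suff [_ ->] : leb.-integrable D (EFin \o u n) /\
  \int[leb]_(s in D) u n s = \sum_(j < n) (\int[leb]_(s in D) z j s) * inner v (phi j) by [].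
elim: n => [|n [IH1 IH2]].
  rewrite big_ord0 (_ : u 0%N = fun=> 0); last by apply/funext => s; rewrite /u big_ord0.
  split; last by rewrite Rintegral_cst// mul0r.
  by have := integrableZ_real mD 0 iZ; apply: eq_integrable => // s _; rewrite /= mul0r.
have izc : leb.-integrable D (EFin \o (fun s => z n s * inner v (phi n))).
  have := integrableZ_real mD (inner v (phi n)) (iz n); apply: eq_integrable => // s _.
  by rewrite /= mulrC.
rewrite (_ : u n.+1 = fun s => u n s + z n s * inner v (phi n)); last first.
  by apply/funext => s; rewrite /u big_ord_recr.
split; first exact: integrableD_real.
by rewrite RintegralD// IH2 RintegralZr// big_ord_recr.
Qed.

End WeakConvergence.

Lemma pinfty_adde (R : realType) (x : \bar R) : (0 <= x)%E -> (+oo + x = +oo)%E.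
Proof. by move=> x0; rewrite addye//; apply/eqP => e; rewrite e in x0. Qed.

Lemma Linf_ae (R : realType) (h : R -> \bar R) t : (forall s, 0 <= h s)%E ->
  {ae (@leb R), forall s, `]0, t[%classic s -> (h s <= norm_Linf t h)%E}.
Proof.
move=> h0; have := @ess_sup_ge _ _ R (@leb R) (abse \o (h \_ `]0, t[)).
apply: aeS => s hs st; rewrite /norm_Linf unlock ifT.
  by apply: le_trans hs; rewrite /= patchE mem_set// gee0_abs.
(* The norm of exponent [+oo] is the essential supremum only when the whole space has positive
   measure. *)
have : (leb (`]0%R, 1%R[%classic : set (measurableTypeR R)) <= leb [set: measurableTypeR R])%E.
  by apply: le_measure => //; rewrite inE//; exact: measurable_oo.
by apply: lt_le_trans; rewrite lebesgue_measure_itv/= lte_fin ltr01 -EFinD lte_fin subr0.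
Qed.

(** A real least upper bound, comparable with an [nL2] norm whether or not the latter is finite. *)
Lemma ell2_sup (R : realType) (c : nat -> R) : ell2 c -> exists2 S : R, forall n, enorm n c <= S &
  forall x : \bar R, (forall n, (enorm n c)%:E <= x)%E -> (S%:E <= x)%E.
Proof.
move=> [B hB]; have B0 : 0 <= B by have := hB 0%N; rewrite big_ord0.
pose S := ereal_sup (range (fun n => (enorm n c)%:E)).
have Sle n : ((enorm n c)%:E <= S)%E by apply: ereal_sup_ubound; exists n.
have SB : (S <= (Num.sqrt B)%:E)%E.
  by apply: ge_ereal_sup => _ [n _ <-]; rewrite lee_fin; apply: ler_wsqrtr.
have S0 : (0 <= S)%E by apply: le_trans (Sle 0%N); rewrite lee_fin enorm_ge0.
have Sf : S \is a fin_num by rewrite ge0_fin_numE// (le_lt_trans SB)// ltry.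
exists (fine S) => [n|x hx]; first by rewrite -lee_fin fineK.
by rewrite fineK//; apply: ge_ereal_sup => _ [n _ <-].
Qed.

(** * The weak solution: representation, derivatives, estimates *)

Section SolutionCoords.
Variables (R : realType) (Omega : set (R * R)).
Variables (mu : nat -> R) (phi : nat -> R * R -> R) (hphi : eigenpairs Omega mu phi).
Local Notation W := (functional R).
Variables (al T : R) (al0 : 0 < al) (al1 : al < 1) (T0 : 0 < T).
Local Notation b := (fun s : R => s `^ (- al)).
Variables (f u : R -> W).
Hypothesis H : weak_solution Omega al T f 0 u.

(** The existence of a Caputo derivative at a single time already includes a representation as a
    primitive on all of [[0, T]]. *)
Lemma weak_derivative v : V Omega v -> exists2 g1 : R -> R, leb.-integrable `]0, T[ (EFin \o g1) &
  forall s t, 0 <= s -> s <= t -> t <= T -> u t v - u s v = \int[leb]_(r in `]s, t[) g1 r.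
Proof.
move=> [K hK Kv]; have [_ _ /(_ K hK) h _] := H.
have [t _ [J [c [_ _ hc _]]]] := ae_itv_point T0 h.
by have [g1 [i1 E _]] := caputo_conv al0 al1 hc; exists g1 => // s r *; rewrite -Kv; exact: E.
Qed.

Lemma weak_coef j : exists g1 : R -> R, [/\ leb.-integrable `]0, T[ (EFin \o g1),
  forall s t, 0 <= s -> s <= t -> t <= T -> u t (phi j) - u s (phi j) = \int[leb]_(r in `]s, t[) g1 r &
  {ae (@leb R), forall t, `]0, T[%classic t ->
    conv b g1 t + Gamma (1 - al) * mu j * u t (phi j) = Gamma (1 - al) * f t (phi j)}].
Proof.
have [g1 i1 E1] := weak_derivative (phiV hphi j); exists g1; split => //.
have [K hK Kv] := phiV hphi j; have [_ _ /(_ K hK) h _] := H.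
move: h; apply: aeS => t h Dt; have [J [c [hJ Ju hc hE]]] := h Dt.
rewrite Kv in hc hE.
have [g2 [i2 E2 Ec]] := caputo_conv al0 al1 hc.
(* Each time [t] comes with its own derivative [g2]; having the same primitives, it agrees almost
   everywhere with the fixed [g1]. *)
have g12 : {ae (@leb R), forall s, `]0, T[%classic s -> g1 s = g2 s}.
  by apply: primitive_ae_eq => // a r a0 ar rT; rewrite -E1// E2.
have /andP[t0 tT] : 0 < t < T by move: Dt; rewrite /= in_itv.
have -> : conv b g1 t = conv b g2 t.
  have sub : `]0, t[ `<=` `]0, T[ by apply: subset_itvl; rewrite bnd_simp ltW.
  have mg (g : R -> R) : leb.-integrable `]0, T[ (EFin \o g) -> measurable_fun `]0, t[ (EFin \o (fun s => b (t - s) * g s)).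
    case/integrableP => /measurable_EFinP mg _; apply/measurable_EFinP.
    by apply: measurable_funM; [exact: measurable_powRB|exact: measurable_itvS (ltW tT) mg].
  rewrite /conv /Rintegral; congr fine; apply: ae_eq_integral; [exact: measurable_oo|exact: mg|exact: mg|].
  by move: g12; apply: aeS => s e /sub Ds; rewrite /= e.
rewrite -Ec -hE (hess_form_eigen hJ hK Kv (phiA hphi j)).
by rewrite -(Ju _ (phiV hphi j)) -mulrA -mulrDr.
Qed.

Lemma u0_eq0 v : V Omega v -> u 0 v = 0.
Proof. by move=> Vv; have [_ _ _ [u0 _]] := H; rewrite u0. Qed.

Lemma u_linear t : 0 <= t <= T -> linear_on (V Omega) (u t).
Proof. by move=> tT; have [_ [u1 H1] _ _] := H; exact: (sobolev1_linear T0 H1 tT). Qed.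

Variables (a0 : R) (a0_gt0 : 0 < a0) (a0_beta : a0 * beta (1 - al) al = Gamma (1 - al)).
Variables (fp : R -> W) (gg : nat -> R -> R) (G : R -> R) (F Fp : R).
Local Notation fj := (fun j t => f t (phi j)).
Local Notation fpj := (fun j t => fp t (phi j)).
Hypotheses (mgg : forall j, measurable_fun `]0, T[ (gg j))
  (iG : leb.-integrable `]0, T[ (EFin \o G))
  (gG : forall n s, 0 < s < T -> enorm n (gg^~ s) <= G s)
  (fE : forall j t, 0 <= t <= T -> fj j t = fj j 0 + \int[leb]_(s in `]0, t[) fpj j s)
  (fpE : forall j t, 0 < t <= T -> fpj j t = fpj j 0 + \int[leb]_(s in `]0, t[) gg j s)
  (fF : forall n t, 0 <= t <= T -> enorm n (fj^~ t) <= F)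
  (fpF : forall n t, 0 <= t <= T -> enorm n (fpj^~ t) <= Fp).
Variables (rf : (nat -> R) -> R * R -> R).
Hypotheses (rfL2 : forall c, L2 Omega (rf c))
  (rfE : forall c, ell2 c -> forall j, inner Omega (rf c) (phi j) = c j).

Local Notation M := (vmode al a0 mu fj).
Local Notation M1 := (vmode1 al a0 mu fj fpj).
Local Notation M2 := (vmode2 al a0 mu fj fpj gg).

Lemma u_mode j t : 0 < t <= T -> u t (phi j) = M t j.
Proof.
have [g1 [i1 E1 ae1]] := weak_coef j.
have [P fpb] := fp_powb mgg iG gG fpE j.
have UE r : 0 < r <= T -> u r (phi j) = \int[leb]_(s in `]0, r[) g1 s.
  by move=> /andP[r0 rT]; rewrite -E1 ?(ltW r0)// (u0_eq0 (phiV hphi j)) subr0.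
have Ueq : {ae (@leb R), forall s, `]0, T[%classic s ->
    conv b g1 s + a0 * beta (1 - al) al * mu j * u s (phi j) = a0 * beta (1 - al) al * f s (phi j)}.
  by move: ae1; apply: aeS => s h /h; rewrite a0_beta.
exact: (mode_unique al0 al1 a0_gt0 T0 (fp_measurable mgg iG gG fpE j) fpb (fE j) i1 UE Ueq).
Qed.

Lemma M_ell2 t : 0 < t <= T -> ell2 (M t).
Proof.
move=> tT; apply: ell2_enorm => n.
exact: (vmode_le al0 al1 T0 a0_gt0 (mu_gt0 hphi) mgg iG gG fE fpE fF fpF n tT).
Qed.

Lemma M1_ell2 t : 0 < t <= T -> ell2 (M1 t).
Proof.
move=> tT; apply: ell2_enorm => n.
exact: (vmode1_le al0 al1 T0 a0_gt0 (mu_gt0 hphi) mgg iG gG fpE fF fpF n tT).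
Qed.

Definition vmode1_bound t := Fp * (a0 / al * T `^ al) + F * akern al a0 t.

Lemma vmode1_bound_integrable : leb.-integrable `]0, T[ (EFin \o vmode1_bound).
Proof.
apply: integrableD_real; first exact: measurable_oo.
  by apply: integrable_cst_real; [exact: measurable_oo|rewrite /= lebesgue_measure_itv/= lte_fin T0 -EFinD ltry].
by apply: integrableZ_real; [exact: measurable_oo|exact: akern_integrable].
Qed.

Lemma M1_le_bound n t : 0 < t <= T -> enorm n (M1 t) <= vmode1_bound t.
Proof.
move=> /andP[t0 tT]; have tT' : 0 < t <= T by rewrite t0.
apply: le_trans (vmode1_le al0 al1 T0 a0_gt0 (mu_gt0 hphi) mgg iG gG fpE fF fpF n tT') _.
rewrite lerD2r ler_wpM2l ?(Fp_ge0 T0 fpF)//.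
rewrite ler_wpM2l ?divr_ge0 ?(ltW a0_gt0) ?(ltW al0)//.
by apply: ge0_ler_powR => //; rewrite ?nnegrE; exact: ltW.
Qed.

Lemma MB_le n s t : 0 < s -> s <= t -> t <= T ->
  enorm n (fun j => M t j - M s j) <= \int[leb]_(r in `]s, t[) vmode1_bound r.
Proof.
move=> s0 st tT; under [X in enorm n X]funext do rewrite (vmodeB al0 al1 T0 a0_gt0 (mu_gt0 hphi) mgg iG gG fE fpE fF fpF _ s0 st tT).
apply: minkowski_integral.
- exact: measurable_oo.
- move=> j; have := vmode1_measurable al0 a0 mu fj mgg iG gG fpE j.
  by apply: measurable_funS; [exact: measurable_oo|apply: subset_itv; rewrite bnd_simp// ltW].
- exact: integrable_oo_sub (ltW s0) tT vmode1_bound_integrable.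
- by move=> r /=; rewrite in_itv/= => /andP[sr rt]; apply: M1_le_bound; rewrite (lt_trans s0)//= (le_trans (ltW rt)).
Qed.

(** Coefficients determine [u t] on [V] once it is represented in L2, which the weak formulation
    grants at almost every time. Such times [s m] increase to [t], and both sides are continuous
    along them, by absolute continuity of the integrals. *)
Lemma u_repr t : 0 < t <= T -> eqV Omega (of_L2 Omega (rf (M t))) (u t).
Proof.
move=> /andP[t0 tT] v Vv; have Lv := V_L2 Vv.
have [K0 hK0 _] := Vv; have [_ _ /(_ K0 hK0) hae _] := H.
have ae_fin : {ae (@leb R), forall s, `]0, T[%classic s -> (nL2 Omega (u s) < +oo)%E}.
  move: hae; apply: aeS => s h /h[J [c [hJ Ju _ _]]].
  have LJ : L2 Omega (J [::]) by apply: V_L2; exists J.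
  by apply: le_lt_trans (nL2_le LJ Ju (lexx _)) _; rewrite ltry.
have hs m : exists s, t - t / m.+2%:R < s < t /\ (nL2 Omega (u s) < +oo)%E.
  have tm : 0 < t / m.+2%:R by rewrite divr_gt0.
  have [||s st fs] := @ae_itv_point _ (t - t / m.+2%:R) t (fun s => nL2 Omega (u s) < +oo)%E.
  - by rewrite gtrBl.
  - move: ae_fin; apply: aeS => s h; rewrite /= in_itv/= => /andP[s1 s2]; apply: h.
    rewrite /= in_itv/= (lt_le_trans s2 tT) andbT; apply: le_lt_trans s1.
    by rewrite subr_ge0 ler_pdivrMr// ler_peMr ?(ltW t0)// ler1n.
  - by exists s.
have [s hs'] := choice hs.
have s0 m : 0 < s m.
  have /andP[+ _] := (hs' m).1; apply: le_lt_trans.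
  by rewrite subr_ge0 ler_pdivrMr// ler_peMr ?(ltW t0)// ler1n.
have st m : s m <= t by have /andP[_ /ltW] := (hs' m).1.
have sc : s m @[m --> \oo] --> t.
  have hc := div_harmonic_cvg t.
  have h1 : t - t / m.+2%:R @[m --> \oo] --> t.
    by rewrite -[X in _ --> X]subr0; apply: cvgB => //; exact: cvg_cst.
  apply: (@squeeze_cvgr _ _ _ _ (fun m => t - t / m.+2%:R) (fun=> t)) => //; last exact: cvg_cst.
  by near=> m; have /andP[/ltW -> /ltW ->] := (hs' m).1.
have E m : u (s m) v = of_L2 Omega (rf (M (s m))) v.
  have sT : 0 < s m <= T by rewrite s0 (le_trans (st m)).
  have [w Lw wu] := nL2_fin (hs' m).2.
  rewrite -wu//; apply: (L2_coef_eq hphi Lw (rfL2 _)) => // j.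
  rewrite (of_L2_coef hphi wu) u_mode// rfE//; exact: M_ell2.
have [g1 i1 E1] := weak_derivative Vv.
have tc : (fun=> t) m @[m --> \oo] --> t by exact: cvg_cst.
have c1 := integral_shrink_cvg0 i1 (fun m => ltW (s0 m)) (fun _ => tT) sc tc.
have c2 := integral_shrink_cvg0 vmode1_bound_integrable (fun m => ltW (s0 m)) (fun _ => tT) sc tc.
have c1' : u (s m) v @[m --> \oo] --> u t v.
  have h : u t v - \int[leb]_(r in `]s m, t[) g1 r @[m --> \oo] --> u t v.
    by rewrite -[X in _ --> X]subr0; apply: cvgB => //; exact: cvg_cst.
  apply: cvg_trans h; apply: near_eq_cvg; near=> m.
  by rewrite -E1 ?(ltW (s0 m))// subKr.
have c2' : of_L2 Omega (rf (M (s m))) v @[m --> \oo] --> of_L2 Omega (rf (M t)) v.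
  have h : of_L2 Omega (rf (M t)) v - of_L2 Omega (rf (M (s m))) v @[m --> \oo] --> 0.
    apply/norm_cvg0P; have h0 : (\int[leb]_(r in `]s m, t[) vmode1_bound r) * nrm Omega v @[m --> \oo] --> 0.
      by rewrite -[X in _ --> X](mul0r (nrm Omega v)); apply: cvgMr_tmp.
    apply: (@squeeze_cvgr _ _ _ _ (fun=> 0)) h0; last exact: cvg_cst.
    near=> m; rewrite normr_ge0/=.
    apply: (coef_bound hphi (g := of_L2 Omega (rf (M t)) - of_L2 Omega (rf (M (s m))))) => //.
      apply: nL2_D; first exact: nL2_of_L2_lty.
      by rewrite -scaleN1r; apply: nL2_Z; exact: nL2_of_L2_lty.
    move=> n; have := MB_le n (s0 m) (st m) tT; congr (enorm n _ <= _); apply/funext => j.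
    rewrite -[RHS]/(inner Omega (rf (M t)) (phi j) - inner Omega (rf (M (s m))) (phi j)).
    rewrite !rfE//; apply: M_ell2; rewrite ?t0//.
    by rewrite s0 (le_trans (st m)).
  have h' : of_L2 Omega (rf (M t)) v - (of_L2 Omega (rf (M t)) v - of_L2 Omega (rf (M (s m))) v) @[m --> \oo] -->
      of_L2 Omega (rf (M t)) v - 0 by apply: cvgB => //; exact: cvg_cst.
  rewrite subr0 in h'; apply: cvg_trans h'; apply: near_eq_cvg; near=> m.
  by rewrite subKr.
rewrite -(cvg_lim (@Rhausdorff R) c2') -(cvg_lim (@Rhausdorff R) c1').
by congr (limn _); apply/funext => m; rewrite E.
Unshelve. all: by end_near. Qed.

Local Notation z2 := (vmode2_bound al a0 G F Fp).
Definition du t : W := of_L2 Omega (rf (M1 t)).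

Lemma u_nL2_lty t : 0 < t <= T -> (nL2 Omega (u t) < +oo)%E.
Proof. by move=> /u_repr h; apply: le_lt_trans (nL2_le (rfL2 _) h (lexx _)) _; rewrite ltry. Qed.

Lemma du_nL2_lty t : (nL2 Omega (du t) < +oo)%E.
Proof. exact: nL2_of_L2_lty. Qed.

Lemma du_coef j t : 0 < t <= T -> du t (phi j) = M1 t j.
Proof. by move=> tT; apply: rfE; exact: M1_ell2. Qed.

Lemma du_linear t : linear_on (V Omega) (du t).
Proof. exact: of_L2_linear. Qed.

Lemma ddu_bound_integrable d : 0 < d -> leb.-integrable `]d, T[ (EFin \o z2).
Proof. exact: vmode2_bound_integrable. Qed.

Lemma ddu_bound_ge0 t : 0 < t <= T -> 0 <= z2 t.
Proof. exact: (vmode2_bound_ge0 al T0 a0_gt0 gG fF fpF). Qed.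

Lemma M_quot_le n s t r : 0 < s -> s < t -> t <= T -> s <= r <= t ->
  enorm n (fun j => (M t j - M s j) / (t - s) - M1 r j) <= \int[leb]_(z in `]s, t[) z2 z.
Proof. exact: (vmode_quot_le al0 al1 T0 a0_gt0 (mu_gt0 hphi) mgg iG gG fE fpE fF fpF). Qed.

(** The alternatives are the forward quotient at [s] and the backward quotient at [t]. *)
Lemma nVdual_quot_le s t r h : 0 < s -> s < t -> t <= T -> (r = s /\ h = t - s \/ r = t /\ h = s - t) ->
  (nVdual Omega (h^-1 *: (u (r + h) - u r) - du r)%R <= (\int[leb]_(z in `]s, t[) z2 z)%:E)%E.
Proof.
move=> s0 st tT rh; have t0 := lt_trans s0 st.
have sT : 0 < s <= T by rewrite s0 (le_trans (ltW st)).
have tT' : 0 < t <= T by rewrite t0.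
have ts : 0 < t - s by rewrite subr_gt0.
have [rT rhT rst] : [/\ 0 < r <= T, 0 < r + h <= T & s <= r <= t].
  by case: rh => -[-> ->]; rewrite addrC subrK ?lexx (ltW st).
have lin x : 0 < x <= T -> linear_on (V Omega) (u x) by move=> /andP[/ltW x0 xT]; apply: u_linear; rewrite x0.
apply: (nVdual_coef_le hphi).
- by apply: linear_onB; [apply: linear_on_scale; apply: linear_onB; exact: lin|exact: du_linear].
- by apply: nL2_B; [apply: nL2_Z; apply: nL2_B; exact: u_nL2_lty|exact: du_nL2_lty].
move=> n; have := M_quot_le n s0 st tT rst; congr (enorm n _ <= _); apply/funext => j.
rewrite -[RHS]/(h^-1 * (u (r + h) (phi j) - u r (phi j)) - du r (phi j)) du_coef// !u_mode//.
congr (_ - _); case: rh => -[-> ->]; first by rewrite [s + _]addrC subrK mulrC.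
by rewrite [t + (s - t)]addrC subrK mulrC -[s - t]opprB invrN mulNr -mulrN opprB.
Qed.

Lemma deriv_u t : 0 < t <= T -> deriv_at (nVdual Omega) T u t (du t).
Proof.
move=> /andP[t0 tT].
pose d m := t / m.+2%:R.
have d0 m : 0 < d m by rewrite divr_gt0.
have dt m : d m <= t / 2 by rewrite ler_pM2l// lef_pV2 ?posrE// ler_nat.
(* The window is cut at [T], where the bound [z2] ceases to be available, and stays beyond [t / 2],
   where [z2] is integrable. *)
pose lo m := t - d m; pose hi m := Num.min T (t + d m).
have t2 : 0 < t / 2 by rewrite divr_gt0.
have lo2 m : t / 2 <= lo m by have := dt m; rewrite /lo; lra.
have hiT m : hi m <= T by rewrite /hi ge_min lexx.
have dc : d m @[m --> \oo] --> 0 by exact: div_harmonic_cvg.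
have loc : lo m @[m --> \oo] --> t.
  by rewrite -[X in _ --> X]subr0; apply: cvgB => //; exact: cvg_cst.
have hic : hi m @[m --> \oo] --> t.
  have c : t + d m @[m --> \oo] --> t by rewrite -[X in _ --> X]addr0; apply: cvgD => //; exact: cvg_cst.
  apply: (@squeeze_cvgr _ _ _ _ (fun=> t)) c; last exact: cvg_cst.
  by near=> m; rewrite /hi le_min tT lerDl (ltW (d0 m))/= ge_min lexx orbT.
have Ic := integral_shrink_cvg0 (ddu_bound_integrable t2) lo2 hiT loc hic.
have zlo m s : lo m < s < hi m -> 0 <= z2 s.
  move=> /andP[s1 s2]; apply: ddu_bound_ge0; rewrite (lt_trans _ s1) ?(lt_le_trans t2)//=.
  exact: le_trans (ltW s2) (hiT m).
have ilo m : leb.-integrable `]lo m, hi m[ (EFin \o z2).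
  exact: integrable_oo_sub (lo2 m) (hiT m) (ddu_bound_integrable t2).
have main m h : h != 0 -> `|h| < d m -> 0 <= t + h <= T ->
    (nVdual Omega (h^-1 *: (u (t + h) - u t) - du t)%R <= (\int[leb]_(z in `]lo m, hi m[) z2 z)%:E)%E.
  move=> h0 hd /andP[th0 thT].
  have [hn|hp] : h < 0 \/ 0 < h by case: (ltgtP h 0) h0 => //; [left|right].
    rewrite ltr0_norm// in hd; have dm := dt m.
    have s0 : 0 < t + h by lra.
    have st : t + h < t by lra.
    apply: le_trans (nVdual_quot_le (r := t) (h := h) s0 st tT _) _.
      by right; split => //; rewrite addrAC subrr add0r.
    rewrite lee_fin; apply: ge0_Rintegral_oo_sub (ilo m) (zlo m); first by rewrite /lo; lra.
    by rewrite /hi le_min tT lerDl ltW.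
  rewrite gtr0_norm// in hd.
  have st : t < t + h by lra.
  apply: le_trans (nVdual_quot_le (r := t) (h := h) t0 st thT _) _.
    by left; split => //; rewrite addrAC subrr add0r.
  rewrite lee_fin; apply: ge0_Rintegral_oo_sub (ilo m) (zlo m); first by rewrite /lo gerBl ltW.
  by rewrite /hi le_min thT lerD2l ltW.
have N0 := nVdual_ge0 hphi.
have ev (e : R) : 0 < e -> \forall h \near within [set h | 0 <= t + h <= T] 0^',
    (nVdual Omega (h^-1 *: (u (t + h) - u t) - du t)%R <= e%:E)%E.
  move=> e0; have [m hm] := filter_ex (cvgr_lt _ Ic _ e0).
  have h1 : \forall h \near (0 : R)^', h != 0 by exact: nbhs_dnbhs_neq.
  have h2 : \forall h \near (0 : R)^', `|h| < d m by apply: dnbhs0_lt.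
  have : \forall h \near (0 : R)^', 0 <= t + h <= T ->
      (nVdual Omega (h^-1 *: (u (t + h) - u t) - du t)%R <= e%:E)%E.
    apply: filterS2 h1 h2 => h h0 hd hT.
    by apply: le_trans (main m h h0 hd hT) _; rewrite lee_fin ltW.
  exact.
apply/fine_cvgP; split.
  have := ev 1 ltr01; apply: filterS => h hle.
  by rewrite ge0_fin_numE// (le_lt_trans hle)// ltry.
apply/cvgrPdist_le => e e0; have := ev e e0; apply: filterS => h hle.
rewrite sub0r normrN ger0_norm ?fine_ge0// -lee_fin fineK//.
by rewrite ge0_fin_numE// (le_lt_trans hle)// ltry.
Unshelve. all: by end_near. Qed.

(** Backward steps are admissible at every [t > 0], including [t = T]. *)
Lemma deriv_seq (g : R -> W) t d : 0 < t <= T -> deriv_at (nVdual Omega) T g t d ->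
  nVdual Omega ((t / n.+2%:R)^-1 *: (g t - g (t - t / n.+2%:R)) - d) @[n --> \oo] --> 0%E.
Proof.
move=> /andP[t0 tT] Hd.
have hc : - (t / n.+2%:R) @[n --> \oo] --> within [set h | 0 <= t + h <= T] 0^'.
  have c : - (t / n.+2%:R) @[n --> \oo] --> (0 : R).
    by rewrite -[X in _ --> X]oppr0; apply: cvgN; exact: div_harmonic_cvg.
  move=> P /= [e e0 hP].
  move/cvgrPdist_lt : c => /(_ e e0); apply: filterS => n hn; apply: hP => //=.
  - by rewrite oppr_eq0 gt_eqF// divr_gt0.
  - rewrite subr_ge0 ler_pdivrMr// ler_peMr ?(ltW t0) ?ler1n//=.
    by apply: le_trans tT; rewrite gerBl divr_ge0 ?(ltW t0).
have := cvg_comp _ _ hc Hd; apply: cvg_trans; apply: near_eq_cvg; near=> n.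
congr (nVdual Omega (_ - d)); rewrite /= invrN scaleNr -scalerN opprB.
by [].
Unshelve. all: by end_near. Qed.

Lemma deriv_unique (g : R -> W) t d d' : 0 < t <= T -> deriv_at (nVdual Omega) T g t d ->
  deriv_at (nVdual Omega) T g t d' -> eqV Omega d d'.
Proof.
move=> tT /(deriv_seq tT)/nVdual_cvg0[_ h] /(deriv_seq tT)/nVdual_cvg0[_ h'] v Vv.
pose Q n := (t / n.+2%:R)^-1 *: (g t - g (t - t / n.+2%:R)).
have c : (Q n v - d' v) - (Q n v - d v) @[n --> \oo] --> 0 - 0 by apply: cvgB; [exact: h'|exact: h].
have e : (fun n => (Q n v - d' v) - (Q n v - d v)) = (fun=> d v - d' v).
  by apply/funext => n; rewrite opprB addrC addrA subrK.
rewrite e subr0 in c; apply/eqP; rewrite -subr_eq0; apply/eqP.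
by rewrite -(cvg_lim (@Rhausdorff R) c) lim_cst.
Qed.

Lemma M2_ell2 t : 0 < t <= T -> good al G t -> ell2 (M2 t).
Proof.
move=> tT gt; apply: ell2_enorm => n.
exact: (vmode2_le_bound al0 al1 T0 a0_gt0 (mu_gt0 hphi) mgg gG fF fpF n tT gt).
Qed.

Lemma deriv_du t d : 0 < t <= T -> good al G t -> deriv_at (nVdual Omega) T du t d ->
  eqV Omega (of_L2 Omega (rf (M2 t))) d.
Proof.
move=> tT gt; have /andP[t0 tT'] := tT => /(deriv_seq tT)/nVdual_cvg0[_ Hd] v Vv.
pose h n := t / n.+2%:R.
have h0 n : 0 < h n by rewrite divr_gt0.
have ht n : h n <= t / 2 by rewrite ler_pM2l// lef_pV2 ?posrE// ler_nat.
have tht n : 0 < t - h n <= T.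
  by have := ht n; have := h0 n => ? ?; apply/andP; split; lra.
pose Q n : W := (h n)^-1 *: (du t - du (t - h n)).
pose g n : W := Q n - of_L2 Omega (rf (M2 t)).
have Qc n j : Q n (phi j) = (M1 t j - M1 (t - h n) j) / h n.
  by rewrite -[LHS]/((h n)^-1 * (du t (phi j) - du (t - h n) (phi j))) !du_coef// mulrC.
have gc n j : g n (phi j) = (M1 t j - M1 (t - h n) j) / h n - M2 t j.
  by rewrite -Qc -[LHS]/(Q n (phi j) - inner Omega (rf (M2 t)) (phi j)) rfE//; exact: M2_ell2.
have gf n : (nL2 Omega (g n) < +oo)%E.
  by apply: nL2_B; [apply: nL2_Z; apply: nL2_B; exact: du_nL2_lty|exact: nL2_of_L2_lty].
pose B := conv (fun s => 2 * (a0 / al + a0) * s `^ (al - 1)) G t +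
  Fp * (2 * (a0 / al + a0) * t `^ (al - 1)) + F * (6 * a0 * (t / 2) `^ (al - 2)) + z2 t.
have gB n m : enorm m (fun j => g n (phi j)) <= B.
  under [X in enorm m X]funext do rewrite gc -[- M2 _ _]mulN1r.
  apply: le_trans (enormD _ _ _) _; apply: lerD.
    have hh : 0 < h n <= t / 2 by rewrite h0 ht.
    exact: (vquot_le al0 al1 T0 a0_gt0 (mu_gt0 hphi) mgg iG gG fpE fF fpF m hh tT' gt).
  rewrite enormZ normrN normr1 mul1r.
  exact: (vmode2_le_bound al0 al1 T0 a0_gt0 (mu_gt0 hphi) mgg gG fF fpF m tT gt).
have gcv j : g n (phi j) @[n --> \oo] --> 0.
  have E : (fun n => g n (phi j)) = (fun n => (M1 t j - M1 (t - h n) j) / h n - M2 t j).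
    by apply/funext => n; exact: gc.
  rewrite E -[X in _ --> X](subrr (M2 t j)); apply: cvgB; last exact: cvg_cst.
  apply: (mode1_quot_cvg al0 al1 a0_gt0 (mu_gt0 hphi j) T0 (gg_integrable mgg iG gG j) (fpE j) tT).
  - by move=> n; rewrite h0/=; have := ht n; lra.
  - exact: div_harmonic_cvg.
  - apply: (integrable_dom (measurable_oo 0 t) _ gt).
      by apply: measurable_funM; [exact: measurable_powRB|exact: measurable_itvS tT' (mgg j)].
    move=> s /=; rewrite in_itv/= => /andP[s0 st]; rewrite normrM (ger0_norm (powR_ge0 _ _)).
    rewrite ler_wpM2l ?powR_ge0//; have sT : 0 < s < T by rewrite s0 (lt_le_trans st).
    by apply: le_trans (gG j.+1 sT); exact: (@enorm_term _ j.+1 (gg^~ s)).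
have c1 := functional_weak_cvg0 hphi gf gB gcv Vv.
have c2 := Hd v Vv.
have c : g n v - (Q n v - d v) @[n --> \oo] --> 0 - 0 by apply: cvgB; [exact: c1|exact: c2].
have e : (fun n => g n v - (Q n v - d v)) = (fun=> d v - of_L2 Omega (rf (M2 t)) v).
  apply/funext => n; rewrite -[g n v]/(Q n v - of_L2 Omega (rf (M2 t)) v).
  by rewrite opprB addrC addrA subrK.
rewrite e subr0 in c; apply/esym/eqP; rewrite -subr_eq0; apply/eqP.
by rewrite -(cvg_lim (@Rhausdorff R) c) lim_cst.
Qed.

(** At a time that is not [good], take the derivative of [du] if there is one and 0 otherwise; by
    [deriv_unique] the choice does not matter on [V]. *)
Lemma ddu_ex : exists ddu : R -> W,
  (forall t, good al G t -> ddu t = of_L2 Omega (rf (M2 t))) /\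
  forall t d, 0 < t <= T -> deriv_at (nVdual Omega) T du t d -> eqV Omega (ddu t) d.
Proof.
have h t : exists x : W, (good al G t -> x = of_L2 Omega (rf (M2 t))) /\
    forall d, 0 < t <= T -> deriv_at (nVdual Omega) T du t d -> eqV Omega x d.
  have [gt|ngt] := pselect (good al G t).
    by exists (of_L2 Omega (rf (M2 t))); split => // d tT; exact: deriv_du.
  have [[d hd]|nd] := pselect (exists d, deriv_at (nVdual Omega) T du t d).
    by exists d; split => // d' tT; exact: deriv_unique.
  by exists 0; split => // d _ hd; exfalso; apply: nd; exists d.
have [ddu hu2] := choice h; exists ddu; split => t; first exact: (hu2 t).1.
by move=> d; exact: (hu2 t).2.
Qed.

Variables (ddu : R -> W) (ddu_good : forall t, good al G t -> ddu t = of_L2 Omega (rf (M2 t))).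

Lemma bochner_ddu s t : 0 < s -> s <= t -> t <= T ->
  bochner_int (nVdual Omega) `]s, t[ ddu (du t - du s).
Proof.
move=> s0 st tT.
have st0 r : s < r < t -> 0 < r < T by move=> /andP[sr rt]; rewrite (lt_trans s0)//= (lt_le_trans rt).
have sub : `]s, t[ `<=` `]0, T[ by apply: subset_itv; rewrite bnd_simp// ltW.
apply: (@bochner_int_coords_ae R Omega mu phi s t (fun j r => M2 r j) z2 ddu _ hphi).
- move=> j; have := measurable_mode2 al0 a0 (mu j) T0 (fj j) (fpj j) (gg_integrable mgg iG gG j).
  by apply: measurable_funS => //; exact: measurable_oo.
- exact: integrable_oo_sub (lexx s) tT (ddu_bound_integrable s0).
- move: (good_ae al0 T0 iG); apply: aeS => r gr; rewrite /= in_itv/= => /st0 rT.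
  have gr' : good al G r by apply: gr; rewrite /= in_itv.
  have rT' : 0 < r <= T by case/andP: rT => -> /ltW.
  split; first by move=> n; exact: (vmode2_le_bound al0 al1 T0 a0_gt0 (mu_gt0 hphi) mgg gG fF fpF n rT' gr').
  rewrite ddu_good//; split; [exact: of_L2_linear|exact: nL2_of_L2_lty|].
  by move=> j; apply: rfE; exact: M2_ell2.
- by apply: linear_onB; exact: du_linear.
- by apply: nL2_B; exact: du_nL2_lty.
move=> j; rewrite -[LHS]/(du t (phi j) - du s (phi j)) !du_coef ?s0 ?(lt_le_trans s0 st) ?(le_trans st)//.
exact: (mode1_primitive al0 a0 (mu j) T0 (fj j) (gg_integrable mgg iG gG j) (fpE j) s0 st tT).
Qed.

Local Notation cw t := (fun j => f t (phi j) - mu j * M t j).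
(** At [t = 0] the integral defining the Caputo derivative is over the empty set, so the value there
    is 0, not [f 0]. *)
Definition caputo_sol t : W := if 0 < t then of_L2 Omega (rf (cw t)) else 0.

Let b1 : 0 < 1 - al. Proof. by rewrite subr_gt0. Qed.

Lemma vmode1_bound_conv_integrable t : 0 < t <= T ->
  leb.-integrable `]0, t[ (EFin \o (fun s => (t - s) `^ (- al) * vmode1_bound s)).
Proof.
move=> tT; have bb : powb (1 - al) 1 T b by exact: bkern_powb.
have mb : measurable_fun `]0, T[ b by exact: measurable_powRl.
have ma : measurable_fun `]0, T[ (akern al a0).
  by apply: measurable_funM; [exact: measurable_cst|exact: measurable_powRl].
have ab : powb al a0 T (akern al a0).
  move=> s /andP[s0 _]; rewrite ger0_norm// mulr_ge0 ?powR_ge0//.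
  exact: ltW.
have mc : measurable_fun `]0, T[ (fun=> Fp * (a0 / al * T `^ al)) by exact: measurable_cst.
have cb : powb 1 `|Fp * (a0 / al * T `^ al)| T (fun=> Fp * (a0 / al * T `^ al)) by exact: one_powb.
have i1 := powb_conv_integrable mb mc b1 ltr01 bb cb tT.
have i2 := integrableZ_real (measurable_oo 0 t) F (powb_conv_integrable mb ma b1 al0 bb ab tT).
have := integrableD_real (measurable_oo 0 t) i1 i2; apply: eq_integrable; first exact: measurable_oo.
by move=> s _; rewrite /= /vmode1_bound mulrDr; congr (_ + _)%:E; exact: mulrCA.
Qed.

Lemma conv_M1 j t : 0 < t <= T -> conv b (fun s => M1 s j) t = Gamma (1 - al) * cw t j.
Proof.
move=> tT; have [P fpb] := fp_powb mgg iG gG fpE j.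
have := conv_bkern_mode1 al0 al1 (mu j) a0_gt0 T0 (fp_measurable mgg iG gG fpE j) fpb (fE j) tT.
rewrite a0_beta => e.
have -> : conv b (fun s => M1 s j) t = Gamma (1 - al) * f t (phi j) - mu j * Gamma (1 - al) * M t j.
  by rewrite -e addrK.
by rewrite mulrBr mulrCA mulrA.
Qed.

(** Square summability of [mu j * M t j] is not evident term by term. By [conv_M1] the whole
    combination is a multiple of [b*M1], which Minkowski's inequality bounds. *)
Lemma cw_ell2 t : 0 < t <= T -> ell2 (cw t).
Proof.
move=> tT; have /andP[t0 tT'] := tT.
apply: (@ell2_enorm _ _ ((Gamma (1 - al))^-1 * \int[leb]_(s in `]0, t[) ((t - s) `^ (- al) * vmode1_bound s))) => n.
have G0 : 0 < Gamma (1 - al) by apply: Gamma_gt0; rewrite b1 lerBlDr lerDl ltW.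
have -> : cw t = (fun j => (Gamma (1 - al))^-1 * conv b (fun s => M1 s j) t).
  by apply/funext => j; rewrite conv_M1// mulKf// gt_eqF.
rewrite enormZ ger0_norm ?invr_ge0 ?(ltW G0)// ler_wpM2l ?invr_ge0 ?(ltW G0)//.
apply: minkowski_integral.
- exact: measurable_oo.
- move=> j; apply: measurable_funM; first exact: measurable_powRB.
  exact: measurable_itvS tT' (vmode1_measurable al0 a0 mu fj mgg iG gG fpE j).
- exact: vmode1_bound_conv_integrable.
- move=> s /=; rewrite in_itv/= => /andP[s0 st]; rewrite enormZ ger0_norm ?powR_ge0// ler_wpM2l ?powR_ge0//.
  by apply: M1_le_bound; rewrite s0 (le_trans (ltW st)).
Qed.

(** For each [v] the derivative of [u s v] is taken to be the pairing of [du s] with [v].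
    [coords_Rintegral] is used for its primitive and again for its convolution with [b]. *)
Lemma caputo_u t : 0 <= t <= T -> caputo_deriv_at Omega al T u t (caputo_sol t).
Proof.
move=> /andP[t0 tT] v Vv; have Lv := V_L2 Vv.
have G0 : 0 < Gamma (1 - al) by apply: Gamma_gt0; rewrite b1 lerBlDr lerDl ltW.
pose g1 s := inner Omega (rf (M1 s)) v.
have mM1 r j : r <= T -> measurable_fun `]0, r[ (fun s => M1 s j).
  by move=> rT; exact: measurable_itvS rT (vmode1_measurable al0 a0 mu fj mgg iG gG fpE j).
have C1 r : 0 < r <= T -> leb.-integrable `]0, r[ (EFin \o g1) /\ \int[leb]_(s in `]0, r[) g1 s = u r v.
  move=> /andP[r0 rT].
  have i1 : leb.-integrable `]0, r[ (EFin \o vmode1_bound) by exact: integrable_oo_sub (lexx 0) rT vmode1_bound_integrable.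
  have [|||ig ->] := @coords_Rintegral R Omega mu phi hphi rf rfL2 rfE `]0, r[%classic (fun j s => M1 s j) vmode1_bound g1 v Lv (measurable_oo 0 r) _ i1.
  - by move=> j; exact: mM1.
  - move=> n s /=; rewrite in_itv/= => /andP[s0 sr].
    by apply: M1_le_bound; rewrite s0 (le_trans (ltW sr)).
  - by [].
  - have rT' : 0 < r <= T by rewrite r0.
    have -> : (fun j => \int[leb]_(s in `]0, r[) M1 s j) = M r.
      by apply/funext => j; exact/esym/(vmode_primitive al0 T0 a0 mu mgg iG gG fE fpE j rT').
    by split => //; exact: (u_repr rT' Vv).
have [ig _] := C1 T ltac:(by rewrite T0 lexx).
have prim s r : 0 <= s -> s <= r -> r <= T -> u r v - u s v = \int[leb]_(x in `]s, r[) g1 x.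
  move=> s0 sr rT; have [s00|sn0] := eqVneq s 0.
    rewrite s00 (u0_eq0 Vv) subr0; have [r00|rn0] := eqVneq r 0.
      by rewrite r00 (u0_eq0 Vv) set_itv_ge ?bnd_simp ?ltxx// Rintegral_set0.
    have rT' : 0 < r <= T by rewrite lt_neqAle eq_sym rn0 (le_trans s0).
    by have [_ ->] := C1 r rT'.
  have sT : 0 < s <= T by rewrite lt_neqAle eq_sym sn0 s0 (le_trans sr).
  have rT' : 0 < r <= T by rewrite (lt_le_trans _ sr)//; case/andP: sT.
  have [ir <-] := C1 r rT'; have [_ <-] := C1 s sT.
  have srr : 0 <= s <= r by rewrite s0.
  by rewrite (Rintegral_oo_split ir srr) addrAC subrr add0r.
rewrite /caputo_sol; case: ifPn => [t_gt0|]; last first.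
  rewrite -leNgt => tle0; have -> : t = 0 by apply/eqP; rewrite eq_le tle0.
  have z : conv b g1 0 = 0 by rewrite /conv set_itv_ge ?bnd_simp ?ltxx// Rintegral_set0.
  have := conv_caputo (al := al) ig prim (t := 0); rewrite z mulr0; apply.
  by rewrite set_itv_ge ?bnd_simp ?ltxx//; exact: integrable_set0.
have tT' : 0 < t <= T by rewrite t_gt0.
have [|||igt E] := @coords_Rintegral R Omega mu phi hphi rf rfL2 rfE `]0, t[%classic
  (fun j s => (t - s) `^ (- al) * M1 s j) (fun s => (t - s) `^ (- al) * vmode1_bound s) (fun s => (t - s) `^ (- al) * g1 s) v Lv
  (measurable_oo 0 t) _ (vmode1_bound_conv_integrable tT').
- by move=> j; apply: measurable_funM; [exact: measurable_powRB|exact: mM1].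
- move=> n s /=; rewrite in_itv/= => /andP[s0 st]; rewrite enormZ ger0_norm ?powR_ge0// ler_wpM2l ?powR_ge0//.
  by apply: M1_le_bound; rewrite s0 (le_trans (ltW st)).
- move=> s /=; rewrite in_itv/= => /andP[s0 st].
  have sT : 0 < s <= T by rewrite s0 (le_trans (ltW st)).
  have e1 := M1_ell2 sT; have e2 : ell2 (fun j => (t - s) `^ (- al) * M1 s j).
    apply: (@ell2_enorm _ _ ((t - s) `^ (- al) * vmode1_bound s)) => n.
    by rewrite enormZ ger0_norm ?powR_ge0// ler_wpM2l ?powR_ge0//; exact: M1_le_bound.
  by rewrite (rfZ hphi rfL2 rfE e1 e2 Lv).
have := conv_caputo ig prim igt; congr (caputo_at _ _ _ _ _).
rewrite -[conv b g1 t]/(\int[leb]_(s in `]0, t[) ((t - s) `^ (- al) * g1 s)) E.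
have -> : (fun j => \int[leb]_(s in `]0, t[) ((t - s) `^ (- al) * M1 s j)) =
    (fun j => Gamma (1 - al) * cw t j).
  by apply/funext => j; exact: (conv_M1 j tT').
have e1 := cw_ell2 tT'; have e2 : ell2 (fun j => Gamma (1 - al) * cw t j).
  have [B hB] := e1; exists (Gamma (1 - al) ^+ 2 * B) => n.
  under eq_bigr do rewrite exprMn; rewrite -mulr_sumr ler_wpM2l ?sqr_ge0//.
by rewrite (rfZ hphi rfL2 rfE e1 e2 Lv) mulKf// gt_eqF.
Qed.

Let C1 := (1 + a0) * 2 / al.
Let C1_ge0 : 0 <= C1. Proof. by rewrite /C1 divr_ge0 ?(ltW al0)// mulr_ge0// addr_ge0// ltW. Qed.

Lemma conv_nDA (h : R -> W) (r eps t : R) n : 0 < eps < 1 -> 0 < t <= T ->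
  (forall j, measurable_fun `]0, T[ (fun s => h s (phi j))) ->
  (forall j, exists P, powb 1 P T (fun s => h s (phi j))) ->
  norm_Linf t (nDA Omega mu phi r \o h) \is a fin_num ->
  enorm n (wcoef mu (r + 1 - eps / 2) (fun j => conv (ker al a0 (mu j)) (fun s => h s (phi j)) t)) <=
    C1 * (eps^-1 * t `^ (al * eps / 2) * fine (norm_Linf t (nDA Omega mu phi r \o h))).
Proof.
move=> eps01 tT mh hb Nf.
have ae1 := @Linf_ae R (nDA Omega mu phi r \o h) t (fun s => nDA_ge0 hphi r (h s)).
have N0 : 0 <= fine (norm_Linf t (nDA Omega mu phi r \o h)) by rewrite fine_ge0// Lnorm_ge0.
apply: (fractional_estimate al0 al1 a0_gt0 (mu_gt0 hphi) eps01 tT N0 mh hb).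
move: ae1; apply: aeS => s hs st; rewrite -lee_fin fineK//; apply: le_trans (hs st).
exact: nDA_ge_coef.
Qed.

Let mfj j : measurable_fun `]0, T[ (fun s => f s (phi j)).
Proof. exact: (f_measurable T0 mgg iG gG fE fpE fpF j). Qed.

Let bfj j : exists P, powb 1 P T (fun s => f s (phi j)).
Proof.
exists F => s /andP[s0 sT]; rewrite subrr powRr0 mulr1.
have sT' : 0 <= s <= T by rewrite (ltW s0) (ltW sT).
by apply: le_trans (fF j.+1 sT'); exact: (@enorm_term _ j.+1 (fun j => f s (phi j))).
Qed.

Lemma estimate_u (eps q t : R) : 0 < eps < 1 -> -1 <= q -> 0 <= t <= T ->
  (nDA Omega mu phi (q / 2 + 1 - eps / 2) (u t) <=
   C1%:E * ((eps^-1 * t `^ (al * eps / 2))%:E * norm_Linf t (nDA Omega mu phi (q / 2) \o f)))%E.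
Proof.
move=> eps01 q1 /andP[t0 tT]; have /andP[e0 e1] := eps01.
have r0 : 0 <= q / 2 + 1 - eps / 2 by lra.
set N := norm_Linf _ _; have N0 : (0 <= N)%E by exact: Lnorm_ge0.
have c0 : 0 <= eps^-1 * t `^ (al * eps / 2) by rewrite mulr_ge0 ?powR_ge0// invr_ge0 ltW.
have [tn0|tn0] := eqVneq t 0.
  apply: (@le_trans _ _ 0%E); last by rewrite !mule_ge0 ?lee_fin.
  apply: (nDA_le r0 (L2_0 Omega) (B := 0)) => // [v Vv|n].
    by rewrite tn0 (u0_eq0 Vv) /of_L2 inner0.
  rewrite (_ : wcoef _ _ _ = fun=> 0) ?enorm0//.
  by apply/funext => j; rewrite /wcoef inner0 mulr0.
have {}t0 : 0 < t by rewrite lt_neqAle eq_sym tn0.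
have tT' : 0 < t <= T by rewrite t0.
(* An infinite data norm makes the bound trivial, as its coefficient is positive. *)
have [Ni|Nf] := eqVneq N +oo%E.
  have al1' : 0 < C1 by rewrite /C1 divr_gt0// mulr_gt0// addr_gt0.
  by rewrite Ni !gt0_muley ?leey// lte_fin// mulr_gt0 ?invr_gt0// powR_gt0.
have {}Nf : N \is a fin_num by rewrite ge0_fin_numE// ltey.
rewrite -(fineK Nf) -!EFinM.
apply: (nDA_le r0 (rfL2 _) (u_repr tT')).
  exact: mulr_ge0 C1_ge0 (mulr_ge0 c0 (fine_ge0 N0)).
move=> n; apply: le_trans (conv_nDA n eps01 tT' mfj bfj Nf).
rewrite le_eqVlt; apply/orP; left; apply/eqP; congr (enorm n _).
by apply/funext => j; rewrite /wcoef rfE//; exact: M_ell2.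
Qed.

Lemma estimate_du (eps q t : R) : 0 < eps < 1 -> -1 <= q -> 0 < t <= T ->
  (nDA Omega mu phi (q / 2 + 1 - eps / 2) (du t) <=
   C1%:E * ((eps^-1 * t `^ (al * eps / 2))%:E * norm_Linf t (nDA Omega mu phi (q / 2) \o fp)) +
   (1 + a0)%:E * ((t `^ (-1 + al * eps / 2))%:E * nDA Omega mu phi (q / 2) (f 0)))%E.
Proof.
move=> eps01 q1 tT; have /andP[e0 e1] := eps01; have /andP[t0 tT'] := tT.
have r0 : 0 <= q / 2 + 1 - eps / 2 by lra.
set N := norm_Linf _ _; have N0 : (0 <= N)%E by exact: Lnorm_ge0.
set D := nDA _ _ _ _ (f 0); have D0 : (0 <= D)%E by exact: (nDA_ge0 hphi).
have c0 : 0 < eps^-1 * t `^ (al * eps / 2) by rewrite mulr_gt0 ?invr_gt0// powR_gt0.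
have c1 : 0 < t `^ (-1 + al * eps / 2) by rewrite powR_gt0.
have C1_gt0 : 0 < C1 by rewrite /C1 divr_gt0// mulr_gt0// addr_gt0.
have a1 : 0 < 1 + a0 by rewrite addr_gt0.
have [Ni|Nf] := eqVneq N +oo%E.
  by rewrite Ni !gt0_muley ?lte_fin// pinfty_adde ?leey// !mule_ge0// lee_fin ltW.
have [Di|Df] := eqVneq D +oo%E.
  have -> : ((1 + a0)%:E * ((t `^ (-1 + al * eps / 2))%:E * D) = +oo)%E.
    by rewrite Di !gt0_muley ?lte_fin.
  rewrite addeC pinfty_adde ?leey//.
  by rewrite !mule_ge0// lee_fin ltW.
have {}Nf : N \is a fin_num by rewrite ge0_fin_numE// ltey.
have {}Df : D \is a fin_num by rewrite ge0_fin_numE// ltey.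
rewrite -(fineK Nf) -(fineK Df) -!EFinM -EFinD.
have duE : eqV Omega (of_L2 Omega (rf (M1 t))) (du t) by [].
have fN0 := fine_ge0 N0; have fD0 := fine_ge0 D0.
apply: (nDA_le r0 (rfL2 _) duE).
  exact: addr_ge0 (mulr_ge0 C1_ge0 (mulr_ge0 (ltW c0) fN0)) (mulr_ge0 (ltW a1) (mulr_ge0 (ltW c1) fD0)).
have bfp j : exists P, powb 1 P T (fun s => fp s (phi j)) by exact: fp_powb mgg iG gG fpE j.
have mfp j : measurable_fun `]0, T[ (fun s => fp s (phi j)) by exact: fp_measurable mgg iG gG fpE j.
(* In the term with [f 0] the weight [mu^(1 - eps/2)] meets [k] pointwise, without integration in
   time; this is why no factor [eps^-1] appears there. *)
move=> n; rewrite (_ : wcoef _ _ _ = (fun j =>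
  wcoef mu (q / 2 + 1 - eps / 2) (fun j => conv (ker al a0 (mu j)) (fun s => fp s (phi j)) t) j +
  (mu j `^ (1 - eps / 2) * ker al a0 (mu j) t) * wcoef mu (q / 2) (fun j => f 0 (phi j)) j)).
  apply: le_trans (enormD _ _ _) _; apply: lerD; first exact: (conv_nDA n eps01 tT mfp bfp Nf).
  rewrite mulrA.
  apply: (@le_trans _ _ ((1 + a0) * t `^ (-1 + al * eps / 2) * enorm n (wcoef mu (q / 2) (fun j => f 0 (phi j))))).
    have kp j : 0 <= ker al a0 (mu j) t by exact/ltW/(ker_gt0 al0 al1 a0_gt0 (mu_gt0 hphi j) t0).
    apply: enorm_scaled => j; rewrite ger0_norm ?mulr_ge0 ?powR_ge0//.
    have th01 : 0 <= 1 - eps / 2 <= 1 by apply/andP; split; lra.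
    apply: le_trans (ker_interp al0 al1 a0_gt0 (mu_gt0 hphi j) th01 t0) _.
    by rewrite le_eqVlt; apply/orP; left; apply/eqP; congr (_ * _ `^ _); ring.
  rewrite ler_wpM2l ?mulr_ge0 ?(ltW c1) ?(ltW a1)// -lee_fin fineK//.
  exact: nDA_ge_coef.
apply/funext => j; rewrite /wcoef rfE; last exact: M1_ell2.
rewrite [M1 t j]/(conv (ker al a0 (mu j)) (fun s => fp s (phi j)) t + f 0 (phi j) * ker al a0 (mu j) t).
rewrite mulrDr; congr (_ + _).
have -> : mu j `^ (q / 2 + 1 - eps / 2) = mu j `^ (1 - eps / 2) * mu j `^ (q / 2).
  by rewrite -powR_addr ?(mu_gt0 hphi)//; congr (_ `^ _); ring.
by rewrite -!mulrA; congr (_ * _); rewrite mulrA mulrC.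
Qed.

Lemma estimate_caputo (eps t : R) : 0 < eps < 1 -> 0 <= t <= T ->
  (nL2 Omega (caputo_sol t) <=
   C1%:E * ((eps^-1 * t `^ (al * eps / 2))%:E * norm_Linf t (nDA Omega mu phi (eps / 2) \o f)) +
   nL2 Omega (f t))%E.
Proof.
move=> eps01 tT0; have /andP[e0 e1] := eps01; have /andP[t0 tT] := tT0.
set N := norm_Linf _ _; have N0 : (0 <= N)%E by exact: Lnorm_ge0.
have f0 : (0 <= nL2 Omega (f t))%E by exact: (nL2_ge0 hphi).
have c0 : 0 <= eps^-1 * t `^ (al * eps / 2) by rewrite mulr_ge0 ?powR_ge0// invr_ge0 ltW.
rewrite /caputo_sol; case: ifPn => [t_gt0|_]; last first.
  apply: (@le_trans _ _ 0%E); last by rewrite adde_ge0// !mule_ge0 ?lee_fin.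
  apply: (nL2_le (L2_0 Omega)) => [v Vv|]; first by rewrite /of_L2 inner0.
  by rewrite (nrm_le hphi (L2_0 Omega))// => n; rewrite (_ : (fun j => _) = fun=> 0) ?enorm0//; apply/funext => j; rewrite inner0.
have tT' : 0 < t <= T by rewrite t_gt0.
have [Ni|Nf] := eqVneq N +oo%E.
  have al1' : 0 < C1 by rewrite /C1 divr_gt0// mulr_gt0// addr_gt0.
  rewrite Ni !gt0_muley ?pinfty_adde ?leey ?lte_fin//.
  by rewrite mulr_gt0 ?invr_gt0// powR_gt0.
have {}Nf : N \is a fin_num by rewrite ge0_fin_numE// ltey.
have [S hS Sle] : exists2 S : R, forall n, enorm n (fun j => f t (phi j)) <= S &
    forall x : \bar R, (forall n, (enorm n (fun j => f t (phi j)))%:E <= x)%E -> (S%:E <= x)%E.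
  by apply: ell2_sup; apply: ell2_enorm => n; apply: fF.
apply: (@le_trans _ _ ((C1 * (eps^-1 * t `^ (al * eps / 2) * fine N))%:E + S%:E)%E); last first.
  apply: leeD; first by rewrite !EFinM fineK.
  by apply: Sle => n; exact: (nL2_ge_coef hphi).
rewrite -EFinD.
apply: (nL2_le (rfL2 (cw t)) _) => //; apply: (rf_nrm_le hphi rfL2 rfE) => n.
(* With data exponent [eps / 2] the gain [1 - eps / 2] adds up to exactly one power of [mu], which
   is [A u]. *)
have -> : cw t = (fun j => -1 * wcoef mu (eps / 2 + 1 - eps / 2) (fun j => conv (ker al a0 (mu j)) (fun s => f s (phi j)) t) j + f t (phi j)).
  apply/funext => j; rewrite /wcoef addrAC subrr add0r powRr1 ?(ltW (mu_gt0 hphi j))//.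
  by rewrite mulN1r addrC.
apply: le_trans (enormD _ _ _) _; apply: lerD => //.
by rewrite enormZ normrN normr1 mul1r; exact: (conv_nDA n eps01 tT' mfj bfj Nf).
Qed.

Variables (f'' : R -> W).
Hypothesis GN : forall s, 0 < s < T -> ((G s)%:E <= nL2 Omega (f'' s))%E.

Lemma estimate_ddu t : 0 < t <= T ->
  (nL2 Omega (ddu t) <=
   (a0 * Gamma al)%:E * RLint al (nL2 Omega \o f'') t +
   a0%:E * ((t `^ (al - 1))%:E * nL2 Omega (fp 0)) +
   (6 * a0)%:E * ((t `^ (al - 2))%:E * nL2 Omega (f 0)))%E.
Proof.
move=> tT; have /andP[t0 tT'] := tT.
have Ga : 0 < Gamma al by apply: Gamma_gt0; rewrite al0 ltW.
have L0 g : (0 <= nL2 Omega g)%E by exact: (nL2_ge0 hphi).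
have p1 : 0 < t `^ (al - 1) by rewrite powR_gt0.
have p2 : 0 < t `^ (al - 2) by rewrite powR_gt0.
pose J := (\int[leb]_(s in `]0%R, t[) (((t - s) `^ (al - 1))%:E * nL2 Omega (f'' s)))%E.
have J0 : (0 <= J)%E by apply: integral_ge0 => s _; rewrite mule_ge0// lee_fin powR_ge0.
have JE : RLint al (nL2 Omega \o f'') t = ((Gamma al)^-1%:E * J)%E by [].
have rest0 : (0 <= a0%:E * ((t `^ (al - 1))%:E * nL2 Omega (fp 0)))%E.
  by rewrite !mule_ge0// lee_fin ltW.
have rest1 : (0 <= (6 * a0)%:E * ((t `^ (al - 2))%:E * nL2 Omega (f 0)))%E.
  by rewrite !mule_ge0// lee_fin ?mulr_ge0 ?ltW.
(* If [J] is infinite the bound is trivial; if it is finite then [t] is [good], because [G] lies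
   below [nL2 (f'' s)]. So the arbitrary values of [ddu] at other times are harmless. *)
have [Ji|Jf] := eqVneq J +oo%E.
  rewrite JE Ji gt0_muley ?lte_fin ?invr_gt0// gt0_muley ?lte_fin ?mulr_gt0//.
  by rewrite pinfty_adde// pinfty_adde// leey.
have {}Jf : J \is a fin_num by rewrite ge0_fin_numE// ltey.
have mG : measurable_fun `]0, T[ G by case/integrableP : iG => /measurable_EFinP.
have mK : measurable_fun `]0, t[ (fun s => (t - s) `^ (al - 1) * G s).
  by apply: measurable_funM; [exact: measurable_powRB|exact: measurable_itvS tT' mG].
have st0 s : 0 < s < t -> 0 < s < T by move=> /andP[s0 st]; rewrite s0 (lt_le_trans st).
have G0 s : 0 < s < t -> 0 <= G s by move=> /st0; exact: (G_ge0 gG).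
have KJ : (\int[leb]_(s in `]0%R, t[) ((t - s) `^ (al - 1) * G s)%:E <= J)%E.
  apply: integral_le_ae; [exact: measurable_oo| | |].
  - by move=> s /=; rewrite in_itv/= => /G0 g0; rewrite lee_fin mulr_ge0 ?powR_ge0.
  - by move=> s _; rewrite mule_ge0// lee_fin powR_ge0.
  - apply: aeW => s /=; rewrite in_itv/= => /st0 sT; rewrite EFinM lee_wpmul2l ?lee_fin ?powR_ge0//.
    exact: GN.
have gt : good al G t.
  apply/integrableP; split; first exact/measurable_EFinP.
  have -> : (\int[leb]_(s in `]0%R, t[) `|((t - s) `^ (al - 1) * G s)%:E| =
      \int[leb]_(s in `]0%R, t[) ((t - s) `^ (al - 1) * G s)%:E)%E.
    apply: eq_integral => s sT; have g0 : 0 <= G s by apply: G0; move/set_mem: sT; rewrite /= in_itv.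
    by rewrite gee0_abs// lee_fin mulr_ge0 ?powR_ge0.
  by apply: le_lt_trans KJ _; rewrite ltey_eq Jf.
have Kf : (\int[leb]_(s in `]0%R, t[) ((t - s) `^ (al - 1) * G s)%:E)%E \is a fin_num.
  exact: (integrable_fin_num (measurable_oo 0 t) gt).
have cE : conv (akern al a0) G t = a0 * \int[leb]_(s in `]0, t[) ((t - s) `^ (al - 1) * G s).
  rewrite -(RintegralZl a0 (measurable_oo 0 t) gt) /conv; apply: eq_Rintegral => s _.
  by rewrite /akern mulrA.
have KJ' : \int[leb]_(s in `]0, t[) ((t - s) `^ (al - 1) * G s) <= fine J.
  by rewrite -lee_fin fineK// /Rintegral fineK.
have [S1 hS1 S1le] : exists2 S : R, forall n, enorm n (fun j => fp 0 (phi j)) <= S &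
    forall x : \bar R, (forall n, (enorm n (fun j => fp 0 (phi j)))%:E <= x)%E -> (S%:E <= x)%E.
  by apply: ell2_sup; apply: ell2_enorm => n; apply: fpF; rewrite lexx ltW.
have [S0 hS0 S0le] : exists2 S : R, forall n, enorm n (fun j => f 0 (phi j)) <= S &
    forall x : \bar R, (forall n, (enorm n (fun j => f 0 (phi j)))%:E <= x)%E -> (S%:E <= x)%E.
  by apply: ell2_sup; apply: ell2_enorm => n; apply: fF; rewrite lexx ltW.
apply: (@le_trans _ _ ((a0 * fine J)%:E + (a0 * (t `^ (al - 1) * S1))%:E + (6 * a0 * (t `^ (al - 2) * S0))%:E)%E); last first.
  apply: leeD; [apply: leeD|].
  - by rewrite JE muleA -EFinM -mulrA divff ?gt_eqF// mulr1 EFinM fineK.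
  - rewrite !EFinM lee_wpmul2l ?lee_fin ?(ltW a0_gt0)// lee_wpmul2l ?lee_fin ?(ltW p1)//.
    by apply: S1le => n; exact: (nL2_ge_coef hphi).
  - rewrite [X in (X <= _)%E]EFinM [X in (_ * X <= _)%E]EFinM.
    rewrite lee_wpmul2l ?lee_fin ?mulr_ge0 ?(ltW a0_gt0)// lee_wpmul2l ?lee_fin ?(ltW p2)//.
    by apply: S0le => n; exact: (nL2_ge_coef hphi).
rewrite -!EFinD ddu_good//.
apply: (nL2_le (rfL2 (M2 t)) _) => //; apply: (rf_nrm_le hphi rfL2 rfE) => n.
apply: le_trans (vmode2_le al0 al1 a0_gt0 (mu_gt0 hphi) fj fpj mgg gG n tT gt) _.
apply: lerD; [apply: lerD|].
- by rewrite cE ler_wpM2l// ltW.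
- by rewrite /akern mulrC -mulrA ler_wpM2l ?(ltW a0_gt0)// ler_wpM2l ?(ltW p1).
- rewrite [leLHS]mulrC -[leLHS]mulrA; apply: ler_wpM2l; first by rewrite mulr_ge0// ltW.
  by apply: ler_wpM2l; [exact: ltW|exact: hS0].
Qed.

End SolutionCoords.

(** Here [c1] will be the constant of the fractional estimate and [c2] the product
    [a0 * Gamma alpha], which undoes the factor in [RLint]; [1 + a0] comes from interpolation and
    [6 * a0] from [wker_bound]. *)
Lemma constant_ex (R : realType) (a0 c1 c2 : R) : 0 < a0 -> 0 < c1 -> 0 < c2 ->
  exists C : R, [/\ 0 < C, c1 <= C, c2 <= C, 1 + a0 <= C & 6 * a0 <= C].
Proof. by move=> *; exists (c1 + c2 + 1 + 6 * a0); split; lra. Qed.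

Theorem theorem2p8 (R : realType) (Omega : set (R * R))
  (hOmega : polygonal_domain Omega)
  (mu : nat -> R) (phi : nat -> R * R -> R) (hphi : eigenpairs Omega mu phi)
  (T alpha : R) (hT : 0 < T) (halpha : 0 < alpha < 1) :
  exists C : R, 0 < C /\
  forall (q : R) (f f' f'' u : R -> functional R),
    -1 <= q <= 1 ->
    sobolev1 (nDA Omega mu phi (q / 2)) +oo%E T f f' ->
    sobolev1 (nL2 Omega) 1%E T f f' ->
    sobolev1 (nL2 Omega) 1%E T f' f'' ->
    weak_solution Omega alpha T f 0 u ->
  [/\ forall eps t : R, 0 < eps < 1 -> 0 <= t <= T ->
        (nDA Omega mu phi (q / 2 + 1 - eps / 2) (u t) <=
         C%:E * ((eps^-1 * t `^ (alpha * eps / 2))%:E *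
                 norm_Linf t (nDA Omega mu phi (q / 2) \o f)))%E,
      exists u' u'' : R -> functional R,
        [/\ forall t, 0 < t <= T -> deriv_at (nVdual Omega) T u t (u' t),
            forall s t, 0 < s -> s <= t -> t <= T ->
              bochner_int (nVdual Omega) `]s, t[ u'' (u' t - u' s),
            forall t d, 0 < t <= T ->
              deriv_at (nVdual Omega) T u' t d -> eqV Omega (u'' t) d,
            forall eps t : R, 0 < eps < 1 -> 0 < t <= T ->
              (nDA Omega mu phi (q / 2 + 1 - eps / 2) (u' t) <=
               C%:E * ((eps^-1 * t `^ (alpha * eps / 2))%:E *
                       norm_Linf t (nDA Omega mu phi (q / 2) \o f') +
                       (t `^ (-1 + alpha * eps / 2))%:E *
                       nDA Omega mu phi (q / 2) (f 0%R)))%E &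
            forall t, 0 < t <= T ->
              (nL2 Omega (u'' t) <=
               C%:E * (RLint alpha (nL2 Omega \o f'') t +
                       (t `^ (alpha - 1))%:E * nL2 Omega (f' 0%R) +
                       (t `^ (alpha - 2))%:E * nL2 Omega (f 0%R)))%E] &
      exists w : R -> functional R,
        (forall t, 0 <= t <= T -> caputo_deriv_at Omega alpha T u t (w t)) /\
        forall eps t : R, 0 < eps < 1 -> 0 <= t <= T ->
          (nL2 Omega (w t) <=
           C%:E * ((eps^-1 * t `^ (alpha * eps / 2))%:E *
                   norm_Linf t (nDA Omega mu phi (eps / 2) \o f) +
                   nL2 Omega (f t)))%E].

Proof.
have /andP[al0 al1] := halpha.
have [a0 a0_gt0 a0_beta] := kernel_normalization halpha.
have Ga : 0 < Gamma alpha by apply: Gamma_gt0; rewrite al0 ltW.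
have c1_0 : 0 < (1 + a0) * 2 / alpha by rewrite divr_gt0// mulr_gt0// addr_gt0.
have c2_0 : 0 < a0 * Gamma alpha by rewrite mulr_gt0.
(* The arguments depend on [alpha] only: the kernel bounds are uniform in the eigenvalues and in
   time. *)
have [C [C0 C1 C2 C3 C4]] := constant_ex a0_gt0 c1_0 c2_0.
have C5 : a0 <= C by apply: le_trans C3; rewrite lerDr.
have C6 : 1 <= C by apply: le_trans C3; rewrite lerDl ltW.
exists C; split => // q f f' f'' u /andP[q1 _] _ Hf Hf' Hu.
have [gg [G [F [Fp [[mgg iG] GP fE fpE FP]]]]] := data_ex hphi hT Hf Hf'.
have [rf [rfL2 rfE]] := rf_ex hphi.
have mggT j : measurable_fun `]0, T[ (gg j) by apply: measurable_funTS; exact: mgg.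
have gG n s : 0 < s < T -> enorm n (gg^~ s) <= G s by move=> /GP[+ _]; exact.
have GN s : 0 < s < T -> ((G s)%:E <= nL2 Omega (f'' s))%E by move=> /GP[].
have fpE' j t : 0 < t <= T -> f' t (phi j) = f' 0 (phi j) + \int[lebesgue_measure]_(s in `]0, t[) gg j s.
  by move=> /andP[t0 tT]; apply: fpE; rewrite ltW.
have fF n t : 0 <= t <= T -> enorm n (fun j => f t (phi j)) <= F by move=> /(FP n)[].
have fpF n t : 0 <= t <= T -> enorm n (fun j => f' t (phi j)) <= Fp by move=> /(FP n)[].
have mulC (c : R) (x y : \bar R) : 0 <= c -> c <= C -> (0 <= x)%E -> (0 <= y)%E -> (x <= y)%E ->
    (c%:E * x <= C%:E * y)%E.
  move=> c0 cC x0 y0 xy; apply: (@le_trans _ _ (C%:E * x)%E).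
    by rewrite lee_wpmul2r// lee_fin.
  by rewrite lee_wpmul2l// lee_fin ltW.
have D0 r g : (0 <= nDA Omega mu phi r g)%E by exact: (nDA_ge0 hphi).
have L0 g : (0 <= nL2 Omega g)%E by exact: (nL2_ge0 hphi).
have N0 (t : R) (h : R -> \bar R) : (0 <= norm_Linf t h)%E by exact: Lnorm_ge0.
have p0 (x y : R) : (0 <= (x `^ y)%:E)%E by rewrite lee_fin powR_ge0.
have e0 (eps x y : R) : 0 < eps < 1 -> (0 <= (eps^-1 * x `^ y)%:E)%E.
  by move=> /andP[/ltW eps0 _]; rewrite lee_fin mulr_ge0 ?invr_ge0 ?powR_ge0.
split.
- move=> eps t eps01 tT.
  apply: le_trans (estimate_u hphi al0 al1 hT Hu a0_gt0 a0_beta mggT iG gG fE fpE' fF fpF rfL2 rfE eps01 q1 tT) _.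
  by apply: mulC; rewrite ?mule_ge0 ?e0// ltW.
- have [ddu [ddu_good ddu_der]] := ddu_ex hphi al0 al1 hT a0_gt0 mggT iG gG fpE' fF fpF rfL2 rfE.
  exists (du Omega mu phi alpha f a0 f' rf), ddu; split.
  + move=> t; exact: (deriv_u hphi al0 al1 hT Hu a0_gt0 a0_beta mggT iG gG fE fpE' fF fpF rfL2 rfE).
  + move=> s t s0 st tT.
    exact: (bochner_ddu hphi al0 al1 hT a0_gt0 mggT iG gG fpE' fF fpF rfL2 rfE ddu_good s0 st tT).
  + by move=> t d; exact: ddu_der.
  + move=> eps t eps01 tT.
    apply: le_trans (estimate_du hphi al0 al1 hT a0_gt0 mggT iG gG fpE' fF fpF rfL2 rfE eps01 q1 tT) _.
    have A := mule_ge0 (e0 eps t (alpha * eps / 2) eps01) (N0 t (nDA Omega mu phi (q / 2) \o f')).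
    have B := mule_ge0 (p0 t (-1 + alpha * eps / 2)) (D0 (q / 2) (f 0)).
    by rewrite (ge0_muleDr _ A B); apply: leeD; apply: mulC => //; rewrite ltW// addr_gt0.
  + move=> t tT.
    apply: le_trans (estimate_ddu hphi al0 al1 hT a0_gt0 mggT iG gG fF fpF rfL2 rfE ddu_good GN tT) _.
    have I0 : (0 <= RLint alpha (nL2 Omega \o f'') t)%E.
      rewrite /RLint mule_ge0 ?lee_fin ?invr_ge0 ?(ltW Ga)//; apply: integral_ge0 => s _.
      exact: mule_ge0 (p0 _ _) (L0 (f'' s)).
    have A := mule_ge0 (p0 t (alpha - 1)) (L0 (f' 0)).
    have B := mule_ge0 (p0 t (alpha - 2)) (L0 (f 0)).
    rewrite (ge0_muleDr _ (adde_ge0 I0 A) B) (ge0_muleDr _ I0 A).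
    by apply: leeD; [apply: leeD|]; apply: mulC => //; rewrite ltW// mulr_gt0.
- exists (caputo_sol Omega mu phi alpha f a0 rf); split.
    move=> t tT; exact: (caputo_u hphi al0 al1 hT Hu a0_gt0 a0_beta mggT iG gG fE fpE' fF fpF rfL2 rfE tT).
  move=> eps t eps01 tT.
  have h := (estimate_caputo hphi al0 al1 hT a0_gt0 mggT iG gG fE fpE' fF fpF rfL2 rfE eps01 tT).
  apply: le_trans h _.
  have A := mule_ge0 (e0 eps t (alpha * eps / 2) eps01) (N0 t (nDA Omega mu phi (eps / 2) \o f)).
  rewrite (ge0_muleDr _ A (L0 (f t))); apply: leeD; first by apply: mulC => //; exact: ltW.
  by rewrite -[leLHS]mul1e; apply: mulC.
Qed.
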